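(* Let $\Omega=\{0,1\}^{\mathbb Z}$, let $\sigma$ be the shift map, and for $p\in[0,1]$ let $\mathbb P_p$ be the Bernoulli measure with $\mathbb P_p([0])=p$, where $[0]=\{\omega\colon\omega_0=0\}$. Let $\mathcal L_0$ be the Perron-Frobenius operator of $T_0\colon z\mapsto z^2$ and $\mathcal L_1$ the Perron-Frobenius operator of $T_1\colon z\mapsto\left[(z+\frac14)/(1+\frac z4)\right]^2$, and consider the operator cocycle generated by $\mathcal L_\omega:=\mathcal L_{\omega_0}$ over $\sigma$, acting on $H^2(A_R)$, where $0<R<1$ satisfies $r_{\mathcal T}(R)<R$. Then: (a) if $p<\frac12$, the cocycle has countably infinitely many finite Lyapunov exponents; (b) if $p\ge\frac12$, then $\lambda_1=0$ and all remaining Lyapunov exponents are $-\infty$.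
   Context: Notation: $C_1$ is the unit circle, $A_R=\{z\colon R<|z|<1/R\}$. For a Blaschke product $T$, $r_T(R)=\max_{|z|=R}|T(z)|$; for the cocycle $\mathcal T=(T_{\omega_0})_{\omega\in\Omega}$, $r_{\mathcal T}(R)=\operatorname{ess\,sup}_\omega r_{T_{\omega_0}}(R)$. $H^2(A_R)$ is the Hardy–Hilbert space of analytic functions on $A_R$ with $L^2$ boundary extension to $\partial A_R$, with inner product $\langle f,g\rangle=\frac1{2\pi}\int_{\partial A_R}f\bar g\,\frac{|dz|}{|z|}$; an orthonormal basis is $\{(R^{2n}+R^{-2n})^{-1/2}z^n\colon n\in\mathbb Z\}$. The Perron-Frobenius operator is $\mathcal L_Tf(z)=\sum_{y\in T^{-1}z}f(y)/T'(y)$ for $z\in C_1$; for $f\in H^2(A_R)$ and $r_T(R)<R$, $\mathcal L_Tf$ is the element of $H^2(A_R)$ given on $C_1$ by this formula, and $\mathcal L_T$ is then a compact operator on $H^2(A_R)$. $\mathcal L^{(n)}_\omega=\mathcal L_{\sigma^{n-1}\omega}\circ\cdots\circ\mathcal L_\omega$. Lyapunov exponents: for a compact cocycle over an invertible ergodic base with $\lim\frac1n\log\|\mathcal L_\omega^{(n)}\|=\lambda_1>-\infty$, the Multiplicative Ergodic Theorem gives finite exponents $\lambda_1>\lambda_2>\cdots$ (finitely or infinitely many), and for a.e. $\omega$ finite-dimensional equivariant Oseledets spaces $V_i(\omega)$ of a.e. constant dimension $m_i$ (the multiplicity) with $\frac1n\log\|\mathcal L^{(n)}_\omega f\|\to\lambda_i$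 for $f\in V_i(\omega)\setminus\{0\}$, and for each $j$ a closed equivariant complement $F_j(\omega)$ of $V_1(\omega)\oplus\cdots\oplus V_j(\omega)$ with $\limsup\frac1n\log\|\mathcal L^{(n)}_\omega f\|\le\lambda_{j+1}$ for $f\in F_j(\omega)$ (with $\lambda_{j+1}:=-\infty$ if $\lambda_j$ is the last finite exponent). ''$\lambda_1=0$ and all remaining exponents are $-\infty$'' means the only finite exponent is $0$, with multiplicity $1$. *)

(* Defs.v *)
From HB Require Import structures.
From mathcomp Require Import all_boot all_order all_algebra.
From mathcomp Require Import all_classical all_reals all_analysis ess_sup_inf.
From mathcomp Require Export complex.

Set Implicit Arguments.
Unset Strict Implicit.
Unset Printing Implicit Defensive.
Import Order.TTheory GRing.Theory Num.Theory.
Import numFieldNormedType.Exports.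
Import Normc.

Local Open Scope classical_set_scope.
Local Open Scope ring_scope.
Local Open Scope complex_scope.

(* R[i] as a normed space over itself: derivable and derive1 then refer to
   complex differentiability. *)
HB.instance Definition _ (R : realType) := NormedModule.copy R[i] R[i]^o.

Section LinearSets.
Context {K : numFieldType} {U : lmodType K}.
Implicit Types V F X : set U.

Definition linear_set V :=
  V 0 /\ forall (a : K) f g, V f -> V g -> V (a *: f + g).

Definition has_dim V (m : nat) :=
  exists e : 'I_m -> U,
    (forall c : 'I_m -> K, \sum_i c i *: e i = 0 -> forall i, c i = 0) /\
    V = [set f | exists c : 'I_m -> K, f = \sum_i c i *: e i].

(* X is the internal direct sum of V 0, ..., V j and F. *)
Definition direct_sum X (V : nat -> set U) (j : nat) F :=
  [/\ forall i, (i <= j)%N -> V i `<=` X,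
      F `<=` X &
      forall f, X f -> exists! vg : {ffun 'I_j.+1 -> U} * U,
        [/\ forall i : 'I_j.+1, V i (vg.1 i), F vg.2 &
            f = \sum_i vg.1 i + vg.2]].

End LinearSets.

(* A cocycle over s : Omega -> Omega of operators L w on the normed space whose
   set of vectors is X, inside U, and whose norm is nrm. *)
Section Lyapunov.
Context {R : realType} {d : measure_display} {Omega : measurableType d}.
Variables (P : probability Omega R) (s : Omega -> Omega).
Context {K : numFieldType} {U : lmodType K}.
Variables (X : set U) (nrm : U -> R) (L : Omega -> U -> U).

Fixpoint cocycle_iter (n : nat) (w : Omega) (f : U) : U :=
  if n is n'.+1 then L (iter n' s w) (cocycle_iter n' w f) else f.

Definition closed_in (F : set U) :=
  forall (u : nat -> U) (f : U), (forall n, F (u n)) -> X f ->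
    (nrm (u n - f) @[n --> \oo] --> (0 : R)) -> F f.

Definition op_norm (A : U -> U) : \bar R :=
  ereal_sup [set (nrm (A f))%:E | f in [set f | X f /\ nrm f <= 1]].

(* (1/n) log x, with log 0 = -oo *)
Definition growth (x : nat -> \bar R) (n : nat) : \bar R :=
  ((n%:R^-1)%:E * lne (x n))%E.

Definition vector_growth (w : Omega) (f : U) : nat -> \bar R :=
  growth (fun n => (nrm (cocycle_iter n w f))%:E).

(* Number of finite exponents: Some k, or None for infinitely many. *)
Definition is_index (N : option nat) (i : nat) : bool :=
  if N is Some k then (i < k)%N else true.

Definition exponent (N : option nat) (lam : nat -> R) (i : nat) : \bar R :=
  if is_index N i then (lam i)%:E else -oo%E.

(* Conclusion of the multiplicative ergodic theorem: the finite exponents are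
   lam i with multiplicity m i, for the i satisfying is_index N (numbered from
   0), and -oo is the next exponent if N is finite.  V i w is the Oseledets
   space of lam i; F j w is the complement of V 0 w + ... + V j w.
   The growth rates determine N, and lam and m on the indices. *)
Definition lyapunov_spectrum (N : option nat) (lam : nat -> R)
    (m : nat -> nat) : Prop :=
  [/\ is_index N 0,
      forall i, is_index N i.+1 -> lam i.+1 < lam i,
      forall i, is_index N i -> (0 < m i)%N,
      {ae P, forall w,
        growth (fun n => op_norm (cocycle_iter n w)) n @[n --> \oo]
          --> (lam 0%N)%:E} &
      exists V F : nat -> Omega -> set U,
        {ae P, forall w, forall i, is_index N i ->
          [/\ [/\ has_dim (V i w) (m i),
                  L w @` V i w = V i (s w) &
                  forall f, V i w f -> f <> 0 ->
                    vector_growth w f n @[n --> \oo] --> (lam i)%:E],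
              [/\ linear_set (F i w), closed_in (F i w) &
                  direct_sum X (V ^~ w) i (F i w)],
              L w @` F i w `<=` F i (s w) &
              forall f, F i w f ->
                (limn_esup (vector_growth w f) <= exponent N lam i.+1)%E]}].

End Lyapunov.

Section Hardy.
Context {R : realType}.
Local Notation C := R[i].
Implicit Types (rho r x : R) (f g b : C -> C) (T : C -> C) (z : C).

Definition angles : set R := `[0, 2 * pi].

Definition circle_pt r x : C := r%:C * (cos x +i* sin x).

Definition annulus rho : set C := [set z | rho < normc z < rho^-1].

(* integral of |f|^2 over the circle |z| = r with respect to |dz| / |z| *)
Definition circle_sqint f r : \bar R :=
  (\int[lebesgue_measure]_(x in angles)
     (normc (f (circle_pt r x)) ^+ 2)%:E)%E.

Definition circle_L2 f r : Prop :=
  [/\ measurable_fun angles (fun x => complex.Re (f (circle_pt r x))),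
      measurable_fun angles (fun x => complex.Im (f (circle_pt r x))) &
      (circle_sqint f r < +oo)%E].

(* b, of which only the values on the two boundary circles matter, is the L^2
   boundary extension of f: the limit in L^2(dx) of the functions
   x |-> f (r e^{ix}).  Mere a.e. radial limits would give a larger space. *)
Definition L2_boundary rho f b : Prop :=
  forall s, s = rho \/ s = rho^-1 ->
    circle_L2 b s /\
    (\int[lebesgue_measure]_(x in angles)
        (normc (f (circle_pt r x) - b (circle_pt s x)) ^+ 2)%:E)%E
      @[r --> within [set r | rho < r < rho^-1] (nbhs s)] --> 0%E.

(* Functions on the annulus are represented by their extension by 0. *)
Definition H2 rho : set (C -> C) := [set f |
  [/\ forall z, annulus rho z -> derivable f z 1,
      forall z, ~ annulus rho z -> f z = 0 &
      exists b, L2_boundary rho f b]].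

Definition boundary rho f : C -> C := xget 0 [set b | L2_boundary rho f b].

(* norm of the inner product (2 pi)^-1 * integral of f g^* |dz| / |z| over the
   boundary of the annulus *)
Definition H2norm rho f : R :=
  Num.sqrt ((2 * pi)^-1 * fine (circle_sqint (boundary rho f) rho +
                                circle_sqint (boundary rho f) rho^-1)%E).

Definition PF_sum T f z : C := \sum_(y \in T @^-1` [set z]) f y / derive1 T y.

(* By the identity theorem at most one g qualifies. *)
Definition PF rho T f : C -> C :=
  xget 0 [set g | H2 rho g /\ forall z, normc z = 1 -> g z = PF_sum T f z].

Definition rmax T r : R := sup [set normc (T z) | z in [set z | normc z = r]].

End Hardy.

Section Shift.

Definition coord_sets : set (set (int -> bool)) :=
  [set A | exists (k : int) (a : bool), A = [set w | w k = a]].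

(* {0,1}^Z with the product sigma-algebra; the symbols 0, 1 are false, true. *)
Definition Omega2 := g_sigma_algebraType coord_sets.

Definition left_shift (w : Omega2) : Omega2 := fun k : int => w (k + 1).

(* By the pi-lambda theorem at most one probability qualifies. *)
Definition bernoulli_shift {R : realType} (p : R)
    (P : probability Omega2 R) : Prop :=
  forall (I : seq int) (a : int -> bool), uniq I ->
    P [set w : Omega2 | forall k, k \in I -> w k = a k] =
      (\prod_(k <- I) (if a k then 1 - p else p))%:E.

End Shift.

Definition blaschke {R : realType} (a : bool) (z : R[i]) : R[i] :=
  if a then ((z + 4^-1) / (1 + z / 4)) ^+ 2 else z ^+ 2.

Definition r_ess {R : realType} (P : probability Omega2 R) (rho : R) : \bar R :=
  ess_sup P (fun w : Omega2 => (rmax (blaschke (w 0)) rho)%:E).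

Definition blaschke_spectrum {R : realType} (P : probability Omega2 R)
    (rho : R) : option nat -> (nat -> R) -> (nat -> nat) -> Prop :=
  lyapunov_spectrum P left_shift (H2 rho) (H2norm rho)
    (fun w : Omega2 => PF rho (blaschke (w 0))).

(* Main.v *)
Require Import Defs.
From HB Require Import structures.
From mathcomp Require Import all_boot all_order all_algebra.
From mathcomp Require Import all_classical all_reals all_analysis ess_sup_inf measurable_realfun.
From mathcomp Require Import ring lra zify.
Import Order.TTheory GRing.Theory Num.Theory.
Import numFieldNormedType.Exports.
Import Normc.

Set Implicit Arguments.
Unset Strict Implicit.
Unset Printing Implicit Defensive.

Local Open Scope classical_set_scope.
Local Open Scope ring_scope.
Local Open Scope complex_scope.

(* The pull-back of 0 under T_(w_-1), T_(w_-2), ... converges to a random fixed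
   point x(w) in [0, rho), with T_(w_0) (x w) = x (shift w).  In the Moebius
   coordinate u vanishing at x(w) the Blaschke product becomes
   u |-> u (u + b) / (1 + b u) with b = T'(x w) in [0, 1).  The Perron-Frobenius
   operator is dual to composition with T under the pairing <f, g> = coefficient
   of 1/z in f g, so that the pairings of L^n f with the powers u^i (and, by the
   symmetry z |-> 1/z, their mirror images) satisfy a triangular recursion with
   diagonal factors b_0^i ... b_(n-1)^i.  Hence the exponents are i E(log b),
   with multiplicity 1 for i = 0 and 2 for i >= 1; the limits of the normalized
   pairings are linear forms whose common kernels are the complements of the
   Oseledets spaces.
   A run of j zeros in w_0, w_-1, ... makes b doubly exponentially small,
   - log b ~ 2^j, and such a run has probability p^j: E(log b) is finite if and
   only if p < 1/2.  If p >= 1/2, truncating log b shows that L^n decays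
   superexponentially on the kernel of the pairing with 1.  Birkhoff's theorem
   is used in the form: if E g < 0 then the sums of g along almost every orbit
   are bounded above. *)


(** * Integration in the complex plane *)

(** Independence of circle means from the radius is the single analytic input: exponential
    coordinates reduce it to Goursat's theorem on rectangles, and Laurent expansions, residues and
    the duality are derived from it. The recursion is triangular towards higher powers: the pairing
    of order i is fed by the orders m > i, which decay faster. It is cut at an order j, and the
    remainder must then decay like the product of the multipliers to the power j + 1. A uniform
    contraction constant would be too weak for this, so [eps] is assembled from the multipliers
    themselves. The splitting is explicit. Vanishing of all moments above order i is preserved
    exactly by the operators and makes the Oseledets spaces finite-dimensional; the limit forms
    separate their orders. Estimates are kept in the form of a constant times an exponential, so
    that they can be multiplied along an induction, and upper bounds on ergodic sums are all that
    they require. If p >= 1/2 the multipliers may vanish and the pairings cannot be normalised;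
    there the expansion at order 0, which involves only the conserved pairing with 1, is enough. *)

Section ComplexNorm.
Context {R : realType}.
Local Notation C := R[i].
Local Notation Re := (@complex.Re R).
Local Notation Im := (@complex.Im R).
Implicit Types (x y z : C) (t : R).

Lemma normc_norm z : `|z| = (normc z)%:C.
Proof. by []. Qed.

Lemma normc_ge0 z : 0 <= normc z.
Proof. by case: z => a b; exact: sqrtr_ge0. Qed.

Lemma normcD x y : normc (x + y) <= normc x + normc y.
Proof. exact: le_normcD. Qed.

Lemma normcNN x : normc (- x) = normc x.
Proof. exact: normcN. Qed.

Lemma normc_distC x y : normc (x - y) = normc (y - x).
Proof. by rewrite -opprB normcNN. Qed.

Lemma normcB x y : normc (x - y) <= normc x + normc y.
Proof. by rewrite -(normcNN y); exact: normcD. Qed.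

Lemma normcX x n : normc (x ^+ n) = normc x ^+ n.
Proof.
elim: n => [|n IH]; first by rewrite !expr0 normc1.
by rewrite !exprS normcM IH.
Qed.

Lemma normc_real t : normc t%:C = `|t|.
Proof. by rewrite /= expr0n /= addr0 sqrtr_sqr. Qed.

Lemma normc_realp t : 0 <= t -> normc t%:C = t.
Proof. by move=> t0; rewrite normc_real ger0_norm. Qed.

Lemma normc_eq0 z : (normc z == 0) = (z == 0).
Proof. by apply/eqP/eqP => [/eq0_normc//|->]; rewrite normc0. Qed.

Lemma normc_gt0 z : (0 < normc z) = (z != 0).
Proof. by rewrite lt_def normc_eq0 normc_ge0 andbT. Qed.

Lemma sqr_normc z : normc z ^+ 2 = Re z ^+ 2 + Im z ^+ 2.
Proof. by case: z => a b; rewrite sqr_sqrtr // addr_ge0 ?sqr_ge0. Qed.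

Lemma Re_le_normc z : `|Re z| <= normc z.
Proof.
rewrite -(ler_pXn2r (n := 2)) ?nnegrE ?normc_ge0 //.
by rewrite real_normK ?num_real // sqr_normc lerDl sqr_ge0.
Qed.

Lemma Im_le_normc z : `|Im z| <= normc z.
Proof.
rewrite -(ler_pXn2r (n := 2)) ?nnegrE ?normc_ge0 //.
by rewrite real_normK ?num_real // sqr_normc lerDr sqr_ge0.
Qed.

Lemma normc_le_ReIm z : normc z <= `|Re z| + `|Im z|.
Proof.
rewrite -(ler_pXn2r (n := 2)) ?nnegrE ?normc_ge0 ?addr_ge0 //.
rewrite sqr_normc sqrrD !real_normK ?num_real // lerD2r lerDl.
by rewrite mulrn_wge0 // mulr_ge0.
Qed.

Lemma normc_sum (I : Type) (s : seq I) (P : pred I) (F : I -> C) :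
  normc (\sum_(i <- s | P i) F i) <= \sum_(i <- s | P i) normc (F i).
Proof.
elim/big_ind2 : _ => [|u a v b ha hb|//]; first by rewrite normc0.
by rewrite (le_trans (normcD _ _)) // lerD.
Qed.

Lemma normc_lb x y : normc x - normc y <= normc (x - y).
Proof. by rewrite lerBlDr -{1}(subrK y x) normcD. Qed.

Lemma normc_lbD x y : normc x - normc y <= normc (x + y).
Proof. by rewrite -{2}[y]opprK (le_trans _ (normc_lb _ _)) // normcNN. Qed.

Lemma cReD x y : Re (x + y) = Re x + Re y.
Proof. by case: x; case: y. Qed.

Lemma cImD x y : Im (x + y) = Im x + Im y.
Proof. by case: x; case: y. Qed.

Lemma cReN x : Re (- x) = - Re x.
Proof. by case: x. Qed.

Lemma cImN x : Im (- x) = - Im x.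
Proof. by case: x. Qed.

Lemma cReM x y : Re (x * y) =
  Re x * Re y - Im x * Im y.
Proof. by case: x; case: y. Qed.

Lemma cImM x y : Im (x * y) =
  Re x * Im y + Im x * Re y.
Proof. by case: x; case: y. Qed.

Lemma eqcP x y : Re x = Re y -> Im x = Im y ->
  x = y.
Proof. by case: x; case: y => a b c d /= -> ->. Qed.

Lemma cplx_gt0 z : 0 < z -> 0 < Re z /\ z = (Re z)%:C.
Proof. by case: z => a b; rewrite ltcE /= => /andP[/eqP -> ->]. Qed.

Lemma cvgcP (T : Type) (F : set_system T) {FF : Filter F} (f : T -> C) (l : C) :
  f @ F --> l <->
  forall e : R, 0 < e -> \forall t \near F, normc (l - f t) < e.
Proof.
split=> [/cvgrPdist_lt h e e0|h].
  have := h e%:C; rewrite ltcR => /(_ e0).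
  by apply: filterS => t; rewrite normc_norm ltcR.
apply/cvgrPdist_lt => e /cplx_gt0[e0 ->].
by apply: filterS (h _ e0) => t; rewrite normc_norm ltcR.
Qed.

Lemma near_normc z (e : R) : 0 < e -> \forall w \near z, normc (z - w) < e.
Proof.
move=> e0; apply/nbhs_ballP; exists e%:C; first by rewrite /= ltcR.
by move=> w h; have := (h : `|z - w| < e%:C); rewrite normc_norm ltcR.
Qed.

Lemma continuous_Re : continuous (Re : C -> R).
Proof.
move=> z; apply/(@cvgrPdist_lt _ _ _ (nbhs z) (nbhs_filter z)) => e e0.
apply: (@filterS _ _ (nbhs_filter z)) (near_normc z e0) => w; apply: le_lt_trans.
by rewrite -cReN -cReD Re_le_normc.
Qed.

Lemma continuous_Im : continuous (Im : C -> R).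
Proof.
move=> z; apply/(@cvgrPdist_lt _ _ _ (nbhs z) (nbhs_filter z)) => e e0.
apply: (@filterS _ _ (nbhs_filter z)) (near_normc z e0) => w; apply: le_lt_trans.
by rewrite -cImN -cImD Im_le_normc.
Qed.

Lemma continuous_normc : continuous (@normc R : C -> R).
Proof.
move=> z; apply/(@cvgrPdist_lt _ _ _ (nbhs z) (nbhs_filter z)) => e e0.
apply: (@filterS _ _ (nbhs_filter z)) (near_normc z e0) => w; apply: le_lt_trans.
rewrite ler_norml normc_lb andbT lerNl opprB.
by rewrite normc_distC normc_lb.
Qed.

Lemma cvg_complex (T : Type) (F : set_system T) {FF : Filter F}
    (f : T -> C) (l : C) :
  Re (f x) @[x --> F] --> Re l ->
  Im (f x) @[x --> F] --> Im l -> f @ F --> l.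
Proof.
move=> /cvgrPdist_lt hR /cvgrPdist_lt hI; apply/cvgcP => e e0.
have e20 : 0 < e / 2 by rewrite divr_gt0.
near=> t; apply: le_lt_trans (normc_le_ReIm _) _.
rewrite cReD cReN cImD cImN [ltRHS]splitr ltrD //.
- by near: t; exact: hR.
- by near: t; exact: hI.
Unshelve. all: end_near. Qed.

Lemma continuous_complex (T : topologicalType) (f : T -> C) :
  continuous (fun x : T => Re (f x)) ->
  continuous (fun x : T => Im (f x)) -> continuous f.
Proof.
move=> hR hI t.
by apply: (@cvg_complex _ (nbhs t) _ f (f t)); [exact: hR|exact: hI].
Qed.


End ComplexNorm.

Section ComplexContinuity.
Context {R : realType}.
Local Notation C := R[i].
Local Notation Re := (@complex.Re R).
Local Notation Im := (@complex.Im R).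
Implicit Types (z : C) (t : R).

Lemma continuous_ReT (T : topologicalType) (f : T -> C) : continuous f ->
  continuous (fun x : T => Re (f x)).
Proof.
by move=> cf t; apply: (@continuous_comp _ _ _ f); [exact: cf|exact: continuous_Re].
Qed.

Lemma continuous_ImT (T : topologicalType) (f : T -> C) : continuous f ->
  continuous (fun x : T => Im (f x)).
Proof.
by move=> cf t; apply: (@continuous_comp _ _ _ f); [exact: cf|exact: continuous_Im].
Qed.

Lemma continuousMc (T : topologicalType) (f g : T -> C) : continuous f ->
  continuous g -> continuous (fun x : T => f x * g x).
Proof. by move=> cf cg t; apply: (@cvgM _ _ (nbhs t)); [exact: cf|exact: cg]. Qed.

Lemma continuousDc (T : topologicalType) (f g : T -> C) : continuous f ->
  continuous g -> continuous (fun x : T => f x + g x).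
Proof. by move=> cf cg t; apply: (@cvgD _ _ _ (nbhs t)); [exact: cf|exact: cg]. Qed.

Lemma continuousNc (T : topologicalType) (f : T -> C) : continuous f ->
  continuous (fun x : T => - f x).
Proof. by move=> cf t; apply: (@cvgN _ _ _ (nbhs t)); exact: cf. Qed.

Lemma continuousBc (T : topologicalType) (f g : T -> C) : continuous f ->
  continuous g -> continuous (fun x : T => f x - g x).
Proof. by move=> cf cg; exact: (continuousDc cf (continuousNc cg)). Qed.

Lemma continuousKc (T : topologicalType) (c : C) : continuous (fun _ : T => c).
Proof. by move=> t; exact: cvg_cst. Qed.

Lemma continuous_realc (T : topologicalType) (f : T -> R) : continuous f ->
  continuous (fun x : T => (f x)%:C).
Proof. by move=> cf; apply: continuous_complex => //= t; exact: cvg_cst. Qed.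

Lemma continuous_ofR : continuous (fun t : R => t%:C).
Proof. by apply: continuous_realc => t; exact: cvg_id. Qed.

Section Iint.
Local Notation mu := (@lebesgue_measure R).
Implicit Types (a b c M : R) (h : R -> R).

(** Integrands are taken continuous on the whole line, which makes them integrable on every segment;
    functions given only on part of it are first extended continuously. *)
Definition iint a b h : R := \int[mu]_(x in `[a, b]) h x.

Lemma iint_integrable a b h : continuous h ->
  mu.-integrable `[a, b] (EFin \o h).
Proof.
move=> ch; apply: continuous_compact_integrable; first exact: segment_compact.
by move=> x; apply: continuous_subspaceT => // ? ; exact: ch.
Qed.
Let ii := iint_integrable.

Lemma iintD a b h k : continuous h -> continuous k ->
  iint a b (fun x => h x + k x) = iint a b h + iint a b k.
Proof. by move=> ch ck; rewrite /iint RintegralD//; exact: ii. Qed.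

Lemma iintZ a b (c : R) h : continuous h ->
  iint a b (fun x => c * h x) = c * iint a b h.
Proof. by move=> ch; rewrite /iint RintegralZl//; exact: ii. Qed.

Lemma iintN a b h : continuous h ->
  iint a b (fun x => - h x) = - iint a b h.
Proof.
move=> ch; rewrite -mulN1r -iintZ //; congr iint.
by apply/funext => x; rewrite mulN1r.
Qed.

Lemma iint_cst a b c : a <= b -> iint a b (fun=> c) = c * (b - a).
Proof.
move=> ab; rewrite /iint Rintegral_cst //; congr (c * _).
transitivity (fine (@lebesgue_measure R `[a, b])); first by [].
rewrite lebesgue_measure_itv.
by rewrite /= lte_fin; case: ltgtP ab => // -> _; rewrite subrr.
Qed.

Lemma iint_le a b h k : continuous h -> continuous k ->
  (forall x, a <= x <= b -> h x <= k x) -> iint a b h <= iint a b k.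
Proof.
move=> ch ck hk; apply: le_Rintegral; [by []|exact: ii|exact: ii|].
by move=> x /=; rewrite in_itv; exact: hk.
Qed.

Lemma iint_bound a b h M : a <= b -> continuous h ->
  (forall x, a <= x <= b -> `|h x| <= M) -> `|iint a b h| <= M * (b - a).
Proof.
move=> ab ch hM; rewrite -iint_cst // ler_norml; apply/andP; split.
  rewrite lerNl -iintN //; apply: iint_le => //.
  - by move=> u; apply: (@cvgN _ _ _ (nbhs u)); exact: ch.
  - by move=> x; exact: cvg_cst.
  - by move=> u /hM; rewrite ler_norml => /andP[]; rewrite lerNl.
apply: iint_le => //; first by move=> x; exact: cvg_cst.
by move=> u /hM; rewrite ler_norml => /andP[].
Qed.

Lemma iint_split a b c h : a <= c <= b -> continuous h ->
  iint a b h = iint a c h + iint c b h.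
Proof.
move=> /andP[ac cb] ch; have := @Rintegral_itvB R h (BLeft a) (BRight b) c.
rewrite /= !bnd_simp => /(_ (iint_integrable _ _ ch) ac cb).
rewrite /iint Rintegral_itv_obnd_cbnd; first by move=> <-; rewrite addrC subrK.
by apply: integrableS (iint_integrable c b ch) => //; apply: subset_itvr; rewrite bnd_simp.
Qed.

Lemma eq_iint a b h k : (forall x, a <= x <= b -> h x = k x) ->
  iint a b h = iint a b k.
Proof.
by move=> hk; apply: eq_Rintegral => x; rewrite inE /= in_itv /= => /hk.
Qed.

Lemma iint_FTC a b (F h : R -> R) : a < b -> continuous h ->
  (forall x : R, is_derive x 1 F (h x)) -> iint a b h = F b - F a.
Proof.
move=> ab ch dF; rewrite /iint /Rintegral (@continuous_FTC2 _ _ F) //.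
- by move=> x; apply: continuous_subspaceT => // ? ; exact: ch.
- have cF x : {for x, continuous F}.
    by apply: differentiable_continuous; apply/derivable1_diffP; have [] := dF x.
  split.
  + by move=> x _; have [] := dF x.
  + exact: cvg_at_right_filter (cF a).
  + exact: cvg_at_left_filter (cF b).
- by move=> x _; rewrite derive1E; have [_ ->] := dF x.
Qed.

End Iint.
End ComplexContinuity.

Section ComplexIntegral.
Context {R : realType}.
Local Notation C := R[i].
Local Notation Re := (@complex.Re R).
Local Notation Im := (@complex.Im R).
Implicit Types (a b c M : R) (F G : R -> C).

Definition cint a b F : C :=
  iint a b (fun t => Re (F t)) +i* iint a b (fun t => Im (F t)).

Lemma cintD a b F G : continuous F -> continuous G ->
  cint a b (fun t => F t + G t) = cint a b F + cint a b G.
Proof.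
move=> cF cG; have cR := continuous_ReT cF; have cI := continuous_ImT cF.
have dR := continuous_ReT cG; have dI := continuous_ImT cG.
apply: eqcP; rewrite ?cReD ?cImD /=.
- by rewrite -(iintD _ _ cR dR); apply: eq_iint => t _; rewrite cReD.
- by rewrite -(iintD _ _ cI dI); apply: eq_iint => t _; rewrite cImD.
Qed.

Lemma cintZ a b (c : C) F : continuous F ->
  cint a b (fun t => c * F t) = c * cint a b F.
Proof.
move=> cF; have cR := continuous_ReT cF; have cI := continuous_ImT cF.
have cZ (k : R) (h : R -> R) : continuous h -> continuous (fun x => k * h x).
  by move=> ch x; apply: (@cvgM _ _ (nbhs x)); [exact: cvg_cst|exact: ch].
apply: eqcP.
- rewrite cReM -(iintZ _ _ _ cR) -(iintZ _ _ _ cI) -(iintN _ _ (cZ _ _ cI)).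
  rewrite -(iintD _ _ (cZ _ _ cR)); first by apply: eq_iint => x _; rewrite cReM.
  by move=> x; apply: (@cvgN _ _ _ (nbhs x)); exact: cZ.
- rewrite cImM -(iintZ _ _ _ cR) -(iintZ _ _ _ cI).
  rewrite -(iintD _ _ (cZ _ _ cI) (cZ _ _ cR)).
  by apply: eq_iint => x _; rewrite cImM.
Qed.

Lemma cintN a b F : continuous F -> cint a b (fun t => - F t) = - cint a b F.
Proof.
move=> cF; rewrite -mulN1r -(cintZ _ _ _ cF); congr cint.
by apply/funext => t; rewrite mulN1r.
Qed.

Lemma cintB a b F G : continuous F -> continuous G ->
  cint a b (fun t => F t - G t) = cint a b F - cint a b G.
Proof.
by move=> cF cG; rewrite -(cintN _ _ cG) -(cintD _ _ cF (continuousNc cG)).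
Qed.

Lemma cint_cst a b (c : C) : a <= b -> cint a b (fun=> c) = c * (b - a)%:C.
Proof.
move=> ab; apply: eqcP; rewrite /= iint_cst // ?cReM ?cImM /=.
- by rewrite mulr0 subr0.
- by rewrite mulr0 add0r.
Qed.

Lemma cint_split a b c F : a <= c <= b -> continuous F ->
  cint a b F = cint a c F + cint c b F.
Proof.
move=> acb cF; apply: eqcP; rewrite ?cReD ?cImD /=.
- exact: (iint_split acb (continuous_ReT cF)).
- exact: (iint_split acb (continuous_ImT cF)).
Qed.

Lemma eq_cint a b F G : (forall t, a <= t <= b -> F t = G t) ->
  cint a b F = cint a b G.
Proof. by move=> FG; apply: eqcP; apply: eq_iint => t /FG ->. Qed.

(** The factor 2 comes from bounding real and imaginary parts separately; it propagates to all
    coefficient bounds below, where only the order of magnitude matters. *)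
Lemma cint_bound a b F M : a <= b -> continuous F ->
  (forall t, a <= t <= b -> normc (F t) <= M) ->
  normc (cint a b F) <= 2 * M * (b - a).
Proof.
move=> ab cF FM; apply: le_trans (normc_le_ReIm _) _ => /=.
rewrite -mulrA mulr_natl mulr2n; apply: lerD.
- apply: (iint_bound ab (continuous_ReT cF)) => t /FM.
  by apply: le_trans; exact: Re_le_normc.
- apply: (iint_bound ab (continuous_ImT cF)) => t /FM.
  by apply: le_trans; exact: Im_le_normc.
Qed.

Lemma iint_id a b : a < b -> iint a b id = (b ^+ 2 - a ^+ 2) / 2.
Proof.
move=> ab; have d (x : R) : is_derive x 1 (fun y : R => 2^-1 *: y ^+ 2) x.
  by apply: is_derive_eq; rewrite /GRing.scale /=; field.
have ci : continuous (@id R) by move=> x; exact: cvg_id.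
by rewrite (iint_FTC ab ci d) /GRing.scale /= -mulrBr mulrC.
Qed.

Lemma cint_affine a b (A D : C) : a < b ->
  cint a b (fun t => A + D * t%:C) =
    A * (b%:C - a%:C) + D * ((b%:C ^+ 2 - a%:C ^+ 2) / 2).
Proof.
move=> ab; rewrite (cintD _ _ (@continuousKc R R A)); last first.
  exact: (continuousMc (@continuousKc R R D) continuous_ofR).
rewrite (cintZ _ _ _ continuous_ofR) (cint_cst _ (ltW ab)) rmorphB; congr (_ + D * _).
apply: eqcP => /=.
  by rewrite iint_id //; field.
by rewrite (iint_cst _ (ltW ab)) mul0r; field.
Qed.

End ComplexIntegral.

(** * Cauchy's theorem on rectangles *)

Section Goursat.
Context {R : realType}.
Local Notation C := R[i].
Local Notation Re := (@complex.Re R).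
Local Notation Im := (@complex.Im R).

Lemma nested_intervals (a l : nat -> R) : (forall n, a n <= a n.+1) ->
  (forall n, a n.+1 + l n.+1 <= a n + l n) -> (forall n, 0 <= l n) ->
  exists s, forall n, a n <= s <= a n + l n.
Proof.
move=> ha hb l0.
have am : {homo a : n m / (n <= m)%N >-> n <= m}.
  by apply: homo_leq => [x|x y z|//]; [exact: lexx|exact: le_trans].
have bm : {homo (fun n => - (a n + l n)) : n m / (n <= m)%N >-> n <= m}.
  apply: (@homo_leq _ (fun n => - (a n + l n)) <=%R) => [x|x y z|n].
  - exact: lexx.
  - exact: le_trans.
  - by rewrite lerN2.
have ab n m : a n <= a m + l m.
  have [nm|/ltnW mn] := leqP n m.
    by rewrite (le_trans (am _ _ nm)) // lerDl.
  have := bm _ _ mn; rewrite lerN2; apply: le_trans.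
  by rewrite lerDl.
exists (sup (range a)) => n; apply/andP; split.
  apply: ub_le_sup; last by exists n.
  by exists (a 0%N + l 0%N) => _ [k _ <-].
by apply: ge_sup; [exists (a 0%N), 0%N|move=> _ [k _ <-]].
Qed.

(** The contour integral of [g] against $ds + i\,dt$ along the boundary of the rectangle,
    counterclockwise. *)
Definition rect_int (g : R -> R -> C) (a b c d : R) : C :=
  cint a b (fun s => g s c) + 'i * cint c d (g b)
  - cint a b (fun s => g s d) - 'i * cint c d (g a).

(** Complex differentiability at [s0 + i t0] relative to the closed rectangle, with the error
    measured against the sum of the two increments. *)
Definition rect_diff (g : R -> R -> C) (a b c d s0 t0 : R) :=
  exists D : C, forall e : R, 0 < e -> exists2 dl : R, 0 < dl &
    forall s t, a <= s <= b -> c <= t <= d ->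
      `|s - s0| < dl -> `|t - t0| < dl ->
      normc (g s t - g s0 t0 - D * ((s - s0)%:C + 'i * (t - t0)%:C)) <=
        e * (`|s - s0| + `|t - t0|).

Lemma rect_int_affine (A D : C) (a b c d : R) : a < b -> c < d ->
  rect_int (fun s t => A + D * (s%:C + 'i * t%:C)) a b c d = 0.
Proof.
move=> ab cd; rewrite /rect_int.
have E1 t : cint a b (fun s => A + D * (s%:C + 'i * t%:C)) =
    cint a b (fun s => (A + D * 'i * t%:C) + D * s%:C).
  by congr cint; apply/funext => s; ring.
have E2 s : cint c d (fun t => A + D * (s%:C + 'i * t%:C)) =
    cint c d (fun t => (A + D * s%:C) + (D * 'i) * t%:C).
  by congr cint; apply/funext => t; ring.
by rewrite !E1 !E2 !cint_affine //; ring.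
Qed.

Lemma rect_intB (g h : R -> R -> C) (a b c d : R) :
  (forall t, continuous (fun s => g s t)) -> (forall s, continuous (g s)) ->
  (forall t, continuous (fun s => h s t)) -> (forall s, continuous (h s)) ->
  rect_int (fun s t => g s t - h s t) a b c d =
  rect_int g a b c d - rect_int h a b c d.
Proof.
move=> g1 g2 h1 h2; rewrite /rect_int.
by rewrite !(cintB _ _ (g1 _) (h1 _)) !(cintB _ _ (g2 _) (h2 _)); ring.
Qed.

Lemma rect_int_bound (g : R -> R -> C) (a b c d M : R) : a <= b -> c <= d ->
  (forall t, continuous (fun s => g s t)) -> (forall s, continuous (g s)) ->
  (forall s t, a <= s <= b -> c <= t <= d -> normc (g s t) <= M) ->
  normc (rect_int g a b c d) <= 4 * M * ((b - a) + (d - c)).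
Proof.
move=> ab cd c1 c2 gM.
have h1 t : c <= t <= d -> normc (cint a b (fun s => g s t)) <= 2 * M * (b - a).
  by move=> tcd; apply: (cint_bound ab (c1 t)) => s sab; exact: gM.
have h2 s : a <= s <= b -> normc ('i * cint c d (g s)) <= 2 * M * (d - c).
  move=> sab; rewrite normcM (_ : normc 'i = 1) ?mul1r; last first.
    by rewrite /normc /= expr0n expr1n add0r sqrtr1.
  by apply: (cint_bound cd (c2 s)) => t; exact: gM.
have hc : c <= c <= d by rewrite lexx.
have hd : c <= d <= d by rewrite lexx andbT.
have ha : a <= a <= b by rewrite lexx.
have hb : a <= b <= b by rewrite lexx andbT.
have := h1 _ hc; have := h1 _ hd; have := h2 _ ha; have := h2 _ hb.
rewrite /rect_int; set z2 := 'i * cint c d (g b); set z4 := 'i * cint c d (g a).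
set z3 := cint a b _; set z1 := cint a b _ => k1 k2 k3 k4.
have := normcB (z1 + z2 - z3) z4; have := normcB (z1 + z2) z3.
have := normcD z1 z2; lra.
Qed.

Lemma rect_int_quarters (g : R -> R -> C) (a m b c n d : R) :
  (forall t, continuous (fun s => g s t)) -> (forall s, continuous (g s)) ->
  a <= m <= b -> c <= n <= d ->
  rect_int g a b c d = rect_int g a m c n + rect_int g m b c n +
    rect_int g a m n d + rect_int g m b n d.
Proof.
move=> c1 c2 mab ncd; rewrite /rect_int.
by rewrite !(cint_split mab (c1 _)) !(cint_split ncd (c2 _)); ring.
Qed.

(** Some quarter of each rectangle carries at least a fourth of the modulus of the integral. The
    chosen quarters shrink to a point near which [g] is affine up to a small error, and affine
    functions have integral 0. *)
Lemma goursat (g : R -> R -> C) (a b c d : R) : a < b -> c < d ->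
  (forall t, continuous (fun s => g s t)) -> (forall s, continuous (g s)) ->
  (forall s t, a <= s <= b -> c <= t <= d -> rect_diff g a b c d s t) ->
  rect_int g a b c d = 0.
Proof.
move=> ab cd c1 c2 hg.
pose l n : R := (b - a) / 2 ^+ n; pose h n : R := (d - c) / 2 ^+ n.
have p2 n : (0 : R) < 2 ^+ n by rewrite exprn_gt0.
have lS n : l n = l n.+1 + l n.+1.
  by rewrite /l exprS; field; rewrite gt_eqF.
have hS n : h n = h n.+1 + h n.+1.
  by rewrite /h exprS; field; rewrite gt_eqF.
have l0 n : 0 < l n by rewrite divr_gt0 ?subr_gt0.
have h0 n : 0 < h n by rewrite divr_gt0 ?subr_gt0.
have lE n : l n = (b - a) / 2 ^+ n by [].
have hE n : h n = (d - c) / 2 ^+ n by [].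
clearbody l h.
pose J n (p : R * R) := rect_int g p.1 (p.1 + l n) p.2 (p.2 + h n).
pose sub n (p : R * R) (q : bool * bool) : R * R :=
  (p.1 + (if q.1 then l n.+1 else 0), p.2 + (if q.2 then h n.+1 else 0)).
have step (np : nat * (R * R)) : exists q : bool * bool,
    normc (J np.1 np.2) <= 4 * normc (J np.1.+1 (sub np.1 np.2 q)).
  case: np => n [x y] /=; apply: contrapT => /forallNP hq.
  have {}hq q : 4 * normc (J n.+1 (sub n (x, y) q)) < normc (J n (x, y)).
    by rewrite ltNge; apply/negP/hq.
  have l1 := l0 n.+1; have h1 := h0 n.+1.
  have mx : x <= x + l n.+1 <= x + l n by rewrite (lS n); lra.
  have my : y <= y + h n.+1 <= y + h n by rewrite (hS n); lra.
  have : J n (x, y) = J n.+1 (sub n (x, y) (false, false)) +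
      J n.+1 (sub n (x, y) (true, false)) +
      J n.+1 (sub n (x, y) (false, true)) + J n.+1 (sub n (x, y) (true, true)).
    transitivity (rect_int g x (x + l n) y (y + h n)); first by [].
    have e1 : x + l n = x + l n.+1 + l n.+1 by rewrite (lS n) addrA.
    have e2 : y + h n = y + h n.+1 + h n.+1 by rewrite (hS n) addrA.
    by rewrite (rect_int_quarters c1 c2 mx my) /J /sub /= !addr0 e1 e2.
  have := hq (false, false); have := hq (true, false).
  have := hq (false, true); have := hq (true, true).
  move: (J _ _) (J _ _) (J _ _) (J _ _) (J _ _) => w z1 z2 z3 z4.
  move=> hw1 hw2 hw3 hw4 zE.
  have := normcD (w + z1 + z2) z4; have := normcD (w + z1) z2.
  by have := normcD w z1; rewrite -zE; lra.
have [q hq] := choice step.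
pose p := fix p n : R * R := if n is k.+1 then sub k (p k) (q (k, p k)) else (a, c).
have pJ n : normc (J 0%N (a, c)) <= 4 ^+ n * normc (J n (p n)).
  elim: n => [|n IH]; first by rewrite expr0 mul1r.
  apply: le_trans IH _; rewrite exprSr -mulrA ler_pM2l ?exprn_gt0 //.
  exact: (hq (n, p n)).
have [s hs] : exists s, forall n, (p n).1 <= s <= (p n).1 + l n.
  apply: nested_intervals => n /=; last exact: ltW.
    by rewrite lerDl; case: ifP => // _; exact: ltW.
  by rewrite (lS n); case: ifP => _; have := l0 n.+1; lra.
have [t ht] : exists t, forall n, (p n).2 <= t <= (p n).2 + h n.
  apply: nested_intervals => n /=; last exact: ltW.
    by rewrite lerDl; case: ifP => // _; exact: ltW.
  by rewrite (hS n); case: ifP => _; have := h0 n.+1; lra.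
have pin n : [/\ a <= (p n).1, (p n).1 + l n <= b, c <= (p n).2 &
    (p n).2 + h n <= d].
  elim: n => [|n [i1 i2 i3 i4]].
    by rewrite lE hE expr0 !divr1 /= !subrKC !lexx.
  have l1 := l0 n.+1; have h1 := h0 n.+1.
  by move: i2 i4; rewrite (lS n) (hS n) /=; split; case: ifP => _; lra.
have sab : a <= s <= b.
  by have := hs 0%N; rewrite lE expr0 divr1 /= subrKC.
have tcd : c <= t <= d.
  by have := ht 0%N; rewrite hE expr0 divr1 /= subrKC.
have J0E : J 0%N (a, c) = rect_int g a b c d.
  by rewrite /J lE hE !expr0 !divr1 /= !subrKC.
apply/eqP; rewrite -normc_eq0 -J0E eq_le normc_ge0 andbT.
apply/ler_addgt0Pr => e e0; rewrite add0r.
have [D hD] := hg _ _ sab tcd.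
pose L := (b - a) + (d - c).
have L0 : 0 < L by rewrite /L; lra.
(* At stage n the side lengths add up to [L / 2 ^+ n], so the error is at most [e' * (L / 2 ^+ n)]
   and its contour integral at most [4 * e' * (L / 2 ^+ n) ^+ 2]; the factor [4 ^+ n] lost by
   quartering turns this into [e]. *)
pose e' := e / (4 * L ^+ 2).
have e'0 : 0 < e' by rewrite divr_gt0 // mulr_gt0 // exprn_gt0.
have [dl dl0 hdl] := hD _ e'0.
have [n Ln] : exists n, L / 2 ^+ n < dl.
  have [n hn] : exists n, L / dl < 2 ^+ n.
    pose k := Num.truncn (L / dl); exists k.+1.
    apply: lt_le_trans (_ : k.+1%:R <= _); first exact: truncnS_gt.
    by rewrite -natrX ler_nat ltnW // ltn_expl.
  by exists n; rewrite ltr_pdivrMr // mulrC -ltr_pdivrMr.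
have [i1 i2 i3 i4] := pin n; have /andP[s1 s2] := hs n; have /andP[t1 t2] := ht n.
have lL : l n <= L / 2 ^+ n.
  by rewrite ?lE ?hE ler_pM2r ?invr_gt0 // /L; lra.
have hL : h n <= L / 2 ^+ n.
  by rewrite ?lE ?hE ler_pM2r ?invr_gt0 // /L; lra.
have lhL : l n + h n = L / 2 ^+ n by rewrite lE hE -mulrDl.
pose A := g s t - D * (s%:C + 'i * t%:C).
pose g0 (x y : R) := A + D * (x%:C + 'i * y%:C).
have cg1 y : continuous (fun x => g0 x y).
  apply: (continuousDc (@continuousKc R R A)).
  apply: (continuousMc (@continuousKc R R D)).
  exact: (continuousDc continuous_ofR (@continuousKc R R _)).
have cg2 x : continuous (g0 x).
  apply: (continuousDc (@continuousKc R R A)).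
  apply: (continuousMc (@continuousKc R R D)).
  apply: (continuousDc (@continuousKc R R _)).
  exact: (continuousMc (@continuousKc R R _) continuous_ofR).
have JnE : J n (p n) = rect_int (fun x y => g x y - g0 x y) (p n).1
    ((p n).1 + l n) (p n).2 ((p n).2 + h n).
  by rewrite (rect_intB _ _ _ _ c1 c2 cg1 cg2) rect_int_affine ?subr0 ?ltrDl.
apply: le_trans (pJ n) _; rewrite JnE.
have hb : normc (rect_int (fun x y => g x y - g0 x y) (p n).1
    ((p n).1 + l n) (p n).2 ((p n).2 + h n)) <=
    4 * (e' * (L / 2 ^+ n)) * (((p n).1 + l n - (p n).1) + ((p n).2 + h n - (p n).2)).
  apply: rect_int_bound.
  - by rewrite lerDl ltW.
  - by rewrite lerDl ltW.
  - by move=> y; exact: (continuousBc (c1 y) (cg1 y)).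
  - by move=> x; exact: (continuousBc (c2 x) (cg2 x)).
  move=> x y /andP[x1 x2] /andP[y1 y2].
  have -> : g x y - g0 x y =
      g x y - g s t - D * ((x - s)%:C + 'i * (y - t)%:C).
    by rewrite /g0 /A !rmorphB; ring.
  have xs : `|x - s| <= l n by rewrite ler_norml; lra.
  have yt : `|y - t| <= h n by rewrite ler_norml; lra.
  apply: le_trans (hdl x y _ _ _ _) _.
  - by apply/andP; split; lra.
  - by apply/andP; split; lra.
  - by apply: le_lt_trans xs _; apply: le_lt_trans lL _.
  - by apply: le_lt_trans yt _; apply: le_lt_trans hL _.
  by rewrite ler_pM2l // -lhL lerD.
apply: le_trans (ler_wpM2l _ hb) _; first by rewrite exprn_ge0.
rewrite ![_ + _ - _]addrAC !subrr !add0r lhL le_eqVlt; apply/orP; left; apply/eqP.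
have -> : (4 : R) ^+ n = 2 ^+ n * 2 ^+ n by rewrite -exprMn; congr (_ ^+ _); ring.
by rewrite /e'; field; rewrite !gt_eqF.
Qed.

End Goursat.

(** * Complex derivatives *)

Section ComplexDerivative.
Context {R : realType}.
Local Notation C := R[i].
Implicit Types (f g : C -> C) (z w D E : C).

(* Caratheodory's form of complex differentiability. *)
Definition cderiv f z D := exists phi : C -> C,
  [/\ phi @ z --> phi z, phi z = D & forall w, f w = f z + phi w * (w - z)].

Lemma cvg_at_cP f z :
  (f @ z --> f z) <-> forall e : R, 0 < e -> exists2 dl : R, 0 < dl &
    forall w, normc (w - z) < dl -> normc (f w - f z) < e.
Proof.
split=> [/(@cvgcP R C (nbhs z) (nbhs_filter z)) h e e0|h].
  have /nbhs_ballP[dl /cplx_gt0[d0 ->] hd] := h _ e0.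
  exists (complex.Re dl) => // w wz; rewrite normc_distC; apply: hd.
  have : `|z - w| < (complex.Re dl)%:C by rewrite normc_norm ltcR normc_distC.
  by [].
apply/(@cvgcP R C (nbhs z) (nbhs_filter z)) => e e0.
have [dl d0 hd] := h _ e0.
apply: (@filterS _ _ (nbhs_filter z)) (near_normc z d0) => w wz.
by rewrite normc_distC; apply: hd; rewrite normc_distC.
Qed.

(** Away from [z] the difference quotient always provides the factorisation that [cderiv] requires
    at every point, so a factorisation near [z] suffices. *)
Lemma cderiv_near f z (phi : C -> C) : phi @ z --> phi z ->
  (\forall w \near z, f w = f z + phi w * (w - z)) -> cderiv f z (phi z).
Proof.
move=> cphi /nbhs_ballP[dl /cplx_gt0[d0 dlE] hd].
pose psi w := if w == z then phi z else (f w - f z) / (w - z).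
exists psi; split.
- apply/cvg_at_cP => e e0; have /cvg_at_cP/(_ _ e0)[d1 d10 h1] := cphi.
  exists (Num.min d1 (complex.Re dl)); first by rewrite lt_min d10.
  move=> w; rewrite lt_min => /andP[w1 w2]; rewrite /psi eqxx.
  have [//|wz] := eqVneq w z; first by rewrite subrr normc0.
  have -> : f w = f z + phi w * (w - z).
    apply: hd; have : `|z - w| < (complex.Re dl)%:C.
      by rewrite normc_norm ltcR normc_distC.
    by rewrite dlE.
  by rewrite [f z + _]addrC addrK mulfK ?subr_eq0 //; exact: h1.
- by rewrite /psi eqxx.
move=> w; rewrite /psi; have [->|wz] := eqVneq w z; first by rewrite subrr mulr0 addr0.
by rewrite divfK ?subr_eq0 // addrC subrK.
Qed.

Lemma cderiv_continuous f z D : cderiv f z D -> f @ z --> f z.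
Proof.
move=> [phi [cphi _ fE]].
have -> : f = (fun w => f z + phi w * (w - z)) by apply/funext => w; exact: fE.
apply: (@cvgD _ _ _ (nbhs z)); first exact: cvg_cst.
apply: (@cvgM _ _ (nbhs z)); first exact: cphi.
by apply: (@cvgB _ _ _ (nbhs z)); [exact: cvg_id|exact: cvg_cst].
Qed.

Lemma cderiv_cst (c : C) z : cderiv (fun=> c) z 0.
Proof.
exists (fun=> 0); split=> [||w]; [exact: (@continuousKc R C 0 z)|by []|].
by rewrite mul0r addr0.
Qed.

Lemma cderiv_id z : cderiv id z 1.
Proof.
exists (fun=> 1); split=> [||w]; [exact: (@continuousKc R C 1 z)|by []|].
by rewrite mul1r addrC subrK.
Qed.

Lemma cderivD f g z D E : cderiv f z D -> cderiv g z E ->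
  cderiv (fun w => f w + g w) z (D + E).
Proof.
move=> [phi [cphi <- fE]] [psi [cpsi <- gE]].
exists (fun w => phi w + psi w); split=> [||w].
- by apply: (@cvgD _ _ _ (nbhs z)); [exact: cphi|exact: cpsi].
- by [].
by rewrite {1}fE {1}gE; ring.
Qed.

Lemma cderivM f g z D E : cderiv f z D -> cderiv g z E ->
  cderiv (fun w => f w * g w) z (D * g z + f z * E).
Proof.
move=> dF dG; have cg := cderiv_continuous dG.
move: dF dG => [phi [cphi <- fE]] [psi [cpsi <- gE]].
exists (fun w => phi w * g w + f z * psi w); split=> [||w].
- apply: (@cvgD _ _ _ (nbhs z)); apply: (@cvgM _ _ (nbhs z)).
  + exact: cphi.
  + exact: cg.
  + exact: (@continuousKc R C (f z) z).
  + exact: cpsi.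
- by [].
by rewrite {1}(fE w) mulrDl {1}(gE w); ring.
Qed.

Lemma cderivZ (c : C) f z D : cderiv f z D -> cderiv (fun w => c * f w) z (c * D).
Proof. by move=> /(cderivM (cderiv_cst c z)); rewrite mul0r add0r. Qed.

Lemma cderivN f z D : cderiv f z D -> cderiv (fun w => - f w) z (- D).
Proof.
move=> /(cderivZ (-1)); rewrite mulN1r.
by under [X in cderiv X]funext do rewrite mulN1r.
Qed.

Lemma cderivB f g z D E : cderiv f z D -> cderiv g z E ->
  cderiv (fun w => f w - g w) z (D - E).
Proof. by move=> dF /cderivN; exact: cderivD. Qed.

Lemma cderivV f z D : f z != 0 -> cderiv f z D ->
  cderiv (fun w => (f w)^-1) z (- D / f z ^+ 2).
Proof.
move=> fz dF; have cf := cderiv_continuous dF; move: dF => [phi [cphi <- fE]].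
pose psi w := - phi w / (f w * f z).
have -> : - phi z / f z ^+ 2 = psi z by [].
apply: cderiv_near.
  apply: (@cvgM _ _ (nbhs z)); first by apply: (@cvgN _ _ _ (nbhs z)); exact: cphi.
  apply: (@cvgV _ _ (nbhs z)); first by rewrite mulf_neq0.
  by apply: (@cvgM _ _ (nbhs z)); [exact: cf|exact: cvg_cst].
have /cvg_at_cP/(_ (normc (f z)))[|dl d0 hd] := cf; first by rewrite normc_gt0.
apply: (@filterS _ _ (nbhs_filter z)) (near_normc z d0) => w wz.
have fw : f w != 0.
  apply/eqP => fw0; have := hd w; rewrite normc_distC => /(_ wz).
  by rewrite fw0 sub0r normcNN ltxx.
have e : phi w * (w - z) = f w - f z by rewrite [f w]fE [f z + _]addrC addrK.
rewrite /psi mulrAC mulNr e.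
by field; rewrite fw fz.
Qed.

Lemma cderiv_comp f g z D E : cderiv f z D -> cderiv g (f z) E ->
  cderiv (fun w => g (f w)) z (E * D).
Proof.
move=> dF; have cf := cderiv_continuous dF.
move: dF => [phi [cphi <- fE]] [psi [cpsi <- gE]].
exists (fun w => psi (f w) * phi w); split=> [||w].
- apply: (@cvgM _ _ (nbhs z)); last exact: cphi.
  exact: (continuous_comp cf cpsi).
- by [].
have e : f w - f z = phi w * (w - z) by rewrite {1}(fE w) [f z + _]addrC addrK.
by rewrite (gE (f w)) e; ring.
Qed.

Lemma cderivX f z D n : cderiv f z D ->
  cderiv (fun w => f w ^+ n) z (n%:R * f z ^+ n.-1 * D).
Proof.
move=> dF; elim: n => [|n IH].
  rewrite mul0r mul0r; under [X in cderiv X]funext do rewrite expr0.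
  exact: cderiv_cst.
under [X in cderiv X]funext do rewrite exprS.
have -> : n.+1%:R * f z ^+ n * D = D * f z ^+ n + f z * (n%:R * f z ^+ n.-1 * D).
  case: n {IH} => [|n]; first by rewrite !expr0; ring.
  by rewrite exprS -[n.+2]addn1 natrD /=; ring.
exact: (cderivM dF IH).
Qed.

Lemma cderivXz z (n : int) : z != 0 -> exists D, cderiv (fun w => w ^ n) z D.
Proof.
move=> z0; case: n => n.
  by eexists; exact: (cderivX n (cderiv_id z)).
by eexists; apply: cderivV; [rewrite expf_neq0|exact: (cderivX n.+1 (cderiv_id z))].
Qed.

Lemma cderiv_dist f z D : cderiv f z D -> forall e : R, 0 < e ->
  exists2 dl : R, 0 < dl & forall h, normc h < dl ->
    normc (f (z + h) - f z - D * h) <= e * normc h.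
Proof.
move=> [phi [cphi <- fE]] e e0; have /cvg_at_cP/(_ _ e0)[dl d0 hd] := cphi.
exists dl => // h hh; rewrite fE [z + h]addrC addrK [_ + phi _ * h]addrC addrK.
rewrite -mulrBl normcM ler_wpM2r ?normc_ge0 //; apply/ltW/hd.
by rewrite addrK.
Qed.

Lemma derivable_cderivP f z D :
  ((fun h : C => h^-1 *: (f (h *: 1 + z) - f z)) @ 0^' --> D) <-> cderiv f z D.
Proof.
split=> [h|[phi [cphi <- fE]]].
  pose phi w := if w == z then D else (f w - f z) / (w - z).
  have pz : phi z = D by rewrite /phi eqxx.
  rewrite -pz; apply: cderiv_near.
    apply/cvg_at_cP => e e0.
    have /(@cvgcP R C (0^') _)/(_ _ e0) := h.
    move=> /nbhs_ballP[dl /cplx_gt0[d0 dlE] hd].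
    exists (complex.Re dl) => // w wz; rewrite pz /phi.
    have [_|wnz] := eqVneq w z; first by rewrite subrr normc0.
    rewrite normc_distC.
    have := hd (w - z); rewrite /GRing.scale /= mulr1 subrK mulrC.
    apply; last by rewrite subr_eq0.
    have : `|0 - (w - z)| < (complex.Re dl)%:C.
      by rewrite sub0r normrN normc_norm ltcR.
    by rewrite -dlE.
  near=> w; rewrite /phi; have [->|wz] := eqVneq w z.
    by rewrite subrr mulr0 addr0.
  by rewrite divfK ?subr_eq0 // addrC subrK.
apply/(@cvgcP R C (0^') _) => e e0.
have /cvg_at_cP/(_ _ e0)[dl d0 hd] := cphi.
have hn := near_normc (0 : C) d0.
rewrite near_withinE; apply: (@filterS _ _ (nbhs_filter (0 : C))) hn => h.
rewrite sub0r normcNN => hh h0.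
rewrite /GRing.scale /= mulr1 [f (h + z)]fE addrK [f z + _]addrC addrK.
by rewrite mulrC mulfK // normc_distC; apply: hd; rewrite addrK.
Unshelve. all: end_near. Qed.

Lemma derivable_cderiv f z : derivable f z 1 -> exists D, cderiv f z D.
Proof.
move=> /cvg_ex[D hD]; exists D; apply/derivable_cderivP; exact: hD.
Qed.

Lemma cderiv_derivable f z D : cderiv f z D -> derivable f z 1.
Proof.
move=> /derivable_cderivP h; apply/cvg_ex; exists D; exact: h.
Qed.

Lemma cderiv_derive1 f z D : cderiv f z D -> derive1 f z = D.
Proof.
move=> /derivable_cderivP h; rewrite derive1E.
by apply: (@cvg_lim _ (@norm_hausdorff _ _)); exact: h.
Qed.

End ComplexDerivative.

(** * Circle means and Laurent expansions *)

Section CircleMean.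
Context {R : realType}.
Local Notation C := R[i].
Local Notation Re := (@complex.Re R).
Local Notation Im := (@complex.Im R).
Implicit Types (F G f : C -> C) (z w : C) (r s t h k e M : R).

Definition cis t : C := cos t +i* sin t.

Lemma cisD s t : cis (s + t) = cis s * cis t.
Proof. by apply: eqcP; rewrite /= ?cosD ?sinD // addrC mulrC. Qed.

Lemma normc_cis t : normc (cis t) = 1.
Proof. by rewrite /normc /= cos2Dsin2 sqrtr1. Qed.

Lemma normc_circle_pt r t : 0 <= r -> normc (circle_pt r t) = r.
Proof. by move=> r0; rewrite normcM normc_cis mulr1 normc_realp. Qed.

Lemma circle_pt0 r : circle_pt r 0 = r%:C.
Proof. by rewrite /circle_pt cos0 sin0 mulr1. Qed.

Lemma circle_pt2pi r : circle_pt r (2 * pi) = r%:C.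
Proof. by rewrite /circle_pt mulr_natl cos2pi sin2pi mulr1. Qed.

Lemma pi2_gt0 : 0 < 2 * pi :> R.
Proof. by rewrite mulr_gt0 // pi_gt0. Qed.

Lemma continuous_cis : continuous cis.
Proof.
by apply: continuous_complex => t /=; [exact: continuous_cos|exact: continuous_sin].
Qed.

Lemma continuous_circle_pt r : continuous (circle_pt r).
Proof. exact: (continuousMc (@continuousKc R R _) continuous_cis). Qed.

Definition on_circle r F := forall z, normc z = r -> F @ z --> F z.

Lemma on_circleP r F : 0 <= r -> on_circle r F ->
  continuous (fun t => F (circle_pt r t)).
Proof.
move=> r0 cF t; have cz := cF _ (normc_circle_pt t r0).
exact: (continuous_comp (@continuous_circle_pt r t) cz).
Qed.

Lemma on_circleD r F G : on_circle r F -> on_circle r G ->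
  on_circle r (fun z => F z + G z).
Proof.
move=> cF cG z zr.
by apply: (@cvgD _ _ _ (nbhs z)); [exact: cF|exact: cG].
Qed.

Lemma on_circleM r F G : on_circle r F -> on_circle r G ->
  on_circle r (fun z => F z * G z).
Proof.
move=> cF cG z zr.
by apply: (@cvgM _ _ (nbhs z)); [exact: cF|exact: cG].
Qed.

Lemma on_circleK r (c : C) : on_circle r (fun=> c).
Proof. by move=> z _; exact: (@continuousKc R C c z). Qed.

Lemma on_circleB r F G : on_circle r F -> on_circle r G ->
  on_circle r (fun z => F z - G z).
Proof.
move=> cF cG z zr.
by apply: (@cvgB _ _ _ (nbhs z)); [exact: cF|exact: cG].
Qed.

Lemma on_circle_deriv r F : (forall z, normc z = r -> exists D, cderiv F z D) ->
  on_circle r F.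
Proof. by move=> h z /h[D]; exact: cderiv_continuous. Qed.

Lemma normc_neq0 z r : 0 < r -> normc z = r -> z != 0.
Proof. by move=> r0 zr; rewrite -normc_gt0 zr. Qed.

Lemma on_circleXz r (n : int) : 0 < r -> on_circle r (fun z => z ^ n).
Proof.
by move=> r0; apply: on_circle_deriv => z /(normc_neq0 r0)/cderivXz.
Qed.

Lemma circle_bounded r F : 0 <= r -> on_circle r F ->
  exists2 M, 0 <= M & forall t, 0 <= t <= 2 * pi -> normc (F (circle_pt r t)) <= M.
Proof.
move=> r0 /(on_circleP r0) cF.
have [||c _ hc] := @EVT_max R (fun t => normc (F (circle_pt r t))) 0 (2 * pi).
- exact: ltW pi2_gt0.
- move=> x; apply: continuous_subspaceT => {}x.
  exact: (continuous_comp (cF x) (@continuous_normc R _)).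
exists (normc (F (circle_pt r c))); first exact: normc_ge0.
by move=> t ht; apply: hc; rewrite in_itv.
Qed.

(** On the circle this is $\frac{1}{2\pi i}\oint F(z)\,dz/z$; Cauchy's theorem thus becomes
    independence of the radius, and the mean of a constant is that constant. *)
Definition cmean r F : C := (2 * pi)^-1%:C * cint 0 (2 * pi) (fun t => F (circle_pt r t)).

Lemma cmeanD r F G : 0 <= r -> on_circle r F -> on_circle r G ->
  cmean r (fun z => F z + G z) = cmean r F + cmean r G.
Proof.
move=> r0 /(on_circleP r0) cF /(on_circleP r0) cG.
by rewrite /cmean (cintD _ _ cF cG) mulrDr.
Qed.

Lemma cmeanB r F G : 0 <= r -> on_circle r F -> on_circle r G ->
  cmean r (fun z => F z - G z) = cmean r F - cmean r G.
Proof.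
move=> r0 /(on_circleP r0) cF /(on_circleP r0) cG.
by rewrite /cmean (cintB _ _ cF cG) mulrBr.
Qed.

Lemma cmeanZ r (c : C) F : 0 <= r -> on_circle r F ->
  cmean r (fun z => c * F z) = c * cmean r F.
Proof.
by move=> r0 /(on_circleP r0) cF; rewrite /cmean (cintZ _ _ _ cF) mulrCA.
Qed.

Lemma cmean_cst r (c : C) : cmean r (fun=> c) = c.
Proof.
rewrite /cmean (cint_cst _ (ltW pi2_gt0)) subr0 mulrCA -rmorphM mulVf ?mulr1 //.
by rewrite gt_eqF // pi2_gt0.
Qed.

Lemma eq_cmean r F G : (forall t, F (circle_pt r t) = G (circle_pt r t)) ->
  cmean r F = cmean r G.
Proof. by move=> FG; congr (_ * _); apply: eq_cint => t _. Qed.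

Lemma cmean_bound r F M : 0 <= r -> on_circle r F ->
  (forall t, 0 <= t <= 2 * pi -> normc (F (circle_pt r t)) <= M) ->
  normc (cmean r F) <= 2 * M.
Proof.
move=> r0 /(on_circleP r0) cF FM.
rewrite normcM normc_realp ?invr_ge0 ?(ltW pi2_gt0) //.
rewrite ler_pdivrMl ?pi2_gt0 // [leRHS]mulrC.
by have := cint_bound (ltW pi2_gt0) cF FM; rewrite subr0.
Qed.

Lemma real_deriv_dist (f : R -> R) (x d : R) : is_derive x 1 f d ->
  forall e, 0 < e -> exists2 dl : R, 0 < dl & forall h, `|h| < dl ->
    `|f (x + h) - f x - d * h| <= e * `|h|.
Proof.
move=> [/cvg_ex[l hl] dE] e e0.
have ld : l = d.
  by rewrite -dE; apply/esym; apply: (@cvg_lim _ (@norm_hausdorff _ _)); exact: hl.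
move: hl; rewrite ld => /cvgrPdist_le/(_ _ e0).
move=> /nbhs_ballP[dl /= d0 hd]; exists dl => // h hh.
have [->|h0] := eqVneq h 0; first by rewrite addr0 mulr0 subr0 subrr normr0 mulr0.
have := hd h; rewrite /ball /= sub0r normrN => /(_ hh h0).
rewrite /GRing.scale /= mulr1 => hb.
have -> : f (x + h) - f x - d * h = - (d - h^-1 * (f (h + x) - f x)) * h.
  by rewrite [h + x]addrC; field.
by rewrite normrM normrN ler_wpM2r.
Qed.

Definition polar s t : C := circle_pt (expR s) t.

Lemma polarD s t h k : polar (s + h) (t + k) = polar s t * polar h k.
Proof.
rewrite /polar /circle_pt -!/(cis _) cisD expRD rmorphM /=.
by rewrite mulrACA.
Qed.

Lemma polar_diff0 e : 0 < e -> exists2 dl : R, 0 < dl & forall h k,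
  `|h| < dl -> `|k| < dl ->
  normc (polar h k - 1 - (h%:C + 'i * k%:C)) <= e * (`|h| + `|k|).
Proof.
(* Real and imaginary parts contribute five error terms, whose sum is at most [5 * e'] times the
   increments; [e' <= 1] keeps [1 + h] bounded by 2. *)
move=> e0; pose e' := Num.min 1 (e / 5).
have e'0 : 0 < e' by rewrite lt_min ltr01 divr_gt0.
have e'1 : e' <= 1 by rewrite ge_min lexx.
have e'5 : 5 * e' <= e.
  by rewrite mulrC -ler_pdivlMr // ge_min lexx orbT.
clearbody e'.
have [d1 d10 h1] := real_deriv_dist (is_derive_expR 0) e'0.
have [d2 d20 h2] := real_deriv_dist (is_derive_cos 0) e'0.
have [d3 d30 h3] := real_deriv_dist (is_derive_sin 0) e'0.
exists (Num.min e' (Num.min d1 (Num.min d2 d3))); first by rewrite !lt_min e'0 d10 d20.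
move=> h k; rewrite !lt_min => /and4P[he hd1 _ _] /and4P[_ _ kd2 kd3].
have {h1} := h1 _ hd1; have {h2} := h2 _ kd2; have {h3} := h3 _ kd3.
rewrite !add0r expR0 cos0 sin0 oppr0 mul0r !mul1r !subr0 !addr0 => h3 h2 h1.
have c1 : `|cos k| <= 1 by rewrite ler_norml cos_geN1 cos_le1.
have s1 : `|sin k| <= 1 by rewrite ler_norml sin_geN1 sin_le1.
apply: le_trans (normc_le_ReIm _) _.
have -> : Re (polar h k - 1 - (h%:C + 'i * k%:C)) =
    (expR h - 1 - h) * cos k + (1 + h) * (cos k - 1).
  by rewrite /=; ring.
have -> : Im (polar h k - 1 - (h%:C + 'i * k%:C)) =
    (expR h - 1 - h) * sin k + (1 + h) * (sin k - k) + h * k.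
  by rewrite /=; ring.
have h1e : `|1 + h| <= 2.
  rewrite (le_trans (ler_normD _ _)) // normr1.
  by have := ltW (lt_le_trans he e'1); lra.
have H0 := normr_ge0 h; have K0 := normr_ge0 k.
have b1 : `|(expR h - 1 - h) * cos k| <= e' * `|h|.
  by rewrite normrM (le_trans _ h1) // ler_piMr.
have b2 : `|(1 + h) * (cos k - 1)| <= 2 * (e' * `|k|) by rewrite normrM ler_pM.
have b3 : `|(expR h - 1 - h) * sin k| <= e' * `|h|.
  by rewrite normrM (le_trans _ h1) // ler_piMr.
have b4 : `|(1 + h) * (sin k - k)| <= 2 * (e' * `|k|) by rewrite normrM ler_pM.
have b5 : `|h * k| <= e' * `|k| by rewrite normrM ler_wpM2r // ltW.
have b6 : 5 * e' * (`|h| + `|k|) <= e * (`|h| + `|k|) by rewrite ler_wpM2r // addr_ge0.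
have b7 : 0 <= e' * `|h| by rewrite mulr_ge0 // ltW.
have := ler_normD ((expR h - 1 - h) * cos k) ((1 + h) * (cos k - 1)).
have := ler_normD ((expR h - 1 - h) * sin k + (1 + h) * (sin k - k)) (h * k).
have := ler_normD ((expR h - 1 - h) * sin k) ((1 + h) * (sin k - k)).
move: b1 b2 b3 b4 b5 b6 b7; clear; lra.
Qed.

Lemma cplx_i_neq0 : ('i : C) != 0.
Proof. by apply/eqP => -[/eqP]; rewrite oner_eq0. Qed.

(** In the coordinate $s + it \mapsto e^{s+it}$ the annulus becomes a rectangle of height $2\pi$.
    The horizontal sides cancel by periodicity, and the vertical ones are the two circle
    integrals. *)
Lemma polar_mean_const F (a b : R) : a < b ->
  (forall z, expR a <= normc z <= expR b -> exists D, cderiv F z D) ->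
  cint 0 (2 * pi) (fun t => F (polar a t)) = cint 0 (2 * pi) (fun t => F (polar b t)).
Proof.
move=> ab hF.
(* The clamp of [s] to the interval from [a] to [b], written with absolute values so that its
   continuity is immediate. It extends the integrand continuously to the whole plane, as [goursat]
   demands. *)
pose cl s := (`|s - a| - `|s - b| + (a + b)) / 2.
have clE s : a <= s <= b -> cl s = s.
  move=> /andP[as_ sb]; rewrite /cl ger0_norm ?subr_ge0 // distrC ger0_norm ?subr_ge0 //.
  by field.
have clab s : a <= cl s <= b.
  rewrite /cl; have [sa|sa] := leP a s; have [sb|sb] := leP s b.
  - have -> : `|s - a| = s - a by rewrite ger0_norm ?subr_ge0.
    have -> : `|s - b| = b - s by rewrite distrC ger0_norm ?subr_ge0.
    by apply/andP; split; lra.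
  - have -> : `|s - a| = s - a by rewrite ger0_norm ?subr_ge0.
    have -> : `|s - b| = s - b by rewrite ger0_norm ?subr_ge0 ?ltW.
    by apply/andP; split; lra.
  - have -> : `|s - a| = a - s by rewrite distrC ger0_norm ?subr_ge0 ?ltW.
    have -> : `|s - b| = b - s by rewrite distrC ger0_norm ?subr_ge0.
    by apply/andP; split; lra.
  - by exfalso; lra.
have ccl : continuous cl.
  move=> s; apply: (@cvgM _ _ (nbhs s)); last exact: cvg_cst.
  apply: (@cvgD _ _ _ (nbhs s)); last exact: cvg_cst.
  by apply: (@cvgB _ _ _ (nbhs s)); apply: (@cvg_norm _ _ _ (nbhs s));
    (apply: (@cvgB _ _ _ (nbhs s)); [exact: cvg_id|exact: cvg_cst]).
have npol s t : normc (polar (cl s) t) = expR (cl s).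
  by rewrite normc_circle_pt // expR_ge0.
have Fc s t : F @ polar (cl s) t --> F (polar (cl s) t).
  have [|D] := hF (polar (cl s) t); last exact: cderiv_continuous.
  by rewrite npol !ler_expR.
pose g s t := F (polar (cl s) t).
have c1 t : continuous (fun s => g s t).
  move=> s; have cp : {for s, continuous (fun s => polar (cl s) t)}.
    apply: (@cvgM _ _ (nbhs s)); last exact: (@continuousKc R R _ s).
    have ce : continuous (fun s => expR (cl s)).
      by move=> x; apply: (continuous_comp (ccl x)); exact: continuous_expR.
    exact: (continuous_realc ce).
  exact: (continuous_comp cp (Fc s t)).
have c2 s : continuous (g s).
  move=> t; exact: (continuous_comp (@continuous_circle_pt _ t) (Fc s t)).
have J0 : rect_int g a b 0 (2 * pi) = 0.
  apply: (goursat ab pi2_gt0 c1 c2) => s t sab _; have [D hD] : exists D, cderiv F (polar s t) D.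
    by apply: hF; rewrite normc_circle_pt ?expR_ge0 // !ler_expR.
  set z0 := polar s t in hD *.
  have z0p : 0 < normc z0 by rewrite normc_circle_pt ?expR_gt0 ?expR_ge0.
  exists (D * z0) => e e0.
  (* Half of [e] pays for the expansion of [polar], multiplied by [D * z0]; the other half pays for
     the derivative of [F] on increments of size at most [2 * normc z0] times the coordinate
     increments. The [+ 1] avoids a zero denominator. *)
  pose e1 := Num.min 1 (e / (2 * (normc D * normc z0 + 1))).
  have q0 : 0 < 2 * (normc D * normc z0 + 1).
    by rewrite mulr_gt0 // ltr_wpDl // mulr_ge0 // normc_ge0.
  have e10 : 0 < e1 by rewrite lt_min ltr01 divr_gt0.
  have e11 : e1 <= 1 by rewrite ge_min lexx.
  have e1e : 2 * (normc D * normc z0 * e1) <= e.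
    have : e1 <= e / (2 * (normc D * normc z0 + 1)) by rewrite ge_min lexx orbT.
    rewrite ler_pdivlMr // => h1; apply: le_trans h1.
    have := ltW e10; have : 0 <= normc D * normc z0 by rewrite mulr_ge0 ?normc_ge0.
    by move: (_ * normc z0) => x; nra.
  have e20 : 0 < e / (4 * normc z0) by rewrite divr_gt0 // mulr_gt0.
  clearbody e1.
  have [d1 d10 h1] := polar_diff0 e10.
  have [d2 d20 h2] := cderiv_dist hD e20.
  have d30 : 0 < d2 / (4 * normc z0) by rewrite divr_gt0 // mulr_gt0.
  exists (Num.min d1 (d2 / (4 * normc z0))); first by rewrite lt_min d10.
  move=> s' t' s'ab t'cd; rewrite !lt_min => /andP[s1 s2] /andP[t1 t2].
  rewrite /g !clE // -/z0.
  set h := s' - s in s1 s2 *; set k := t' - t in t1 t2 *.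
  have -> : polar s' t' = z0 + z0 * (polar h k - 1).
    rewrite mulrBr mulr1 addrC subrK -polarD; congr polar; rewrite /h /k; ring.
  have {}h1 := h1 _ _ s1 t1.
  have hk : normc (h%:C + 'i * k%:C) <= `|h| + `|k|.
    by apply: le_trans (normc_le_ReIm _) _; rewrite /= !mul0r !mul1r subr0 !add0r !addr0.
  have dl : normc (z0 * (polar h k - 1)) <= 2 * normc z0 * (`|h| + `|k|).
    rewrite normcM -mulrA mulrCA ler_wpM2l ?normc_ge0 //.
    have := normcD (polar h k - 1 - (h%:C + 'i * k%:C)) (h%:C + 'i * k%:C).
    rewrite subrK; have : e1 * (`|h| + `|k|) <= `|h| + `|k|.
      by rewrite ler_piMl // addr_ge0.
    by move: hk h1; lra.
  have {}h2 : normc (F (z0 + z0 * (polar h k - 1)) - F z0 - D * (z0 * (polar h k - 1)))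
      <= e / (4 * normc z0) * normc (z0 * (polar h k - 1)).
    apply: h2; apply: le_lt_trans dl _.
    move: s2 t2; rewrite !ltr_pdivlMr ?mulr_gt0 //; move: `|h| `|k| => x y; nra.
  have -> : F (z0 + z0 * (polar h k - 1)) - F z0 - D * z0 * (h%:C + 'i * k%:C) =
      (F (z0 + z0 * (polar h k - 1)) - F z0 - D * (z0 * (polar h k - 1))) +
      D * z0 * (polar h k - 1 - (h%:C + 'i * k%:C)) by ring.
  apply: le_trans (normcD _ _) _.
  have g1 : e / (4 * normc z0) * normc (z0 * (polar h k - 1)) <=
      e / 2 * (`|h| + `|k|).
    have -> : e / 2 * (`|h| + `|k|) =
        e / (4 * normc z0) * (2 * normc z0 * (`|h| + `|k|)).
      by field; rewrite gt_eqF.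
    by rewrite ler_wpM2l // ltW.
  have g2 : normc (D * z0 * (polar h k - 1 - (h%:C + 'i * k%:C))) <=
      e / 2 * (`|h| + `|k|).
    rewrite (normcM (D * z0)) (normcM D z0); apply: le_trans (ler_wpM2l _ h1) _.
      by rewrite mulr_ge0 ?normc_ge0.
    by rewrite mulrA ler_wpM2r ?addr_ge0 //; lra.
  by have := le_trans h2 g1; move: g2; lra.
have E1 s : a <= s <= b -> g s = (fun t => F (polar s t)).
  by move=> sab; apply/funext => t; rewrite /g clE.
have E2 : cint a b (fun s => g s 0) = cint a b (fun s => g s (2 * pi)).
  by apply: eq_cint => s _; rewrite /g /polar circle_pt0 circle_pt2pi.
have ha : a <= a <= b by rewrite lexx ltW.
have hb : a <= b <= b by rewrite lexx ltW.
move: J0; rewrite /rect_int E2 (E1 a ha) (E1 b hb).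
move: (cint _ _ _) (cint _ _ _) (cint _ _ _) => u v w.
rewrite [w + _]addrC addrK -mulrBr => /eqP.
by rewrite mulf_eq0 subr_eq0 (negbTE cplx_i_neq0) eq_sym => /eqP.
Qed.

Lemma cmean_const F (r1 r2 : R) : 0 < r1 -> 0 < r2 ->
  (forall z, Num.min r1 r2 <= normc z <= Num.max r1 r2 -> exists D, cderiv F z D) ->
  cmean r1 F = cmean r2 F.
Proof.
wlog r12 : r1 r2 / r1 < r2 => [hw|].
  move=> p1 p2 hF; have [h|h|->//] := ltgtP r1 r2; first exact: hw.
  by apply/esym/(hw _ _ h p2 p1) => z zr; apply: hF; rewrite minC maxC.
move=> p1 p2; rewrite min_l ?max_r ?ltW // => hF; congr (_ * _).
have := @polar_mean_const F (ln r1) (ln r2); rewrite /polar !lnK ?posrE //.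
by apply => //; rewrite ltr_ln ?posrE.
Qed.

(** Doubling the radius multiplies the mean by $2^n$, whereas Cauchy's theorem leaves it unchanged;
    so it is 0 unless n = 0. *)
Lemma cmeanXz r (n : int) : 0 < r -> cmean r (fun z => z ^ n) = (n == 0)%:R.
Proof.
move=> r0; have [->|n0] := eqVneq n 0.
  by rewrite -[RHS](cmean_cst r); apply: eq_cmean => t; rewrite expr0z.
have r20 : 0 < 2 * r by rewrite mulr_gt0.
have E : cmean (2 * r) (fun z => z ^ n) = 2 ^ n * cmean r (fun z => z ^ n).
  rewrite -cmeanZ ?ltW //; last exact: on_circleXz.
  congr (_ * _); apply: eq_cint => t _.
  by rewrite -expfzMl /circle_pt rmorphM mulrA -(rmorphMn (real_complex R) 2).
rewrite (@cmean_const _ _ r) // in E; last first.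
  move=> z /andP[zr _]; apply: cderivXz; rewrite -normc_gt0 (lt_le_trans _ zr) //.
  by rewrite lt_min r20.
have : (2 ^ n - 1) * cmean r (fun z => z ^ n) = 0 by rewrite mulrBl mul1r -E subrr.
move=> /eqP; rewrite mulf_eq0 subr_eq0 => /orP[|/eqP//] /eqP/(congr1 (@normc R)).
rewrite normc1 => h2; exfalso; move: h2.
have two : normc (2 : C) = 2.
  by rewrite (_ : 2 = (2 : R)%:C) ?normc_realp // rmorphD rmorph1.
case: n n0 {E} => [[//|n]|n] _.
  rewrite -exprnP normcX two => /eqP; rewrite gt_eqF //.
  by rewrite exprn_egt1 // ltr1n.
rewrite NegzE -exprnN normcV normcX two => /eqP; rewrite lt_eqF // invf_lt1 ?exprn_gt0 //.
by rewrite exprn_egt1 // ltr1n.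
Qed.

End CircleMean.

Section Laurent.
Context {R : realType}.
Local Notation C := R[i].
Implicit Types (F G f : C -> C) (z w : C) (r s t e M : R).

Lemma geometric_small (K th e : R) : 0 <= th < 1 -> 0 < e ->
  exists N0, forall N, (N0 <= N)%N -> K * th ^+ N < e.
Proof.
move=> /andP[t0 t1] e0.
have h : (fun n => K * th ^+ n) @ \oo --> (0 : R).
  rewrite -(mulr0 K); apply: cvgM; first exact: cvg_cst.
  by apply: cvg_expr; rewrite ger0_norm.
have /cvgrPdist_lt/(_ _ e0)[N0 _ hN] := h.
exists N0 => N /hN /=; rewrite sub0r normrN; apply: le_lt_trans.
exact: ler_norm.
Qed.

Lemma normcXz z (n : int) : normc (z ^ n) = normc z ^ n.
Proof. by case: n => n; rewrite ?NegzE -?exprnN -?exprnP ?normcV normcX. Qed.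

Lemma circle_unif F s : 0 < s -> on_circle s F -> forall e, 0 < e ->
  exists2 dl : R, 0 < dl & forall r t, `|r - s| < dl -> 0 <= t <= 2 * pi ->
    normc (F (circle_pt r t) - F (circle_pt s t)) < e.
Proof.
move=> s0 cF e e0.
have : near_covering `[(0 : R), 2 * pi].
  by apply/compact_near_coveringP; exact: segment_compact.
move=> /(_ R (nbhs s) (fun r t => normc (F (circle_pt r t) - F (circle_pt s t)) < e) _).
case=> [t _|dl /= d0 hd]; last first.
  exists dl => // r t rs tp; apply: hd => /=; last by rewrite in_itv.
  by rewrite /ball /= distrC.
have /cvg_at_cP/(_ (e / 2))[|d1 d10 h1] := cF _ (normc_circle_pt t (ltW s0)).
  by rewrite divr_gt0.
have d20 : 0 < d1 / 2 by rewrite divr_gt0.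
have d30 : 0 < d1 / (2 * s) by rewrite divr_gt0 // mulr_gt0.
have /(@cvgcP R R (nbhs t) (nbhs_filter t))/(_ _ d30) hc := @continuous_cis R t.
exists ([set t' | normc (cis t - cis t') < d1 / (2 * s)],
  [set r | `|s - r| < d1 / 2]).
  split; first exact: hc.
  by exists (d1 / 2).
move=> [t' r] [/= h2 h3].
have b1 : normc (circle_pt s t' - circle_pt s t) < d1 / 2.
  rewrite /circle_pt -!/(cis _) -mulrBr normcM normc_realp ?ltW // normc_distC.
  move: h2; rewrite ltr_pdivlMr ?mulr_gt0 // => h2.
  by rewrite ltr_pdivlMr // mulrC mulrA mulrC.
have b2 : normc (circle_pt r t' - circle_pt s t') < d1 / 2.
  rewrite /circle_pt -!/(cis _) -mulrBl normcM normc_cis mulr1 -rmorphB.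
  by rewrite normc_real distrC.
have b3 : normc (circle_pt r t' - circle_pt s t) < d1.
  rewrite -(subrK (circle_pt s t') (circle_pt r t')) -addrA.
  by rewrite (le_lt_trans (normcD _ _)) // [ltRHS]splitr ltrD.
have k1 := h1 _ b3; have k2 : normc (F (circle_pt s t') - F (circle_pt s t)) < e / 2.
  by apply: h1; apply: lt_trans b1 _; rewrite ltr_pdivrMr // ltr_pMr // ltr1n.
rewrite -(subrK (F (circle_pt s t)) (F (circle_pt r t'))) -addrA.
by rewrite (le_lt_trans (normcD _ _)) // [ltRHS]splitr ltrD // normc_distC.
Qed.

Lemma cmean_near F s : 0 < s -> on_circle s F -> forall e, 0 < e ->
  exists2 dl : R, 0 < dl & forall r, `|r - s| < dl -> 0 <= r -> on_circle r F ->
    normc (cmean r F - cmean s F) <= 2 * e.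
Proof.
move=> s0 cF e e0; have [dl d0 hd] := circle_unif s0 cF e0.
exists dl => // r rs r0 cFr.
have c1 := on_circleP r0 cFr; have c2 := on_circleP (ltW s0) cF.
rewrite /cmean -mulrBr -(cintB _ _ c1 c2) normcM normc_realp; last first.
  by rewrite invr_ge0 ltW ?pi2_gt0.
rewrite ler_pdivrMl ?pi2_gt0 // [leRHS]mulrC.
have := cint_bound (ltW pi2_gt0) (continuousBc c1 c2) (fun t ht => ltW (hd r t rs ht)).
by rewrite subr0.
Qed.

Lemma cderiv_eq_near f g z (D : C) : cderiv f z D ->
  (\forall w \near z, f w = g w) -> cderiv g z D.
Proof.
move=> [phi [cphi <- fE]] fg; apply: (cderiv_near cphi).
have fgz := nbhs_singleton fg.
by apply: (@filterS _ _ (nbhs_filter z)) fg => w fgw; rewrite -fgw -fgz.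
Qed.

Definition coef r (n : int) f : C := cmean r (fun z => f z * z ^ (- n)).

Lemma geometric_pos (x q M : R) N : 0 < q ->
  x ^+ N * (2 * (M * q ^ (- (N%:Z - 1)))) = 2 * M * q * (x / q) ^+ N.
Proof.
move=> q0; rewrite opprB addrC expfzDr ?gt_eqF // expr1z -exprnN expr_div_n.
have qN : q ^+ N != 0 by rewrite expf_neq0 // gt_eqF.
by field.
Qed.

Lemma geometric_neg (x p M : R) N : 0 < p -> 0 < x ->
  (x ^+ N)^-1 * (2 * (M * p ^ (- (- N%:Z - 1)))) = 2 * M * p * (p / x) ^+ N.
Proof.
move=> p0 x0; rewrite opprB opprK addrC expfzDr ?gt_eqF // expr1z -exprnP.
have xN : x ^+ N != 0 by rewrite expf_neq0 // gt_eqF.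
by rewrite expr_div_n; field.
Qed.

Lemma ratio_lt1 (x y : R) : 0 < x -> 0 < y -> x < y -> 0 <= x / y < 1.
Proof.
by move=> x0 y0 xy; rewrite (divr_ge0 (ltW x0) (ltW y0)) ltr_pdivrMr // mul1r.
Qed.

Section Expansion.
Variables (f : C -> C) (r1 r2 : R).
Hypothesis r10 : 0 <= r1.
Hypothesis hf : forall z, r1 < normc z < r2 -> exists D, cderiv f z D.

Let in_ann r z : r1 < r < r2 -> normc z = r -> z != 0.
Proof. by move=> /andP[h _]; apply: normc_neq0; exact: le_lt_trans h. Qed.

Lemma coef_const r s n : r1 < r < r2 -> r1 < s < r2 -> coef r n f = coef s n f.
Proof.
move=> /andP[ra rb] /andP[sa sb]; apply: cmean_const.
- exact: le_lt_trans ra.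
- exact: le_lt_trans sa.
move=> z /andP[za zb].
have zin : r1 < normc z < r2.
  by rewrite (lt_le_trans _ za) ?lt_min ?ra // (le_lt_trans zb) // gt_max rb.
have [D hD] := hf zin; have [E hE] := cderivXz (- n) (in_ann zin erefl).
by eexists; exact: (cderivM hD hE).
Qed.

Lemma coef_bound r n F M : 0 < r -> on_circle r F ->
  (forall t, 0 <= t <= 2 * pi -> normc (F (circle_pt r t)) <= M) ->
  normc (coef r n F) <= 2 * (M * r ^ (- n)).
Proof.
move=> r0 cF FM; apply: cmean_bound; first exact: ltW.
  exact: (on_circleM cF (@on_circleXz R r (- n) r0)).
move=> t ht; rewrite normcM normcXz normc_circle_pt ?(ltW r0) //.
by apply: ler_wpM2r; [apply: exprz_ge0; exact: ltW|exact: FM].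
Qed.

Definition laurent_sum (a : int -> C) N z : C :=
  \sum_(k < N) a k%:Z * z ^ k%:Z + \sum_(k < N) a (- k.+1%:Z) * z ^ (- k.+1%:Z).

(** With [G] the difference quotient of [f] at [z0], the relation [f = f z0 + G * (z - z0)] makes
    the terms of the series telescope: up to the contribution of [f z0] at n = 0, each one is
    [gam n - gam (n + 1)]. The two end terms are estimated on circles of radius [q] outside and [p]
    inside the circle through [z0], which gives geometric convergence. *)
Lemma laurent r0 z0 : r1 < r0 < r2 -> r1 < normc z0 < r2 -> forall e, 0 < e ->
  exists N0, forall N, (N0 <= N)%N ->
    normc (f z0 - laurent_sum (fun n => coef r0 n f) N z0) < e.
Proof.
move=> r0in z0in e e0; have z00 := in_ann z0in erefl.
have [D [G [cG GD fE]]] := hf z0in.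
have {}fE w : f w = f z0 + G w * (w - z0) by exact: fE.
have GE w : w != z0 -> G w = (f w - f z0) / (w - z0).
  by move=> wz; rewrite {1}fE [f z0 + _]addrC addrK mulfK // subr_eq0.
have dG w : r1 < normc w < r2 -> w != z0 -> exists E, cderiv G w E.
  move=> win wz; have [E hE] := hf win.
  have h1 : cderiv (fun x => f x - f z0) w (E - 0) := cderivB hE (cderiv_cst (f z0) w).
  have h2 : cderiv (fun x => x - z0) w (1 - 0) := cderivB (cderiv_id w) (cderiv_cst z0 w).
  have wz' : w - z0 != 0 by rewrite subr_eq0.
  have h2' := @cderivV R (fun x => x - z0) w _ wz' h2.
  eexists; apply: (cderiv_eq_near (cderivM h1 h2')).
  have d0 : 0 < normc (w - z0) by rewrite normc_gt0 subr_eq0.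
  apply: (@filterS _ _ (nbhs_filter w)) (near_normc w d0) => x xw.
  rewrite GE //; apply/eqP => xz; by move: xw; rewrite xz ltxx.
have cGa r : r1 < r < r2 -> on_circle r G.
  move=> rin z zr; have [->|zz] := eqVneq z z0; first exact: cG.
  have [|E] := dG z _ zz; first by rewrite zr.
  exact: cderiv_continuous.
have rp r : r1 < r < r2 -> 0 < r by move=> /andP[h _]; exact: le_lt_trans h.
have cfa r : r1 < r < r2 -> on_circle r f.
  by move=> rin; apply: on_circle_deriv => z zr; apply: hf; rewrite zr.
have cz r n : r1 < r < r2 -> on_circle r (fun z => z ^ n).
  by move=> /rp; exact: on_circleXz.
pose gam r (n : int) := z0 ^ n * coef r (n - 1) G.
have step r n : r1 < r < r2 ->
    coef r0 n f * z0 ^ n = f z0 * (n == 0)%:R + gam r n - gam r (n + 1).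
  move=> rin; rewrite (coef_const _ r0in rin).
  have r_gt0 := rp _ rin; have r_ge0 := ltW r_gt0.
  have c0 := @on_circleK R r (f z0).
  have c1 := on_circleM c0 (cz r (- n) rin).
  have c2 := on_circleM (cGa r rin) (cz r (- (n - 1)) rin).
  have c3 := on_circleM (cGa r rin) (cz r (- n) rin).
  have c4 := on_circleM (@on_circleK R r z0) c3.
  have E : coef r n f = f z0 * (n == 0)%:R + coef r (n - 1) G - z0 * coef r n G.
    rewrite /coef -(cmeanZ _ r_ge0 c3) -(oppr_eq0 n) -(cmeanXz _ r_gt0).
    rewrite -(cmeanZ _ r_ge0 (cz r (- n) rin)) -(cmeanD r_ge0 c1 c2).
    rewrite -(cmeanB r_ge0 (on_circleD c1 c2) c4); apply: eq_cmean => t.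
    set w := circle_pt r t.
    have w0 : w != 0 by apply: (in_ann rin); rewrite normc_circle_pt.
    rewrite fE opprB addrC expfzDr // expr1z; ring.
  rewrite E /gam addrK expfzDr // expr1z.
  by have [->|n0] := eqVneq n 0; rewrite ?expr0z /= ?mulr1n ?mulr0n; ring.
set rho0 := normc z0 in z0in *.
have /andP[ha hb] := z0in.
have rho00 : 0 < rho0 by apply: rp.
pose p := (r1 + rho0) / 2; pose q := (rho0 + r2) / 2.
have pin : r1 < p < r2 by rewrite /p; apply/andP; split; lra.
have qin : r1 < q < r2 by rewrite /q; apply/andP; split; lra.
have prho : p < rho0 by rewrite /p; lra.
have rhoq : rho0 < q by rewrite /q; lra.
clearbody p q; have p0 := rp _ pin; have q0 := rp _ qin.
have hpos N : \sum_(k < N.+1) coef r0 k%:Z f * z0 ^ k%:Z = f z0 + gam q 0 - gam q N.+1%:Z.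
  elim: N => [|N IH].
    by rewrite big_ord_recl big_ord0 addr0 (step q) // eqxx mulr1 add0r.
  rewrite big_ord_recr /= IH (step q) // mulr0 add0r.
  by rewrite -[N.+1%:Z + 1](@PoszD N.+1 1) addn1; ring.
have hneg N : \sum_(k < N) coef r0 (- k.+1%:Z) f * z0 ^ (- k.+1%:Z) =
    gam p (- N%:Z) - gam p 0.
  elim: N => [|N IH]; first by rewrite big_ord0 oppr0 subrr.
  rewrite big_ord_recr /= IH (step p) //.
  rewrite oppr_eq0 /= mulr0 add0r.
  have -> : - N.+1%:Z + 1 = - N%:Z by rewrite -[N.+1]addn1 PoszD opprD subrK.
  by ring.
(* On the circle through [z0] the quotient [G] is known only to be continuous at [z0], so
   [cmean_const] cannot cross that circle; its two sides are joined by letting the radii tend to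
   it. *)
have gpq : gam p 0 = gam q 0.
  suff : coef p (0 - 1) G = coef q (0 - 1) G by rewrite /gam => ->.
  pose H z := G z * z ^ (- (0 - 1 : int)).
  have cH r : r1 < r < r2 -> on_circle r H.
    by move=> rin; exact: (on_circleM (cGa r rin) (cz r _ rin)).
  have dH w : r1 < normc w < r2 -> w != z0 -> exists E, cderiv H w E.
    move=> win wz; have [E hE] := dG w win wz.
    have [E' hE'] := cderivXz (- (0 - 1 : int)) (in_ann win erefl).
    by eexists; exact: (cderivM hE hE').
  have kp r : p <= r < rho0 -> cmean r H = cmean p H.
    move=> /andP[pr rr]; apply: cmean_const => //; first exact: lt_le_trans pr.
    move=> z; rewrite min_r // max_l // => /andP[zp zr]; apply: dH.
      by apply/andP; split; [move: pin => /andP[]|]; lra.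
    by apply/eqP => zz; move: zr; rewrite zz leNgt rr.
  have kq r : rho0 < r <= q -> cmean r H = cmean q H.
    move=> /andP[pr rr]; apply: cmean_const => //; first exact: lt_trans pr.
    move=> z; rewrite min_l // max_r // => /andP[zp zr]; apply: dH.
      by apply/andP; split; [|move: qin => /andP[]]; lra.
    by apply/eqP => zz; move: zp; rewrite zz leNgt pr.
  apply/eqP; rewrite -subr_eq0 -normc_eq0 eq_le normc_ge0 andbT.
  apply/ler_addgt0Pr => e1 e10; rewrite [leRHS]add0r.
  have e14 : 0 < e1 / 4 by rewrite divr_gt0.
  have [dl d0 hd] := cmean_near rho00 (cH _ z0in) e14.
  pose d := Num.min (dl / 2) (Num.min (rho0 - p) (q - rho0)).
  have d_gt0 : 0 < d by rewrite !lt_min divr_gt0 // !subr_gt0 prho.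
  have d1 : d < dl.
    have : d <= dl / 2 by rewrite ge_min lexx.
    by lra.
  have d2 : d <= rho0 - p by rewrite !ge_min lexx orbT.
  have d3 : d <= q - rho0 by rewrite !ge_min lexx !orbT.
  clearbody d.
  have i1 : r1 < rho0 - d < r2 by move: pin => /andP[? ?]; apply/andP; split; lra.
  have i2 : r1 < rho0 + d < r2 by move: qin => /andP[? ?]; apply/andP; split; lra.
  have D1 : `|rho0 + d - rho0| < dl.
    by rewrite addrAC subrr add0r ger0_norm // ltW.
  have D2 : `|rho0 - d - rho0| < dl.
    by rewrite addrAC subrr add0r normrN ger0_norm // ltW.
  have k1 := hd _ D1 (ltW (rp _ i2)) (cH _ i2).
  have k2 := hd _ D2 (ltW (rp _ i1)) (cH _ i1).
  have e1' : rho0 < rho0 + d <= q by rewrite ltrDl d_gt0 -lerBrDl.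
  have e2' : p <= rho0 - d < rho0 by rewrite gtrDl oppr_lt0 d_gt0 lerBrDl -lerBrDr andbT.
  rewrite (kq _ e1') in k1; rewrite (kp _ e2') in k2.
  change (normc (cmean p H - cmean q H) <= e1).
  have -> : cmean p H - cmean q H =
    (cmean p H - cmean rho0 H) - (cmean q H - cmean rho0 H).
    by rewrite opprB addrA subrK.
  apply: le_trans (normcB _ _) _.
  have e1E : e1 = 2 * (e1 / 4) + 2 * (e1 / 4) by field.
  by rewrite [leRHS]e1E; exact: (lerD k2 k1).
have [Mq Mq0 hMq] := circle_bounded (ltW q0) (cGa _ qin).
have [Mp Mp0 hMp] := circle_bounded (ltW p0) (cGa _ pin).
have bq N : normc (gam q N%:Z) <= (2 * Mq * q) * (rho0 / q) ^+ N.
  rewrite -(geometric_pos _ _ _ q0) normcM normcXz -exprnP.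
  apply: ler_wpM2l; first exact/exprn_ge0/normc_ge0.
  exact: coef_bound q0 (cGa _ qin) hMq.
have bp N : normc (gam p (- N%:Z)) <= (2 * Mp * p) * (p / rho0) ^+ N.
  rewrite -(geometric_neg _ _ p0 rho00) normcM normcXz -exprnN.
  apply: ler_wpM2l; first by rewrite invr_ge0; exact/exprn_ge0/normc_ge0.
  exact: coef_bound p0 (cGa _ pin) hMp.
clearbody gam; clear step cfa cz cGa dG GE fE GD cG D hf.
have e20 : 0 < e / 2 by exact: divr_gt0.
have [N1 h1] := geometric_small (2 * Mq * q) (ratio_lt1 rho00 q0 rhoq) e20.
have [N2 h2] := geometric_small (2 * Mp * p) (ratio_lt1 p0 rho00 prho) e20.
(* At least one nonnegative power must be present, since the telescoped sum [hpos] includes the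
   exceptional term n = 0. *)
exists (maxn 1 (maxn N1 N2)) => -[|N]; rewrite !geq_max => /and3P[i0 n1 n2].
  by move: i0.
rewrite /laurent_sum hpos hneg gpq.
have -> : f z0 - (f z0 + gam q 0 - gam q N.+1%:Z + (gam p (- N.+1%:Z) - gam q 0)) =
  gam q N.+1%:Z - gam p (- N.+1%:Z) by ring.
apply: le_lt_trans (normcB _ _) _; rewrite [ltRHS]splitr; apply: ltrD.
- exact: le_lt_trans (bq _) (h1 _ n1).
- exact: le_lt_trans (bp _) (h2 _ n2).
Qed.

End Expansion.
End Laurent.

(** * The Hardy space of the annulus *)

Section HardySpace.
Context {R : realType}.
Local Notation C := R[i].
Local Notation Re := (@complex.Re R).
Local Notation Im := (@complex.Im R).
Local Notation mu := (@lebesgue_measure R).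
Implicit Types (f g b F : C -> C) (z w : C) (r s t e M rho : R).

Lemma sq_normcD_le z w : normc (z + w) ^+ 2 <= 2 * normc z ^+ 2 + 2 * normc w ^+ 2.
Proof.
apply: (@le_trans _ _ ((normc z + normc w) ^+ 2)).
  by rewrite ler_pXn2r ?nnegrE ?addr_ge0 ?normc_ge0 ?normcD.
have := sqr_ge0 (normc z - normc w); rewrite sqrrB sqrrD.
by move: (normc z) (normc w) => x y; lra.
Qed.

Lemma sqint_iint (h : R -> R) : continuous h ->
  (\int[mu]_(x in angles) (h x)%:E)%E = (iint 0 (2 * pi) h)%:E.
Proof.
move=> ch; rewrite /iint /Rintegral fineK //.
by have := iint_integrable 0 (2 * pi) ch; exact: integrable_fin_num.
Qed.

Lemma continuous_sq_normc (F : R -> C) : continuous F ->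
  continuous (fun x : R => normc (F x) ^+ 2).
Proof.
move=> cF x.
have h : {for x, continuous (fun x : R => normc (F x))}.
  exact: (continuous_comp (cF x) (@continuous_normc R _)).
exact: (continuous_comp h (@exprn_continuous R 2 _)).
Qed.

Definition mcomplex (F : R -> C) : Prop :=
  measurable_fun angles (fun x => Re (F x)) /\
  measurable_fun angles (fun x => Im (F x)).

Lemma mcomplex_continuous (F : R -> C) : continuous F -> mcomplex F.
Proof.
move=> cF; split; apply: subspace_continuous_measurable_fun.
- exact: measurable_itv.
- exact: (continuous_subspaceT (continuous_ReT cF)).
- exact: measurable_itv.
- exact: (continuous_subspaceT (continuous_ImT cF)).
Qed.

Lemma mcomplexD (F G : R -> C) : mcomplex F -> mcomplex G ->
  mcomplex (fun x => F x + G x).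
Proof.
move=> [F1 F2] [G1 G2]; split.
- by under eq_fun do rewrite cReD; exact: measurable_funD.
- by under eq_fun do rewrite cImD; exact: measurable_funD.
Qed.

Lemma mcomplexZ (c : C) (F : R -> C) : mcomplex F -> mcomplex (fun x => c * F x).
Proof.
move=> [F1 F2]; split.
- by under eq_fun do rewrite cReM; apply: measurable_funB; exact: measurable_funM.
- by under eq_fun do rewrite cImM; apply: measurable_funD; exact: measurable_funM.
Qed.

Lemma mcomplexB (F G : R -> C) : mcomplex F -> mcomplex G ->
  mcomplex (fun x => F x - G x).
Proof.
move=> mF mG; have := mcomplexD mF (mcomplexZ (-1) mG).
by under [X in mcomplex X -> _]funext do rewrite mulN1r.
Qed.

Lemma measurable_sq_normc (F : R -> C) : mcomplex F ->
  measurable_fun angles (fun x => (normc (F x) ^+ 2)%:E).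
Proof.
move=> [F1 F2]; apply/measurable_EFinP.
under eq_fun do rewrite sqr_normc.
by apply: measurable_funD; exact: measurable_funX.
Qed.

Definition sqn (F : R -> C) : \bar R := (\int[mu]_(x in angles) (normc (F x) ^+ 2)%:E)%E.

Lemma measurable_angles : measurable (angles : set R).
Proof. exact: measurable_itv. Qed.

Lemma sqn_ge0 (F : R -> C) : (0 <= sqn F)%E.
Proof. by apply: integral_ge0 => x _; rewrite lee_fin sqr_ge0. Qed.

(** Stands in for the triangle inequality of $L^2$. Its factor 2 is the loss visible in the
    constants of [boundary_le] and [boundary_coef]. *)
Lemma sqnD (F G : R -> C) : mcomplex F -> mcomplex G ->
  (sqn (fun x => (F x + G x)%R) <= 2%:E * sqn F + 2%:E * sqn G)%E.
Proof.
move=> mF mG; have mFG := mcomplexD mF mG.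
have p0 (H : R -> C) : forall x, angles x -> (0%:E <= (normc (H x) ^+ 2)%:E)%E.
  by move=> x _; rewrite lee_fin sqr_ge0.
have m2 (H : R -> C) : mcomplex H ->
    measurable_fun angles (fun x => (2%:E * (normc (H x) ^+ 2)%:E)%E).
  by move=> mH; apply: measurable_funeM; exact: measurable_sq_normc.
have p2 (H : R -> C) : forall x, angles x -> (0%:E <= 2%:E * (normc (H x) ^+ 2)%:E)%E.
  by move=> x ax; apply: mule_ge0; [rewrite lee_fin|exact: p0].
have EF (H : R -> C) : mcomplex H ->
    (\int[mu]_(x in angles) (2%:E * (normc (H x) ^+ 2)%:E) = 2%:E * sqn H)%E.
  move=> mH; exact: (ge0_integralZl_EFin mu measurable_angles (p0 H)
    (measurable_sq_normc mH) (ler0n _ 2)).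
have ED := ge0_integralD mu measurable_angles (p2 F) (m2 F mF) (p2 G) (m2 G mG).
rewrite -(EF F mF) -(EF G mG) -ED.
have m12 := emeasurable_funD (m2 F mF) (m2 G mG).
apply: (@ge0_le_integral _ _ _ mu _ measurable_angles) => //.
- exact: p0.
- exact: measurable_sq_normc mFG.
- by move=> x _; rewrite -!EFinM -EFinD lee_fin sq_normcD_le.
Qed.

Lemma sqnZ (c : C) (F : R -> C) : mcomplex F ->
  sqn (fun x => (c * F x)%R) = ((normc c ^+ 2)%:E * sqn F)%E.
Proof.
move=> mF; have p0 x : angles x -> (0%:E <= (normc (F x) ^+ 2)%:E)%E.
  by move=> _; rewrite lee_fin sqr_ge0.
have <- := ge0_integralZl_EFin mu measurable_angles p0 (measurable_sq_normc mF)
  (sqr_ge0 (normc c)).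
by apply: eq_integral => x _; rewrite normcM exprMn.
Qed.

Lemma sqn_continuous (F : R -> C) : continuous F ->
  sqn F = (iint 0 (2 * pi) (fun x => normc (F x) ^+ 2))%:E.
Proof. by move=> cF; exact: (sqint_iint (continuous_sq_normc cF)). Qed.

Lemma sqn_le_bound (F : R -> C) M : continuous F ->
  (forall x, 0 <= x <= 2 * pi -> normc (F x) <= M) ->
  (sqn F <= (2 * pi * M ^+ 2)%:E)%E.
Proof.
move=> cF FM; rewrite (sqn_continuous cF) lee_fin.
have M0 : 0 <= M.
  by apply: le_trans (FM 0 _); [exact: normc_ge0|rewrite lexx ltW ?pi2_gt0].
apply: le_trans (ler_norm _) _.
have H := @iint_bound R 0 (2 * pi) (fun x => normc (F x) ^+ 2) (M ^+ 2)
  (ltW pi2_gt0) (continuous_sq_normc cF).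
apply: le_trans (H _) _; last by rewrite subr0 mulrC.
move=> x hx.
by rewrite ger0_norm ?sqr_ge0 // ler_pXn2r ?nnegrE ?normc_ge0 //; exact: FM.
Qed.

(* Young's inequality with parameter [lam] replaces Cauchy-Schwarz. *)
Lemma cint_young (F : R -> C) (lam S : R) : 0 < lam -> continuous F ->
  (sqn F <= S%:E)%E ->
  normc (cint 0 (2 * pi) F) <= 2 * pi * lam + S / lam.
Proof.
move=> l0 cF; rewrite (sqn_continuous cF) lee_fin => hS.
have cS := continuous_sq_normc cF.
have key (h : R -> R) : continuous h -> (forall x, `|h x| <= normc (F x)) ->
    `|iint 0 (2 * pi) h| <= pi * lam + S / (2 * lam).
  move=> ch hF.
  pose k x := lam / 2 + (2 * lam)^-1 * normc (F x) ^+ 2.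
  have ck0 : continuous (fun x : R => (2 * lam)^-1 * normc (F x) ^+ 2).
    by move=> x; apply: (@cvgM _ _ (nbhs x)); [exact: cvg_cst|exact: cS].
  have ccst : continuous (fun _ : R => lam / 2) by move=> x; exact: cvg_cst.
  have ck : continuous k.
    by move=> x; apply: (@cvgD _ _ _ (nbhs x)); [exact: ccst|exact: ck0].
  have hk x : `|h x| <= k x.
    apply: le_trans (hF x) _; rewrite /k.
    have -> : lam / 2 + (2 * lam)^-1 * normc (F x) ^+ 2 =
      (2 * lam)^-1 * (lam ^+ 2 + normc (F x) ^+ 2) by field; rewrite gt_eqF.
    rewrite ler_pdivlMl ?mulr_gt0 //; have := sqr_ge0 (lam - normc (F x)).
    by rewrite sqrrB; lra.
  have kI : iint 0 (2 * pi) k <= pi * lam + S / (2 * lam).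
    rewrite (iintD _ _ ccst ck0) (iint_cst _ (ltW pi2_gt0)) (iintZ _ _ _ cS).
    rewrite [X in _ <= _ + X]mulrC lerD //.
      by rewrite le_eqVlt; apply/orP; left; apply/eqP; field.
    by rewrite ler_wpM2l // invr_ge0 mulr_ge0 // ltW.
  rewrite ler_norml; apply/andP; split.
    rewrite lerNl -(iintN _ _ ch); apply: le_trans kI; apply: iint_le => //.
      by move=> x; apply: (@cvgN _ _ _ (nbhs x)); exact: ch.
    by move=> x _; apply: le_trans (hk x); rewrite -normrN ler_norm.
  apply: le_trans kI; apply: iint_le => // x _.
  by apply: le_trans (hk x); exact: ler_norm.
apply: le_trans (normc_le_ReIm _) _ => /=.
have -> : 2 * pi * lam + S / lam =
  (pi * lam + S / (2 * lam)) + (pi * lam + S / (2 * lam)).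
  by field; rewrite gt_eqF.
apply: lerD; apply: key.
- exact: (continuous_ReT cF).
- by move=> x; exact: Re_le_normc.
- exact: (continuous_ImT cF).
- by move=> x; exact: Im_le_normc.
Qed.

Definition hol rho f := forall z, annulus rho z -> exists D, cderiv f z D.

Lemma H2_hol rho f : H2 rho f -> hol rho f.
Proof. by move=> [h _ _] z /h; exact: derivable_cderiv. Qed.

Lemma annulus_circle rho f r : hol rho f -> rho < r < rho^-1 -> on_circle r f.
Proof. by move=> hf rin; apply: on_circle_deriv => z zr; apply: hf; rewrite /annulus /= zr. Qed.

Lemma annulus_pt rho r x : 0 <= r -> rho < r < rho^-1 -> annulus rho (circle_pt r x).
Proof.
move=> r0 rin; change (rho < normc (circle_pt r x) < rho^-1).
by rewrite normc_circle_pt.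
Qed.

(** Multiplication by $r^n$ turns the coefficient into the mean of [f] against a unimodular
    character, so that only the $L^2$ mass of [f] on the circle enters. *)
Lemma coef_young r n f (lam S : R) : 0 < r -> on_circle r f -> 0 < lam ->
  (sqn (fun x => f (circle_pt r x)) <= S%:E)%E ->
  normc (coef r n f) * r ^ n <= lam + S / (2 * pi * lam).
Proof.
move=> r0 on_f l0 hS; have cr := on_circleP (ltW r0) on_f.
have pn0 : (pi : R) != 0 by rewrite gt_eqF // pi_gt0.
have rz (k : int) : (r ^ k)%:C = r%:C ^ k :> C.
  case: k => k; first by rewrite -!exprnP rmorphXn.
  by rewrite NegzE -!exprnN fmorphV rmorphXn.
have on_g := on_circleM on_f (@on_circleXz R r (- n) r0).
have -> : normc (coef r n f) * r ^ n =
    normc (cmean r (fun z => r%:C ^ n * (f z * z ^ (- n)))).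
  rewrite (cmeanZ _ (ltW r0) on_g) (normcM (r%:C ^ n)) -rz.
  by rewrite (normc_realp (exprz_ge0 n (ltW r0))) mulrC.
pose G x := cis x ^ (- n) * f (circle_pt r x).
have cG : continuous G.
  apply: continuousMc; last exact: cr.
  have -> : (fun x => cis x ^ (- n) : C) = (fun x => circle_pt 1 x ^ (- n)).
    by apply/funext => x; rewrite /circle_pt mul1r.
  exact: (on_circleP ler01 (@on_circleXz R 1 (- n) ltr01)).
have GE : cmean r (fun z => r%:C ^ n * (f z * z ^ (- n))) =
    (2 * pi)^-1%:C * cint 0 (2 * pi) G.
  congr (_ * _); apply: eq_cint => x _; rewrite /G /circle_pt -!/(cis _) expfzMl.
  have rn0 : (r%:C : C) != 0 by rewrite -normc_gt0 normc_realp // ltW.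
  rewrite -[r%:C ^ (- n)]invr_expz; have := expfz_neq0 n rn0.
  by move: (r%:C ^ n) => u u0; field.
rewrite GE normcM normc_realp ?invr_ge0 ?(ltW pi2_gt0) //.
have nG x : normc (G x) = normc (f (circle_pt r x)).
  by rewrite normcM normcXz normc_cis exp1rz mul1r.
have sG : (sqn G <= S%:E)%E.
  have -> // : sqn G = sqn (fun x => f (circle_pt r x)).
  by apply: eq_integral => x _; rewrite nG.
rewrite ler_pdivrMl ?pi2_gt0 //; apply: le_trans (cint_young l0 cG sG) _.
have key (q l : R) : q != 0 -> l != 0 ->
    2 * q * l + S / l = 2 * q * (l + S / (2 * q * l)).
  by move=> q0 l0'; field; rewrite q0 l0'.
by rewrite -key // gt_eqF.
Qed.

Lemma hol_coef rho f r n : 0 < rho < 1 -> hol rho f -> rho < r < rho^-1 ->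
  coef 1 n f = coef r n f.
Proof.
move=> /andP[rho0 rho1] hf rin.
have in1 : rho < 1 < rho^-1 by rewrite rho1 invf_gt1.
have hf' z : rho < normc z < rho^-1 -> exists D, cderiv f z D by exact: hf.
exact: (coef_const (ltW rho0) hf' n in1 rin).
Qed.

Section Boundary.
Variables (rho : R) (f b : C -> C).
Hypothesis rho01 : 0 < rho < 1.
Hypothesis hf : hol rho f.
Hypothesis hb : L2_boundary rho f b.

Let rho0 : 0 < rho. Proof. by case/andP: rho01. Qed.
Let rho1 : rho < 1. Proof. by case/andP: rho01. Qed.
Let rhoV : 1 < rho^-1. Proof. by rewrite invf_gt1. Qed.

Lemma boundary_s_gt0 s : s = rho \/ s = rho^-1 -> 0 < s.
Proof. by case=> ->; rewrite ?invr_gt0. Qed.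

Lemma boundary_near s e d : s = rho \/ s = rho^-1 -> 0 < e -> 0 < d ->
  exists r, [/\ rho < r < rho^-1, `|r - s| < d &
    (sqn (fun x => (f (circle_pt r x) - b (circle_pt s x))%R) < e%:E)%E].
Proof.
move=> hs e0 d0; have [_ hlim] := hb hs.
have : \forall r \near within [set r | rho < r < rho^-1] (nbhs s),
    (sqn (fun x => (f (circle_pt r x) - b (circle_pt s x))%R) < e%:E)%E.
  have ne : nbhs (0%E : \bar R) [set x | (x < e%:E)%E].
    by exists e => //= x /=; rewrite sub0r normrN lte_fin => /ltr_normlW.
  exact: (hlim _ ne).
rewrite near_withinE => /nbhs_ballP[d1 /= d10 h1].
pose dd := Num.min (Num.min d d1) ((rho^-1 - rho)).
have dd0 : 0 < dd.
  by rewrite !lt_min d0 d10 subr_gt0 (lt_trans rho1 rhoV).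
have dd1 : dd <= d by rewrite !ge_min lexx.
have dd2 : dd <= d1 by rewrite !ge_min lexx orbT.
have dd3 : dd <= rho^-1 - rho by rewrite !ge_min lexx orbT.
clearbody dd.
case: hs => ss.
- have rin : rho < rho + dd / 2 < rho^-1 by apply/andP; split; lra.
  exists (rho + dd / 2); split => //.
    by rewrite ss addrAC subrr add0r ger0_norm; lra.
  apply: h1 => //; rewrite /ball /= ss opprD addrA subrr add0r normrN ger0_norm; lra.
- have rin : rho < rho^-1 - dd / 2 < rho^-1 by apply/andP; split; lra.
  exists (rho^-1 - dd / 2); split => //.
    by rewrite ss addrAC subrr add0r normrN ger0_norm; lra.
  apply: h1 => //; rewrite /ball /= ss opprB addrC subrK ger0_norm; lra.
Qed.

Lemma boundary_mcomplex s : s = rho \/ s = rho^-1 ->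
  mcomplex (fun x => b (circle_pt s x)).
Proof. by move=> /hb[[]]. Qed.

Lemma boundary_fin s : s = rho \/ s = rho^-1 -> circle_sqint b s \is a fin_num.
Proof.
move=> /hb[[_ _ h] _]; rewrite ge0_fin_numE //; exact: sqn_ge0.
Qed.

Let cfr r : rho < r < rho^-1 -> continuous (fun x => f (circle_pt r x)).
Proof.
move=> rin; apply: on_circleP; last exact: (annulus_circle hf rin).
by case/andP: rin => h _; apply/ltW/(lt_trans rho0 h).
Qed.

Lemma boundary_le s M : s = rho \/ s = rho^-1 ->
  (forall z, annulus rho z -> normc (f z) <= M) ->
  fine (circle_sqint b s) <= 4 * pi * M ^+ 2.
Proof.
move=> hs fM; apply/ler_addgt0Pr => e e0; have s0 := boundary_s_gt0 hs.
have e20 : 0 < e / 2 by rewrite divr_gt0.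
have [r [rin _ hr]] := boundary_near hs e20 ltr01.
have cr := cfr rin; have r0 : 0 <= r.
  by case/andP: rin => h _; apply/ltW/(lt_trans rho0 h).
have mb := boundary_mcomplex hs; have mfr := mcomplex_continuous cr.
rewrite -lee_fin fineK ?boundary_fin //.
have -> : circle_sqint b s = sqn (fun x => f (circle_pt r x) +
    (-1) * (f (circle_pt r x) - b (circle_pt s x))).
  apply: eq_integral => x _; congr ((normc _ ^+ 2)%:E).
  by rewrite mulN1r opprB addrC subrK.
have mB := mcomplexB mfr mb.
apply: le_trans (sqnD mfr (mcomplexZ (-1) mB)) _.
rewrite (sqnZ _ mB) normcNN normc1 expr1n mul1e.
have hM : (sqn (fun x => f (circle_pt r x)) <= (2 * pi * M ^+ 2)%:E)%E.
  apply: (sqn_le_bound cr) => x _; apply: fM.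
  exact: annulus_pt.
have -> : (4 * pi * M ^+ 2 + e)%:E =
    (2%:E * (2 * pi * M ^+ 2)%:E + 2%:E * (e / 2)%:E)%E.
  by rewrite -!EFinM -EFinD; congr (_%:E); field.
by apply: leeD; apply: lee_wpmul2l; rewrite ?lee_fin // ltW.
Qed.

(** The coefficient does not depend on the radius, so the estimate of [coef_young] on circles inside
    the annulus passes to the boundary radius: $r^n$ tends to $s^n$ and [f] tends to [b] in
    $L^2$. *)
Lemma boundary_coef s n : s = rho \/ s = rho^-1 -> forall lam, 0 < lam ->
  normc (coef 1 n f) * s ^ n <= lam + fine (circle_sqint b s) / (pi * lam).
Proof.
move=> hs lam l0; have s0 := boundary_s_gt0 hs.
set S := fine _.
have S0 : 0 <= S by apply: fine_ge0; exact: sqn_ge0.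
have SE : S%:E = circle_sqint b s by rewrite fineK ?boundary_fin.
clearbody S.
have pl0 : 0 < pi * lam by rewrite mulr_gt0 ?pi_gt0.
have [A AE] : exists A, A = normc (coef 1 n f) by eexists.
rewrite -AE; have A0 : 0 <= A by rewrite AE normc_ge0.
apply/ler_addgt0Pr => e e0.
have c2 : (fun r : R => r ^ n) @ s --> s ^ n.
  case: n AE => k _; first exact: (@exprn_continuous R k s).
  change ((fun r : R => (r ^+ k.+1)^-1) @ s --> (s ^+ k.+1)^-1).
  apply: (@cvgV _ _ (nbhs s)); first by rewrite expf_neq0 // gt_eqF.
  exact: (@exprn_continuous R k.+1 s).
pose e1 := e / (2 * (A + 1)).
have e10 : 0 < e1 by rewrite divr_gt0 // mulr_gt0 // ltr_wpDl.
have Ae : A * e1 <= e / 2.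
  rewrite /e1 mulrA ler_pdivrMr ?mulr_gt0 ?ltr_wpDl //.
  have -> : e / 2 * (2 * (A + 1)) = A * e + e by field.
  by rewrite lerDl ltW.
clearbody e1.
move/cvgrPdist_lt/(_ _ e10) : c2 => /nbhs_ballP[d /= d0 hd].
pose e2 := e / 2 * (pi * lam).
have e20 : 0 < e2 by rewrite mulr_gt0 // divr_gt0.
have e2E : e2 / (pi * lam) = e / 2 by rewrite /e2 mulfK // gt_eqF.
clearbody e2.
have [r [rin rs hr]] := boundary_near hs e20 d0.
have r0 : 0 < r by case/andP: rin => h _; apply/(lt_trans rho0 h).
have cr := cfr rin.
have mb := boundary_mcomplex hs; have mfr := mcomplex_continuous cr.
have mB := mcomplexB mfr mb.
have hS : (sqn (fun x => f (circle_pt r x)) <= (2 * S + 2 * e2)%:E)%E.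
  have -> : sqn (fun x => f (circle_pt r x)) = sqn (fun x => b (circle_pt s x) +
      (f (circle_pt r x) - b (circle_pt s x))).
    by apply: eq_integral => x _; rewrite addrC subrK.
  apply: le_trans (sqnD mb mB) _.
  have -> : (2 * S + 2 * e2)%:E = (2%:E * S%:E + 2%:E * e2%:E)%E.
    by rewrite -!EFinM -EFinD.
  apply: leeD; apply: lee_wpmul2l; [by rewrite lee_fin| |by rewrite lee_fin|exact: ltW].
  by rewrite SE.
have A_le : A * r ^ n <= lam + (S + e2) / (pi * lam).
  rewrite AE (hol_coef n rho01 hf rin).
  apply: le_trans (coef_young n r0 (annulus_circle hf rin) l0 hS) _.
  have -> : 2 * S + 2 * e2 = 2 * (S + e2) by rewrite mulrDr.
  by rewrite -[2 * pi * lam]mulrA -mulf_div divff ?mul1r.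
have rn : s ^ n <= r ^ n + e1.
  have brs : ball s d r by rewrite /ball /= distrC.
  have := hd r brs; rewrite ltr_norml => /andP[_ /ltW].
  by rewrite lerBlDl.
have -> : lam + S / (pi * lam) + e = lam + (S + e2) / (pi * lam) + e / 2.
  have -> : (S + e2) / (pi * lam) = S / (pi * lam) + e / 2 by rewrite -e2E -mulrDl.
  by move: (S / _) => X; field.
apply: le_trans (ler_wpM2l A0 rn) _; rewrite mulrDr.
exact: lerD A_le Ae.
Qed.

End Boundary.
End HardySpace.

Section HardySpaceTheory.
Context {R : realType}.
Local Notation C := R[i].
Local Notation Re := (@complex.Re R).
Local Notation Im := (@complex.Im R).
Implicit Types (f g b F : C -> C) (z w : C) (r s t e M rho : R).

Lemma H2_boundary rho f : H2 rho f -> L2_boundary rho f (boundary rho f).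
Proof. by move=> [_ _ [b hb]]; rewrite /boundary; case: xgetP => // /(_ b). Qed.

Lemma sqr_H2norm rho f : 0 < rho < 1 -> H2 rho f ->
  H2norm rho f ^+ 2 = (2 * pi)^-1 * (fine (circle_sqint (boundary rho f) rho) +
                                fine (circle_sqint (boundary rho f) rho^-1)).
Proof.
move=> rho01 hf; have hb := H2_boundary hf.
have f1 := boundary_fin hb (or_introl erefl).
have f2 := boundary_fin hb (or_intror erefl).
have g1 : 0 <= fine (circle_sqint (boundary rho f) rho) by apply/fine_ge0/sqn_ge0.
have g2 : 0 <= fine (circle_sqint (boundary rho f) rho^-1) by apply/fine_ge0/sqn_ge0.
rewrite /H2norm fineD // sqr_sqrtr // mulr_ge0 ?addr_ge0 // invr_ge0.
exact: ltW pi2_gt0.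
Qed.

Lemma H2norm_ge0 rho f : 0 <= H2norm rho f.
Proof. exact: sqrtr_ge0. Qed.

(** Apart from nonnegativity, the later parts know the norm through this bound and [H2norm_le]: the
    norm controls the Laurent coefficients, and a uniform bound on the annulus controls the norm. *)
Lemma H2_coef_bound rho f n s : 0 < rho < 1 -> H2 rho f ->
  s = rho \/ s = rho^-1 -> normc (coef 1 n f) * s ^ n <= 3 * H2norm rho f.
Proof.
move=> rho01 hf hs; have hb := H2_boundary hf.
have N0 := H2norm_ge0 rho f; have sq := sqr_H2norm rho01 hf.
have p0 := @pi_gt0 R.
have Sle : fine (circle_sqint (boundary rho f) s) <= 2 * pi * H2norm rho f ^+ 2.
  rewrite sq mulrA mulfV ?mul1r ?gt_eqF ?mulr_gt0 //.
  have g1 : 0 <= fine (circle_sqint (boundary rho f) rho) by apply/fine_ge0/sqn_ge0.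
  have g2 : 0 <= fine (circle_sqint (boundary rho f) rho^-1) by apply/fine_ge0/sqn_ge0.
  by case: hs => ->; rewrite ?lerDl ?lerDr.
have key := boundary_coef rho01 (H2_hol hf) hb n hs.
move: (normc _ * _) key Sle N0 => X key.
move: (fine _) key (H2norm rho f) => S key N Sle N0.
(* The Young parameter is the norm [N] itself, which gives N + 2N; for N = 0 an arbitrarily small
   parameter is used. *)
have [N_gt0|N_le0] := ltP 0 N.
  apply: le_trans (key _ N_gt0) _.
  have -> : 3 * N = N + 2 * pi * N ^+ 2 / (pi * N).
    have kk (q x : R) : q != 0 -> x != 0 -> 3 * x = x + 2 * q * x ^+ 2 / (q * x).
      by move=> q0 x0; field; rewrite q0 x0.
    by apply: kk; rewrite gt_eqF.
  by rewrite lerD2l ler_wpM2r // invr_ge0 mulr_ge0 // ltW.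
have N00 : N = 0 by apply/eqP; rewrite eq_le N_le0.
rewrite N00 mulr0; apply/ler_addgt0Pr => e e0; rewrite add0r.
apply: le_trans (key _ e0) _; rewrite gerDl.
apply: mulr_le0_ge0; first by move: Sle; rewrite N00 expr0n mulr0.
by rewrite invr_ge0 mulr_ge0 // ltW.
Qed.

Lemma H2norm_le rho f M : 0 < rho < 1 -> H2 rho f -> 0 <= M ->
  (forall z, annulus rho z -> normc (f z) <= M) -> H2norm rho f <= 2 * M.
Proof.
move=> rho01 hf M0 fM; have hb := H2_boundary hf.
rewrite -(ler_pXn2r (n := 2)) ?nnegrE ?H2norm_ge0 ?mulr_ge0 //.
rewrite (sqr_H2norm rho01 hf) ler_pdivrMl ?pi2_gt0 //.
have h1 := boundary_le rho01 (H2_hol hf) hb (or_introl erefl) fM.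
have h2 := boundary_le rho01 (H2_hol hf) hb (or_intror erefl) fM.
apply: le_trans (lerD h1 h2) _; rewrite le_eqVlt; apply/orP; left; apply/eqP.
by rewrite exprMn; move: (pi : R) => q; ring.
Qed.

Lemma sqn_cvg0_lin (T : Type) (Fi : set_system T) {FF : Filter Fi} (a : C)
    (F G : T -> R -> C) :
  (forall i, mcomplex (F i)) -> (forall i, mcomplex (G i)) ->
  sqn (F i) @[i --> Fi] --> 0%E -> sqn (G i) @[i --> Fi] --> 0%E ->
  sqn (fun x => a * F i x + G i x) @[i --> Fi] --> 0%E.
Proof.
move=> mF mG cF cG.
have h : (2%:E * ((normc a ^+ 2)%:E * sqn (F i)) + 2%:E * sqn (G i))%E @[i --> Fi] --> 0%E.
  rewrite -[X in _ --> X](_ : (2%:E * ((normc a ^+ 2)%:E * 0) + 2%:E * 0 = 0)%E); last first.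
    by rewrite !mule0 adde0.
  apply: cvgeD; first by rewrite !mule0.
    by apply: cvgeZl => //; apply: cvgeZl.
  by apply: cvgeZl.
apply: (squeeze_cvge _ (cvg_cst 0%E) h).
apply: nearW => i; rewrite sqn_ge0 /=.
apply: le_trans (sqnD (mcomplexZ a (mF i)) (mG i)) _.
by rewrite (sqnZ _ (mF i)).
Qed.

Lemma lin_lty (k : R) (x y : \bar R) : (0 <= x)%E -> (x < +oo)%E ->
  (0 <= y)%E -> (y < +oo)%E -> (2%:E * (k%:E * x) + 2%:E * y < +oo)%E.
Proof.
case: x y => [x||] [y||] // _ _ _ _.
by rewrite -!EFinM -EFinD ltry.
Qed.

Lemma H2_lin rho (a : C) f g : 0 < rho < 1 -> H2 rho f -> H2 rho g ->
  H2 rho (a *: f + g).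
Proof.
move=> rho01 hf hg; have bf := H2_boundary hf; have bg := H2_boundary hg.
have dh z : annulus rho z -> exists D, cderiv (fun w => a * f w + g w) z D.
  move=> za; have [D hD] := H2_hol hf za; have [E hE] := H2_hol hg za.
  by eexists; exact: (cderivD (cderivZ a hD) hE).
split=> [z /dh[D]|z za|].
- exact: cderiv_derivable.
- have [[_ f0 _] [_ g0 _]] := (hf, hg).
  change (a * f z + g z = 0).
  by rewrite (f0 _ za) (g0 _ za) mulr0 addr0.
exists (fun z => a * boundary rho f z + boundary rho g z) => s hs.
have mf := boundary_mcomplex bf hs; have mg := boundary_mcomplex bg hs.
have m1 := mcomplexZ a mf; have m2 := mcomplexD m1 mg.
split.
  split; [exact: m2.1|exact: m2.2|].
  have [[_ _ l1] _] := bf s hs; have [[_ _ l2] _] := bg s hs.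
  apply: le_lt_trans (sqnD m1 mg) _; rewrite (sqnZ _ mf).
  exact: (lin_lty (normc a ^+ 2) (sqn_ge0 _) l1 (sqn_ge0 _) l2).
have [_ cf] := bf s hs; have [_ cg] := bg s hs.
have mfr r : rho < r < rho^-1 -> mcomplex (fun x => f (circle_pt r x)).
  move=> rin; apply: mcomplex_continuous; apply: on_circleP.
    by case/andP: rin rho01 => h _ /andP[h0 _]; apply/ltW/(lt_trans h0 h).
  exact: (annulus_circle (H2_hol hf) rin).
have mgr r : rho < r < rho^-1 -> mcomplex (fun x => g (circle_pt r x)).
  move=> rin; apply: mcomplex_continuous; apply: on_circleP.
    by case/andP: rin rho01 => h _ /andP[h0 _]; apply/ltW/(lt_trans h0 h).
  exact: (annulus_circle (H2_hol hg) rin).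
(* Radii outside the annulus are replaced by 1, so that the measurability required by [sqn_cvg0_lin]
   holds for every index and not just near the limit. *)
pose cl r := if rho < r < rho^-1 then r else 1.
have clin r : rho < cl r < rho^-1.
  rewrite /cl; case: ifP => // _; case/andP: rho01 => h0 h1.
  by rewrite h1 invf_gt1.
have clE : \forall r \near within [set r | rho < r < rho^-1] (nbhs s), cl r = r.
  by rewrite near_withinE; apply: nearW => r /= rin; rewrite /cl rin.
have L := sqn_cvg0_lin a
  (fun r => mcomplexB (mfr _ (clin r)) mf) (fun r => mcomplexB (mgr _ (clin r)) mg).
apply: cvg_trans (L _ (within_filter _ (nbhs_filter s)) _ _).
- apply: near_eq_cvg; apply: filterS clE => r clr.
  apply: eq_integral => x _; congr ((normc _ ^+ 2)%:E); rewrite clr.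
  change (a * (f (circle_pt r x) - boundary rho f (circle_pt s x)) +
    (g (circle_pt r x) - boundary rho g (circle_pt s x)) =
    a * f (circle_pt r x) + g (circle_pt r x) -
    (a * boundary rho f (circle_pt s x) + boundary rho g (circle_pt s x))).
  by rewrite mulrBr opprD addrACA.
- apply: cvg_trans cf; apply: near_eq_cvg; apply: filterS clE => r clr.
  by rewrite clr.
- apply: cvg_trans cg; apply: near_eq_cvg; apply: filterS clE => r clr.
  by rewrite clr.
Qed.

Definition aext rho F : C -> C := fun z => if `[< annulus rho z >] then F z else 0.

Lemma aextE rho F z : annulus rho z -> aext rho F z = F z.
Proof. by move=> za; rewrite /aext asboolT. Qed.

Lemma annulus_near rho z : annulus rho z -> \forall w \near z, annulus rho w.
Proof.
move=> /andP[z1 z2].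
pose d := Num.min (normc z - rho) (rho^-1 - normc z).
have d0 : 0 < d by rewrite lt_min !subr_gt0 z1.
have d1 : d <= normc z - rho by rewrite ge_min lexx.
have d2 : d <= rho^-1 - normc z by rewrite ge_min lexx orbT.
clearbody d.
apply: (@filterS _ _ (nbhs_filter z)) (near_normc z d0) => w wz.
have := normc_lb z w; have := normc_lb w z; rewrite [normc (w - z)]normc_distC => h1 h2.
change (rho < normc w < rho^-1).
by move: wz h1 h2 d1 d2; move: (normc (z - w)) (normc z) (normc w) => x y u *;
  apply/andP; split; lra.
Qed.

Lemma hol_aext rho F : hol rho F -> hol rho (aext rho F).
Proof.
move=> hF z za; have [D hD] := hF z za; exists D; apply: (cderiv_eq_near hD).
by apply: (@filterS _ _ (nbhs_filter z)) (annulus_near za) => w /aextE ->.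
Qed.

(** A function holomorphic on a larger annulus is its own boundary value: it is continuous on the
    closed annulus, and convergence on nearby circles is uniform, hence in $L^2$. *)
Lemma H2_aext rho t F : 0 < t < rho -> rho < 1 -> hol t F ->
  H2 rho (aext rho F).
Proof.
move=> /andP[t0 trho] rho1 hF; have rho0 := lt_trans t0 trho.
have rho01 : 0 < rho < 1 by rewrite rho0.
have sub z : annulus rho z -> annulus t z.
  move=> /andP[z1 z2]; apply/andP; split; first exact: lt_trans z1.
  by apply: lt_trans z2 _; rewrite ltf_pV2 ?posrE.
have hFr : hol rho F by move=> z /sub; exact: hF.
have hr := hol_aext hFr.
split=> [z /hr[D]|z za|]; first exact: cderiv_derivable.
  by rewrite /aext asboolF.
exists F => s hs.
have s0 : 0 < s by case: hs => ->; rewrite ?invr_gt0.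
have sin : t < s < t^-1.
  case: hs => ->; first by rewrite trho (lt_trans rho1) // invf_gt1 // (lt_trans trho).
  by rewrite ltf_pV2 ?posrE // trho andbT (lt_trans (lt_trans trho rho1)) // invf_gt1.
have cs : on_circle s F by exact: (annulus_circle hF sin).
have cFs := on_circleP (ltW s0) cs.
have m := mcomplex_continuous cFs.
split.
  split; [exact: m.1|exact: m.2|].
  rewrite -[circle_sqint _ _]/(sqn (fun x => F (circle_pt s x))).
  by rewrite (sqn_continuous cFs) ltry.
apply/fine_cvgP; split.
  rewrite near_withinE; apply: nearW => r rin.
  have r0 : 0 < r by case/andP: rin => h _; exact: (lt_trans rho0 h).
  have c1 : continuous (fun x => aext rho F (circle_pt r x) - F (circle_pt s x)).
    apply: continuousBc cFs.
    exact: (on_circleP (ltW r0) (annulus_circle hr rin)).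
  by rewrite -[X in X \is a _]/(sqn _) (sqn_continuous c1).
apply/cvgrPdist_lt => e e0.
pose e1 := Num.min 1 (e / (2 * (2 * pi))).
have p2 := @pi2_gt0 R.
have e10 : 0 < e1 by rewrite lt_min ltr01 divr_gt0 // mulr_gt0.
have e11 : e1 <= 1 by rewrite ge_min lexx.
have e1e : e1 <= e / (2 * (2 * pi)) by rewrite ge_min lexx orbT.
clearbody e1.
have [d d0 hd] := circle_unif s0 cs e10.
rewrite near_withinE; apply/nbhs_ballP; exists d => //= r rs rin.
have r0 : 0 < r by case/andP: rin => h _; exact: (lt_trans rho0 h).
have c1 : continuous (fun x => aext rho F (circle_pt r x) - F (circle_pt s x)).
  apply: continuousBc cFs.
  exact: (on_circleP (ltW r0) (annulus_circle hr rin)).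
rewrite sub0r normrN.
set I := (\int[_]_(x in _) _)%E.
have Ile : (I <= (2 * pi * e1 ^+ 2)%:E)%E.
  apply: (sqn_le_bound c1) => x hx; rewrite (aextE F (annulus_pt x (ltW r0) rin)).
  by apply/ltW/hd => //; move: rs; rewrite /ball /= distrC.
have I0 : (0 <= I)%E by exact: sqn_ge0.
have If : I \is a fin_num by rewrite ge0_fin_numE // (le_lt_trans Ile) // ltry.
rewrite ger0_norm ?fine_ge0 //.
apply: (@le_lt_trans _ _ (2 * pi * e1 ^+ 2)); first by rewrite -lee_fin fineK.
apply: (@le_lt_trans _ _ (2 * pi * e1)).
  by rewrite ler_pM2l // expr2 ler_piMr // ltW.
have p22 : 0 < 2 * (2 * pi) :> R by exact: (mulr_gt0 (ltr0Sn _ 1) p2).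
move: e1e; rewrite (ler_pdivlMr _ _ p22) => h.
apply: lt_le_trans h; rewrite [ltRHS]mulrC ltr_pM2r //.
by rewrite ltr_pMl // ltr1n.
Qed.

End HardySpaceTheory.

(** * The transfer operators and their duality *)

Section Moebius.
Context {R : realType}.
Local Notation C := R[i].
Implicit Types (f g F k : C -> C) (z w u : C) (a r s rho : R).

(* [nob a] is the inverse of [mob a], and [dmob a] the derivative of [mob a]. *)
Definition mob a z : C := (z + a%:C) / (1 + a%:C * z).
Definition nob a : C -> C := mob (- a).
Definition dmob a z : C := (1 - a%:C ^+ 2) / (1 + a%:C * z) ^+ 2.

(** The identity behind [mob_le], [mob_lt1] and [mob_eq1]: the sign of the difference is that of
    [1 - normc z ^+ 2]. *)
Lemma mob_id a z : normc (1 + a%:C * z) ^+ 2 - normc (z + a%:C) ^+ 2 =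
  (1 - a ^+ 2) * (1 - normc z ^+ 2).
Proof. by case: z => x y; rewrite !sqr_normc /=; ring. Qed.

Lemma mob_den a z : `|a| < 1 -> normc z <= 1 -> 1 + a%:C * z != 0.
Proof.
move=> a1 z1; rewrite -normc_gt0; apply: lt_le_trans (normc_lbD _ _).
rewrite normc1 normcM normc_real subr_gt0; apply: le_lt_trans a1.
by rewrite ler_piMr.
Qed.

Lemma mob_denr a : `|a| < 1 -> 1 - a%:C ^+ 2 != 0 :> C.
Proof.
move=> a1; rewrite -rmorphXn /= -(rmorph1 (real_complex R)) -rmorphB.
rewrite -normc_gt0 normc_real normr_gt0 subr_eq0 eq_sym.
by rewrite -(real_normK (num_real a)) lt_eqF // exprn_ilt1.
Qed.

Lemma mobK a z : `|a| < 1 -> 1 + a%:C * z != 0 -> nob a (mob a z) = z.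
Proof.
move=> a1 dz; have da := mob_denr a1; rewrite /nob /mob rmorphN.
have d2 : 1 + - a%:C * ((z + a%:C) / (1 + a%:C * z)) =
  (1 - a%:C ^+ 2) / (1 + a%:C * z) by field.
by rewrite d2; field; rewrite da dz.
Qed.

Lemma nobK a u : `|a| < 1 -> 1 - a%:C * u != 0 -> mob a (nob a u) = u.
Proof.
move=> a1 du; have := @mobK (- a) u; rewrite /nob opprK normrN; apply => //.
by rewrite rmorphN mulNr.
Qed.

Lemma mobV a z : z != 0 -> mob a z^-1 = (mob a z)^-1.
Proof.
move=> z0; rewrite /mob invf_div.
have -> : z^-1 + a%:C = (1 + a%:C * z) / z by field.
have -> : 1 + a%:C / z = (z + a%:C) / z by field.
by rewrite invf_div mulrA mulrVK ?unitfE.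
Qed.

Lemma mob_le a r z : 0 <= a < 1 -> 0 <= r < 1 -> normc z <= r ->
  normc (mob a z) <= (r + a) / (1 + a * r).
Proof.
move=> /andP[a0 a1] /andP[r0 r1] zr.
have na : `|a| < 1 by rewrite ger0_norm.
have dz := mob_den na (le_trans zr (ltW r1)); move: (dz); rewrite -normc_gt0 => dp.
have ar0 : 0 < 1 + a * r by rewrite ltr_wpDr // mulr_ge0.
rewrite normcM normcV ler_pdivrMr // mulrAC ler_pdivlMr //.
rewrite -(ler_pXn2r (n := 2)) ?nnegrE ?mulr_ge0 ?normc_ge0 ?(ltW ar0) ?addr_ge0 //.
have idz := mob_id a z.
have z0 := normc_ge0 z.
have dle : normc (1 + a%:C * z) ^+ 2 <= (1 + a * r) ^+ 2.
  rewrite ler_pXn2r ?nnegrE ?normc_ge0 ?(ltW ar0) //.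
  apply: le_trans (normcD _ _) _; rewrite normc1 lerD2l normcM normc_realp //.
  exact: ler_wpM2l.
have zr2 : normc z ^+ 2 <= r ^+ 2 by rewrite ler_pXn2r ?nnegrE.
have a2 : a ^+ 2 <= 1 by rewrite expr_le1 // ltW.
have r2 : r ^+ 2 <= 1 by rewrite expr_le1 // ltW.
have e1 : normc (z + a%:C) ^+ 2 =
  normc (1 + a%:C * z) ^+ 2 - (1 - a ^+ 2) * (1 - normc z ^+ 2) by rewrite -idz; ring.
rewrite !exprMn e1.
have -> : (r + a) ^+ 2 = (1 + a * r) ^+ 2 - (1 - a ^+ 2) * (1 - r ^+ 2) by ring.
have p1 : 0 <= (1 - a ^+ 2) * (1 - r ^+ 2) by rewrite mulr_ge0 // subr_ge0.
have p2 : (1 - a ^+ 2) * (1 - r ^+ 2) <= (1 - a ^+ 2) * (1 - normc z ^+ 2).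
  by rewrite ler_wpM2l ?subr_ge0 // lerD2l lerN2.
have p3 : 0 <= normc (1 + a%:C * z) ^+ 2 by rewrite sqr_ge0.
have aux (A B x y : R) : 0 <= A -> A <= B -> 0 <= x -> x <= y ->
    (A - y) * B <= (B - x) * A.
  move=> A0 AB x0 xy; rewrite !mulrBl [B * A]mulrC lerD2l lerN2.
  exact: ler_pM.
exact: aux p3 dle p1 p2.
Qed.

Lemma mob_eq1 a z : `|a| < 1 -> normc z = 1 -> normc (mob a z) = 1.
Proof.
move=> a1 z1; have z1' : normc z <= 1 by rewrite z1.
have dz := mob_den a1 z1'.
have := mob_id a z; rewrite z1 expr1n subrr mulr0 => /eqP; rewrite subr_eq0.
rewrite eqrXn2 ?normc_ge0 // => /eqP e.
by rewrite normcM normcV -e mulfV // normc_eq0.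
Qed.

Lemma mob_lt1 a z : `|a| < 1 -> normc z < 1 -> normc (mob a z) < 1.
Proof.
move=> a1 z1; have dz := mob_den a1 (ltW z1).
move: (dz); rewrite -normc_gt0 => dp.
rewrite normcM normcV ltr_pdivrMr // mul1r -(ltr_pXn2r (n := 2)) ?nnegrE ?normc_ge0 //.
have a2 : a ^+ 2 < 1 by rewrite -(real_normK (num_real a)) expr_lt1.
have z2 : normc z ^+ 2 < 1 by rewrite expr_lt1 // normc_ge0.
by rewrite -subr_gt0 mob_id mulr_gt0 // subr_gt0.
Qed.

Lemma cderiv_mob a z : 1 + a%:C * z != 0 -> cderiv (mob a) z (dmob a z).
Proof.
move=> dz.
have h1 : cderiv (fun x => x + a%:C) z (1 + 0) := cderivD (cderiv_id z) (cderiv_cst _ z).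
have h2 : cderiv (fun x => 1 + a%:C * x) z (0 + a%:C * 1) :=
  cderivD (cderiv_cst 1 z) (cderivZ a%:C (cderiv_id z)).
have h3 := @cderivV R (fun x => 1 + a%:C * x) z _ dz h2.
have := cderivM h1 h3; congr (cderiv _ _ _).
by rewrite /dmob; field.
Qed.

Definition tee a z : C := mob a z ^+ 2.

(* maximum of [mob a] in absolute value over the circle of radius [r] *)
Definition mrad a r : R := (r + a) / (1 + a * r).

Lemma mrad_ge a r : 0 <= a < 1 -> 0 <= r -> a <= mrad a r.
Proof.
move=> /andP[a0 a1] r0; rewrite /mrad ler_pdivlMr; last by rewrite ltr_wpDr ?mulr_ge0.
have : a * (a * r) <= r by rewrite mulrA ler_piMl // mulr_ile1 // ltW.
by rewrite mulrDr mulr1; lra.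
Qed.

Lemma mrad_lt1 a r : 0 <= a < 1 -> 0 <= r < 1 -> mrad a r < 1.
Proof.
move=> /andP[a0 a1] /andP[r0 r1]; rewrite /mrad ltr_pdivrMr ?mul1r; last first.
  by rewrite ltr_wpDr ?mulr_ge0.
have : 0 < (1 - a) * (1 - r) by rewrite mulr_gt0 // subr_gt0.
by lra.
Qed.

Lemma mrad_ge_r a r : 0 <= a < 1 -> 0 <= r < 1 -> r <= mrad a r.
Proof.
move=> /andP[a0 a1] /andP[r0 r1]; rewrite /mrad ler_pdivlMr; last first.
  by rewrite ltr_wpDr ?mulr_ge0.
have : r * (a * r) <= a * 1 * 1 by rewrite mulrCA -mulrA ler_wpM2l // mulr1 mulr_ile1 // ltW.
by rewrite mulrDr !mulr1; lra.
Qed.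

Lemma nob_le a rho u : 0 <= a < 1 -> 0 < rho < 1 -> 1 - a%:C * u != 0 ->
  normc (nob a u) <= rho -> normc u <= mrad a rho.
Proof.
move=> a01 /andP[r0 r1] du h; have na : `|a| < 1 by case/andP: a01 => ? ?; rewrite ger0_norm.
by rewrite -[u](nobK na du); apply: mob_le => //; rewrite (ltW r0).
Qed.

Lemma annulus_neq0 rho z : 0 < rho -> annulus rho z -> z != 0.
Proof. by move=> r0 /andP[h _]; rewrite -normc_gt0; exact: lt_trans h. Qed.

Lemma annulusV rho z : 0 < rho -> annulus rho z -> annulus rho z^-1.
Proof.
move=> r0 /andP[h1 h2]; have z0 := lt_trans r0 h1.
change (rho < normc z^-1 < rho^-1); rewrite normcV ltf_pV2 ?posrE // h1 andbT.
by rewrite -[rho]invrK ltf_pV2 ?posrE ?invr_gt0.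
Qed.

Lemma annulusN rho z : annulus rho z -> annulus rho (- z).
Proof. by rewrite /annulus /= -/(normc _) normcNN. Qed.

Lemma annulus_den a rho u : 0 <= a < 1 -> 0 < rho < 1 ->
  annulus (mrad a rho) u -> 1 - a%:C * u != 0.
Proof.
move=> a01 /andP[r0 r1] /andP[_ u2]; apply/eqP => e.
have m0 : 0 < mrad a rho.
  by case/andP: a01 => a0 _; rewrite divr_gt0 // ?ltr_wpDr // mulr_ge0 // ltW.
have ma := mrad_ge a01 (ltW r0).
have : normc (a%:C * u) = 1.
  by move/eqP: e; rewrite subr_eq0 => /eqP <-; rewrite normc1.
case/andP: a01 => a0 a1; rewrite normcM normc_realp // => au.
have u0 : 0 < normc u.
  by rewrite lt_neqAle normc_ge0 andbT; apply/eqP => u0; move: au; rewrite -u0 mulr0 => /eqP; rewrite eq_sym oner_eq0.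
have : normc u * mrad a rho < 1 by rewrite -ltr_pdivlMr // mul1r.
have : a * normc u <= mrad a rho * normc u by rewrite ler_pM2r.
by rewrite au [mrad a rho * _]mulrC; lra.
Qed.

(** The inner bound is the contrapositive of [nob_le]; the outer one is the inner one at [u^-1],
    because [nob a] commutes with inversion. *)
Lemma nob_annulus a rho u : 0 <= a < 1 -> 0 < rho < 1 ->
  annulus (mrad a rho) u -> annulus rho (nob a u).
Proof.
move=> a01 rho01 ua; have /andP[r0 r1] := rho01.
have m0 : 0 < mrad a rho.
  by case/andP: a01 => a0 _; rewrite divr_gt0 // ?ltr_wpDr // mulr_ge0 // ltW.
have u0 := annulus_neq0 m0 ua.
have h v : annulus (mrad a rho) v -> rho < normc (nob a v).
  move=> va; rewrite ltNge; apply/negP => hv.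
  have := nob_le a01 rho01 (annulus_den a01 rho01 va) hv.
  by case/andP: va => v1 _; rewrite leNgt v1.
apply/andP; split; first exact: h.
have := h _ (annulusV m0 ua); rewrite /nob mobV // normcV => hv.
have n0 : 0 < normc (mob (- a) u).
  by rewrite -invr_gt0; exact: lt_trans hv.
by rewrite -[normc _]invrK ltf_pV2 ?posrE ?invr_gt0.
Qed.

(* The preimages of [z] under [tee a] are [nob a w] and [nob a (- w)] with
   [w ^+ 2 = z]. *)
Definition qfun a f u : C := f (nob a u) * dmob (- a) u.

(** The quotient is even in [w], so it does not depend on the root chosen by [sqrtc]; the minus sign
    is the factor [1 / (2 * w)] taken at the root [- w]. *)
Definition PFop a f z : C :=
  let w := sqrtc z in (qfun a f w - qfun a f (- w)) / (2 * w).

(** [sqrtc] jumps across a branch cut. As [k] is even, it may be replaced by [sg], the root nearest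
    to [w0], and $|sg(z) - w_0|^2 \le |z - w_0^2|$ makes this one continuous at [w0 ^+ 2]. *)
Lemma cderiv_even_sqrt k w0 (K : C) : w0 != 0 -> (forall u, k (- u) = k u) ->
  cderiv k w0 K -> cderiv (fun z => k (sqrtc z)) (w0 ^+ 2) (K / (2 * w0)).
Proof.
move=> w00 keven dk; have [phi [cphi <- kE]] := dk.
pose sg z := if normc (sqrtc z - w0) <= normc (sqrtc z + w0) then sqrtc z else - sqrtc z.
have sgE z : sg z ^+ 2 = z.
  by rewrite /sg; case: ifP => _; rewrite ?sqrrN sqr_sqrtc.
have ksg z : k (sqrtc z) = k (sg z) by rewrite /sg; case: ifP.
have sgle z : normc (sg z - w0) ^+ 2 <= normc (z - w0 ^+ 2).
  have -> : z - w0 ^+ 2 = (sg z - w0) * (sg z + w0) by rewrite -{1}(sgE z); ring.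
  rewrite normcM expr2 ler_wpM2l ?normc_ge0 // /sg; case: ifP => // /negbT.
  rewrite -ltNge -opprD normcNN => /ltW h; apply: le_trans h _.
  by rewrite normc_distC addrC.
have sg0 : sg (w0 ^+ 2) = w0.
  apply/eqP; rewrite -subr_eq0 -normc_eq0 -sqrf_eq0 eq_le sqr_ge0 andbT.
  by have := sgle (w0 ^+ 2); rewrite subrr normc0.
have csg : sg @ (w0 ^+ 2) --> sg (w0 ^+ 2).
  apply/cvg_at_cP => e e0; exists (e ^+ 2); first exact: exprn_gt0.
  move=> z hz; rewrite sg0 -(ltr_pXn2r (n := 2)) ?nnegrE ?normc_ge0 ?ltW //.
  exact: le_lt_trans (sgle z) hz.
pose psi z := phi (sg z) / (sg z + w0).
have -> : phi w0 / (2 * w0) = psi (w0 ^+ 2).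
  by rewrite /psi sg0; congr (_ / _); ring.
have w2 : sg (w0 ^+ 2) + w0 != 0.
  by rewrite sg0 -mulr2n mulrn_eq0 negb_or.
have cs : (fun z => sg z + w0) @ (w0 ^+ 2) --> sg (w0 ^+ 2) + w0.
  by apply: (@cvgD _ _ _ (nbhs (w0 ^+ 2))); [exact: csg|exact: cvg_cst].
apply: cderiv_near.
  apply: (@cvgM _ _ (nbhs (w0 ^+ 2))).
    have cphi' : {for sg (w0 ^+ 2), continuous phi} by rewrite sg0; exact: cphi.
    exact: (continuous_comp csg cphi').
  by apply: (@cvgV _ _ (nbhs (w0 ^+ 2))); [exact: w2|exact: cs].
have n0 : 0 < normc (sg (w0 ^+ 2) + w0) by rewrite normc_gt0.
have [dl d0 hd] := (cvg_at_cP (fun z => sg z + w0) (w0 ^+ 2)).1 cs _ n0.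
apply: (@filterS _ _ (nbhs_filter (w0 ^+ 2))) (near_normc _ d0) => z zw.
have sz : sg z + w0 != 0.
  apply/eqP => e; have := hd z; rewrite normc_distC => /(_ zw).
  by rewrite e sub0r normcNN ltxx.
rewrite !ksg sg0 (kE (sg z)) /psi; congr (_ + _).
have -> : z - w0 ^+ 2 = (sg z - w0) * (sg z + w0) by rewrite -{1}(sgE z); ring.
by field.
Qed.

Lemma normc_sqrtc z : normc (sqrtc z) ^+ 2 = normc z.
Proof. by rewrite -normcX sqr_sqrtc. Qed.

Lemma sqrtc_annulus s z : 0 < s -> annulus (s ^+ 2) z -> annulus s (sqrtc z).
Proof.
move=> s0 /andP[z1 z2]; move: z1 z2; rewrite -/(normc _) -normc_sqrtc => z1 z2.
have n0 := normc_ge0 (sqrtc z).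
apply/andP; split; rewrite -/(normc _).
  by rewrite -(ltr_pXn2r (n := 2)) ?nnegrE ?(ltW s0).
by rewrite -(ltr_pXn2r (n := 2)) ?nnegrE ?invr_ge0 ?(ltW s0) // exprVn.
Qed.

Lemma qfun_hol a rho f : 0 <= a < 1 -> 0 < rho < 1 -> hol rho f ->
  hol (mrad a rho) (qfun a f).
Proof.
move=> a01 rho01 hf u ua; have du := annulus_den a01 rho01 ua.
have du' : 1 + (- a)%:C * u != 0 by rewrite rmorphN mulNr.
have [D hD] := hf _ (nob_annulus a01 rho01 ua).
have h1 := cderiv_comp (cderiv_mob du') hD.
have h2 : cderiv (fun x => 1 + (- a)%:C * x) u (0 + (- a)%:C * 1) :=
  cderivD (cderiv_cst 1 u) (cderivZ _ (cderiv_id u)).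
have h3 := cderivX 2 h2.
have du2 : (1 + (- a)%:C * u) ^+ 2 != 0 by rewrite expf_neq0.
have h4 := @cderivV R (fun x => (1 + (- a)%:C * x) ^+ 2) u _ du2 h3.
by eexists; exact: (cderivM h1 (cderivZ (1 - (- a)%:C ^+ 2) h4)).
Qed.

(** The operator enlarges the domain: if [mrad a rho ^+ 2 < rho], the image is holomorphic across
    both boundary circles of the annulus of [rho], which is what [H2_aext] needs. *)
Lemma PFop_hol a rho f : 0 <= a < 1 -> 0 < rho < 1 -> hol rho f ->
  hol (mrad a rho ^+ 2) (PFop a f).
Proof.
move=> a01 rho01 hf z za.
have m0 : 0 < mrad a rho.
  by case/andP: a01 => a0 _; case/andP: rho01 => r0 _; rewrite divr_gt0 // ?ltr_wpDr // mulr_ge0 // ltW.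
have wa := sqrtc_annulus m0 za; have w0 := annulus_neq0 m0 wa.
have [D hD] := qfun_hol a01 rho01 hf wa.
have [E hE] := qfun_hol a01 rho01 hf (annulusN wa).
have h1 := cderiv_comp (cderivN (cderiv_id (sqrtc z))) hE.
have h2 := cderivZ 2 (cderiv_id (sqrtc z)).
have w2 : 2 * id (sqrtc z) != 0 by rewrite mulf_neq0 ?pnatr_eq0.
have h3 := @cderivV R (fun x => 2 * x) _ _ w2 h2.
pose k u := (qfun a f u - qfun a f (- u)) / (2 * u).
have hk : cderiv k (sqrtc z) _ := cderivM (cderivB hD h1) h3.
have ke u : k (- u) = k u.
  rewrite /k opprK mulrN invrN mulrN -mulNr opprB //.
have := cderiv_even_sqrt w0 ke hk; rewrite sqr_sqrtc => h.
by eexists; exact: h.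
Qed.

End Moebius.

Section Transfer.
Context {R : realType}.
Local Notation C := R[i].
Implicit Types (f g F k : C -> C) (z w u : C) (a r s t rho : R).

Lemma dmob_nob a w : `|a| < 1 -> 1 - a%:C * w != 0 ->
  dmob a (nob a w) * dmob (- a) w = 1 /\ 1 + a%:C * nob a w != 0.
Proof.
move=> a1 dw; have da := mob_denr a1.
have d1 : 1 + a%:C * nob a w = (1 - a%:C ^+ 2) / (1 - a%:C * w).
  by rewrite /nob /mob rmorphN mulNr; field.
split; last by rewrite d1 mulf_neq0 ?invr_eq0.
by rewrite /dmob d1 rmorphN mulNr sqrrN; field; rewrite da dw.
Qed.

Lemma PF_sumE a f z : 0 <= a < 1 -> normc z = 1 -> PF_sum (tee a) f z = PFop a f z.
Proof.
move=> a01 z1; have a1 : `|a| < 1 by case/andP: a01 => ? ?; rewrite ger0_norm.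
rewrite /PFop; set w := sqrtc z.
have w1 : normc w = 1.
  apply/eqP; rewrite -(eqrXn2 (n := 2)) ?normc_ge0 // normc_sqrtc z1.
  by rewrite expr1n.
have w2 : w ^+ 2 = z by exact: sqr_sqrtc.
have Na1 : `|- a| < 1 by rewrite normrN.
have w0 : w != 0 by rewrite -normc_gt0 w1.
have dw : 1 - a%:C * w != 0.
  by rewrite -mulNr -rmorphN mob_den // w1.
have dNw : 1 - a%:C * - w != 0.
  by rewrite -mulNr -rmorphN mob_den // normcNN w1.
have [e1 d1] := dmob_nob a1 dw; have [e2 d2] := dmob_nob a1 dNw.
have pre : tee a @^-1` [set z] = [set nob a w] `|` [set nob a (- w)].
  apply/seteqP; split=> [y /= ty|y /= [->|->]]; last 2 first.
  - by rewrite /tee nobK.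
  - by rewrite /tee nobK // sqrrN.
  have : mob a y ^+ 2 == w ^+ 2 by rewrite w2; apply/eqP.
  rewrite eqf_sqr => /orP m.
  have dy : 1 + a%:C * y != 0.
    apply/eqP => dy0; move: m; rewrite /mob dy0 invr0 mulr0.
    by rewrite ![0 == _]eq_sym oppr_eq0 (negbTE w0) => -[].
  by case: m => /eqP m; [left|right]; rewrite -m mobK.
have nw : nob a w != nob a (- w).
  apply/eqP => /(congr1 (mob a)); rewrite !nobK // => /eqP.
  by rewrite -subr_eq0 opprK -mulr2n mulrn_eq0 (negbTE w0).
have der y : 1 + a%:C * y != 0 -> derive1 (tee a) y = 2 * mob a y * dmob a y.
  by move=> dy; rewrite (cderiv_derive1 (cderivX 2 (cderiv_mob dy))).
have dj : [set nob a w] `&` [set nob a (- w)] `<=` set0.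
  by move=> i [/= -> ii]; move: nw; rewrite ii eqxx.
rewrite /PF_sum pre fsbigU0; [|exact: finite_set1|exact: finite_set1|exact: dj].
rewrite !fsbig_set1 (der _ d1) (der _ d2) !nobK // /qfun.
have q1 : dmob a (nob a w) != 0.
  by apply/eqP => q0; move: e1; rewrite q0 mul0r => /eqP; rewrite eq_sym oner_eq0.
have q2 : dmob a (nob a (- w)) != 0.
  by apply/eqP => q0; move: e2; rewrite q0 mul0r => /eqP; rewrite eq_sym oner_eq0.
have -> : dmob (- a) w = (dmob a (nob a w))^-1.
  by apply: (mulfI q1); rewrite e1 mulfV.
have -> : dmob (- a) (- w) = (dmob a (nob a (- w)))^-1.
  by apply: (mulfI q2); rewrite e2 mulfV.
have aux (A B x y : C) : x != 0 -> y != 0 ->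
    A / (2 * w * x) + B / (2 * - w * y) = (A / x - B / y) / (2 * w).
  by move=> x0 y0; field; rewrite w0 x0 y0.
exact: aux.
Qed.

Lemma annulus_sub s t z : 0 < s <= t -> annulus t z -> annulus s z.
Proof.
move=> /andP[s0 st] /andP[z1 z2]; apply/andP; split; first exact: le_lt_trans z1.
by apply: lt_le_trans z2 _; rewrite lef_pV2 ?posrE // (lt_le_trans s0).
Qed.

Lemma hol_sub s t f : 0 < s <= t -> hol s f -> hol t f.
Proof. by move=> st hf z /(annulus_sub st); exact: hf. Qed.

Lemma unit_annulus s : 0 < s < 1 -> s < 1 < s^-1.
Proof. by move=> /andP[s0 s1]; rewrite s1 invf_gt1. Qed.

Lemma hol_circle s f : 0 < s < 1 -> hol s f -> on_circle 1 f.
Proof. by move=> s01 hf; apply: (annulus_circle hf); exact: unit_annulus. Qed.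

Definition geom_bound (a : int -> C) (B th : R) :=
  (forall k : nat, normc (a k%:Z) <= B * th ^+ k) /\
  (forall k : nat, normc (a (- k.+1%:Z)) <= B * th ^+ k.+1).

Lemma hol_geom s f : 0 < s < 1 -> hol s f ->
  exists B th, [/\ 0 <= B, 0 < th < 1 & geom_bound (fun n => coef 1 n f) B th].
Proof.
move=> s01 hf; have /andP[s0 s1] := s01.
pose r := (s + 1) / 2.
have r01 : 0 < r < 1 by rewrite /r; apply/andP; split; lra.
have sr : s < r by rewrite /r; lra.
clearbody r; have /andP[r0 r1] := r01.
have rin : s < r < s^-1 by rewrite sr (lt_trans r1) // invf_gt1.
have rVin : s < r^-1 < s^-1.
  by rewrite ltf_pV2 ?posrE // sr andbT (lt_trans s1) // invf_gt1.
have [M1 M10 h1] := circle_bounded (ltW r0) (annulus_circle hf rin).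
have rV0 : 0 < r^-1 by rewrite invr_gt0.
have [M2 M20 h2] := circle_bounded (ltW rV0) (annulus_circle hf rVin).
exists (2 * M1 + 2 * M2), r; split=> //; first by rewrite addr_ge0 // mulr_ge0.
split=> k.
  rewrite (hol_coef _ s01 hf rVin).
  apply: le_trans (coef_bound _ rV0 (annulus_circle hf rVin) h2) _.
  rewrite mulrA -exprnN exprVn invrK ler_wpM2r ?exprn_ge0 ?(ltW r0) //.
  by rewrite lerDr mulr_ge0.
rewrite (hol_coef _ s01 hf rin).
apply: le_trans (coef_bound _ r0 (annulus_circle hf rin) h1) _.
rewrite opprK mulrA -exprnP ler_wpM2r ?exprn_ge0 ?(ltW r0) //.
by rewrite lerDl mulr_ge0.
Qed.

Lemma laurent_sumS (a : int -> C) N z : laurent_sum a N.+1 z =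
  laurent_sum a N z + (a N%:Z * z ^ N%:Z + a (- N.+1%:Z) * z ^ (- N.+1%:Z)).
Proof. by rewrite /laurent_sum !big_ord_recr /= addrACA. Qed.

Lemma laurent_tail (a : int -> C) (B th : R) N n z : 0 <= B -> 0 < th < 1 ->
  (forall k : nat, normc (a k%:Z * z ^ k%:Z) <= B * th ^+ k) ->
  (forall k : nat, normc (a (- k.+1%:Z) * z ^ (- k.+1%:Z)) <= B * th ^+ k) ->
  normc (laurent_sum a (N + n) z - laurent_sum a N z) <= 2 * (B * th ^+ N / (1 - th)).
Proof.
move=> B0 /andP[t0 t1] h1 h2; have d0 : 0 < 1 - th by rewrite subr_gt0.
(* The remaining geometric tail is kept in the bound, so that the induction on [n] closes with
   equality. *)
suff h : normc (laurent_sum a (N + n) z - laurent_sum a N z) <=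
    2 * (B * th ^+ N / (1 - th)) - 2 * (B * th ^+ (N + n) / (1 - th)).
  apply: le_trans h _; rewrite gerBl mulr_ge0 // divr_ge0 ?(ltW d0) // mulr_ge0 //.
  exact: exprn_ge0 (ltW t0).
elim: n => [|n IH]; first by rewrite addn0 !subrr normc0.
rewrite addnS laurent_sumS.
move: (laurent_sum a (N + n) z) (laurent_sum a N z) IH => u v IH.
have g1 := h1 (N + n)%N; have g2 := h2 (N + n)%N.
move: (a _ * _) (a _ * _) g1 g2 => x y g1 g2.
have -> : u + (y + x) - v = (u - v) + (y + x) by ring.
apply: le_trans (normcD _ _) _; apply: le_trans (lerD IH (normcD _ _)) _.
apply: le_trans (lerD (lexx _) (lerD g1 g2)) _.
rewrite le_eqVlt; apply/orP; left; apply/eqP; rewrite exprS.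
by field; rewrite gt_eqF.
Qed.

Lemma laurent_rem s f z (B th : R) N : 0 < s < 1 -> hol s f -> annulus s z ->
  0 <= B -> 0 < th < 1 ->
  (forall k : nat, normc (coef 1 k%:Z f * z ^ k%:Z) <= B * th ^+ k) ->
  (forall k : nat, normc (coef 1 (- k.+1%:Z) f * z ^ (- k.+1%:Z)) <= B * th ^+ k) ->
  normc (f z - laurent_sum (fun n => coef 1 n f) N z) <= 2 * (B * th ^+ N / (1 - th)).
Proof.
move=> s01 hf za B0 th01 h1 h2; apply/ler_addgt0Pr => e e0.
have s0 : 0 <= s by case/andP: s01 => /ltW.
have hf' w : s < normc w < s^-1 -> exists D, cderiv f w D by exact: hf.
have [N0 hN] := laurent s0 hf' (unit_annulus s01) za e0.
have := @laurent_tail (fun n => coef 1 n f) B th N N0 z B0 th01 h1 h2.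
have := hN (N + N0)%N (leq_addl _ _).
move: (laurent_sum _ (N + N0) z) (laurent_sum _ N z) => u v k1 k2.
have -> : f z - v = (u - v) + (f z - u) by ring.
by apply: le_trans (normcD _ _) _; apply: lerD => //; exact: ltW.
Qed.

Lemma normc1Xz z (n : int) : normc z = 1 -> normc (z ^ n) = 1.
Proof. by move=> z1; rewrite normcXz z1 exp1rz. Qed.

Lemma hol_approx s f e : 0 < s < 1 -> hol s f -> 0 < e -> exists N, forall z,
  normc z = 1 -> normc (f z - laurent_sum (fun n => coef 1 n f) N z) <= e.
Proof.
move=> s01 hf e0; have [B [th [B0 th01 [g1 g2]]]] := hol_geom s01 hf.
have /andP[t0 t1] := th01.
have th01' : 0 <= th < 1 by rewrite (ltW t0).
have [N hN] := geometric_small (2 * (B / (1 - th))) th01' e0.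
exists N => z z1.
have za : annulus s z by have := unit_annulus s01; rewrite -z1.
apply: le_trans (laurent_rem N s01 hf za B0 th01 _ _) _.
- by move=> k; rewrite normcM normc1Xz // mulr1.
- move=> k; rewrite normcM normc1Xz // mulr1; apply: le_trans (g2 k) _.
  by rewrite exprS ler_wpM2l // ler_piMl ?exprn_ge0 ?(ltW t0) // ltW.
- have -> : 2 * (B * th ^+ N / (1 - th)) = 2 * (B / (1 - th)) * th ^+ N by ring.
  exact: ltW (hN N (leqnn _)).
Qed.

Lemma holD s f g : hol s f -> hol s g -> hol s (fun z => f z + g z).
Proof.
by move=> hf hg z za; have [D hD] := hf z za; have [E hE] := hg z za;
  eexists; exact: (cderivD hD hE).
Qed.

Lemma holM s f g : hol s f -> hol s g -> hol s (fun z => f z * g z).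
Proof.
by move=> hf hg z za; have [D hD] := hf z za; have [E hE] := hg z za;
  eexists; exact: (cderivM hD hE).
Qed.

Lemma holK s (c : C) : hol s (fun=> c).
Proof. by move=> z _; eexists; exact: cderiv_cst. Qed.

Lemma holXz s (n : int) : 0 < s -> hol s (fun z => z ^ n).
Proof. by move=> s0 z za; apply: cderivXz; exact: annulus_neq0 za. Qed.

Lemma hol_id s : hol s (fun z => z).
Proof. by move=> z _; eexists; exact: cderiv_id. Qed.

Lemma hol_laurent_sum s (a : int -> C) N : 0 < s -> hol s (fun z => laurent_sum a N z).
Proof.
move=> s0; elim: N => [|N IH].
  under [X in hol s X]funext do rewrite /laurent_sum !big_ord0 addr0.
  exact: holK.
under [X in hol s X]funext do rewrite laurent_sumS.
apply: (holD IH); apply: holD; apply: holM; by [exact: holK|exact: holXz].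
Qed.

Lemma identity_principle s f g : 0 < s < 1 -> hol s f -> hol s g ->
  (forall n, coef 1 n f = coef 1 n g) -> forall z, annulus s z -> f z = g z.
Proof.
move=> s01 hf hg fg z za.
apply/eqP; rewrite -subr_eq0 -normc_eq0 eq_le normc_ge0 andbT.
apply/ler_addgt0Pr => e e0; rewrite add0r.
have s0 : 0 <= s by case/andP: s01 => /ltW.
have e20 : 0 < e / 2 by rewrite divr_gt0.
have hf' w : s < normc w < s^-1 -> exists D, cderiv f w D by exact: hf.
have hg' w : s < normc w < s^-1 -> exists D, cderiv g w D by exact: hg.
have [N1 h1] := laurent s0 hf' (unit_annulus s01) za e20.
have [N2 h2] := laurent s0 hg' (unit_annulus s01) za e20.
have {}h1 := ltW (h1 (N1 + N2)%N (leq_addr _ _)).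
have := ltW (h2 (N1 + N2)%N (leq_addl _ _)).
have -> : (fun n => coef 1 n g) = (fun n => coef 1 n f) by apply/funext.
move=> {}h2; move: (laurent_sum _ _ _) h1 h2 => u h1 h2.
have -> : f z - g z = (f z - u) - (g z - u) by ring.
by apply: le_trans (normcB _ _) _; rewrite [leRHS]splitr; exact: lerD.
Qed.

Section CirclePrinciple.
Variables (T : (C -> C) -> C -> C) (K : R).
Hypothesis K0 : 0 <= K.
Hypothesis TD : forall F G z, T (fun x => F x + G x) z = T F z + T G z.
Hypothesis TZ : forall c F z, T (fun x => c * F x) z = c * T F z.
Hypothesis Tb : forall F M, (forall z, normc z = 1 -> normc (F z) <= M) ->
  forall z, normc z = 1 -> normc (T F z) <= K * M.
Hypothesis Tc : forall s F, 0 < s < 1 -> hol s F -> on_circle 1 (T F).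
Hypothesis Tm : forall n : int,
  cmean 1 (fun z => z * T (fun x => x ^ n) z) = (n == -1)%:R.

(** Both sides are linear and bounded for the uniform norm on the unit circle, they agree on
    monomials, and Laurent polynomials approximate [F] uniformly there. It serves both inversion and
    the transfer operators. *)
Lemma circle_principle s F : 0 < s < 1 -> hol s F ->
  cmean 1 (fun z => z * T F z) = cmean 1 (fun z => z * F z).
Proof.
move=> s01 hF; have s0 : 0 < s by case/andP: s01.
pose Phi G := cmean 1 (fun z => z * T G z) - cmean 1 (fun z => z * G z).
have cid : on_circle 1 (fun z => z) := hol_circle s01 (@hol_id s).
have c1 G : hol s G -> on_circle 1 (fun z => z * T G z).
  by move=> hG; exact: (on_circleM cid (Tc s01 hG)).
have c2 G : hol s G -> on_circle 1 (fun z => z * G z).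
  by move=> hG; exact: (on_circleM cid (hol_circle s01 hG)).
have PhiD G H : hol s G -> hol s H -> Phi (fun z => G z + H z) = Phi G + Phi H.
  move=> hG hH; rewrite /Phi.
  have -> : cmean 1 (fun z => z * T (fun x => G x + H x) z) =
      cmean 1 (fun z => z * T G z) + cmean 1 (fun z => z * T H z).
    rewrite -(cmeanD ler01 (c1 _ hG) (c1 _ hH)); apply: eq_cmean => t.
    by rewrite TD mulrDr.
  have -> : cmean 1 (fun z => z * (G z + H z)) =
      cmean 1 (fun z => z * G z) + cmean 1 (fun z => z * H z).
    rewrite -(cmeanD ler01 (c2 _ hG) (c2 _ hH)); apply: eq_cmean => t.
    by rewrite mulrDr.
  by ring.
have PhiZ c G : hol s G -> Phi (fun z => c * G z) = c * Phi G.
  move=> hG; rewrite /Phi.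
  have -> : cmean 1 (fun z => z * T (fun x => c * G x) z) =
      c * cmean 1 (fun z => z * T G z).
    by rewrite -(cmeanZ _ ler01 (c1 _ hG)); apply: eq_cmean => t; rewrite TZ mulrCA.
  have -> : cmean 1 (fun z => z * (c * G z)) = c * cmean 1 (fun z => z * G z).
    by rewrite -(cmeanZ _ ler01 (c2 _ hG)); apply: eq_cmean => t; rewrite mulrCA.
  by rewrite mulrBr.
have PhiX n : Phi (fun z => z ^ n) = 0.
  rewrite /Phi Tm; have -> : cmean 1 (fun z => z * z ^ n) = cmean 1 (fun z : C => z ^ (n + 1)).
    apply: eq_cmean => t; rewrite expfzDr ?expr1z 1?mulrC //.
    by apply: (normc_neq0 ltr01); rewrite normc_circle_pt.
  by rewrite cmeanXz // -[n == -1]subr_eq0 opprK subrr.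
have PhiL (a : int -> C) N : Phi (fun z => laurent_sum a N z) = 0.
  elim: N => [|N IH].
    have -> : (fun z => laurent_sum a 0 z) = (fun z => 0 * z ^ (0 : int)).
      by apply/funext => z; rewrite /laurent_sum !big_ord0 addr0 mul0r.
    by rewrite (PhiZ _ _ (@holXz s 0 s0)) mul0r.
  have -> : (fun z => laurent_sum a N.+1 z) = (fun z => laurent_sum a N z +
      (a N%:Z * z ^ N%:Z + a (- N.+1%:Z) * z ^ (- N.+1%:Z))).
    by apply/funext => z; rewrite laurent_sumS.
  have h1 := holM (@holK s (a N%:Z)) (@holXz s N%:Z s0).
  have h2 := holM (@holK s (a (- N.+1%:Z))) (@holXz s (- N.+1%:Z) s0).
  rewrite (PhiD _ _ (@hol_laurent_sum s a N s0) (holD h1 h2)) IH (PhiD _ _ h1 h2).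
  by rewrite !(PhiZ _ _ (@holXz s _ s0)) !PhiX !mulr0 !addr0.
apply/eqP; rewrite -subr_eq0 -/(Phi F) -normc_eq0 eq_le normc_ge0 andbT.
apply/ler_addgt0Pr => e e0; rewrite add0r.
have K1 : 0 < 2 * (K + 1) by rewrite mulr_gt0 // ltr_wpDl.
have [N hN] := hol_approx s01 hF (divr_gt0 e0 K1).
set S := laurent_sum _ N in hN.
have hS : hol s S by exact: (@hol_laurent_sum s).
have hFS : hol s (fun z => F z + (-1) * S z).
  exact: (holD hF (holM (@holK s (-1)) hS)).
have -> : Phi F = Phi (fun z => F z + (-1) * S z).
  by rewrite (PhiD _ _ hF (holM (@holK s (-1)) hS)) (PhiZ _ _ hS) PhiL mulr0 addr0.
have bd z : normc z = 1 -> normc (F z + (-1) * S z) <= e / (2 * (K + 1)).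
  by move=> z1; rewrite mulN1r; exact: hN.
have b1 : normc (cmean 1 (fun z => z * T (fun z => F z + (-1) * S z) z)) <=
    2 * (K * (e / (2 * (K + 1)))).
  apply: (cmean_bound ler01 (c1 _ hFS)) => t _.
  have p1 := @normc_circle_pt R 1 t ler01.
  by rewrite normcM p1 mul1r; exact: (Tb bd).
have b2 : normc (cmean 1 (fun z => z * (F z + (-1) * S z))) <= 2 * (e / (2 * (K + 1))).
  apply: (cmean_bound ler01 (c2 _ hFS)) => t _.
  have p1 := @normc_circle_pt R 1 t ler01.
  by rewrite normcM p1 mul1r; exact: bd.
apply: le_trans (normcB _ _) _; apply: le_trans (lerD b1 b2) _.
rewrite le_eqVlt; apply/orP; left; apply/eqP; field.
by rewrite gt_eqF // ltr_wpDl.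
Qed.

End CirclePrinciple.

End Transfer.

Section Duality.
Context {R : realType}.
Local Notation C := R[i].
Implicit Types (f g F G k : C -> C) (z w u : C) (a r s t rho : R).

Lemma hol_comp_inv s F : 0 < s -> hol s F -> hol s (fun z => F z^-1).
Proof.
move=> s0 hF z za; have z0 := annulus_neq0 s0 za.
have [D hD] := hF _ (annulusV s0 za).
by eexists; exact: (cderiv_comp (@cderivV R id z _ z0 (cderiv_id z)) hD).
Qed.

Lemma normc1_neq0 z : normc z = 1 -> z != 0.
Proof. by move=> z1; rewrite -normc_gt0 z1. Qed.

Lemma normc1_circle t : normc (circle_pt 1 t : C) = 1.
Proof. exact: normc_circle_pt. Qed.

Lemma eq_cmean1 F G : (forall z, normc z = 1 -> F z = G z) -> cmean 1 F = cmean 1 G.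
Proof. by move=> FG; apply: eq_cmean => t; apply: FG; exact: normc1_circle. Qed.

Lemma cmean_inv s G : 0 < s < 1 -> hol s G -> cmean 1 (fun z => G z^-1) = cmean 1 G.
Proof.
move=> s01 hG; have s0 : 0 < s by case/andP: s01.
have hX r : 0 < r -> hol r (fun z : C => z^-1).
  by move=> r0 z /(annulus_neq0 r0) z0; eexists; exact: (@cderivV R id z _ z0 (cderiv_id z)).
(* The Jacobian factor makes $z\,TF(z) = z^{-1}F(z^{-1})$; on $F = z^{-1}G$ this is $G(z^{-1})$, and
   the untransformed side is $G(z)$. *)
pose T F z := z ^ (- 2%:Z) * F z^-1.
have Tc r F : 0 < r < 1 -> hol r F -> on_circle 1 (T F).
  move=> r01 hF; have r0 : 0 < r by case/andP: r01.
  exact: (hol_circle r01 (holM (@holXz _ r (- 2%:Z) r0) (hol_comp_inv r0 hF))).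
have Tb F M : (forall z, normc z = 1 -> normc (F z) <= M) ->
    forall z, normc z = 1 -> normc (T F z) <= 1 * M.
  by move=> FM z z1; rewrite /T normcM normc1Xz // !mul1r FM // normcV z1 invr1.
have TD F H z : T (fun x => F x + H x) z = T F z + T H z by rewrite /T mulrDr.
have TZ c F z : T (fun x => c * F x) z = c * T F z by rewrite /T mulrCA.
have Tm n : cmean 1 (fun z => z * T (fun x => x ^ n) z) = (n == -1)%:R.
  have -> : cmean 1 (fun z => z * T (fun x => x ^ n) z) =
      cmean 1 (fun z : C => z ^ (- n - 1)).
    apply: eq_cmean1 => z /normc1_neq0 z0; rewrite /T exprz_inv -[X in X * (_ * _)]expr1z.
    by rewrite mulrA -!expfzDr //; congr (_ ^ _); lia.
  rewrite cmeanXz //; congr (_%:R); lia.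
have := circle_principle ler01 TD TZ Tb Tc Tm s01 (holM (hX _ s0) hG).
rewrite (@eq_cmean1 (fun z => z * (z^-1 * G z)) G); last first.
  by move=> z /normc1_neq0 z0; rewrite mulrA divff // mul1r.
move=> <-; apply: eq_cmean1 => z /normc1_neq0 z0.
rewrite /T invrK; have -> : z ^ (- 2%:Z) = z ^- 2 by [].
by field.
Qed.

Lemma cmean_disc r G : 0 < r -> (forall z, normc z <= r -> exists D, cderiv G z D) ->
  cmean r G = G 0.
Proof.
move=> r0 hG; apply/eqP; rewrite -subr_eq0 -normc_eq0 eq_le normc_ge0 andbT.
apply/ler_addgt0Pr => e e0; rewrite add0r.
have [D0 hD0] : exists D, cderiv G 0 D by apply: hG; rewrite normc0 ltW.
have [d d0 hd] := (cvg_at_cP G 0).1 (cderiv_continuous hD0) _ (divr_gt0 e0 (ltr0n R 2)).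
pose q := Num.min r (d / 2).
have d20 : 0 < d / 2 by rewrite divr_gt0.
have q0 : 0 < q by rewrite lt_min r0.
have qr : q <= r by rewrite ge_min lexx.
have qd : q < d.
  apply: (@le_lt_trans _ _ (d / 2)); first by rewrite ge_min lexx orbT.
  by rewrite ltr_pdivrMr // ltr_pMr // ltr1n.
clearbody q.
have -> : cmean r G = cmean q G.
  apply: (cmean_const r0 q0) => z /andP[_ zr]; apply: hG; apply: le_trans zr _.
  by rewrite ge_max lexx.
have cG : on_circle q G by apply: on_circle_deriv => z zq; apply: hG; rewrite zq.
rewrite -[G 0](cmean_cst q) -(cmeanB (ltW q0) cG (@on_circleK R q (G 0))).
apply: le_trans (cmean_bound (M := e / 2) (ltW q0) (on_circleB cG (@on_circleK R q (G 0))) _) _.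
  move=> t _; have := hd (circle_pt q t).
  by rewrite subr0 normc_circle_pt ?(ltW q0) // => /(_ qd)/ltW.
by rewrite mulrC divfK.
Qed.

Lemma mob_annulus_neq0 a s z : 0 < s -> `|a| <= s -> annulus s z ->
  z + a%:C != 0 /\ 1 + a%:C * z != 0.
Proof.
move=> s0 as_ /andP[z1 z2].
have zp : 0 < normc z by apply: lt_trans z1.
have za : normc (a%:C * z) < 1.
  rewrite normcM normc_real; apply: (@le_lt_trans _ _ (s * normc z)).
    by rewrite ler_pM2r.
  by rewrite mulrC -ltr_pdivlMr // div1r.
split; apply/eqP => e.
  have : normc z = `|a| by rewrite -normc_real -(normcNN z) -(addr0_eq e).
  by move=> h; move: z1; rewrite -/(normc z) h ltNge as_.
by move: za; rewrite -(addr0_eq e) normcNN normc1 ltxx.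
Qed.

Lemma mob_neq0 a z : z + a%:C != 0 -> 1 + a%:C * z != 0 -> mob a z != 0.
Proof. by move=> h1 h2; rewrite mulf_neq0 ?invr_eq0. Qed.

Lemma cderiv_dmob a z : 1 + a%:C * z != 0 -> exists D, cderiv (dmob a) z D.
Proof.
move=> dz.
have h2 : cderiv (fun x => 1 + a%:C * x) z (0 + a%:C * 1) :=
  cderivD (cderiv_cst 1 z) (cderivZ _ (cderiv_id z)).
have h3 := cderivX 2 h2.
have dz2 : (1 + a%:C * z) ^+ 2 != 0 by rewrite expf_neq0.
have h4 := @cderivV R (fun x => (1 + a%:C * x) ^+ 2) z _ dz2 h3.
by eexists; exact: (cderivZ (1 - a%:C ^+ 2) h4).
Qed.

Lemma hol_mobXz a s (m : int) : 0 < s -> `|a| <= s -> hol s (fun z => mob a z ^ m).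
Proof.
move=> s0 as_ z za; have [h1 h2] := mob_annulus_neq0 s0 as_ za.
have [D hD] := cderivXz m (mob_neq0 h1 h2).
by eexists; exact: (cderiv_comp (cderiv_mob h2) hD).
Qed.

Lemma hol_dmob a s : 0 < s -> `|a| <= s -> hol s (dmob a).
Proof.
by move=> s0 as_ z za; have [h1 h2] := mob_annulus_neq0 s0 as_ za; exact: cderiv_dmob.
Qed.

Lemma unit_radius a : `|a| < 1 -> exists2 s, 0 < s < 1 & `|a| <= s.
Proof.
move=> a1; exists ((`|a| + 1) / 2); last by lra.
have := normr_ge0 a; lra.
Qed.

(** The residue of $u^m\,du$ under $u = $ [mob a z]. For m >= 0 the integrand is holomorphic in the
    disc and vanishes at 0; inversion exchanges m with - m - 2; the remaining case m = -1 splits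
    explicitly as $1 - k(1/z) - k(z)$, where [k] vanishes at 0. *)
Lemma mob_residue a (m : int) : `|a| < 1 ->
  cmean 1 (fun z => z * (mob a z ^ m * dmob a z)) = (m == -1)%:R.
Proof.
move=> a1; have [s s01 as_] := unit_radius a1; have s0 : 0 < s by case/andP: s01.
pose H m z := z * (mob a z ^ m * dmob a z).
have hH n : hol s (H n).
  exact: (holM (@hol_id _ s) (holM (hol_mobXz n s0 as_) (hol_dmob s0 as_))).
have pos n : cmean 1 (H (Posz n)) = 0.
  rewrite cmean_disc ?ltr01 // ?/H ?mul0r // => z z1.
  have dz := mob_den a1 z1; have [D hD] := cderiv_dmob dz.
  by eexists; exact: (cderivM (cderiv_id z) (cderivM (cderivX n (cderiv_mob dz)) hD)).
have sym n : cmean 1 (H n) = cmean 1 (H (- n - 2)).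
  rewrite -(cmean_inv s01 (hH n)); apply: eq_cmean1 => z z1; rewrite /H.
  have z0 := normc1_neq0 z1.
  have za : annulus s z by have := unit_annulus s01; rewrite -z1.
  have [h1 h2] := mob_annulus_neq0 s0 as_ za; have M0 := mob_neq0 h1 h2.
  rewrite mobV // exprz_inv (expfzDr (- n) (- 2) M0).
  have -> : mob a z ^ (- 2) = mob a z ^- 2 by [].
  move: (mob a z ^ (- n)) => X; rewrite /dmob /mob.
  have -> : 1 + a%:C * z^-1 = (z + a%:C) / z by field.
  by field; rewrite h1 h2 z0.
case: m => [n|[|n]].
- exact: pos.
- have -> : (Negz 0 == -1) = true by [].
  rewrite NegzE /=.
  pose k z := a%:C * (z / (1 + a%:C * z)).
  have hk z : 1 + a%:C * z != 0 -> exists D, cderiv k z D.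
    move=> dz; have h2 : cderiv (fun x => 1 + a%:C * x) z (0 + a%:C * 1) :=
      cderivD (cderiv_cst 1 z) (cderivZ _ (cderiv_id z)).
    have h3 := @cderivV R (fun x => 1 + a%:C * x) z _ dz h2.
    by eexists; exact: (cderivZ a%:C (cderivM (cderiv_id z) h3)).
  have hks : hol s k.
    by move=> z za; have [h1 h2] := mob_annulus_neq0 s0 as_ za; exact: hk.
  have k0 : cmean 1 k = 0.
    rewrite cmean_disc ?ltr01 // ?/k ?mul0r ?mulr0 // => z z1.
    exact: (hk _ (mob_den a1 z1)).
  have kV : cmean 1 (fun z => k z^-1) = 0 by rewrite (cmean_inv s01 hks).
  have c1 := @on_circleK R 1 1.
  have c2 := hol_circle s01 hks.
  have c3 := hol_circle s01 (hol_comp_inv s0 hks).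
  have -> : cmean 1 (fun z => z * (mob a z ^ (-1%:Z) * dmob a z)) =
      cmean 1 (fun z => (1 - k z^-1) - k z).
    apply: eq_cmean1 => z z1; have z0 := normc1_neq0 z1.
    have za : annulus s z by have := unit_annulus s01; rewrite -z1.
    have [h1 h2] := mob_annulus_neq0 s0 as_ za.
    rewrite exprN1 /k /mob /dmob.
    have -> : 1 + a%:C * z^-1 = (z + a%:C) / z by field.
    by field; rewrite h1 h2 z0.
  by rewrite (cmeanB ler01 (on_circleB c1 c3) c2) (cmeanB ler01 c1 c3) k0 kV cmean_cst !subr0.
- rewrite -/(H _) sym; have -> : (- Negz n.+1 - 2 = Posz n) by lia.
  have -> : (Negz n.+1 == -1) = false by lia.
  exact: pos.
Qed.

Lemma nob0 z : nob 0 z = z.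
Proof. by rewrite /nob /mob oppr0 addr0 mul0r addr0 divr1. Qed.

Lemma PFop_qfun a f z : PFop a f z = PFop 0 (qfun a f) z.
Proof.
have q0 g u : qfun 0 g u = g u.
  by rewrite /qfun nob0 /dmob oppr0 mul0r addr0 expr0n subr0 expr1n divr1 mulr1.
by rewrite /PFop !q0.
Qed.

Lemma PFopD a f g z : PFop a (fun x => f x + g x) z = PFop a f z + PFop a g z.
Proof. by rewrite /PFop /qfun; move: (_^-1) => i; ring. Qed.

Lemma PFopZ a c f z : PFop a (fun x => c * f x) z = c * PFop a f z.
Proof. by rewrite /PFop /qfun; move: (_^-1) => i; ring. Qed.

Lemma normc1_sqrtc z : normc z = 1 -> normc (sqrtc z) = 1.
Proof.
move=> z1; apply/eqP; rewrite -(eqrXn2 (n := 2)) ?normc_ge0 // normc_sqrtc z1.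
by rewrite expr1n.
Qed.

Lemma PFop_circle_bound a f M : 0 <= a < 1 ->
  (forall z, normc z = 1 -> normc (f z) <= M) ->
  forall z, normc z = 1 -> normc (PFop a f z) <= (1 - a) ^- 2 * M.
Proof.
move=> a01 fM z z1; have /andP[a0 a1] := a01.
have na : `|- a| < 1 by rewrite normrN ger0_norm.
have qb u : normc u = 1 -> normc (qfun a f u) <= (1 - a) ^- 2 * M.
  move=> u1; rewrite mulrC normcM; apply: ler_pM; rewrite ?normc_ge0 //.
    by apply: fM; exact: mob_eq1.
  rewrite /dmob rmorphN sqrrN normcM normcV normcX.
  have -> : 1 - a%:C ^+ 2 = (1 - a ^+ 2)%:C :> C by rewrite rmorphB rmorph1 rmorphXn.
  rewrite normc_realp ?subr_ge0 ?expr_le1 // ?(ltW a1) //.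
  have d0 : 0 < 1 - a by rewrite subr_gt0.
  have dl : 1 - a <= normc (1 - a%:C * u).
    have := normc_lb 1 (a%:C * u).
    by rewrite normcM u1 mulr1 normc_realp // normc1.
  rewrite mulNr; apply: (@le_trans _ _ (1 * (normc (1 - a%:C * u) ^+ 2)^-1)).
    by rewrite ler_wpM2r ?invr_ge0 ?exprn_ge0 ?normc_ge0 // gerBl sqr_ge0.
  rewrite mul1r lef_pV2 ?posrE ?exprn_gt0 //; last exact: lt_le_trans dl.
  by rewrite ler_pXn2r ?nnegrE ?normc_ge0 ?(ltW d0).
have w1 := normc1_sqrtc z1; rewrite /PFop; move: (sqrtc z) w1 => w w1.
have h1 := qb _ w1; have h2 : normc (qfun a f (- w)) <= (1 - a) ^- 2 * M.
  by apply: qb; rewrite normcNN.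
rewrite normcM normcV normcM w1 mulr1.
have -> : normc 2 = 2 :> R by have := @normc_realp R 2 (ler0n _ _); rewrite rmorph_nat.
rewrite ler_pdivrMr //; apply: le_trans (normcB _ _) _.
by apply: le_trans (lerD h1 h2) _; rewrite mulr2n mulrDr mulr1.
Qed.

Lemma mrad_gt0 a r : 0 <= a -> 0 < r -> 0 < mrad a r.
Proof. by move=> a0 r0; rewrite divr_gt0 ?ltr_wpDr // mulr_ge0 // ltW. Qed.

Lemma PFop_on_circle a s f : 0 <= a < 1 -> 0 < s < 1 -> hol s f ->
  on_circle 1 (PFop a f).
Proof.
move=> a01 s01 hf; apply: (@hol_circle _ (mrad a s ^+ 2)) (PFop_hol a01 s01 hf).
have /andP[s0 s1] := s01; have /andP[a0 _] := a01.
have s01' : 0 <= s < 1 by rewrite (ltW s0).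
have m0 := mrad_gt0 a0 s0.
by rewrite exprn_gt0 //= exprn_ilt1 ?(ltW m0) // mrad_lt1.
Qed.

Lemma int_parity (n : int) : exists m : int, n = m * 2 \/ n = m * 2 + 1.
Proof.
exists (n %/ 2)%Z; have e := divz_eq n 2.
have h1 := @modz_ge0 n 2 isT; have h2 := @ltz_pmod n 2 isT.
move: e h1 h2; move: (n %% 2)%Z (n %/ 2)%Z => x y; lia.
Qed.

(** For the squaring map even powers are annihilated and the power 2m + 1 is sent to the power m. *)
Lemma PFop0_monomial (n : int) :
  cmean 1 (fun z => z * PFop 0 (fun x : C => x ^ n) z) = (n == -1)%:R.
Proof.
have q0 (g : C -> C) u : qfun 0 g u = g u.
  by rewrite /qfun nob0 /dmob oppr0 mul0r addr0 expr0n subr0 expr1n divr1 mulr1.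
have [m [->|->]] := int_parity n.
  have -> : (m * 2 == -1 :> int) = false by lia.
  rewrite -[RHS](cmean_cst 1); apply: eq_cmean1 => z z1.
  rewrite /PFop !q0 [m * 2]mulrC -!exprz_exp.
  by rewrite -![_ ^ 2]/(_ ^+ 2) sqrrN subrr mul0r mulr0.
have -> : cmean 1 (fun z => z * PFop 0 (fun x : C => x ^ (m * 2 + 1)) z) =
    cmean 1 (fun z : C => z ^ (m + 1)).
  apply: eq_cmean1 => z z1; have w1 := normc1_sqrtc z1.
  have w0 := normc1_neq0 w1; have z0 := normc1_neq0 z1.
  rewrite /PFop !q0 !expfzDr ?oppr_eq0 // !expr1z [m * 2]mulrC -!exprz_exp.
  rewrite -![_ ^ 2]/(_ ^+ 2) sqrrN sqr_sqrtc; move: (z ^ m) => X.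
  by field.
by rewrite cmeanXz //; congr (_%:R); lia.
Qed.

(** [PFop a f] is the operator of the squaring map applied to [qfun a f]. The squaring part is
    checked on monomials, and the change of variables hidden in [qfun] is the residue
    [mob_residue]. *)
Lemma PFop_mean a s f : 0 <= a < 1 -> 0 < s < 1 -> hol s f ->
  cmean 1 (fun z => z * PFop a f z) = cmean 1 (fun z => z * f z).
Proof.
have z01 : (0 : R) <= (0 : R) < 1 by rewrite lexx ltr01.
have K0 (b : R) : 0 <= (1 - b) ^- 2 by rewrite invr_ge0 sqr_ge0.
have P0 r F : 0 < r < 1 -> hol r F ->
    cmean 1 (fun z => z * PFop 0 F z) = cmean 1 (fun z => z * F z).
  apply: (circle_principle (K0 0) (@PFopD 0) (@PFopZ 0)).
  - by move=> G M; exact: PFop_circle_bound.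
  - by move=> p G; exact: PFop_on_circle.
  - exact: PFop0_monomial.
move=> a01 s01 hf; have /andP[a0 a1] := a01.
have na : `|- a| < 1 by rewrite normrN ger0_norm.
apply: (circle_principle (K0 a) (@PFopD a) (@PFopZ a)) s01 hf.
- by move=> G M; exact: PFop_circle_bound.
- by move=> p G; exact: PFop_on_circle.
move=> n; rewrite -(mob_residue n na).
have [p p01 ap] := unit_radius na; have p0 : 0 < p by case/andP: p01.
have hq : hol p (qfun a (fun x => x ^ n)).
  exact: (holM (hol_mobXz n p0 ap) (hol_dmob p0 ap)).
rewrite -(P0 _ _ p01 hq); apply: eq_cmean1 => z z1.
by rewrite PFop_qfun.
Qed.

Lemma PFop_proj a f g z : 0 <= a < 1 -> normc z = 1 ->
  PFop a f z * g z = PFop a (fun x => f x * g (tee a x)) z.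
Proof.
move=> a01 z1; have a1 : `|a| < 1 by case/andP: a01 => ? ?; rewrite ger0_norm.
have na : `|- a| < 1 by rewrite normrN.
have w1 := normc1_sqrtc z1.
have dw u : normc u = 1 -> 1 - a%:C * u != 0.
  by move=> u1; rewrite -mulNr -rmorphN mob_den // u1.
have tw u : normc u = 1 -> u ^+ 2 = z -> tee a (nob a u) = z.
  by move=> u1 uz; rewrite /tee nobK // dw.
have nw1 : normc (- sqrtc z) = 1 by rewrite normcNN.
rewrite /PFop /qfun !tw ?sqrrN ?sqr_sqrtc //.
by move: (_^-1) => i; ring.
Qed.

Definition pair f g : C := cmean 1 (fun z => z * (f z * g z)).

(** The projection formula [PFop_proj] brings [g] inside the operator, and [PFop_mean] then removes
    the operator. *)
Lemma pair_PFop a s f g : 0 <= a < 1 -> 0 < s < 1 -> hol s f ->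
  hol s (fun z => g (tee a z)) -> pair (PFop a f) g = pair f (fun z => g (tee a z)).
Proof.
move=> a01 s01 hf hg; rewrite /pair -(PFop_mean a01 s01 (holM hf hg)).
by apply: eq_cmean1 => z z1; rewrite PFop_proj.
Qed.

Lemma coef_pair (n : int) f : coef 1 n f = pair f (fun z => z ^ (- n - 1)).
Proof.
apply: eq_cmean1 => z z1; rewrite expfzDr ?normc1_neq0 // exprN1 mulrCA.
by rewrite [_ ^ _ * _]mulrC mulVKf ?normc1_neq0.
Qed.

Definition blaschke_shift (c : bool) : R := if c then 4^-1 else 0.

Lemma blaschke_shift01 c : 0 <= blaschke_shift c < 1.
Proof. by case: c; rewrite /blaschke_shift; lra. Qed.

Lemma blaschkeE c : @blaschke R c = tee (blaschke_shift c).
Proof.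
apply/funext => z; case: c; rewrite /blaschke /tee /mob /blaschke_shift.
  by rewrite fmorphV rmorph_nat [z / 4]mulrC.
by rewrite addr0 mul0r addr0 divr1.
Qed.

(** [PF] selects an element by its values on the unit circle. The explicit operator, extended by 0,
    has these values, and the identity principle makes it the only candidate. *)
Lemma PF_blaschke rho c f : 0 < rho < 1 -> mrad (blaschke_shift c) rho ^+ 2 < rho ->
  H2 rho f ->
  let F := aext rho (PFop (blaschke_shift c) f) in
  PF rho (blaschke c) f = F /\ H2 rho F.
Proof.
move=> rho01 mr Hf F; have a01 := blaschke_shift01 c.
have /andP[r0 r1] := rho01; have hf := H2_hol Hf.
have m0 : 0 < mrad (blaschke_shift c) rho.
  by apply: mrad_gt0 => //; case/andP: a01.
have HF : H2 rho F.
  by apply: H2_aext (PFop_hol a01 rho01 hf) => //; rewrite exprn_gt0.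
split=> //; apply: xget_unique.
  split=> // z z1; rewrite /F aextE.
    by rewrite blaschkeE PF_sumE.
  by have := unit_annulus rho01; rewrite -z1.
move=> g [Hg gE]; apply/funext => z.
have [za|za] := pselect (annulus rho z); last first.
  by case: Hg => _ -> // _; case: HF => _ ->.
apply: (identity_principle rho01 (H2_hol Hg) (H2_hol HF)) => // n.
apply: eq_cmean1 => w w1; rewrite gE // /F aextE.
  by rewrite blaschkeE PF_sumE.
by have := unit_annulus rho01; rewrite -w1.
Qed.

End Duality.

(** * Test functions near the closed unit disc and their Taylor expansions *)

Section TestFunctions.
Context {R : realType}.
Local Notation C := R[i].
Implicit Types (f g h F G p q : C -> C) (z w u v : C) (a r s t d M rho : R).

(* Holomorphy on a neighbourhood of the closed unit disc; the condition on maps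
   makes such functions stable under composition. *)
Definition dhol g := exists2 s, 0 < s < 1 &
  forall z, normc z < s^-1 -> exists D, cderiv g z D.

Definition dmap p := forall s, 0 < s < 1 -> exists2 s', 0 < s' < 1 &
  forall z, normc z < s'^-1 -> (exists D, cderiv p z D) /\ normc (p z) < s^-1.

Lemma max01 s s' : 0 < s < 1 -> 0 < s' < 1 -> 0 < Num.max s s' < 1.
Proof. by move=> /andP[s0 s1] /andP[t0 t1]; rewrite lt_max s0 gt_max s1 t1. Qed.

Lemma disc_max s s' z : 0 < s < 1 -> 0 < s' < 1 ->
  normc z < (Num.max s s')^-1 -> normc z < s^-1 /\ normc z < s'^-1.
Proof.
move=> s01 s01' zm; have /andP[m0 _] := max01 s01 s01'.
have /andP[s0 _] := s01; have /andP[t0 _] := s01'.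
by split; apply: lt_le_trans zm _; rewrite lef_pV2 ?posrE // le_max lexx ?orbT.
Qed.

Lemma half01 : 0 < (2^-1 : R) < 1.
Proof. lra. Qed.

Lemma dhol_cst (c : C) : dhol (fun=> c).
Proof. by exists 2^-1 => [|z _]; [exact: half01|eexists; exact: cderiv_cst]. Qed.

Lemma dholD g h : dhol g -> dhol h -> dhol (fun z => g z + h z).
Proof.
move=> [s s01 hg] [s' s01' hh]; exists (Num.max s s'); first exact: max01.
move=> z /(disc_max s01 s01')[/hg[D hD] /hh[E hE]].
by eexists; exact: (cderivD hD hE).
Qed.

Lemma dholM g h : dhol g -> dhol h -> dhol (fun z => g z * h z).
Proof.
move=> [s s01 hg] [s' s01' hh]; exists (Num.max s s'); first exact: max01.
move=> z /(disc_max s01 s01')[/hg[D hD] /hh[E hE]].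
by eexists; exact: (cderivM hD hE).
Qed.

Lemma dholX g n : dhol g -> dhol (fun z => g z ^+ n).
Proof. by move=> [s s01 hg]; exists s => // z /hg[D hD]; eexists; exact: (cderivX n hD). Qed.

Lemma dhol_comp g p : dhol g -> dmap p -> dhol (fun z => g (p z)).
Proof.
move=> [s s01 hg] /(_ _ s01)[s' s01' hp]; exists s' => // z /hp[[D hD] /hg[E hE]].
by eexists; exact: (cderiv_comp hD hE).
Qed.

Lemma dmap_dhol p : dmap p -> dhol p.
Proof. by move=> /(_ _ half01)[s s01 hp]; exists s => // z /hp[]. Qed.

Lemma dmap_id : dmap id.
Proof. by move=> s s01; exists s => // z zs; split=> //; eexists; exact: cderiv_id. Qed.

Lemma dmap_comp p q : dmap p -> dmap q -> dmap (fun z => p (q z)).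
Proof.
move=> hp hq s /hp[s1 /hq[s2 s201 h2] h1]; exists s2 => // z /h2[[D hD] /h1[[E hE] pz]].
by split=> //; eexists; exact: (cderiv_comp hD hE).
Qed.

Lemma dmapM p q : dmap p -> dmap q -> dmap (fun z => p z * q z).
Proof.
(* The arithmetic mean of 1 and [s] satisfies [s <= m * m], so two factors of modulus below [m^-1]
   have a product below [s^-1]. *)
move=> hp hq s s01; pose m := (1 + s) / 2.
have m01 : 0 < m < 1 by rewrite /m; lra.
have sm : s <= m * m by rewrite /m; nra.
clearbody m; have /andP[m0 m1] := m01; have /andP[s0 _] := s01.
have [s1 s101 h1] := hp _ m01; have [s2 s201 h2] := hq _ m01.
exists (Num.max s1 s2); first exact: max01.
move=> z /(disc_max s101 s201)[/h1[[D hD] pz] /h2[[E hE] qz]].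
split; first by eexists; exact: (cderivM hD hE).
rewrite normcM; apply: (@lt_le_trans _ _ (m^-1 * m^-1)).
  by apply: ltr_pM; rewrite ?normc_ge0.
by rewrite -invfM lef_pV2 ?posrE // mulr_gt0.
Qed.

Lemma dmapX p n : dmap p -> dmap (fun z => p z ^+ n.+1).
Proof.
move=> hp; elim: n => [|n IH]; first by under [X in dmap X]funext do rewrite expr1.
by under [X in dmap X]funext do rewrite exprS; exact: dmapM.
Qed.

Lemma mob_le1 a z : `|a| < 1 -> normc z <= 1 -> normc (mob a z) <= 1.
Proof.
move=> a1; rewrite le_eqVlt => /orP[/eqP z1|z1]; first by rewrite mob_eq1.
exact: ltW (mob_lt1 a1 z1).
Qed.

Lemma mobN a z : mob (- a) z = - mob a (- z).
Proof. by rewrite /mob rmorphN mulrN !mulNr -[RHS]mulNr opprD opprK. Qed.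

Lemma dmap_nob a : 0 <= a < 1 -> dmap (nob a).
Proof.
move=> a01 s s01; have /andP[a0 a1] := a01; have /andP[s0 s1] := s01.
have na : `|- a| < 1 by rewrite normrN ger0_norm.
have s01' : 0 <= s < 1 by rewrite (ltW s0).
exists (mrad a s); first by rewrite mrad_gt0 //= mrad_lt1.
move=> z zs; have [z1|z1] := leP (normc z) 1.
  split; first by eexists; exact: (cderiv_mob (mob_den na z1)).
  by apply: le_lt_trans (mob_le1 na z1) _; rewrite invf_gt1.
have za : annulus (mrad a s) z by apply/andP; split => //; exact: lt_trans (mrad_lt1 a01 s01') z1.
have dz := annulus_den a01 s01 za; split.
  have dz' : 1 + (- a)%:C * z != 0 by rewrite rmorphN mulNr.
  by eexists; exact: (cderiv_mob dz').
by have /andP[_] := nob_annulus a01 s01 za.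
Qed.

Lemma dmapN p : dmap p -> dmap (fun z => - p (- z)).
Proof.
move=> hp s /hp[s' s01' h]; exists s' => // z zs.
have [|[D hD] pz] := h (- z); first by rewrite normcNN.
by rewrite normcNN; split=> //; eexists; exact: (cderivN (cderiv_comp (cderivN (cderiv_id z)) hD)).
Qed.

Lemma dmap_mob a : `|a| < 1 -> dmap (mob a).
Proof.
move=> a1; have [a0|a0] := leP 0 a; last first.
  have a01 : 0 <= - a < 1 by rewrite oppr_ge0 (ltW a0) /= -ltr0_norm.
  by have := dmap_nob a01; rewrite /nob opprK.
have a01 : 0 <= a < 1 by rewrite a0 -(ger0_norm a0).
have := dmapN (dmap_nob a01).
by under [X in dmap X]funext do rewrite /nob mobN !opprK.
Qed.

Lemma dmap_tee a : `|a| < 1 -> dmap (tee a).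
Proof. by move=> a1; exact: (dmapX 1 (dmap_mob a1)). Qed.

Lemma dhol_hol g : dhol g -> exists2 s, 0 < s < 1 & hol s g.
Proof. by move=> [s s01 hg]; exists s => // z /andP[_ /hg]. Qed.

Lemma dhol_at g z : dhol g -> normc z <= 1 -> exists D, cderiv g z D.
Proof.
move=> [s /andP[s0 s1] hg] z1; apply: hg; apply: le_lt_trans z1 _.
by rewrite invf_gt1.
Qed.

Definition tcoef G m : C := coef 1 m%:Z G.

Lemma coef_neg_dhol G (k : nat) : dhol G -> coef 1 (- k.+1%:Z) G = 0.
Proof.
move=> hG; have -> : coef 1 (- k.+1%:Z) G = cmean 1 (fun z => G z * z ^+ k.+1).
  by apply: eq_cmean1 => z _; rewrite opprK.
rewrite cmean_disc ?ltr01 ?expr0n ?mulr0 // => z z1; have [D hD] := dhol_at hG z1.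
by eexists; exact: (cderivM hD (cderivX k.+1 (cderiv_id z))).
Qed.

Lemma coef_radius G d (n : int) : dhol G -> 0 < d <= 1 -> coef 1 n G = coef d n G.
Proof.
move=> hG /andP[d0 d1]; apply: (cmean_const ltr01 d0) => z.
rewrite (min_idPr d1) (max_idPl d1) => /andP[dz z1].
have z0 : z != 0 by rewrite -normc_gt0; exact: lt_le_trans dz.
have [D hD] := dhol_at hG z1; have [E hE] := cderivXz (- n) z0.
by eexists; exact: (cderivM hD hE).
Qed.

Lemma dhol_on_circle G d : dhol G -> d <= 1 -> on_circle d G.
Proof. by move=> hG d1; apply: on_circle_deriv => z zd; apply: (dhol_at hG); rewrite zd. Qed.

Lemma tcoef_bound G d M m : dhol G -> 0 < d <= 1 ->
  (forall z, normc z <= d -> normc (G z) <= M) -> normc (tcoef G m) <= 2 * M / d ^+ m.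
Proof.
move=> hG d01 GM; have /andP[d0 d1] := d01.
rewrite /tcoef (coef_radius _ hG d01).
apply: le_trans (coef_bound (M := M) _ d0 (dhol_on_circle hG d1) _) _.
  by move=> t _; apply: GM; rewrite normc_circle_pt ?(ltW d0).
by rewrite mulrA -exprnN.
Qed.

Lemma tcoefM_low G i m : dhol G -> (m < i)%N -> tcoef (fun v => v ^+ i * G v) m = 0.
Proof.
move=> hG mi; have -> : tcoef (fun v => v ^+ i * G v) m =
    cmean 1 (fun z => z ^+ (i - m) * G z).
  apply: eq_cmean1 => z /normc1_neq0 z0; rewrite -{1}(subnK (ltnW mi)) exprD.
  by rewrite -exprnN mulrAC mulfK // expf_neq0.
rewrite cmean_disc ?ltr01 //.
  by rewrite expr0n subn_eq0 leqNgt mi mul0r.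
move=> z z1; have [D hD] := dhol_at hG z1.
by eexists; exact: (cderivM (cderivX (i - m) (cderiv_id z)) hD).
Qed.

Lemma tcoefM_lead G i : dhol G -> tcoef (fun v => v ^+ i * G v) i = G 0.
Proof.
move=> hG; have -> : tcoef (fun v => v ^+ i * G v) i = cmean 1 G.
  apply: eq_cmean1 => z /normc1_neq0 z0.
  by rewrite -exprnN mulrAC mulfV ?mul1r // expf_neq0.
by rewrite cmean_disc ?ltr01 // => z z1; exact: (dhol_at hG z1).
Qed.

Lemma taylor G d M j v : dhol G -> 0 < d <= 1 ->
  (forall z, normc z <= d -> normc (G z) <= M) -> normc v < d ->
  normc (G v - \sum_(m < j) tcoef G m * v ^+ m) <=
    4 * M * (normc v / d) ^+ j / (1 - normc v / d).
Proof.
move=> hG d01 GM vd; have /andP[d0 d1] := d01.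
have G0M : normc (G 0) <= M by apply: GM; rewrite normc0 ltW.
have M0 : 0 <= M by apply: le_trans G0M; exact: normc_ge0.
(* Laurent expansions live on punctured discs, so the centre is treated by hand. *)
have [->|v0] := eqVneq v 0.
  rewrite normc0 mul0r subr0 divr1; case: j => [|j].
    rewrite big_ord0 subr0 expr0 mulr1; apply: le_trans G0M _.
    by rewrite ler_peMl // ler1n.
  have -> : \sum_(m < j.+1) tcoef G m * 0 ^+ m = tcoef G 0.
    by rewrite big_ord_recl big1 ?addr0 ?expr0 ?mulr1 // => i _; rewrite expr0n mulr0.
  have -> : tcoef G 0 = G 0.
    rewrite -(tcoefM_lead 0 hG); apply: eq_cmean1 => z _; congr (_ * _).
    by rewrite mul1r.
  by rewrite subrr normc0 !mulr_ge0 // exprn_ge0.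
have vp : 0 < normc v by rewrite normc_gt0.
have th01 : 0 < normc v / d < 1 by rewrite divr_gt0 //= ltr_pdivrMr // mul1r.
have /andP[th0 th1] := th01.
have lsE N : laurent_sum (fun n => coef 1 n G) N v = \sum_(m < N) tcoef G m * v ^+ m.
  rewrite /laurent_sum [X in _ + X]big1 ?addr0 // => k _.
  by rewrite coef_neg_dhol // mul0r.
have h1 (k : nat) : normc (coef 1 k%:Z G * v ^ k%:Z) <= 2 * M * (normc v / d) ^+ k.
  rewrite normcM -exprnP normcX expr_div_n.
  have := tcoef_bound k hG d01 GM; rewrite /tcoef => hk.
  apply: le_trans (ler_wpM2r (exprn_ge0 _ (normc_ge0 _)) hk) _.
  by rewrite mulrAC -mulrA.
have h2 (k : nat) : normc (coef 1 (- k.+1%:Z) G * v ^ (- k.+1%:Z)) <= 2 * M * (normc v / d) ^+ k.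
  by rewrite coef_neg_dhol // mul0r normc0 !mulr_ge0 // exprn_ge0 ?(ltW th0).
have M20 : 0 <= 2 * M by rewrite mulr_ge0.
apply/ler_addgt0Pr => e e0.
have [s /andP[s0 s1] hs] := hG.
have hG' w : 0 < normc w < s^-1 -> exists D, cderiv G w D by move=> /andP[_ /hs].
have in1 : (0 : R) < (1 : R) < s^-1 by rewrite ltr01 invf_gt1.
have inv : 0 < normc v < s^-1.
  by rewrite vp (lt_le_trans vd) // (le_trans d1) // ltW // invf_gt1.
have [N0 hN] := laurent (lexx 0) hG' in1 inv e0.
have := @laurent_tail _ (fun n => coef 1 n G) (2 * M) _ j N0 v M20 th01 h1 h2.
have := ltW (hN (j + N0)%N (leq_addl _ _)); rewrite !lsE.
move: (\sum_(m < _) _) (\sum_(m < _) _) => y x k1 k2.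
have -> : G v - y = (x - y) + (G v - x) by ring.
apply: le_trans (normcD _ _) _; apply: lerD k1.
apply: le_trans k2 _; rewrite le_eqVlt; apply/orP; left; apply/eqP; ring.
Qed.

End TestFunctions.

(** * Pairings with the two halves of the Laurent coefficients *)

Section SignedPairing.
Context {R : realType}.
Local Notation C := R[i].
Implicit Types (f g h F G p q : C -> C) (z w u v : C) (a r s t d M rho x : R).

(* The Blaschke products commute with [z |-> z^-1] on the unit circle; [flip false]
   gives access to the remaining half of the Laurent coefficients. *)
Definition flip (b : bool) z := if b then z else z^-1.

Definition spair b f g := pair f (fun z => g (flip b z)).

Lemma normc_flip b z : normc z = 1 -> normc (flip b z) = 1.
Proof. by case: b => //= z1; rewrite normcV z1 invr1. Qed.

Lemma hol_flip b g : dhol g -> exists2 s, 0 < s < 1 & hol s (fun z => g (flip b z)).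
Proof.
move=> /dhol_hol[s s01 hg]; exists s => //; case: b => //=.
by apply: hol_comp_inv => //; case/andP: s01.
Qed.

Lemma eq_spair b f g h : (forall z, normc z = 1 -> g z = h z) -> spair b f g = spair b f h.
Proof. by move=> gh; apply: eq_cmean1 => z z1; rewrite gh // normc_flip. Qed.

Lemma eq_spair_l b f f' g : (forall z, normc z = 1 -> f z = f' z) -> spair b f g = spair b f' g.
Proof. by move=> ff; apply: eq_cmean1 => z z1; rewrite ff. Qed.

Lemma spair_on_circle b rho f g : 0 < rho < 1 -> hol rho f -> dhol g ->
  on_circle 1 (fun z => z * (f z * g (flip b z))).
Proof.
move=> rho01 hf /(hol_flip b)[s s01 hg].
exact: (on_circleM (hol_circle rho01 (@hol_id _ rho))
  (on_circleM (hol_circle rho01 hf) (hol_circle s01 hg))).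
Qed.

Lemma spair_lin b rho f g h (c : C) : 0 < rho < 1 -> hol rho f -> dhol g -> dhol h ->
  spair b f (fun z => g z + c * h z) = spair b f g + c * spair b f h.
Proof.
move=> rho01 hf hg hh.
have c1 := spair_on_circle (b := b) rho01 hf hg; have c2 := spair_on_circle (b := b) rho01 hf hh.
rewrite /spair /pair -(cmeanZ c ler01 c2) -(cmeanD ler01 c1 (on_circleM (@on_circleK _ 1 c) c2)).
by apply: eq_cmean => t; ring.
Qed.

Lemma spair_lin_l b rho f f' g (c : C) : 0 < rho < 1 -> hol rho f -> hol rho f' -> dhol g ->
  spair b (c *: f + f') g = c * spair b f g + spair b f' g.
Proof.
move=> rho01 hf hf' hg.
have c1 := spair_on_circle (b := b) rho01 hf hg; have c2 := spair_on_circle (b := b) rho01 hf' hg.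
rewrite /spair /pair -(cmeanZ c ler01 c1) -(cmeanD ler01 (on_circleM (@on_circleK _ 1 c) c1) c2).
apply: eq_cmean => t; have -> : (c *: f + f') (circle_pt 1 t) =
  c * f (circle_pt 1 t) + f' (circle_pt 1 t) by [].
ring.
Qed.

Lemma spair0 b f : spair b f (fun=> 0) = 0.
Proof.
rewrite -[RHS](cmean_cst 1); apply: eq_cmean => t.
by rewrite mulr0 mulr0.
Qed.

Lemma spair_sum b rho f j (c : nat -> C) (h : nat -> C -> C) : 0 < rho < 1 ->
  hol rho f -> (forall m, dhol (h m)) ->
  spair b f (fun z => \sum_(m < j) c m * h m z) = \sum_(m < j) c m * spair b f (h m).
Proof.
move=> rho01 hf hh.
have dS k : dhol (fun z => \sum_(m < k) c m * h m z).
  elim: k => [|k IH]; first by under [X in dhol X]funext do rewrite big_ord0; exact: dhol_cst.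
  under [X in dhol X]funext do rewrite big_ord_recr /=.
  exact: (dholD IH (dholM (dhol_cst (c k)) (hh k))).
elim: j => [|j IH].
  by rewrite big_ord0 -[RHS](spair0 b f); apply: eq_spair => z _; rewrite big_ord0.
rewrite big_ord_recr /= -IH -(spair_lin b _ rho01 hf (dS j) (hh j)).
by apply: eq_spair => z _; rewrite big_ord_recr.
Qed.

(** The contour is moved from the unit circle to the circle of radius [r], or [r^-1] when [b] is
    false; in both cases [g] is evaluated on the circle of radius [r] inside the disc, where
    iterated test functions are small. *)
Lemma spair_bound b rho r f g Mf Mg : 0 < rho -> rho < r < 1 -> hol rho f ->
  (forall z, normc z = r \/ normc z = r^-1 -> normc (f z) <= Mf) -> dhol g ->
  (forall z, normc z = r -> normc (g z) <= Mg) ->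
  normc (spair b f g) <= 2 * (rho^-1 * (Mf * Mg)).
Proof.
move=> rho0 /andP[rr r1] hf fM hg gM; have r0 := lt_trans rho0 rr.
have rho1 := lt_trans rr r1; have rV1 : 1 < r^-1 by rewrite invf_gt1.
have rVr : r^-1 < rho^-1 by rewrite ltf_pV2 ?posrE.
case: b; rewrite /spair /pair /flip.
  have hz z : r <= normc z <= 1 -> exists D, cderiv (fun z => z * (f z * g z)) z D.
    move=> /andP[z1 z2].
    have za : annulus rho z.
      by apply/andP; split; [exact: lt_le_trans z1|apply: le_lt_trans z2 _; rewrite invf_gt1].
    have [D hD] := hf z za; have [E hE] := dhol_at hg z2.
    by eexists; exact: (cderivM (cderiv_id z) (cderivM hD hE)).
  have -> : cmean 1 (fun z => z * (f z * g z)) = cmean r (fun z => z * (f z * g z)).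
    apply: (cmean_const ltr01 r0) => z.
    by rewrite (min_idPr (ltW r1)) (max_idPl (ltW r1)); exact: hz.
  apply: (cmean_bound (ltW r0)).
    by apply: on_circle_deriv => z zr; apply: hz; rewrite zr lexx ltW.
  move=> t _; have nz := @normc_circle_pt _ r t (ltW r0).
  rewrite normcM nz; apply: ler_pM; rewrite ?(ltW r0) ?normc_ge0 //.
    by apply: (ltW (lt_trans r1 _)); rewrite invf_gt1.
  by rewrite normcM; apply: ler_pM; rewrite ?normc_ge0 ?fM ?gM //; left.
have rV0 : 0 < r^-1 by rewrite invr_gt0.
have hz z : 1 <= normc z <= r^-1 -> exists D, cderiv (fun z => z * (f z * g z^-1)) z D.
  move=> /andP[z1 z2].
  have za : annulus rho z.
    by apply/andP; split; [exact: lt_le_trans z1|exact: le_lt_trans z2 _].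
  have z0 := annulus_neq0 rho0 za.
  have z3 : normc z^-1 <= 1 by rewrite normcV invf_le1 // (lt_le_trans ltr01).
  have [D hD] := hf z za; have [E hE] := dhol_at hg z3.
  eexists; apply: (cderivM (cderiv_id z) (cderivM hD _)).
  exact: (cderiv_comp (@cderivV R id z _ z0 (cderiv_id z)) hE).
have -> : cmean 1 (fun z => z * (f z * g z^-1)) = cmean r^-1 (fun z => z * (f z * g z^-1)).
  apply: (cmean_const ltr01 rV0) => z.
  by rewrite (min_idPl (ltW rV1)) (max_idPr (ltW rV1)); exact: hz.
apply: (cmean_bound (ltW rV0)).
  by apply: on_circle_deriv => z zr; apply: hz; rewrite zr lexx ltW.
move=> t _; have nz := @normc_circle_pt _ r^-1 t (ltW rV0).
rewrite normcM nz; apply: ler_pM; rewrite ?(ltW rV0) ?normc_ge0 //.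
  exact: ltW.
rewrite normcM; apply: ler_pM; rewrite ?normc_ge0 //; first by apply: fM; right.
by apply: gM; rewrite normcV nz invrK.
Qed.

Lemma H2_coef_pos rho f (k : nat) : 0 < rho < 1 -> H2 rho f ->
  normc (coef 1 k%:Z f) <= 3 * H2norm rho f * rho ^+ k.
Proof.
move=> rho01 Hf; have /andP[r0 _] := rho01.
have := H2_coef_bound k%:Z rho01 Hf (or_intror (erefl rho^-1)).
by rewrite exprz_inv -exprnN ler_pdivrMr // exprn_gt0.
Qed.

Lemma H2_coef_neg rho f (k : nat) : 0 < rho < 1 -> H2 rho f ->
  normc (coef 1 (- k%:Z) f) <= 3 * H2norm rho f * rho ^+ k.
Proof.
move=> rho01 Hf; have /andP[r0 _] := rho01.
have := H2_coef_bound (- k%:Z) rho01 Hf (or_introl (erefl rho)).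
by rewrite -exprnN ler_pdivrMr // exprn_gt0.
Qed.

Lemma H2_circle_bound rho r : 0 < rho -> rho < r < 1 -> exists2 K : R, 0 <= K &
  forall f z, H2 rho f -> normc z = r \/ normc z = r^-1 ->
    normc (f z) <= K * H2norm rho f.
Proof.
move=> rho0 /andP[rr r1]; have r0 := lt_trans rho0 rr.
have rho01 : 0 < rho < 1 by rewrite rho0 (lt_trans rr).
have th01 : 0 < rho / r < 1 by rewrite divr_gt0 //= ltr_pdivrMr // mul1r.
have /andP[th0 th1] := th01.
exists (2 * (3 / (1 - rho / r))).
  by rewrite !mulr_ge0 // invr_ge0 subr_ge0 ltW.
move=> f z Hf zr; have H0 := H2norm_ge0 rho f.
have rV1 : 1 < r^-1 by rewrite invf_gt1.
have zle : r <= normc z <= r^-1.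
  by case: zr => ->; rewrite lexx ?andbT /=; exact: ltW (lt_trans r1 rV1).
have /andP[z1 z2] := zle.
have zp : 0 < normc z by exact: lt_le_trans z1.
have za : annulus rho z.
  apply/andP; split; first exact: lt_le_trans z1.
  by apply: le_lt_trans z2 _; rewrite ltf_pV2 ?posrE.
have zVr : (normc z)^-1 <= r^-1 by rewrite lef_pV2 ?posrE.
have B0 : 0 <= 3 * H2norm rho f by rewrite mulr_ge0.
have := @laurent_rem _ rho f z (3 * H2norm rho f) (rho / r) 0 rho01 (H2_hol Hf) za B0 th01.
rewrite /laurent_sum !big_ord0 addr0 subr0 expr0 mulr1 => h.
have -> : 2 * (3 / (1 - rho / r)) * H2norm rho f =
  2 * (3 * H2norm rho f / (1 - rho / r)) by ring.
apply: h => k.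
  rewrite normcM -exprnP normcX expr_div_n.
  rewrite mulrA -[_ / _]/(_ * _) -exprVn; apply: ler_pM.
  - exact: normc_ge0.
  - by rewrite exprn_ge0 ?normc_ge0.
  - exact: H2_coef_pos.
  - by rewrite lerXn2r ?nnegrE ?normc_ge0 ?invr_ge0 ?(ltW r0).
rewrite normcM -exprnN normcV normcX -exprVn.
apply: (@le_trans _ _ (3 * H2norm rho f * (rho / r) ^+ k.+1)).
  rewrite expr_div_n mulrA -exprVn; apply: ler_pM.
  - exact: normc_ge0.
  - by rewrite exprn_ge0 ?invr_ge0 ?normc_ge0.
  - exact: H2_coef_neg.
  - by rewrite lerXn2r ?nnegrE ?invr_ge0 ?normc_ge0 ?(ltW r0).
rewrite ler_wpM2l // exprS ler_piMl ?exprn_ge0 ?(ltW th0) //; exact: ltW.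
Qed.

Lemma spair_H2_bound rho r : 0 < rho -> rho < r < 1 -> exists2 K : R, 0 <= K &
  forall b f g M, H2 rho f -> dhol g -> (forall z, normc z = r -> normc (g z) <= M) ->
    normc (spair b f g) <= K * H2norm rho f * M.
Proof.
move=> rho0 rr; have [K K0 hK] := H2_circle_bound rho0 rr.
exists (2 * (rho^-1 * K)); first by rewrite !mulr_ge0 // invr_ge0 ltW.
move=> b f g M Hf hg gM.
have fM z : normc z = r \/ normc z = r^-1 -> normc (f z) <= K * H2norm rho f by exact: hK.
apply: le_trans (spair_bound b rho0 rr (H2_hol Hf) fM hg gM) _.
by rewrite le_eqVlt; apply/orP; left; apply/eqP; ring.
Qed.

Lemma coef_spair_neg f (k : nat) : coef 1 (- k.+1%:Z) f = spair true f (fun z => z ^+ k).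
Proof.
rewrite coef_pair; apply: eq_cmean1 => z _; rewrite exprnP; congr (_ * (_ * _ ^ _)); lia.
Qed.

Lemma coef_spair_pos f (k : nat) : coef 1 k%:Z f = spair false f (fun z => z ^+ k.+1).
Proof.
rewrite coef_pair; apply: eq_cmean1 => z _; rewrite /flip exprVn exprnN; congr (_ * (_ * _ ^ _)); lia.
Qed.

(** Pairings with powers of [z] are the Laurent coefficients. As [th < rho], they decay fast enough
    for the series to converge uniformly on the annulus, and [H2norm_le] applies. *)
Lemma H2norm_spair_le rho th B f : 0 < rho < 1 -> 0 < th < rho -> H2 rho f -> 0 <= B ->
  (forall b k, normc (spair b f (fun z => z ^+ k)) <= B * th ^+ k) ->
  H2norm rho f <= 4 / (rho * (1 - th / rho)) * B.
Proof.
move=> rho01 /andP[th0 thr] Hf B0 fB; have /andP[r0 r1] := rho01.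
have q01 : 0 < th / rho < 1 by rewrite divr_gt0 //= ltr_pdivrMr // mul1r.
have /andP[q0 q1] := q01.
have BB0 : 0 <= B / rho by rewrite divr_ge0 // ltW.
have M0 : 0 <= 2 * (B / rho / (1 - th / rho)).
  by rewrite mulr_ge0 // divr_ge0 // subr_ge0 ltW.
apply: le_trans (H2norm_le rho01 Hf M0 _) _; last first.
  rewrite le_eqVlt; apply/orP; left; apply/eqP; field.
  by rewrite subr_eq0 gt_eqF // gt_eqF.
move=> z za; have /andP[z1 z2] := za.
have zp : 0 < normc z by exact: lt_trans z1.
have := @laurent_rem _ rho f z (B / rho) (th / rho) 0 rho01 (H2_hol Hf) za BB0 q01.
rewrite /laurent_sum !big_ord0 addr0 subr0 expr0 mulr1; apply => k.
  rewrite coef_spair_pos normcM -exprnP normcX.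
  apply: (@le_trans _ _ (B * th ^+ k.+1 * rho^-1 ^+ k)).
    apply: ler_pM; rewrite ?normc_ge0 ?exprn_ge0 ?normc_ge0 //.
    by rewrite lerXn2r ?nnegrE ?invr_ge0 ?normc_ge0 ?(ltW r0) // ltW.
  have -> : B * th ^+ k.+1 * rho^-1 ^+ k = B * (th ^+ k * rho^-1 ^+ k) * th.
    by rewrite exprS; ring.
  have -> : B / rho * (th / rho) ^+ k = B * (th ^+ k * rho^-1 ^+ k) * rho^-1.
    by rewrite expr_div_n exprVn; ring.
  apply: ler_wpM2l.
    by rewrite !mulr_ge0 ?exprn_ge0 ?invr_ge0 ?(ltW th0) ?(ltW r0).
  by apply: (le_trans (ltW thr)); rewrite (le_trans (ltW r1)) // invf_ge1 // ltW.
rewrite coef_spair_neg normcM -exprnN normcV normcX -exprVn.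
apply: (@le_trans _ _ (B * th ^+ k * rho^-1 ^+ k.+1)).
  apply: ler_pM; rewrite ?normc_ge0 ?exprn_ge0 ?invr_ge0 ?normc_ge0 //.
  rewrite lerXn2r ?nnegrE ?invr_ge0 ?normc_ge0 ?(ltW r0) // lef_pV2 ?posrE // ltW //.
by rewrite le_eqVlt; apply/orP; left; apply/eqP; rewrite exprS expr_div_n exprVn; ring.
Qed.

(** [G] is expanded at 0 and evaluated at [p], which maps the test circle into the disc of radius
    [e < d]; the remainder is thus uniformly small on the only circle that the pairing sees. *)
Lemma spair_taylor b rho r f G p d M e K j : 0 < rho < 1 -> hol rho f ->
  (forall g M', dhol g -> (forall z, normc z = r -> normc (g z) <= M') ->
     normc (spair b f g) <= K * M') ->
  dhol G -> dmap p -> 0 < d <= 1 -> (forall z, normc z <= d -> normc (G z) <= M) ->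
  0 <= e -> e < d -> (forall z, normc z = r -> normc (p z) <= e) ->
  normc (spair b f (fun z => G (p z)) -
         \sum_(m < j) tcoef G m * spair b f (fun z => p z ^+ m)) <=
    K * (4 * M * (e / d) ^+ j / (1 - e / d)).
Proof.
move=> rho01 hf hK hG hp d01 GM e0 ed pe; have /andP[d0 d1] := d01.
have M0 : 0 <= M by apply: le_trans (GM 0 _); rewrite ?normc_ge0 // normc0 ltW.
have hX m : dhol (fun z => p z ^+ m) by exact: (dholX m (dmap_dhol hp)).
have hS : dhol (fun z => \sum_(m < j) tcoef G m * p z ^+ m).
  elim: j => [|k IH]; first by under [X in dhol X]funext do rewrite big_ord0; exact: dhol_cst.
  under [X in dhol X]funext do rewrite big_ord_recr /=.
  exact: (dholD IH (dholM (dhol_cst (tcoef G k)) (hX k))).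
have hGp := dhol_comp hG hp.
rewrite -(spair_sum b j (tcoef G) rho01 hf hX) //.
have -> : spair b f (fun z => G (p z)) -
    spair b f (fun z => \sum_(m < j) tcoef G m * p z ^+ m) =
    spair b f (fun z => G (p z) + (-1) * \sum_(m < j) tcoef G m * p z ^+ m).
  by rewrite (spair_lin b _ rho01 hf hGp hS) mulN1r.
apply: hK; first exact: (dholD hGp (dholM (dhol_cst (-1)) hS)).
move=> z zr; rewrite mulN1r; have pz := pe z zr.
apply: le_trans (taylor j hG d01 GM (le_lt_trans pz ed)) _.
have ed1 : e / d < 1 by rewrite ltr_pdivrMr // mul1r.
have q1 : normc (p z) / d <= e / d by rewrite ler_pM2r // invr_gt0.
have q0 : 0 <= normc (p z) / d by rewrite divr_ge0 ?normc_ge0 // ltW.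
apply: ler_pM.
- by rewrite !mulr_ge0 // exprn_ge0.
- by rewrite invr_ge0 subr_ge0 (le_trans q1) // ltW.
- by rewrite ler_wpM2l ?mulr_ge0 // lerXn2r ?nnegrE // (le_trans q0).
- by rewrite lef_pV2 ?posrE ?subr_gt0 ?(le_lt_trans q1) // lerD2l lerN2.
Qed.

End SignedPairing.

(** * Moving coordinates along an orbit *)

Section Orbit.
Context {R : realType}.
Local Notation C := R[i].
Implicit Types (f g h F G p q : C -> C) (z w u v : C) (a b r s t d M rho : R).

Lemma mrad_mono a b r : 0 <= a -> a <= b -> 0 <= r <= 1 -> mrad a r <= mrad b r.
Proof.
move=> a0 ab /andP[r0 r1]; have b0 := le_trans a0 ab.
rewrite /mrad ler_pdivrMr ?ltr_wpDr ?mulr_ge0 // mulrAC ler_pdivlMr ?ltr_wpDr ?mulr_ge0 //.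
rewrite -subr_ge0; have -> : (r + b) * (1 + a * r) - (r + a) * (1 + b * r) =
  (b - a) * (1 - r ^+ 2) by ring.
by rewrite mulr_ge0 ?subr_ge0 // expr_le1.
Qed.

Lemma mrad_leD a r : 0 <= a -> 0 <= r -> mrad a r <= a + r.
Proof.
move=> a0 r0; rewrite /mrad ler_pdivrMr ?ltr_wpDr ?mulr_ge0 // addrC ler_peMr ?addr_ge0 //.
by rewrite lerDl mulr_ge0.
Qed.

Lemma mob_neg_le a r z : 0 <= a < 1 -> 0 <= r < 1 -> normc z <= r ->
  normc (mob (- a) z) <= mrad a r.
Proof. by move=> a01 r01 zr; rewrite mobN normcNN; apply: mob_le; rewrite // normcNN. Qed.

Definition bmap b v : C := v * mob b v.

(** The derivative at 0 of the squaring map after Moebius changes of coordinate moving X and its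
    image $X^2$ to 0: $2X(1-X^2)/(1-X^4)$. *)
Definition bmult (e : bool) (y : R) : R :=
  let X := mrad (blaschke_shift e) y in 2 * X / (1 + X ^+ 2).

(** Since $1 - b = (1-X)^2/(1+X^2) \ge (1-X)^2/2$ and $X \le (1+X^2)/2 \le (1+t)/2$, the gap is at
    least $(1-t)^2/8$. *)
Lemma bmult_bound e y t : 0 <= y < 1 -> t < 1 ->
  mrad (blaschke_shift e) y ^+ 2 <= t -> 0 <= bmult e y <= 1 - (1 - t) ^+ 2 / 8.
Proof.
move=> /andP[y0 y1] t1; rewrite /bmult; have a01 := @blaschke_shift01 R e.
have y01 : 0 <= y < 1 by rewrite y0.
have X1 := mrad_lt1 a01 y01.
have X0 : 0 <= mrad (blaschke_shift e) y.
  by case/andP: a01 => a0 _; rewrite divr_ge0 ?addr_ge0 ?mulr_ge0.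
move: (mrad _ _) X0 X1 => X X0 X1 Xt.
have p0 : 0 < 1 + X ^+ 2 by rewrite ltr_wpDr ?sqr_ge0.
rewrite divr_ge0 ?mulr_ge0 ?(ltW p0) //= ler_pdivrMr //.
have Xh : X <= (1 + t) / 2 by nra.
have h1 : (1 - t) / 2 <= 1 - X by lra.
have h2 : ((1 - t) / 2) ^+ 2 <= (1 - X) ^+ 2.
  by rewrite lerXn2r ?nnegrE ?subr_ge0 ?(ltW X1) // divr_ge0 // subr_ge0 ltW.
have h3 : (1 + X ^+ 2) * ((1 - t) ^+ 2 / 8) <= 2 * ((1 - t) ^+ 2 / 8).
  rewrite ler_wpM2r // ?divr_ge0 ?sqr_ge0 //.
  have : X ^+ 2 <= 1 by rewrite expr_le1 // ltW.
  lra.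
nra.
Qed.

Lemma bmap_conj_aux (w X : C) : 1 - X * w != 0 -> 1 + X * w != 0 -> 1 + X ^+ 2 != 0 ->
  1 - X ^+ 2 != 0 -> (w ^+ 2 - X ^+ 2) / (1 - X ^+ 2 * w ^+ 2) =
  ((w - X) / (1 - X * w)) * (((w - X) / (1 - X * w) + 2 * X / (1 + X ^+ 2)) /
    (1 + 2 * X / (1 + X ^+ 2) * ((w - X) / (1 - X * w)))).
Proof.
move=> h1 h2 h3 h4.
have -> : 1 + 2 * X / (1 + X ^+ 2) * ((w - X) / (1 - X * w)) =
  (1 - X ^+ 2) * (1 + X * w) / ((1 + X ^+ 2) * (1 - X * w)) by field; rewrite h1 h3.
have -> : 1 - X ^+ 2 * w ^+ 2 = (1 - X * w) * (1 + X * w) by ring.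
by field; rewrite h1 h2 h3 h4.
Qed.

Lemma mob_comp_aux (z A Y : C) : 1 + A * z != 0 -> 1 - Y * z != 0 -> 1 + A * Y != 0 ->
  1 - A ^+ 2 != 0 ->
  let X := (Y + A) / (1 + A * Y) in
  let w := (z + A) / (1 + A * z) in
  1 - X * w != 0 -> (w - X) / (1 - X * w) = (z - Y) / (1 - Y * z).
Proof.
move=> h1 h2 h3 h4 X w; rewrite /X /w.
have -> : 1 - (Y + A) / (1 + A * Y) * ((z + A) / (1 + A * z)) =
  (1 - A ^+ 2) * (1 - Y * z) / ((1 + A * Y) * (1 + A * z)) by field; rewrite h1 h3.
by move=> _; field; rewrite h1 h2 h3 h4.
Qed.

Lemma realC_neq0 (y : R) : y != 0 -> y%:C != 0 :> C.
Proof. by move=> y0; rewrite -normc_gt0 normc_real normr_gt0. Qed.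

(* In the coordinates vanishing at the moving points [y] and its image, the
   Blaschke product becomes the Blaschke product [bmap] fixing 0. *)
Lemma bmap_conj e y z : 0 <= y < 1 -> normc z <= 1 ->
  mob (- (mrad (blaschke_shift e) y ^+ 2)) (tee (blaschke_shift e) z) =
  bmap (bmult e y) (mob (- y) z).
Proof.
move=> y01 z1; have a01 := @blaschke_shift01 R e; rewrite /bmult /=; move: (blaschke_shift e) a01 => a a01.
have /andP[a0 a1] := a01; have /andP[y0 y1] := y01.
have na : `|a| < 1 by rewrite ger0_norm.
rewrite /bmap.
have X0 : 0 <= mrad a y by rewrite divr_ge0 ?addr_ge0 ?mulr_ge0.
have X1 := mrad_lt1 a01 y01.
have XE : (mrad a y)%:C = (y%:C + a%:C) / (1 + a%:C * y%:C) :> C.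
  by rewrite /mrad rmorphM fmorphV !rmorphD rmorph1 rmorphM.
have w1 := mob_le1 na z1.
have nX : `|mrad a y| < 1 by rewrite ger0_norm.
have nNX : `|- mrad a y| < 1 by rewrite normrN.
have nNy : `|- y| < 1 by rewrite normrN ger0_norm.
have d1 : 1 - (mrad a y)%:C * mob a z != 0.
  by have := mob_den nNX w1; rewrite rmorphN mulNr.
have d2 := mob_den nX w1.
have d3 : 1 + (mrad a y)%:C ^+ 2 != 0 :> C.
  rewrite -rmorphXn -(rmorph1 (real_complex R)) -rmorphD realC_neq0 //.
  by rewrite gt_eqF // ltr_wpDr ?sqr_ge0.
have d4 := mob_denr nX.
have e1 : mob (- y) z = (mob a z - (mrad a y)%:C) / (1 - (mrad a y)%:C * mob a z).
  have dy : 1 - y%:C * z != 0 by have := mob_den nNy z1; rewrite rmorphN mulNr.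
  have day : 1 + a%:C * y%:C != 0 :> C.
    by have := @mob_den _ a y%:C na; apply; rewrite normc_realp // ltW.
  have := @mob_comp_aux z a%:C y%:C (mob_den na z1) dy day (mob_denr na).
  rewrite -XE => /(_ d1) ->.
  by rewrite /mob rmorphN mulNr.
have be : (2 * mrad a y / (1 + mrad a y ^+ 2))%:C =
    2 * (mrad a y)%:C / (1 + (mrad a y)%:C ^+ 2) :> C.
  by rewrite rmorphM fmorphV rmorphD rmorph1 rmorphXn rmorphM rmorph_nat.
rewrite e1 [X in _ = _ * X]/mob be -(bmap_conj_aux d1 d2 d3 d4).
by rewrite /mob /tee rmorphN rmorphXn /mob mulNr.
Qed.

Lemma dmap_bmap b : `|b| < 1 -> dmap (bmap b).
Proof. by move=> b1; exact: (dmapM dmap_id (dmap_mob b1)). Qed.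

Fixpoint beta (b : nat -> R) n v : C :=
  if n is n'.+1 then bmap (b n') (beta b n' v) else v.

Lemma betaS (b : nat -> R) n v : beta b n.+1 v = beta (fun k => b k.+1) n (bmap (b 0) v).
Proof. by elim: n v => [|n IH] v //=; rewrite -IH. Qed.

Lemma dmap_beta (b : nat -> R) n : (forall k, `|b k| < 1) -> dmap (beta b n).
Proof.
move=> b1; elim: n => [|n IH]; first exact: dmap_id.
exact: (dmap_comp (dmap_bmap (b1 n)) IH).
Qed.

(** The deterministic data read off from one typical point of the shift. The margin [t < rho] keeps
    the moving points uniformly away from the boundary of the annulus. *)
Record bl_orbit rho t (c : nat -> bool) (x : nat -> R) : Prop := Orbit {
  orbit_rho : 0 < rho < 1;
  orbit_t : 0 < t < rho;
  orbit_good : forall n, mrad (blaschke_shift (c n)) rho ^+ 2 < rho;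
  orbit_x : forall n, 0 <= x n <= t;
  orbitS : forall n, x n.+1 = mrad (blaschke_shift (c n)) (x n) ^+ 2
}.

Definition mults (c : nat -> bool) (x : nat -> R) n : R := bmult (c n) (x n).

(** Test functions are estimated on this circle between [rho] and 1. In the moving coordinate it
    lies in the disc of radius [kap], on which [mob b] is bounded by [qap < 1] for every multiplier
    [b] of the orbit. *)
Definition circ rho : R := (1 + rho) / 2.
Definition kap rho t : R := mrad t (circ rho).
Definition qap rho t : R := mrad (1 - (1 - t) ^+ 2 / 8) (kap rho t).
(* bounds [beta b n] on the image in the moving coordinate of the circle of radius
   [circ rho] (lemma beta_le_eps) *)
Definition eps rho t (b : nat -> R) n : R :=
  kap rho t * \prod_(i < n) Num.min (qap rho t) (b i + qap rho t ^+ i).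

Fixpoint Lit rho (c : nat -> bool) n f : C -> C :=
  if n is n'.+1 then PF rho (blaschke (c n')) (Lit rho c n' f) else f.

(* By duality this is the pairing of [Lit rho c n f] with the power of order [i] of
   the coordinate vanishing at [x n] (lemma Lit_spair). *)
Definition tau c x (sg : bool) i n f : C :=
  spair sg f (fun z => beta (mults c x) n (mob (- x 0) z) ^+ i).

Lemma expand_le (a k A h e : R) : 0 <= a -> 0 <= k -> 0 <= A -> 0 <= h -> 0 <= e ->
  a * A + 8 * (k * h) * e <= (a + 8 * k) * (A + h * e).
Proof.
move=> a0 k0 A0 h0 e0; rewrite -subr_ge0.
have -> : (a + 8 * k) * (A + h * e) - (a * A + 8 * (k * h) * e) =
  a * (h * e) + 8 * (k * A) by ring.
by rewrite addr_ge0 // !mulr_ge0.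
Qed.

Section OneOrbit.
Variables (rho t : R) (c : nat -> bool) (x : nat -> R).
Hypothesis O : bl_orbit rho t c x.

Let rho01 : 0 < rho < 1 := orbit_rho O.
Let rho0 : 0 < rho. Proof. by case/andP: rho01. Qed.
Let rho1 : rho < 1. Proof. by case/andP: rho01. Qed.
Let t0 : 0 < t. Proof. by case/andP: (orbit_t O). Qed.
Let trho : t < rho. Proof. by case/andP: (orbit_t O). Qed.
Let t1 : t < 1. Proof. exact: lt_trans trho rho1. Qed.

Lemma orbit_shift : bl_orbit rho t (fun n => c n.+1) (fun n => x n.+1).
Proof. by case: O => h1 h2 h3 h4 h5; split. Qed.

Lemma circ_in : rho < circ rho < 1.
Proof. by rewrite /circ; have := rho1; lra. Qed.

Let r01 : 0 <= circ rho < 1.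
Proof. by case/andP: circ_in => h1 h2; rewrite (ltW (lt_trans rho0 h1)). Qed.

Lemma x01 n : 0 <= x n < 1.
Proof. by case/andP: (orbit_x O n) => -> h /=; exact: le_lt_trans h t1. Qed.

Lemma mults_bound n : 0 <= mults c x n <= 1 - (1 - t) ^+ 2 / 8.
Proof.
apply: bmult_bound (x01 n) t1 _; rewrite -(orbitS O).
by case/andP: (orbit_x O n.+1).
Qed.

Let bm01 : 0 <= 1 - (1 - t) ^+ 2 / 8 < 1.
Proof.
have h : 0 < (1 - t) ^+ 2 by rewrite exprn_gt0 // subr_gt0.
have : (1 - t) ^+ 2 <= 1 by rewrite expr_le1 ?subr_ge0 ?(ltW t1) // gerBl ltW.
lra.
Qed.

Lemma mults01 n : 0 <= mults c x n < 1.
Proof.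
case/andP: (mults_bound n) => -> h /=; apply: le_lt_trans h _.
by case/andP: bm01.
Qed.

Lemma mults_norm n : `|mults c x n| < 1.
Proof. by case/andP: (mults01 n) => h1 h2; rewrite ger0_norm. Qed.

Let kap01 : 0 <= kap rho t < 1.
Proof.
have /andP[h1 _] := r01; have t01 : 0 <= t < 1 by rewrite (ltW t0) t1.
apply/andP; split; last exact: mrad_lt1 t01 r01.
exact: le_trans (ltW t0) (mrad_ge t01 h1).
Qed.

Lemma qap01 : 0 < qap rho t < 1.
Proof.
have /andP[k0 _] := kap01; have /andP[b0 _] := bm01.
apply/andP; split; last exact: mrad_lt1 bm01 kap01.
apply: lt_le_trans (mrad_ge_r bm01 kap01); apply: lt_le_trans t0 _.
have t01 : 0 <= t < 1 by rewrite (ltW t0) t1.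
by have /andP[h _] := r01; exact: mrad_ge t01 h.
Qed.

Lemma min_qap_ge0 n : 0 <= Num.min (qap rho t) (mults c x n + qap rho t ^+ n).
Proof.
have /andP[q0 _] := qap01; have /andP[b0 _] := mults01 n.
by rewrite le_min (ltW q0) addr_ge0 // exprn_ge0 // ltW.
Qed.

Lemma eps_ge0 n : 0 <= eps rho t (mults c x) n.
Proof.
have /andP[k0 _] := kap01; rewrite mulr_ge0 //.
by apply: prodr_ge0 => i _; exact: min_qap_ge0.
Qed.

Lemma epsS n : eps rho t (mults c x) n.+1 = eps rho t (mults c x) n *
  Num.min (qap rho t) (mults c x n + qap rho t ^+ n).
Proof. by rewrite /eps big_ord_recr /= mulrA. Qed.

Lemma eps_le_qap n : eps rho t (mults c x) n <= qap rho t ^+ n.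
Proof.
have /andP[q0 q1] := qap01; have /andP[k0 k1] := kap01.
elim: n => [|n IH]; first by rewrite /eps big_ord0 mulr1 expr0 ltW.
rewrite epsS exprSr; apply: ler_pM => //; rewrite ?eps_ge0 ?min_qap_ge0 //.
by rewrite ge_min lexx.
Qed.

Lemma eps_le_kap n : eps rho t (mults c x) n <= kap rho t.
Proof.
have /andP[q0 q1] := qap01; have /andP[k0 k1] := kap01.
elim: n => [|n IH]; first by rewrite /eps big_ord0 mulr1.
rewrite epsS; apply: le_trans IH; apply: ler_piMr; first exact: eps_ge0.
by rewrite ge_min (ltW q1).
Qed.

Lemma beta_le_eps n z : normc z = circ rho ->
  normc (beta (mults c x) n (mob (- x 0) z)) <= eps rho t (mults c x) n.
Proof.
move=> zr; have /andP[k0 k1] := kap01; have /andP[q0 q1] := qap01.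
elim: n => [|n IH].
  rewrite /eps big_ord0 mulr1 /=; apply: (@le_trans _ _ (mrad (x 0) (circ rho))).
    by apply: mob_neg_le => //; [exact: x01|rewrite zr].
  have /andP[h1 h2] := orbit_x O 0; apply: mrad_mono => //.
  by case/andP: r01 => -> /ltW.
rewrite /= /bmap epsS normcM; apply: ler_pM; rewrite ?normc_ge0 //.
have /andP[b0 b1] := mults_bound n; have ek := eps_le_kap n; have e0 := eps_ge0 n.
(* The new factor [mob b v] has two bounds: [qap], since [v] stays in the disc of radius [kap], and
   [b] plus the modulus of [v], which is already at most [qap ^+ n]. As these corrections are
   summable, the second bound lets [eps] follow the product of the multipliers. *)
rewrite le_min; apply/andP; split.
  apply: (@le_trans _ _ (mrad (mults c x n) (kap rho t))).
    exact: mob_le (mults01 n) kap01 (le_trans IH ek).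
  by apply: mrad_mono => //; rewrite k0 ltW.
apply: (@le_trans _ _ (mrad (mults c x n) (eps rho t (mults c x) n))).
  by apply: mob_le (mults01 n) _ IH; rewrite e0 (le_lt_trans ek).
by apply: le_trans (mrad_leD b0 e0) _; rewrite lerD2l eps_le_qap.
Qed.

Lemma Lit_H2 n f : H2 rho f -> H2 rho (Lit rho c n f).
Proof.
move=> Hf; elim: n => //= n IH.
by have [-> ?] := PF_blaschke rho01 (orbit_good O n) IH.
Qed.

Lemma spair_PF sg n f g : H2 rho f -> dhol g ->
  spair sg (PF rho (blaschke (c n)) f) g =
  spair sg f (fun z => g (tee (blaschke_shift (c n)) z)).
Proof.
move=> Hf hg; have [-> _] := PF_blaschke rho01 (orbit_good O n) Hf.
have a01 := @blaschke_shift01 R (c n); move: (blaschke_shift _) a01 => a a01.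
have a1 : `|a| < 1 by case/andP: a01 => ? ?; rewrite ger0_norm.
rewrite (@eq_spair_l _ _ _ (PFop a f)); last first.
  by move=> z z1; rewrite aextE //; have := unit_annulus rho01; rewrite -z1.
have hgt := dhol_comp hg (dmap_tee a1).
have [s s01 hs] := hol_flip sg hgt.
have m01 := max01 s01 rho01.
have flipE z : z != 0 -> flip sg (tee a z) = tee a (flip sg z).
  by case: sg {hs} => //= z0; rewrite /tee mobV // exprVn.
have hs' : hol s (fun z => g (flip sg (tee a z))).
  move=> z za; have [D hD] := hs z za; exists D; apply: (cderiv_eq_near hD).
  apply: (@filterS _ _ (nbhs_filter z)) (annulus_near za) => w wa.
  by rewrite flipE //; apply: annulus_neq0 wa; case/andP: s01.
have hf' : hol (Num.max s rho) f.
  by apply: hol_sub (H2_hol Hf); rewrite rho0 le_max lexx orbT.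
rewrite /spair (pair_PFop (s := Num.max s rho) a01 m01 hf'); last first.
  by apply: hol_sub hs'; case/andP: s01 => -> _; rewrite le_max lexx.
by apply: eq_cmean1 => z z1; rewrite flipE // normc1_neq0.
Qed.

Lemma spair_PF_mob sg n f G : H2 rho f -> dhol G ->
  spair sg (PF rho (blaschke (c n)) f) (fun z => G (mob (- x n.+1) z)) =
  spair sg f (fun z => G (bmap (mults c x n) (mob (- x n) z))).
Proof.
move=> Hf hG; have nx : `|- x n.+1| < 1 by rewrite normrN; case/andP: (x01 n.+1) => ? ?; rewrite ger0_norm.
rewrite (spair_PF sg n Hf (dhol_comp hG (dmap_mob nx))); apply: eq_spair => z z1.
by rewrite (orbitS O) bmap_conj ?z1 //; exact: x01.
Qed.

Lemma Lit_spair sg n f G : H2 rho f -> dhol G ->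
  spair sg (Lit rho c n f) (fun z => G (mob (- x n) z)) =
  spair sg f (fun z => G (beta (mults c x) n (mob (- x 0) z))).
Proof.
move=> Hf; elim: n G => [|n IH] G hG //=.
rewrite (spair_PF_mob sg n (Lit_H2 n Hf) hG).
exact: (IH _ (dhol_comp hG (dmap_bmap (mults_norm n)))).
Qed.

Lemma norm_x0 : `|- x 0| < 1.
Proof. by rewrite normrN; case/andP: (x01 0) => ? ?; rewrite ger0_norm. Qed.

Lemma dmap_orbit n : dmap (fun z => beta (mults c x) n (mob (- x 0) z)).
Proof. exact: (dmap_comp (dmap_beta n mults_norm) (dmap_mob norm_x0)). Qed.

Lemma tau_shift sg i n f : H2 rho f ->
  tau (fun k => c k.+1) (fun k => x k.+1) sg i n (PF rho (blaschke (c 0)) f) =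
  tau c x sg i n.+1 f.
Proof.
move=> Hf; rewrite /tau.
have hG : dhol (fun v => beta (mults (fun k => c k.+1) (fun k => x k.+1)) n v ^+ i).
  by apply: dholX; apply: dmap_dhol; apply: dmap_beta => k; exact: (mults_norm k.+1).
rewrite (spair_PF_mob sg 0 Hf hG); apply: eq_spair => z _.
by rewrite betaS.
Qed.

(* Expanding the monomials [z ^ k] to order [j] in the moving coordinate. *)
Lemma iter_norm_bound : exists n0 : nat, forall j, exists2 K : R, 0 <= K &
  forall n f A, (n0 <= n)%N -> H2 rho f -> 0 <= A ->
    (forall sg m, (m <= j)%N -> normc (tau c x sg m n f) <= A) ->
    H2norm rho (Lit rho c n f) <= K * (A + H2norm rho f * eps rho t (mults c x) n ^+ j.+1).
Proof.
(* A radius for which the disc of radius [d] in the moving coordinate lies in the disc of radius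
   [th <= t + d < rho] around 0; this makes the pairings with $z^k$ decay like $th^k$. *)
pose d := (rho - t) / 2.
have d0 : 0 < d by rewrite divr_gt0 // subr_gt0.
have d1 : d <= 1 by rewrite /d; have := rho1; have := t0; lra.
pose th := mrad t d.
have th0 : 0 < th by exact: mrad_gt0 (ltW t0) d0.
have thr : th < rho.
  by apply: le_lt_trans (mrad_leD (ltW t0) (ltW d0)) _; rewrite /d; have := trho; lra.
have dlt1 : d < 1 by rewrite /d; have := rho1; have := t0; lra.
have thE a v : 0 <= a <= t -> normc v <= d -> normc (mob a v) <= th.
  move=> /andP[a0 at_] vd; apply: (@le_trans _ _ (mrad a d)).
    by apply: mob_le => //; rewrite ?a0 ?(ltW d0) //= (le_lt_trans at_ t1).
  by apply: mrad_mono; rewrite // (ltW d0).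
clearbody th d.
have /andP[q0 q1] := qap01.
have q01 : 0 <= qap rho t < 1 by rewrite (ltW q0).
have d20 : 0 < d / 2 by rewrite divr_gt0.
(* From [n0] on, [eps] is at most [d / 2], so that the geometric denominator [1 - eps / d] is at
   least 1/2, for every [j]. *)
have [n0 hn0] := geometric_small 1 q01 d20.
have [Kr Kr0 hKr] := spair_H2_bound rho0 circ_in.
exists n0 => j.
pose K1 := 4 / (rho * (1 - th / rho)).
have K10 : 0 <= K1.
  by rewrite divr_ge0 // mulr_ge0 ?(ltW rho0) // subr_ge0 ler_pdivrMr // mul1r ltW.
have D0 : 0 <= d^-1 ^+ j.+1 by rewrite exprn_ge0 // invr_ge0 ltW.
have dV1 : 1 <= d^-1 by rewrite invf_ge1.
exists (K1 * (d^-1 ^+ j.+1 * (2 * j.+1%:R + 8 * Kr))).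
  apply: mulr_ge0 => //; apply: mulr_ge0 => //; apply: addr_ge0; exact: mulr_ge0.
move=> n f A n0n Hf A0 hA.
set en := eps rho t (mults c x) n.
have en0 : 0 <= en by exact: eps_ge0.
have end2 : en <= d / 2.
  by apply: ltW; apply: le_lt_trans (eps_le_qap n) _; have := hn0 n n0n; rewrite mul1r.
have H0 := H2norm_ge0 rho f.
pose B := d^-1 ^+ j.+1 * (2 * j.+1%:R * A + 8 * (Kr * H2norm rho f) * en ^+ j.+1).
have B0 : 0 <= B by rewrite mulr_ge0 // addr_ge0 // !mulr_ge0 // exprn_ge0.
have th0r : 0 < th < rho by rewrite th0.
apply: le_trans (H2norm_spair_le rho01 th0r (Lit_H2 n Hf) B0 _) _; last first.
  rewrite -/K1 -[leRHS]mulrA; apply: ler_wpM2l => //.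
  rewrite /B -[leRHS]mulrA; apply: ler_wpM2l => //.
  by apply: expand_le; rewrite ?exprn_ge0 // mulr_ge0.
move=> sg k.
have nx := x01 n; have /andP[xn0 xnt] := orbit_x O n.
have nxn : `|x n| < 1 by case/andP: nx => ? ?; rewrite ger0_norm.
pose G v := mob (x n) v ^+ k.
have hG : dhol G by exact: (dholX k (dmap_dhol (dmap_mob nxn))).
have -> : spair sg (Lit rho c n f) (fun z => z ^+ k) =
    spair sg f (fun z => G (beta (mults c x) n (mob (- x 0) z))).
  rewrite -(Lit_spair sg n Hf hG); apply: eq_spair => z z1; rewrite /G.
  congr (_ ^+ _); have := @mobK _ (- x n) z; rewrite /nob opprK normrN => -> //.
  by rewrite mob_den ?normrN ?z1.
have GM v : normc v <= d -> normc (G v) <= th ^+ k.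
  by move=> vd; rewrite /G normcX lerXn2r ?nnegrE ?normc_ge0 ?(ltW th0) // thE // xn0.
have d01 : 0 < d <= 1 by rewrite d0.
have ed : en < d by apply: le_lt_trans end2 _; lra.
have hK g M' : dhol g -> (forall z, normc z = circ rho -> normc (g z) <= M') ->
    normc (spair sg f g) <= Kr * H2norm rho f * M' by move=> hg; exact: hKr.
have := spair_taylor j.+1 rho01 (H2_hol Hf) hK hG (dmap_orbit n) d01 GM en0 ed (beta_le_eps n).
set S := \sum_(m < j.+1) _; move: (spair _ _ _) => y hy.
have hS : normc S <= th ^+ k * (d^-1 ^+ j.+1 * (2 * j.+1%:R * A)).
  apply: le_trans (normc_sum _ _ _) _.
  have -> : th ^+ k * (d^-1 ^+ j.+1 * (2 * j.+1%:R * A)) =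
      \sum_(m < j.+1) th ^+ k * (d^-1 ^+ j.+1 * (2 * A)).
    by rewrite sumr_const card_ord -mulr_natr; ring.
  apply: ler_sum => m _; rewrite normcM.
  apply: (@le_trans _ _ (2 * th ^+ k / d ^+ m * A)).
    have mj : (m <= j)%N by rewrite -ltnS.
    apply: ler_pM; [exact: normc_ge0|exact: normc_ge0| |exact: hA mj].
    exact: (tcoef_bound m hG d01 GM).
  have : d^-1 ^+ m <= d^-1 ^+ j.+1 by rewrite ler_weXn2l // ltnW.
  rewrite -exprVn => dm.
  have -> : 2 * th ^+ k * d^-1 ^+ m * A = th ^+ k * (d^-1 ^+ m * (2 * A)) by ring.
  by rewrite ler_wpM2l ?exprn_ge0 ?(ltW th0) // ler_wpM2r // mulr_ge0.
have hT : Kr * H2norm rho f * (4 * th ^+ k * (en / d) ^+ j.+1 / (1 - en / d)) <=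
    th ^+ k * (d^-1 ^+ j.+1 * (8 * (Kr * H2norm rho f) * en ^+ j.+1)).
  have inv2 : (1 - en / d)^-1 <= 2.
    have : en / d <= 2^-1 by rewrite ler_pdivrMr // mulrC.
    move=> h; rewrite -[leRHS]invrK lef_pV2 ?posrE ?invr_gt0 //; first lra.
    by rewrite subr_gt0; lra.
  rewrite expr_div_n -exprVn.
  have -> : Kr * H2norm rho f * (4 * th ^+ k * (en ^+ j.+1 * d^-1 ^+ j.+1) / (1 - en / d)) =
    (Kr * H2norm rho f * (4 * th ^+ k * (en ^+ j.+1 * d^-1 ^+ j.+1))) * (1 - en / d)^-1 by ring.
  have -> : th ^+ k * (d^-1 ^+ j.+1 * (8 * (Kr * H2norm rho f) * en ^+ j.+1)) =
    (Kr * H2norm rho f * (4 * th ^+ k * (en ^+ j.+1 * d^-1 ^+ j.+1))) * 2 by ring.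
  by rewrite ler_wpM2l // !mulr_ge0 // ?exprn_ge0 // ltW.
have -> : y = S + (y - S) by ring.
apply: le_trans (normcD _ _) _; apply: le_trans (lerD hS (le_trans hy hT)) _.
by rewrite /B le_eqVlt; apply/orP; left; apply/eqP; ring.
Qed.

(* Expanding the powers of [bmap] to order [j]. *)
Lemma tau_step : exists n0 : nat, forall j, exists2 K : R, 0 <= K &
  forall n f i sg A, (n0 <= n)%N -> (i <= j)%N -> H2 rho f -> 0 <= A ->
    (forall m, (i < m <= j)%N -> normc (tau c x sg m n f) <= A) ->
    normc (tau c x sg i n.+1 f - (mults c x n)%:C ^+ i * tau c x sg i n f) <=
      K * (A + H2norm rho f * eps rho t (mults c x) n ^+ j.+1).
Proof.
have /andP[q0 q1] := qap01.
have q01 : 0 <= qap rho t < 1 by rewrite (ltW q0).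
have d20 : 0 < 4^-1 :> R by rewrite invr_gt0.
have [n0 hn0] := geometric_small 1 q01 d20.
have [Kr Kr0 hKr] := spair_H2_bound rho0 circ_in.
exists n0 => j; exists (2 ^+ j.+1 * (2 * j.+1%:R + 8 * Kr)).
  apply: mulr_ge0; [exact: exprn_ge0|apply: addr_ge0; exact: mulr_ge0].
move=> n f i sg A n0n ij Hf A0 hA.
set en := eps rho t (mults c x) n.
have en0 : 0 <= en by exact: eps_ge0.
have en4 : en <= 4^-1.
  by apply: ltW; apply: le_lt_trans (eps_le_qap n) _; have := hn0 n n0n; rewrite mul1r.
have H0 := H2norm_ge0 rho f.
have bn := mults_norm n; have /andP[bn0 bn1] := mults01 n.
pose H v := mob (mults c x n) v ^+ i.
have hH : dhol H by exact: (dholX i (dmap_dhol (dmap_mob bn))).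
pose G v := v ^+ i * H v.
have hG : dhol G by exact: (dholM (dholX i (dmap_dhol dmap_id)) hH).
(* Taylor radius 1/2 with bound 1: the coefficients cost at most [2 ^+ j.+1] up to a constant, and
   [eps <= 1/4] leaves a ratio of at most 1/2 in the remainder. *)
have GM v : normc v <= 2^-1 -> normc (G v) <= 1.
  move=> v2; have v1 : normc v <= 1 by apply: le_trans v2 _; lra.
  rewrite normcM !normcX mulr_ile1 ?exprn_ge0 ?normc_ge0 //.
    by rewrite exprn_ile1 ?normc_ge0.
  by rewrite exprn_ile1 ?normc_ge0 // mob_le1.
have d01 : 0 < (2^-1 : R) <= 1 by lra.
have ed : en < 2^-1 by apply: le_lt_trans en4 _; lra.
have hK g M' : dhol g -> (forall z, normc z = circ rho -> normc (g z) <= M') ->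
    normc (spair sg f g) <= Kr * H2norm rho f * M' by move=> hg; exact: hKr.
have := spair_taylor j.+1 rho01 (H2_hol Hf) hK hG (dmap_orbit n) d01 GM en0 ed (beta_le_eps n).
have -> : spair sg f (fun z => G (beta (mults c x) n (mob (- x 0) z))) = tau c x sg i n.+1 f.
  have GE v : G v = bmap (mults c x n) v ^+ i by rewrite /G /H -exprMn.
  by apply: eq_spair => z _; rewrite GE.
set S := \sum_(m < j.+1) _; move: (tau c x sg i n.+1 f) => y hy.
pose S' := \sum_(m < j.+1 | m != i :> nat) tcoef G m * tau c x sg m n f.
have SE : S = (mults c x n)%:C ^+ i * tau c x sg i n f + S'.
  have ij' : (i < j.+1)%N by rewrite ltnS.
  rewrite /S (bigD1 (Ordinal ij')) //=; congr (_ + _).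
  rewrite (tcoefM_lead i hH); congr (_ * _); rewrite /H /mob.
  by rewrite add0r mulr0 addr0 divr1.
have hS : normc S' <= 2 ^+ j.+1 * (2 * j.+1%:R * A).
  apply: le_trans (normc_sum _ _ _) _.
  apply: (@le_trans _ _ (\sum_(m < j.+1) 2 ^+ j.+1 * (2 * A))); last first.
    by rewrite sumr_const card_ord -mulr_natr le_eqVlt; apply/orP; left; apply/eqP; ring.
  apply: (@le_trans _ _ (\sum_(m < j.+1 | m != i :> nat) 2 ^+ j.+1 * (2 * A))); last first.
    rewrite [leRHS](bigID (fun m : 'I_j.+1 => m != i :> nat)) /= lerDl sumr_ge0 // => m _.
    by rewrite !mulr_ge0 ?exprn_ge0.
  (* Triangularity: [G] is divisible by $v^i$, so orders below [i] have coefficient 0 and only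
     orders above [i] contribute. *)
  apply: ler_sum => m mi; have [ml|mg] := ltnP m i.
    by rewrite (tcoefM_low hH ml) mul0r normc0 !mulr_ge0 ?exprn_ge0.
  have im : (i < m)%N by rewrite ltn_neqAle eq_sym mi.
  rewrite normcM; apply: (@le_trans _ _ (2 * 1 / 2^-1 ^+ m * A)).
    have mj : (i < m <= j)%N by rewrite im -ltnS ltn_ord.
    apply: ler_pM; [exact: normc_ge0|exact: normc_ge0| |exact: hA mj].
    exact: (tcoef_bound m hG d01 GM).
  have : 2 ^+ m <= 2 ^+ j.+1 :> R by rewrite ler_weXn2l ?ler1n // ltnW.
  rewrite exprVn invrK mulr1 => h.
  by rewrite mulrAC mulrC ler_wpM2r // mulr_ge0.
have hT : Kr * H2norm rho f * (4 * 1 * (en / 2^-1) ^+ j.+1 / (1 - en / 2^-1)) <=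
    2 ^+ j.+1 * (8 * (Kr * H2norm rho f) * en ^+ j.+1).
  have inv2 : (1 - en / 2^-1)^-1 <= 2.
    rewrite -[leRHS]invrK lef_pV2 ?posrE ?invr_gt0 //; first by rewrite invrK; lra.
    by rewrite invrK; lra.
  move: inv2; rewrite invrK exprMn; move: (1 - en * 2)^-1 => y0 inv2.
  have -> : Kr * H2norm rho f * (4 * 1 * (en ^+ j.+1 * 2 ^+ j.+1) * y0) =
    (Kr * H2norm rho f * (4 * (en ^+ j.+1 * 2 ^+ j.+1))) * y0 by ring.
  have -> : 2 ^+ j.+1 * (8 * (Kr * H2norm rho f) * en ^+ j.+1) =
    (Kr * H2norm rho f * (4 * (en ^+ j.+1 * 2 ^+ j.+1))) * 2 by ring.
  by rewrite ler_wpM2l // !mulr_ge0 // ?exprn_ge0.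
have -> : y - (mults c x n)%:C ^+ i * tau c x sg i n f = S' + (y - S).
  by rewrite SE; ring.
apply: le_trans (normcD _ _) _; apply: le_trans (lerD hS (le_trans hy hT)) _.
rewrite -mulrDr -[leRHS]mulrA; apply: ler_wpM2l; first exact: exprn_ge0.
by apply: expand_le; rewrite ?exprn_ge0 // mulr_ge0.
Qed.

End OneOrbit.
End Orbit.

(** * Exponential bounds and limits of sequences with geometric increments *)

Section Sequences.
Context {R : realType}.
Local Notation C := R[i].
Local Notation Re := (@complex.Re R).
Local Notation Im := (@complex.Im R).

Definition ex (mu : R) (n : nat) : R := expR (mu * n%:R).

Lemma ex_gt0 mu n : 0 < ex mu n. Proof. exact: expR_gt0. Qed.
Lemma ex_ge0 mu n : 0 <= ex mu n. Proof. exact: expR_ge0. Qed.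

Lemma exD mu nu n : ex (mu + nu) n = ex mu n * ex nu n.
Proof. by rewrite /ex mulrDl expRD. Qed.

Lemma exX mu n i : ex mu n ^+ i = ex (i%:R * mu) n.
Proof. by rewrite /ex -expRM_natl mulrA. Qed.

Lemma exE mu n : ex mu n = expR mu ^+ n.
Proof. by rewrite /ex mulrC expRM_natl. Qed.

Lemma exS mu n : ex mu n.+1 = ex mu n * expR mu.
Proof. by rewrite !exE exprSr. Qed.

Lemma le_ex mu nu n : mu <= nu -> ex mu n <= ex nu n.
Proof. by move=> h; rewrite ler_expR ler_wpM2r. Qed.

Lemma real_geo_limit (x : nat -> R) n0 (K th : R) : 0 < th < 1 ->
  (forall n, (n0 <= n)%N -> `|x n.+1 - x n| <= K * th ^+ n) ->
  exists l, forall n, (n0 <= n)%N -> `|x n - l| <= K / (1 - th) * th ^+ n.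
Proof.
move=> /andP[t0 t1] hx; have d0 : 0 < 1 - th by rewrite subr_gt0.
pose e n := K / (1 - th) * th ^+ n.
have eS n : e n - e n.+1 = K * th ^+ n by rewrite /e exprS; field; rewrite gt_eqF.
have K0 : 0 <= K.
  have := le_trans (normr_ge0 _) (hx n0 (leqnn _)).
  by rewrite pmulr_lge0 // exprn_gt0.
have e0 n : 0 <= e n by rewrite mulr_ge0 ?exprn_ge0 ?(ltW t0) // divr_ge0 // ltW.
have step n k : (n0 <= n)%N -> `|x (n + k)%N - x n| <= e n - e (n + k)%N.
  move=> n0n; elim: k => [|k IH]; first by rewrite addn0 !subrr normr0.
  rewrite addnS; have h := hx (n + k)%N (leq_trans n0n (leq_addr _ _)).
  have -> : x (n + k).+1 - x n = (x (n + k).+1 - x (n + k)%N) + (x (n + k)%N - x n) by ring.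
  apply: le_trans (ler_normD _ _) _; rewrite -eS in h; apply: le_trans (lerD h IH) _.
  by rewrite le_eqVlt; apply/orP; left; apply/eqP; ring.
have pair n m : (n0 <= n)%N -> (n0 <= m)%N -> x n - e n <= x m + e m.
  move=> hn hm; have [nm|mn] := leqP n m.
    have := step n (m - n)%N hn; rewrite subnKC // ler_norml => /andP[h _].
    by have := e0 m; lra.
  have := step m (n - m)%N hm; rewrite subnKC 1?ltnW // ler_norml => /andP[_ h].
  by have := e0 n; lra.
pose A := [set x n - e n | n in [set n | (n0 <= n)%N]]%classic.
have A0 : A !=set0 by exists (x n0 - e n0), n0 => /=.
have Aub m : (n0 <= m)%N -> ubound A (x m + e m).
  by move=> hm _ [n /= hn <-]; exact: pair.
exists (sup A) => n hn; rewrite distrC ler_norml; apply/andP; split.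
  have : x n - e n <= sup A.
    by apply: ub_le_sup; [exists (x n0 + e n0); exact: Aub|exists n].
  by rewrite -/(e n); lra.
have : sup A <= x n + e n by apply: ge_sup => //; exact: Aub.
by rewrite -/(e n); lra.
Qed.

Lemma geo_limit (s : nat -> C) n0 (K th : R) : 0 < th < 1 ->
  (forall n, (n0 <= n)%N -> normc (s n.+1 - s n) <= K * th ^+ n) ->
  exists l, forall n, (n0 <= n)%N -> normc (s n - l) <= 2 * (K / (1 - th)) * th ^+ n.
Proof.
move=> th01 hs.
have [|a ha] := @real_geo_limit (fun n => Re (s n)) n0 K th th01.
  by move=> n hn; rewrite -cReN -cReD; apply: le_trans (Re_le_normc _) (hs n hn).
have [|b hb] := @real_geo_limit (fun n => Im (s n)) n0 K th th01.
  by move=> n hn; rewrite -cImN -cImD; apply: le_trans (Im_le_normc _) (hs n hn).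
exists (a +i* b) => n hn; apply: le_trans (normc_le_ReIm _) _.
rewrite cReD cImD cReN cImN /= -mulrA mulr2n mulrDl mul1r.
by apply: lerD; [exact: ha|exact: hb].
Qed.

Definition clim (s : nat -> C) (l : C) := forall e : R, 0 < e ->
  exists N, forall n, (N <= n)%N -> normc (s n - l) <= e.

Lemma clim_uniq s l l' : clim s l -> clim s l' -> l = l'.
Proof.
move=> h h'; apply/eqP; rewrite -subr_eq0 -normc_eq0 eq_le normc_ge0 andbT.
apply/ler_addgt0Pr => e e0; rewrite add0r; have e2 : 0 < e / 2 by rewrite divr_gt0.
have [N hN] := h _ e2; have [M hM] := h' _ e2.
have {}hN := hN (N + M)%N (leq_addr _ _); have {}hM := hM (N + M)%N (leq_addl _ _).
have -> : l - l' = (s (N + M)%N - l') - (s (N + M)%N - l) by ring.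
by apply: le_trans (normcB _ _) _; rewrite [leRHS]splitr; exact: lerD.
Qed.

Lemma clim_lin (a : C) s s' l l' : clim s l -> clim s' l' ->
  clim (fun n => a * s n + s' n) (a * l + l').
Proof.
move=> h h' e e0; have d0 : 0 < e / (2 * (normc a + 1)).
  by rewrite divr_gt0 // mulr_gt0 // ltr_wpDl ?normc_ge0.
have e2 : 0 < e / 2 by rewrite divr_gt0.
have [N hN] := h _ d0; have [M hM] := h' _ e2.
exists (N + M)%N => n nn.
have {}hN := hN n (leq_trans (leq_addr _ _) nn).
have {}hM := hM n (leq_trans (leq_addl _ _) nn).
have -> : a * s n + s' n - (a * l + l') = a * (s n - l) + (s' n - l') by ring.
apply: le_trans (normcD _ _) _; rewrite [leRHS]splitr; apply: lerD hM; rewrite normcM.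
apply: le_trans (ler_wpM2l (normc_ge0 _) hN) _.
have a0 := normc_ge0 a; move: (normc a) a0 => y y0.
have -> : y * (e / (2 * (y + 1))) = e / 2 * (y / (y + 1)) by field; lra.
by rewrite ler_piMr ?(ltW e2) // ler_pdivrMr; lra.
Qed.

Lemma eq_clim s s' l : (forall n, s n = s' n) -> clim s l -> clim s' l.
Proof. by move=> ss h e /h[N hN]; exists N => n /hN; rewrite ss. Qed.

Lemma clim_cst l : clim (fun=> l) l.
Proof. by move=> e e0; exists 0 => n _; rewrite subrr normc0 ltW. Qed.

Lemma clim_geo s l n0 (K th : R) : 0 < th < 1 ->
  (forall n, (n0 <= n)%N -> normc (s n - l) <= K * th ^+ n) -> clim s l.
Proof.
move=> /andP[t0 t1] h e e0; have th01 : 0 <= th < 1 by rewrite (ltW t0).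
have [N hN] := geometric_small K th01 e0.
exists (n0 + N)%N => n nn; apply: le_trans (h n (leq_trans (leq_addr _ _) nn)) _.
by apply/ltW/hN/(leq_trans _ nn); rewrite leq_addl.
Qed.

Lemma bound_all (u : nat -> R) n0 (K mu : R) : (forall n, 0 <= u n) ->
  (forall n, (n0 <= n)%N -> u n <= K * ex mu n) ->
  exists2 K', 0 <= K' & forall n, u n <= K' * ex mu n.
Proof.
move=> u0 h; pose K' := `|K| + \sum_(n < n0) u n / ex mu n.
have S0 : 0 <= \sum_(n < n0) u n / ex mu n.
  by apply: sumr_ge0 => n _; rewrite divr_ge0 // ex_ge0.
exists K' => [|n]; first by rewrite addr_ge0.
have [nn|nn] := leqP n0 n.
  apply: le_trans (h n nn) _; rewrite ler_wpM2r ?ex_ge0 //.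
  by apply: le_trans (ler_norm _) _; rewrite lerDl.
rewrite -ler_pdivrMr ?ex_gt0 //; apply: (@le_trans _ _ (\sum_(n < n0) u n / ex mu n)).
  rewrite (bigD1 (Ordinal nn)) //= lerDl; apply: sumr_ge0 => m _.
  by rewrite divr_ge0 // ex_ge0.
by rewrite lerDr.
Qed.

End Sequences.

Section Moments.
Context {R : realType}.
Local Notation C := R[i].
Variables (rho t : R) (c : nat -> bool) (x : nat -> R).
Hypothesis O : bl_orbit rho t c x.
Implicit Types (f g : C -> C) (sg : bool) (i j k m n : nat).

Let rho01 : 0 < rho < 1 := orbit_rho O.
Let rho0 : 0 < rho. Proof. by case/andP: rho01. Qed.

Definition mom sg m f : C := spair sg f (fun z => mob (- x 0) z ^+ m).

Let dm m : dhol (fun z => mob (- x 0) z ^+ m).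
Proof. exact: (dholX m (dmap_dhol (dmap_mob (norm_x0 O)))). Qed.

Lemma mom_lin sg m f g (a : C) : H2 rho f -> H2 rho g ->
  mom sg m (a *: f + g) = a * mom sg m f + mom sg m g.
Proof. by move=> Hf Hg; exact: (spair_lin_l sg a rho01 (H2_hol Hf) (H2_hol Hg) (dm m)). Qed.

Lemma tau_lin sg i n f g (a : C) : H2 rho f -> H2 rho g ->
  tau c x sg i n (a *: f + g) = a * tau c x sg i n f + tau c x sg i n g.
Proof.
move=> Hf Hg; apply: (spair_lin_l sg a rho01 (H2_hol Hf) (H2_hol Hg)).
exact: (dholX i (dmap_dhol (dmap_orbit O n))).
Qed.

Lemma tau0 sg n f : tau c x sg 0 n f = mom sg 0 f.
Proof. by apply: eq_spair => z _; rewrite !expr0. Qed.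

Lemma mom0_sign sg f : mom sg 0 f = mom true 0 f.
Proof. by apply: eq_cmean1 => z _; rewrite !expr0. Qed.

(** In the expansion to order [k.+1 + N] only the first [k.+1] terms survive, and the remainder
    tends to 0 with [N]; the finite formula is therefore exact. *)
Lemma spair_mob_poly k sg f (G : C -> C) M : H2 rho f -> dhol G ->
  (forall v, normc v <= 1 -> normc (G v) <= M) ->
  (forall m, (k < m)%N -> mom sg m f = 0) ->
  spair sg f (fun z => G (mob (- x 0) z)) = \sum_(m < k.+1) tcoef G m * mom sg m f.
Proof.
move=> Hf hG GM fk; have rr := circ_in O.
have r01 : 0 <= circ rho < 1.
  by case/andP: rr => h1 h2; rewrite h2 (ltW (lt_trans rho0 h1)).
have [Kr Kr0 hKr] := spair_H2_bound rho0 rr.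
have hK g M' : dhol g -> (forall z, normc z = circ rho -> normc (g z) <= M') ->
    normc (spair sg f g) <= Kr * H2norm rho f * M' by move=> hg; exact: hKr.
have H0 := H2norm_ge0 rho f; have x0 := x01 O 0.
pose e := mrad (x 0) (circ rho).
have e0 : 0 <= e.
  by case/andP: (x0) => h _; case/andP: r01 => h' _; exact: le_trans h (mrad_ge x0 h').
have e1 : e < 1 by exact: mrad_lt1.
have pe z : normc z = circ rho -> normc (mob (- x 0) z) <= e.
  by move=> zr; apply: mob_neg_le; rewrite // zr.
clearbody e.
have d11 : 0 < (1 : R) <= 1 by rewrite ltr01 lexx.
have M0 : 0 <= M by apply: le_trans (GM 0 _); rewrite ?normc_ge0 // normc0.
apply/eqP; rewrite -subr_eq0 -normc_eq0 eq_le normc_ge0 andbT.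
apply/ler_addgt0Pr => e' e'0; rewrite add0r.
have e01 : 0 <= e < 1 by rewrite e0.
have [N hN] := geometric_small (Kr * H2norm rho f * (4 * M / (1 - e))) e01 e'0.
have := spair_taylor (k.+1 + N) rho01 (H2_hol Hf) hK hG (dmap_mob (norm_x0 O)) d11 GM e0 e1 pe.
have -> : \sum_(m < k.+1 + N) tcoef G m * spair sg f (fun z => mob (- x 0) z ^+ m) =
    \sum_(m < k.+1) tcoef G m * mom sg m f.
  rewrite big_split_ord /= [X in _ + X]big1 ?addr0 // => m _.
  by rewrite -/(mom sg _ f) fk ?mulr0 // addSn ltnS leq_addr.
move=> h; apply: le_trans h _; apply: le_trans (ltW (hN (k.+1 + N)%N (leq_addl _ _))).
rewrite !divr1 le_eqVlt; apply/orP; left; apply/eqP; ring.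
Qed.

(** The quotient of [beta n v] by [v], defined without division so that it has a value at 0, namely
    the product of the multipliers. *)
Fixpoint gam n v : C :=
  if n is n'.+1 then gam n' v * mob (mults c x n') (beta (mults c x) n' v) else 1.

Definition Dn n : R := \prod_(i < n) mults c x i.

Lemma betaE n v : beta (mults c x) n v = v * gam n v.
Proof.
elim: n => [|n IH] /=; first by rewrite mulr1.
by rewrite /bmap {1}IH mulrA.
Qed.

Lemma beta0 n : beta (mults c x) n 0 = 0.
Proof. by rewrite betaE mul0r. Qed.

Lemma gam0 n : gam n 0 = (Dn n)%:C.
Proof.
rewrite /Dn; elim: n => [|n IH] /=; first by rewrite big_ord0.
by rewrite big_ord_recr /= rmorphM /= -IH beta0 /mob add0r mulr0 addr0 divr1.
Qed.

Lemma dhol_gam n : dhol (gam n).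
Proof.
elim: n => [|n IH]; first exact: dhol_cst.
apply: (dholM IH); apply: dhol_comp (dmap_dhol (dmap_mob (mults_norm O n))) _.
exact: dmap_beta (mults_norm O).
Qed.

Lemma beta_le1 n v : normc v <= 1 -> normc (beta (mults c x) n v) <= 1.
Proof.
move=> v1; elim: n => //= n IH.
by rewrite normcM mulr_ile1 ?normc_ge0 // mob_le1 // (mults_norm O).
Qed.

Lemma tau_mom k sg i n f : H2 rho f -> (forall m, (k < m)%N -> mom sg m f = 0) ->
  ((k < i)%N -> tau c x sg i n f = 0) /\
  (i = k -> tau c x sg i n f = (Dn n)%:C ^+ i * mom sg i f).
Proof.
move=> Hf fk; pose G v := beta (mults c x) n v ^+ i.
have hg : dhol (fun v => gam n v ^+ i) by exact: (dholX i (dhol_gam n)).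
have GE : G = (fun v => v ^+ i * gam n v ^+ i).
  by apply/funext => v; rewrite /G betaE exprMn.
have hG : dhol G by exact: (dholX i (dmap_dhol (dmap_beta n (mults_norm O)))).
have GM v : normc v <= 1 -> normc (G v) <= 1.
  by move=> v1; rewrite normcX exprn_ile1 ?normc_ge0 // beta_le1.
have -> : tau c x sg i n f = \sum_(m < k.+1) tcoef G m * mom sg m f.
  exact: (spair_mob_poly Hf hG GM fk).
split=> [ki|ik].
  apply: big1 => m _; rewrite GE tcoefM_low ?mul0r //.
  by apply: leq_trans ki; rewrite ltn_ord.
rewrite big_ord_recr /= big1 ?add0r => [|m _].
  by rewrite -ik GE (tcoefM_lead i hg) gam0.
by rewrite GE tcoefM_low ?mul0r // ik.
Qed.

Lemma mom_zero f : H2 rho f -> (forall sg m, mom sg m f = 0) -> f = 0.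
Proof.
move=> Hf f0; have x0 := x01 O 0.
have nx : `|x 0| < 1 by case/andP: x0 => ? ?; rewrite ger0_norm.
have sz sg k : spair sg f (fun z => z ^+ k) = 0.
  pose G v := mob (x 0) v ^+ k.
  have hG : dhol G by exact: (dholX k (dmap_dhol (dmap_mob nx))).
  have GM v : normc v <= 1 -> normc (G v) <= 1.
    by move=> v1; rewrite normcX exprn_ile1 ?normc_ge0 // mob_le1.
  have := spair_mob_poly (k := 0) Hf hG GM (fun m _ => f0 sg m).
  rewrite big_ord1 f0 mulr0 => <-; apply: eq_spair => z z1; rewrite /G.
  congr (_ ^+ _); have := @mobK _ (- x 0) z; rewrite /nob opprK normrN => -> //.
  by rewrite mob_den ?normrN ?z1.
apply/funext => z; have [za|za] := pselect (annulus rho z); last first.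
  by case: Hf => _ ->.
apply: (identity_principle rho01 (H2_hol Hf) (@holK _ rho 0)) => // n.
have -> : coef 1 n (fun=> 0 : C) = 0.
  by rewrite -[RHS](cmean_cst 1); apply: eq_cmean1 => w _; rewrite mul0r.
case: n => n; first by rewrite coef_spair_pos sz.
by rewrite NegzE coef_spair_neg sz.
Qed.

(* dual basis to the powers of the moving coordinate (lemma mom_ebas) *)
Definition ebas (l : int) : C -> C :=
  aext rho (fun z => mob (- x 0) z ^ (- l - 1) * dmob (- x 0) z).

Lemma ebas_H2 l : H2 rho (ebas l).
Proof.
have /andP[rho_0 rho_1] := rho01; have /andP[t0 trho] := orbit_t O.
have xt : `|- x 0| <= t by rewrite normrN; have /andP[h1 h2] := orbit_x O 0; rewrite ger0_norm.
apply: (@H2_aext _ rho t); rewrite ?t0 //.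
exact: (holM (hol_mobXz _ t0 xt) (hol_dmob t0 xt)).
Qed.

Definition sgi sg k : int := if sg then k%:Z else - k%:Z.

Lemma mom_ebas sg m l : mom sg m (ebas l) = (l == sgi sg m)%:R.
Proof.
have -> : mom sg m (ebas l) = cmean 1 (fun z =>
    z * (mob (- x 0) z ^ (sgi sg m - l - 1) * dmob (- x 0) z)).
  apply: eq_cmean1 => z z1; have z0 := normc1_neq0 z1.
  have za : annulus rho z by have := unit_annulus rho01; rewrite -z1.
  have u0 : mob (- x 0) z != 0.
    by rewrite normc1_neq0 // mob_eq1 // (norm_x0 O).
  rewrite /ebas aextE // mulrAC; congr (_ * (_ * _)).
  have -> : mob (- x 0) (flip sg z) ^+ m = mob (- x 0) z ^ sgi sg m.
    by case: sg => //=; rewrite mobV // exprVn exprnN.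
  by rewrite -expfzDr //; congr (_ ^ _); lia.
rewrite (mob_residue _ (norm_x0 O)); congr (_%:R); lia.
Qed.

End Moments.

(** * The equivariant splitting *)

Section Exponents.
Context {R : realType}.
Local Notation C := R[i].
Implicit Types (f g : C -> C) (sg : bool) (i j k m n : nat).

(** What ergodic theory contributes about one orbit: [Dn] behaves like $e^{n Lam}$ up to arbitrarily
    small exponential losses, and [eps] is bounded in the same way from above. *)
Record rates rho t (c : nat -> bool) (x : nat -> R) (Lam : R) : Prop := Rates {
  rate_lt0 : Lam < 0;
  eps_rate : forall mu, Lam < mu ->
    exists2 K, 0 <= K & forall n, eps rho t (mults c x) n <= K * ex mu n;
  Dn_lower : forall nu, nu < Lam ->
    exists2 K, 0 <= K & forall n, (Dn c x n)^-1 <= K * ex (- nu) n;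
  Dn_upper : forall mu, Lam < mu ->
    exists2 K, 0 <= K & forall n, Dn c x n <= K * ex mu n;
  mults_gt0 : forall n, 0 < mults c x n
}.

Definition nmom (c : nat -> bool) (x : nat -> R) sg i n f : C :=
  tau c x sg i n f / (Dn c x n)%:C ^+ i.

(* the linear forms that cut out the complements of the Oseledets spaces *)
Definition ell (c : nat -> bool) (x : nat -> R) sg i f : C :=
  xget 0 [set l | clim (fun n => nmom c x sg i n f) l]%classic.

(** Source of the lower growth bounds: the test function in the coordinate at [x n] is at most 1 on
    the test circle, so the constant depends neither on [n] nor on [m]. *)
Lemma iter_mom_le rho t (c : nat -> bool) (x : nat -> R) : bl_orbit rho t c x ->
  exists2 K : R, 0 <= K & forall sg m n f, H2 rho f ->
    normc (tau c x sg m n f) <= K * H2norm rho (Lit rho c n f).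
Proof.
move=> O; have rho01 := orbit_rho O; have /andP[rho0 rho1] := rho01.
have rr := circ_in O; have [Kr Kr0 hKr] := spair_H2_bound rho0 rr.
exists Kr => // sg m n f Hf.
have nx : `|- x n| < 1 by rewrite normrN; case/andP: (x01 O n) => ? ?; rewrite ger0_norm.
have -> : tau c x sg m n f = spair sg (Lit rho c n f) (fun z => mob (- x n) z ^+ m).
  by rewrite (Lit_spair O sg n Hf (dholX m (dmap_dhol (@dmap_id R)))).
rewrite -[leRHS]mulr1; apply: hKr (Lit_H2 O n Hf) (dholX m (dmap_dhol (dmap_mob nx))) _.
move=> z zr; rewrite normcX exprn_ile1 ?normc_ge0 // mob_le1 // zr.
by case/andP: rr => _ /ltW.
Qed.

Section Rates.
Variables (rho t : R) (c : nat -> bool) (x : nat -> R) (Lam : R).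
Hypothesis O : bl_orbit rho t c x.
Hypothesis Q : rates rho t c x Lam.

Let rho01 : 0 < rho < 1 := orbit_rho O.
Let rho0 : 0 < rho. Proof. by case/andP: rho01. Qed.
Let Lam0 : Lam < 0 := rate_lt0 Q.

Lemma DnS n : Dn c x n.+1 = Dn c x n * mults c x n.
Proof. by rewrite /Dn big_ord_recr. Qed.

Lemma Dn_gt0 n : 0 < Dn c x n.
Proof. by apply: prodr_gt0 => k _; exact: mults_gt0 Q k. Qed.

Lemma DnC_neq0 n i : (Dn c x n)%:C ^+ i != 0 :> C.
Proof. by rewrite expf_neq0 // realC_neq0 // gt_eqF // Dn_gt0. Qed.

Lemma nmom_step sg i n f : nmom c x sg i n.+1 f - nmom c x sg i n f =
  (tau c x sg i n.+1 f - (mults c x n)%:C ^+ i * tau c x sg i n f) / (Dn c x n.+1)%:C ^+ i.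
Proof.
rewrite /nmom DnS rmorphM exprMn; have h1 := DnC_neq0 n i.
have h2 : (mults c x n)%:C ^+ i != 0 :> C.
  by rewrite expf_neq0 // realC_neq0 // gt_eqF // (mults_gt0 Q).
by move: (tau _ _ _ _ n.+1 _) (tau _ _ _ _ n _) (_ ^+ i) (_ ^+ i) h1 h2 => y z u v h1 h2;
  field; rewrite h1 h2.
Qed.

(** This is [tau_step] divided by [Dn ^+ i]. The numerator decays at rate [mu1], slightly above
    [j.+1 * Lam], as soon as the pairings of orders between [i] and [j] do; the division costs the
    rate [i * nu], with [nu] slightly below [Lam]. *)
Lemma nmom_step_le i j (nu mu1 : R) : (i <= j)%N -> nu < Lam -> j.+1%:R * Lam < mu1 ->
  exists n0, exists2 K, 0 <= K & forall f sg A n, (n0 <= n)%N -> H2 rho f -> 0 <= A ->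
    (forall m k, (i < m <= j)%N -> normc (tau c x sg m k f) <= A * ex mu1 k) ->
    normc (nmom c x sg i n.+1 f - nmom c x sg i n f) <=
      K * (A + H2norm rho f) * ex (mu1 - i%:R * nu) n.
Proof.
move=> ij nuL muL; have [n0 /(_ j)[K0 K00 hK0]] := tau_step O.
have mu_gt : Lam < mu1 / j.+1%:R by rewrite ltr_pdivlMr ?ltr0n // mulrC.
have [K1 K10 hK1] := eps_rate Q mu_gt; have [K2 K20 hK2] := Dn_lower Q nuL.
exists n0, (K0 * (1 + K1 ^+ j.+1) * (K2 ^+ i * expR (- (i%:R * nu)))).
  by rewrite !mulr_ge0 ?expR_ge0 ?exprn_ge0 // addr_ge0 ?exprn_ge0.
move=> f sg A n n0n Hf A0 hA; have H0 := H2norm_ge0 rho f.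
have e1 : eps rho t (mults c x) n ^+ j.+1 <= K1 ^+ j.+1 * ex mu1 n.
  have -> : ex mu1 n = ex (mu1 / j.+1%:R) n ^+ j.+1.
    by rewrite exX mulrC divfK // pnatr_eq0.
  rewrite -exprMn; apply: lerXn2r; rewrite ?nnegrE ?(eps_ge0 O) ?mulr_ge0 ?ex_ge0 //.
have h1 := hK0 n f i sg (A * ex mu1 n) n0n ij Hf (mulr_ge0 A0 (ex_ge0 _ _))
  (fun m hm => hA m n hm).
have h2 : (Dn c x n.+1)^-1 ^+ i <= K2 ^+ i * (ex (- (i%:R * nu)) n * expR (- (i%:R * nu))).
  rewrite -exS -mulrN -exX -exprMn; apply: lerXn2r; rewrite ?nnegrE ?mulr_ge0 ?ex_ge0 //.
  by rewrite invr_ge0 ltW // Dn_gt0.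
rewrite nmom_step normcM normcV normcX normc_realp ?(ltW (Dn_gt0 _)) // -exprVn.
move: (normc _) h1 (normc_ge0 (tau c x sg i n.+1 f - (mults c x n)%:C ^+ i * tau c x sg i n f)) => y h1 y0.
apply: (@le_trans _ _ (K0 * ((1 + K1 ^+ j.+1) * (A + H2norm rho f) * ex mu1 n) *
    (K2 ^+ i * (ex (- (i%:R * nu)) n * expR (- (i%:R * nu)))))); last first.
  by rewrite exD le_eqVlt; apply/orP; left; apply/eqP; ring.
apply: ler_pM => //; first by rewrite exprn_ge0 // invr_ge0 ltW // Dn_gt0.
apply: le_trans h1 _; apply: ler_wpM2l => //.
have p1 : 0 <= K1 ^+ j.+1 * A * ex mu1 n by rewrite !mulr_ge0 ?exprn_ge0 ?ex_ge0.
have p2 : 0 <= H2norm rho f * ex mu1 n by rewrite mulr_ge0 ?ex_ge0.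
have := ler_wpM2l H0 e1.
have -> : (1 + K1 ^+ j.+1) * (A + H2norm rho f) * ex mu1 n = A * ex mu1 n +
  H2norm rho f * (K1 ^+ j.+1 * ex mu1 n) + (K1 ^+ j.+1 * A * ex mu1 n + H2norm rho f * ex mu1 n) by ring.
lra.
Qed.

Lemma ell_spec i : exists n0, exists2 K, 0 <= K & exists2 th, 0 < th < 1 &
  forall f sg n, (n0 <= n)%N -> H2 rho f ->
    normc (nmom c x sg i n f - ell c x sg i f) <= K * H2norm rho f * th ^+ n.
Proof.
(* Chosen so that the rate [i.+1 * Lam + eta - i * (Lam - eta)] equals [Lam / 2]. With j = i no
   intermediate orders exist, and [A = 0] is allowed. *)
pose eta := - Lam / (2 * i.+1%:R).
have i0 : 0 < i.+1%:R :> R by rewrite ltr0n.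
have eta0 : 0 < eta by rewrite divr_gt0 ?oppr_gt0 // mulr_gt0.
have nuL : Lam - eta < Lam by rewrite gtrBl.
have muL : i.+1%:R * Lam < i.+1%:R * Lam + eta by rewrite ltrDl.
have [n0 [K K0 hK]] := nmom_step_le (leqnn i) nuL muL.
have eE : i.+1%:R * Lam + eta - i%:R * (Lam - eta) = Lam / 2.
  rewrite /eta -[in X in _ - X * _ = _](addrK 1 i%:R) natr1.
  by field; rewrite gt_eqF.
have th01 : 0 < expR (Lam / 2) < 1.
  by rewrite expR_gt0 expR_lt1 pmulr_llt0 ?invr_gt0.
exists n0, (2 * (K / (1 - expR (Lam / 2)))).
  by case/andP: th01 => _ h; rewrite mulr_ge0 // divr_ge0 // subr_ge0 ltW.
exists (expR (Lam / 2)) => // f sg.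
have st n : (n0 <= n)%N -> H2 rho f -> normc (nmom c x sg i n.+1 f - nmom c x sg i n f) <=
    K * H2norm rho f * expR (Lam / 2) ^+ n.
  move=> n0n Hf; rewrite -exE -eE -{1}[H2norm rho f]add0r.
  by apply: hK => // m k /andP[h1 h2]; move: (leq_trans h1 h2); rewrite ltnn.
move=> n n0n Hf.
have [l hl] := geo_limit th01 (fun n h => st n h Hf).
have ll := clim_geo th01 hl.
have -> : ell c x sg i f = l.
  have ex0 : exists l, [set l | clim (fun n => nmom c x sg i n f) l]%classic l by exists l.
  exact: clim_uniq (xgetPex 0 ex0) ll.
apply: le_trans (hl n n0n) _; rewrite le_eqVlt; apply/orP; left; apply/eqP; ring.
Qed.

Lemma ell_clim sg i f : H2 rho f -> clim (fun n => nmom c x sg i n f) (ell c x sg i f).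
Proof.
move=> Hf; have [n0 [K K0 [th th01 h]]] := ell_spec i.
exact: (clim_geo th01 (fun n hn => h f sg n hn Hf)).
Qed.

Lemma ell_eq sg i f l : H2 rho f -> clim (fun n => nmom c x sg i n f) l -> ell c x sg i f = l.
Proof. by move=> Hf; exact: clim_uniq (ell_clim sg i Hf). Qed.

Lemma ell_lin sg i f g (a : C) : H2 rho f -> H2 rho g ->
  ell c x sg i (a *: f + g) = a * ell c x sg i f + ell c x sg i g.
Proof.
move=> Hf Hg; apply: ell_eq; first exact: H2_lin.
apply: eq_clim (clim_lin a (ell_clim sg i Hf) (ell_clim sg i Hg)) => n.
by rewrite /nmom (tau_lin O sg i n a Hf Hg); ring.
Qed.

(** At a fixed time the pairing is bounded by the norm, and [ell_spec] bounds the distance from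
    there to the limit. Continuity of [ell] makes the complements closed. *)
Lemma ell_bound sg i : exists2 K, 0 <= K & forall f, H2 rho f ->
  normc (ell c x sg i f) <= K * H2norm rho f.
Proof.
have [n0 [K K0 [th th01 h]]] := ell_spec i; have /andP[th0 th1] := th01.
have rr := circ_in O; have [Kr Kr0 hKr] := spair_H2_bound rho0 rr.
have D0 : 0 <= (Dn c x n0)^-1 ^+ i by rewrite exprn_ge0 // invr_ge0 ltW // Dn_gt0.
exists (Kr * (Dn c x n0)^-1 ^+ i + K * th ^+ n0).
  by rewrite addr_ge0 // mulr_ge0 // exprn_ge0 // ltW.
move=> f Hf; have H0 := H2norm_ge0 rho f.
have -> : ell c x sg i f = nmom c x sg i n0 f - (nmom c x sg i n0 f - ell c x sg i f) by ring.
apply: le_trans (normcB _ _) _; rewrite mulrDl; apply: lerD.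
  rewrite /nmom normcM normcV normcX normc_realp ?(ltW (Dn_gt0 _)) // -exprVn.
  rewrite mulrAC; apply: ler_wpM2r => //; rewrite -[leRHS]mulr1.
  apply: (hKr _ _ _ _ Hf); first exact: (dholX i (dmap_dhol (dmap_orbit O n0))).
  move=> z zr; rewrite normcX exprn_ile1 ?normc_ge0 //.
  have z1 : normc z <= 1 by rewrite zr; case/andP: rr => _ /ltW.
  exact: (beta_le1 O n0 (mob_le1 (norm_x0 O) z1)).
by apply: le_trans (h f sg n0 (leqnn _) Hf) _; rewrite mulrAC.
Qed.

(** By [tau_mom] the sequences defining these limits do not depend on [n]. *)
Lemma ell_mom k sg f : H2 rho f -> (forall m, (k < m)%N -> mom x sg m f = 0) ->
  ell c x sg k f = mom x sg k f /\ forall i, (k < i)%N -> ell c x sg i f = 0.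
Proof.
move=> Hf fk; split=> [|i ki]; apply: ell_eq => //.
  apply: eq_clim (clim_cst _) => n; have [_ h] := tau_mom O k n Hf fk.
  by rewrite /nmom h // mulrAC mulfV ?mul1r // DnC_neq0.
apply: eq_clim (clim_cst _) => n; have [h _] := tau_mom O i n Hf fk.
by rewrite /nmom h // mul0r.
Qed.

Lemma ell0 sg f : H2 rho f -> ell c x sg 0 f = mom x sg 0 f.
Proof.
move=> Hf; apply: ell_eq => //; apply: eq_clim (clim_cst _) => n.
by rewrite /nmom expr0 divr1 tau0.
Qed.

(** Descending induction on [i]. If the orders between [i] and [j] decay at nearly [j.+1 * Lam], the
    increments of the normalised pairing of order [i] are summable; its limit is 0, so the pairing
    itself is of the size of the tail, and multiplication by [Dn ^+ i] restores the rate. *)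
Lemma tau_decay j f : H2 rho f -> (forall sg i, (i <= j)%N -> ell c x sg i f = 0) ->
  forall mu1, j.+1%:R * Lam < mu1 -> forall sg i, (i <= j)%N ->
  exists2 K, 0 <= K & forall n, normc (tau c x sg i n f) <= K * ex mu1 n.
Proof.
move=> Hf f0 mu1 hmu sg.
suff h k : forall i, (j.+1 <= i + k)%N -> (i <= j)%N ->
    forall mu1, j.+1%:R * Lam < mu1 ->
    exists2 K, 0 <= K & forall n, normc (tau c x sg i n f) <= K * ex mu1 n.
  by move=> i ij; apply: (h j.+1 i) => //; rewrite leq_addl.
elim: k => [|k IH] i ik ij mu hm; first by move: ik; rewrite addn0 ltnNge ij.
pose g := mu - j.+1%:R * Lam.
have g0 : 0 < g by rewrite subr_gt0.
have i1 : 0 < (2 * i + 1)%:R :> R by rewrite ltr0n addn1.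
have i2 : 0 < 2 * i.+1%:R :> R by rewrite mulr_gt0 // ltr0n.
(* The first bound fits the total loss [(2 * i + 1) * eta] into the gap [g]; the second keeps the
   rate [M] of the increments negative. *)
pose eta := Num.min (g / (2 * i + 1)%:R) (- Lam / (2 * i.+1%:R)).
have eta0 : 0 < eta by rewrite lt_min !divr_gt0 // oppr_gt0.
have eta1 : (2 * i%:R + 1) * eta <= g.
  have -> : 2 * i%:R + 1 = (2 * i + 1)%:R :> R by rewrite natrD natrM.
  by rewrite mulrC -ler_pdivlMr // ge_min lexx.
have eta2 : 2 * i.+1%:R * eta <= - Lam.
  by rewrite mulrC -ler_pdivlMr // ge_min lexx orbT.
clearbody eta.
have nuL : Lam - eta < Lam by rewrite gtrBl.
have muL : Lam < Lam + eta by rewrite ltrDl.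
have mu'L : j.+1%:R * Lam < j.+1%:R * Lam + eta by rewrite ltrDl.
have [n0 [K K0 hK]] := nmom_step_le ij nuL mu'L.
have /choice[Kf hKf] : forall m, exists K, 0 <= K /\ ((i < m <= j)%N ->
    forall n, normc (tau c x sg m n f) <= K * ex (j.+1%:R * Lam + eta) n).
  move=> m; have [im|im] := boolP (i < m <= j)%N; last by exists 0.
  have /andP[im1 im2] := im.
  have [|K' K'0 h] := IH m _ im2 _ mu'L; last by exists K'.
  by rewrite (leq_trans ik) // -addSnnS leq_add2r.
pose A := \sum_(m < j.+1) Kf m.
have A0 : 0 <= A by apply: sumr_ge0 => m _; case: (hKf m).
have hA m n : (i < m <= j)%N -> normc (tau c x sg m n f) <= A * ex (j.+1%:R * Lam + eta) n.
  move=> im; have [_ h] := hKf m; apply: le_trans (h im n) _.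
  apply: (ler_wpM2r (ex_ge0 _ _)); have mj : (m < j.+1)%N by case/andP: im.
  rewrite /A (bigD1 (Ordinal mj)) //= lerDl; apply: sumr_ge0 => m' _.
  by case: (hKf m').
have H0 := H2norm_ge0 rho f.
pose M := j.+1%:R * Lam + eta - i%:R * (Lam - eta).
have M0 : M < 0.
  have : (j.+1%:R - i%:R) * Lam <= Lam.
    rewrite -[leRHS]mul1r ler_wnM2r ?(ltW Lam0) //.
    by rewrite -natrB ?ler1n ?subn_gt0 // (leq_trans ij).
  have : i.+1%:R * eta < - Lam.
    have : 0 < i.+1%:R * eta by rewrite mulr_gt0 // ltr0n.
    by move: eta2; rewrite -mulrA; lra.
  rewrite /M mulrBl -natr1 mulrDl mul1r mulrBr -natr1; lra.
have th01 : 0 < expR M < 1 by rewrite expR_gt0 expR_lt1.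
have st n : (n0 <= n)%N -> normc (nmom c x sg i n.+1 f - nmom c x sg i n f) <=
    K * (A + H2norm rho f) * expR M ^+ n.
  by move=> hn; rewrite -exE; exact: (hK f sg A n hn Hf A0 hA).
have [l hl] := geo_limit th01 st.
have l0 : l = 0 by rewrite -(clim_uniq (ell_clim sg i Hf) (clim_geo th01 hl)) f0.
have [K3 K30 hK3] := Dn_upper Q muL.
apply: (@bound_all _ _ n0 (2 * (K * (A + H2norm rho f) / (1 - expR M)) * K3 ^+ i)).
  by move=> n; exact: normc_ge0.
move=> n hn; have := hl n hn; rewrite l0 subr0 -exE => hs.
have D0 := Dn_gt0 n.
have -> : tau c x sg i n f = nmom c x sg i n f * (Dn c x n)%:C ^+ i.
  by rewrite /nmom divfK // DnC_neq0.
rewrite normcM normcX normc_realp ?(ltW D0) //.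
have hD : Dn c x n ^+ i <= K3 ^+ i * ex (i%:R * (Lam + eta)) n.
  by rewrite -exX -exprMn; apply: lerXn2r; rewrite ?nnegrE ?mulr_ge0 ?ex_ge0 // ltW.
have P0 : 0 <= 2 * (K * (A + H2norm rho f) / (1 - expR M)) * K3 ^+ i.
  case/andP: th01 => _ h1; have a0 : 0 <= A + H2norm rho f by rewrite addr_ge0.
  rewrite mulr_ge0 ?exprn_ge0 // mulr_ge0 // divr_ge0 ?mulr_ge0 //.
  by rewrite subr_ge0 ltW.
apply: le_trans (ler_pM (normc_ge0 _) (exprn_ge0 _ (ltW D0)) hs hD) _.
have -> : 2 * (K * (A + H2norm rho f) / (1 - expR M)) * ex M n *
    (K3 ^+ i * ex (i%:R * (Lam + eta)) n) =
    2 * (K * (A + H2norm rho f) / (1 - expR M)) * K3 ^+ i *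
    ex (M + i%:R * (Lam + eta)) n by rewrite (exD M); ring.
apply: (ler_wpM2l P0); apply: le_ex; rewrite /M.
have -> : j.+1%:R * Lam + eta - i%:R * (Lam - eta) + i%:R * (Lam + eta) =
  j.+1%:R * Lam + (2 * i%:R + 1) * eta by ring.
by move: eta1; rewrite /g; lra.
Qed.


Lemma H2_decay j f : H2 rho f -> (forall sg i, (i <= j)%N -> ell c x sg i f = 0) ->
  forall mu1, j.+1%:R * Lam < mu1 ->
  exists2 K, 0 <= K & forall n, H2norm rho (Lit rho c n f) <= K * ex mu1 n.
Proof.
move=> Hf f0 mu1 hmu; have [n0 /(_ j)[K0 K00 hK0]] := iter_norm_bound O.
have /choice[Kf hKf] : forall p : bool * nat, exists K, 0 <= K /\ ((p.2 <= j)%N ->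
    forall n, normc (tau c x p.1 p.2 n f) <= K * ex mu1 n).
  move=> [sg i]; have [ij|ij] := boolP (i <= j)%N; last by exists 0.
  by have [K K1 h] := tau_decay Hf f0 hmu sg ij; exists K.
pose A := \sum_(m < j.+1) (Kf (true, val m) + Kf (false, val m)).
have kf0 m : 0 <= Kf (true, m) + Kf (false, m).
  by rewrite addr_ge0 //; [case: (hKf (true, m))|case: (hKf (false, m))].
have A0 : 0 <= A by apply: sumr_ge0 => m _; exact: kf0.
have hA sg m n : (m <= j)%N -> normc (tau c x sg m n f) <= A * ex mu1 n.
  move=> mj; have [_ h] := hKf (sg, m); apply: le_trans (h mj n) _.
  apply: (ler_wpM2r (ex_ge0 _ _)).
  have mj' : (m < j.+1)%N by rewrite ltnS.
  apply: (@le_trans _ _ (Kf (true, m) + Kf (false, m))).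
    by case: sg h => _; rewrite ?lerDl ?lerDr; [case: (hKf (false, m))|case: (hKf (true, m))].
  by rewrite /A (bigD1 (Ordinal mj')) //= lerDl; apply: sumr_ge0 => m' _; exact: kf0.
have mu_gt : Lam < mu1 / j.+1%:R by rewrite ltr_pdivlMr ?ltr0n // mulrC.
have [K1 K10 hK1] := eps_rate Q mu_gt.
have H0 := H2norm_ge0 rho f.
apply: (@bound_all _ _ n0 (K0 * (A + H2norm rho f * K1 ^+ j.+1))).
  by move=> n; exact: H2norm_ge0.
move=> n hn.
apply: le_trans (hK0 n f (A * ex mu1 n) hn Hf (mulr_ge0 A0 (ex_ge0 _ _)) _) _.
  by move=> sg m mj; exact: hA.
have e1 : eps rho t (mults c x) n ^+ j.+1 <= K1 ^+ j.+1 * ex mu1 n.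
  have -> : ex mu1 n = ex (mu1 / j.+1%:R) n ^+ j.+1.
    by rewrite exX mulrC divfK // pnatr_eq0.
  by rewrite -exprMn; apply: lerXn2r; rewrite ?nnegrE ?(eps_ge0 O) ?mulr_ge0 ?ex_ge0.
rewrite -mulrA; apply: (ler_wpM2l K00); rewrite mulrDl lerD2l -mulrA.
exact: (ler_wpM2l H0).
Qed.

(** The Oseledets space of order [i]. Vanishing moments above [i] leave a finite-dimensional
    equivariant space; vanishing limit forms below [i] remove the slower growth in it. *)
Definition osel i : set (C -> C) := [set f | [/\ H2 rho f,
  forall sg m, (i < m)%N -> mom x sg m f = 0 &
  forall sg l, (l < i)%N -> ell c x sg l f = 0]]%classic.

(** Once the moments above order m vanish, [ell_mom] identifies the moment of order m with the limit
    form of that order, which is 0; descend until no moment is left and apply [mom_zero]. *)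
Lemma osel_zero i f : osel i f -> (forall sg, ell c x sg i f = 0) -> f = 0.
Proof.
move=> [Hf fm fl] fi; apply: (mom_zero O Hf).
suff h k : forall sg m, (i < m + k)%N -> mom x sg m f = 0.
  by move=> sg m; apply: (h i.+1); rewrite leq_addl.
elim: k => [|k IH] sg m; first by rewrite addn0; exact: fm.
move=> mk; have mm' : forall m', (m < m')%N -> mom x sg m' f = 0.
  by move=> m' mm'; apply: IH; lia.
have [h _] := ell_mom Hf mm'; rewrite -h.
have [mi|mi|->] := ltngtP m i; [exact: fl| |exact: fi].
by rewrite h; exact: fm.
Qed.

(** Triangular elimination: start from the dual vector of index k and subtract dual vectors of index
    l = k - 1 down to 1 to kill the form of order l. Such a correction does not affect the forms of
    order above l. Order 0 needs none, since the moment of order 0 is already 0. *)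
Lemma exists_osel sg k : (0 < k)%N -> exists v, [/\ H2 rho v,
  forall sg' m, (k < m)%N || (sg' != sg) || (m == 0%N) -> mom x sg' m v = 0,
  mom x sg k v = 1 &
  forall i, (0 < i < k)%N -> ell c x sg i v = 0].
Proof.
move=> k0; suff h n : (n < k)%N -> exists v, [/\ H2 rho v,
    forall sg' m, (k < m)%N || (sg' != sg) || (m == 0%N) -> mom x sg' m v = 0,
    mom x sg k v = 1 &
    forall i, (k - n <= i < k)%N -> ell c x sg i v = 0].
  have [v [h1 h2 h3 h4]] := h k.-1 ltac:(by rewrite prednK).
  by exists v; split=> // i /andP[i0 ik]; apply: h4; rewrite ik andbT; lia.
have eb l sg' m : (0 < l)%N -> mom x sg' m (ebas rho x (sgi sg l)) =
    ((sg' == sg) && (m == l))%:R.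
  move=> l0; rewrite (mom_ebas O); congr (_%:R); case: sg; case: sg' => /=; lia.
elim: n => [_|n IH nk].
  exists (ebas rho x (sgi sg k)); split.
  - exact: ebas_H2 O _.
  - move=> sg' m h; rewrite eb //; case: eqP h => //= _; rewrite orbF => h.
    by have -> : (m == k) = false by lia.
  - by rewrite eb // !eqxx.
  - by move=> i; rewrite subn0 => /andP[h1 h2]; move: (leq_trans h2 h1); rewrite ltnn.
have [v [h1 h2 h3 h4]] := IH (ltnW nk).
have l0 : (0 < k - n.+1)%N by rewrite subn_gt0.
set l := (k - n.+1)%N in l0 *; have lk : (l < k)%N by rewrite /l; lia.
have He := ebas_H2 O (sgi sg l).
have el : forall i, (l < i)%N -> ell c x sg i (ebas rho x (sgi sg l)) = 0.
  have [//|_ h] := @ell_mom l sg _ He; first by move=> m lm; rewrite eb // gtn_eqF ?andbF.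
  exact: h.
have ell1 : ell c x sg l (ebas rho x (sgi sg l)) = 1.
  have [//|-> _] := @ell_mom l sg _ He; first by move=> m lm; rewrite eb // gtn_eqF ?andbF.
  by rewrite eb // !eqxx.
exists ((- ell c x sg l v) *: ebas rho x (sgi sg l) + v); split.
- exact: H2_lin.
- move=> sg' m hm; rewrite (mom_lin O _ _ _ He h1) h2 // addr0 eb //.
  have -> : (sg' == sg) && (m == l) = false; last by rewrite mulr0.
  by case: eqP hm => //= _; rewrite orbF => hm; lia.
- rewrite (mom_lin O _ _ _ He h1) h3 eb // eqxx /= gtn_eqF // mulr0 add0r //.
- move=> i /andP[li ik]; rewrite (ell_lin _ _ _ He h1).
  have [e|ne] := eqVneq i l; first by rewrite e ell1 mulr1 addNr.
  have li' : (l < i)%N by rewrite ltn_neqAle eq_sym ne.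
  rewrite el // mulr0 add0r; apply: h4; rewrite ik andbT; move: li'; rewrite /l; lia.
Qed.

End Rates.
End Exponents.

(** * Finite-dimensional spaces and direct sums cut out by linear forms *)

Section LinearAlgebra.
Context {K : fieldType} {U : lmodType K}.
Implicit Types (f g : U) (a : K).

Lemma linear_sum (V : set U) (I : Type) (s : seq I) (c : I -> K) (e : I -> U) :
  (V 0 /\ forall a f g, V f -> V g -> V (a *: f + g)) -> (forall i, V (e i)) ->
  V (\sum_(i <- s) c i *: e i).
Proof.
move=> [V0 VD] Ve; elim: s => [|i s IH]; first by rewrite big_nil.
by rewrite big_cons; exact: VD.
Qed.

Lemma functional_sum (V : set U) (phi : U -> K) (I : Type) (s : seq I) (c : I -> K) (e : I -> U) :
  (V 0 /\ forall a f g, V f -> V g -> V (a *: f + g)) -> (forall i, V (e i)) ->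
  (forall a f g, V f -> V g -> phi (a *: f + g) = a * phi f + phi g) ->
  phi (\sum_(i <- s) c i *: e i) = \sum_(i <- s) c i * phi (e i).
Proof.
move=> hV Ve hphi; elim: s => [|i s IH].
  rewrite !big_nil; have := hphi 0 0 0 (proj1 hV) (proj1 hV).
  by rewrite scale0r addr0 mul0r add0r => ->; have := hphi (-1) 0 0 (proj1 hV) (proj1 hV);
    rewrite scaler0 addr0 mulN1r addNr.
by rewrite !big_cons hphi ?IH //; exact: linear_sum.
Qed.

End LinearAlgebra.

Section Splitting.
Context {R : realType} {U : lmodType R[i]}.
Local Notation C := R[i].
Implicit Types (f g : U) (a : C).

Lemma has_dim_dual (V : set U) m (e : 'I_m -> U) (phi : 'I_m -> U -> C) :
  linear_set V -> (forall i, V (e i)) ->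
  (forall i a f g, V f -> V g -> phi i (a *: f + g) = a * phi i f + phi i g) ->
  (forall i j, phi i (e j) = (i == j)%:R) ->
  (forall f, V f -> (forall i, phi i f = 0) -> f = 0) -> has_dim V m.
Proof.
move=> hV Ve hphi dual zero.
have phiS c i : phi i (\sum_j c j *: e j) = c i.
  rewrite (functional_sum _ _ hV Ve (hphi i)) (bigD1 i) //= dual eqxx mulr1 big1 ?addr0 //.
  by move=> j ji; rewrite dual eq_sym (negbTE ji) mulr0.
have VS c : V (\sum_j c j *: e j) by exact: linear_sum.
exists e; split=> [c c0 i|].
  have V0 : V 0 by case: hV.
  rewrite -(phiS c i) c0; have := hphi i (-1) 0 0 V0 V0.
  by rewrite scaler0 addr0 mulN1r addNr.
apply/seteqP; split=> [f Vf|f [c ->]]; last exact: VS.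
exists (fun i => phi i f); apply/eqP; rewrite -subr_eq0 -oppr_eq0 opprB -scaleN1r addrC; apply/eqP.
have VSf := VS (fun i => phi i f).
have -> : - 1 *: f + \sum_i phi i f *: e i = (-1) *: f + \sum_i phi i f *: e i by [].
apply: zero => [|i]; first by case: hV => _; apply.
by rewrite hphi // phiS mulN1r addNr.
Qed.

Variables (X : set U) (V : nat -> set U) (phi : bool -> nat -> U -> C) (j : nat).
Hypothesis hX : linear_set X.
Hypothesis VX : forall i f, (i <= j)%N -> V i f -> X f.
Hypothesis hphi : forall sg i a f g, (i <= j)%N -> X f -> X g ->
  phi sg i (a *: f + g) = a * phi sg i f + phi sg i g.
Hypothesis Vlin : forall i, (i <= j)%N -> linear_set (V i).
Hypothesis Voff : forall i l sg f, (i <= j)%N -> (l <= j)%N -> V i f -> l != i -> phi sg l f = 0.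
Hypothesis Vzero : forall i f, (i <= j)%N -> V i f -> (forall sg, phi sg i f = 0) -> f = 0.
Hypothesis Vsurj : forall i f, (i <= j)%N -> X f ->
  exists2 v, V i v & forall sg, phi sg i v = phi sg i f.

Definition kerset : set U := [set f | X f /\ forall sg i, (i <= j)%N -> phi sg i f = 0].

Let phi0 sg i : (i <= j)%N -> phi sg i 0 = 0.
Proof.
move=> ij; have X0 : X 0 by case: hX.
by have := hphi sg (-1) ij X0 X0; rewrite scaler0 addr0 mulN1r addNr.
Qed.

Lemma kerset_linear : linear_set kerset.
Proof.
split; first by split; [case: hX|move=> sg i ij; exact: phi0].
move=> a f g [Xf f0] [Xg g0]; split; first by case: hX => _; apply.
by move=> sg i ij; rewrite hphi // f0 // g0 // mulr0 addr0.
Qed.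

(** The forms of index i see only the component in [V i]: [Vzero] makes this component unique and
    [Vsurj] provides it. What remains lies in the common kernel. *)
Lemma splitting : direct_sum X V j kerset.
Proof.
split=> [i ij f|f []//|f Xf]; first exact: VX.
have sumX (h : 'I_j.+1 -> U) : (forall i : 'I_j.+1, V i (h i)) -> X (\sum_i h i).
  move=> Vh; have -> : \sum_i h i = \sum_i 1 *: h i by apply: eq_bigr => i _; rewrite scale1r.
  by apply: linear_sum => // i; apply: (VX (ltn_ord i : (i <= j)%N)).
have phiS sg (h : 'I_j.+1 -> U) (l : 'I_j.+1) : (forall i : 'I_j.+1, V i (h i)) ->
    phi sg l (\sum_i h i) = phi sg l (h l).
  move=> Vh; have lj : (l <= j)%N by rewrite -ltnS.
  have -> : \sum_i h i = \sum_i 1 *: h i by apply: eq_bigr => i _; rewrite scale1r.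
  have Xh i : X (h i) by apply: (VX (ltn_ord i : (i <= j)%N)).
  rewrite (functional_sum _ _ hX Xh (fun a f g => @hphi sg l a f g lj)).
  rewrite (bigD1 l) //= mul1r big1 ?addr0 // => i il.
  by rewrite mul1r (@Voff i l) // ?(eq_sym _ (val i)) // -ltnS.
have /choice[v hv] : forall i : 'I_j.+1, exists v, V i v /\ forall sg, phi sg i v = phi sg i f.
  by move=> i; have [|v ? ?] := @Vsurj i f _ Xf; [rewrite -ltnS|exists v].
have Vv (i : 'I_j.+1) : V i (v i) by case: (hv i).
exists ([ffun i => v i], (-1) *: (\sum_i v i) + f); split=> [|[vg g] /= [Vvg [Xg g0] fE]].
  split=> [i|/=|/=]; first by rewrite ffunE.
    split; first by case: hX => _; apply => //; exact: sumX.
    move=> sg i ij; have ij' : (i < j.+1)%N by [].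
    rewrite hphi //; last exact: sumX.
    rewrite (phiS sg v (Ordinal ij')) //=; case: (hv (Ordinal ij')) => _ ->.
    by rewrite mulN1r addNr.
  rewrite scaleN1r addrA.
  have -> : \sum_(i < j.+1) [ffun i => v i] i = \sum_i v i by apply: eq_bigr => i _; rewrite ffunE.
  by rewrite subrr add0r.
have vE i : v i = vg i.
  have ij : (i <= j)%N by rewrite -ltnS.
  apply/eqP; rewrite -subr_eq0 addrC -scaleN1r; apply/eqP.
  have hVi := Vlin ij; apply: (Vzero ij).
    case: hVi => V0 VD; have := VD (-1) _ _ (Vvg i) (Vv i); by [].
  move=> sg; rewrite hphi //; [|exact: (VX ij (Vvg i))|exact: (VX ij (Vv i))].
  case: (hv i) => _ ->; rewrite fE.
  have -> : \sum_(i < j.+1) vg i + g = 1 *: (\sum_(i < j.+1) vg i) + g by rewrite scale1r.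
  rewrite (hphi _ _ ij (sumX _ Vvg) Xg) g0 // (phiS sg vg) // mul1r addr0.
  by rewrite mulN1r addNr.
congr (_, _); first by apply/ffunP => i; rewrite ffunE.
have -> : \sum_i v i = \sum_i vg i by apply: eq_bigr => i _.
by rewrite fE scaleN1r addKr.
Qed.

End Splitting.

Lemma natmul_unbounded {R : realType} (a e : R) : 0 < e ->
  exists N, forall n, (N <= n)%N -> a <= e * n%:R.
Proof.
move=> e0; exists (Num.truncn `|a / e|).+1 => n hn; rewrite -ler_pdivrMl // mulrC.
apply: le_trans (ler_norm _) _; apply: ltW; apply: lt_le_trans (truncnS_gt _) _.
by rewrite ler_nat.
Qed.

(** * From exponential bounds to growth rates *)

Section Growth.
Context {R : realType}.
Local Open Scope ereal_scope.

Lemma in_ge0 (y : \bar R) : 0 <= y -> y \in `[0, +oo%E]%R.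
Proof. by move=> h; rewrite in_itv /= h leey. Qed.

Lemma cvg_finite (u : nat -> \bar R) (r : R) :
  (forall e : R, (0 < e)%R -> exists N, forall n, (N <= n)%N ->
     (r - e)%:E <= u n /\ u n <= (r + e)%:E) ->
  u n @[n --> \oo] --> r%:E.
Proof.
move=> h; have fin : \forall n \near \oo, u n \is a fin_num.
  have [N hN] := h 1%R ltr01; exists N => // n /= Nn; have [h1 h2] := hN n Nn.
  rewrite fin_numE; apply/andP; split; apply/eqP => e.
    by move: h1; rewrite e leeNy_eq.
  by move: h2; rewrite e leye_eq.
apply/fine_cvgP; split=> //; apply/cvgrPdist_le => e e0.
have [N hN] := h e e0; exists N => // n /= Nn; have [h1 h2] := hN n Nn.
have fn : u n \is a fin_num.
  rewrite fin_numE; apply/andP; split; apply/eqP => e'.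
    by move: h1; rewrite e' leeNy_eq.
  by move: h2; rewrite e' leye_eq.
move: h1 h2; rewrite -(fineK fn) !lee_fin => h1 h2.
by rewrite ler_norml; apply/andP; split; lra.
Qed.

Lemma growth_le (x : nat -> \bar R) N0 (K mu e : R) : (0 < e)%R ->
  (forall n, 0 <= x n) -> (forall n, (N0 <= n)%N -> x n <= (K * ex mu n)%:E) ->
  exists N, forall n, (N <= n)%N -> growth x n <= (mu + e)%:E.
Proof.
move=> e0 x0 xK; pose K' := (`|K| + 1)%R.
have K'0 : (0 < K')%R by rewrite ltr_wpDl.
have [N hN] := natmul_unbounded (ln K') e0.
exists (N0 + N).+1 => n hn; have n0n : (N0 <= n)%N by lia.
have nN : (N <= n)%N by lia.
 have n0 : (0 < n%:R :> R)%R by rewrite ltr0n; lia.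
have xl : lne (x n) <= (ln K' + mu * n%:R)%:E.
  have -> : (ln K' + mu * n%:R)%:E = lne (K' * ex mu n)%:E :> \bar R.
    by rewrite lne_EFin ?mulr_gt0 ?ex_gt0 // lnM ?posrE ?ex_gt0 // /ex expRK.
  have kp : 0 <= (K' * ex mu n)%:E by rewrite lee_fin ltW // mulr_gt0 ?ex_gt0.
  rewrite (lee_lne (in_ge0 (x0 n)) (in_ge0 kp)).
  apply: le_trans (xK n n0n) _; rewrite lee_fin ler_wpM2r ?ex_ge0 //.
  by apply: le_trans (ler_norm _) _; rewrite lerDl.
rewrite /growth; apply: (@le_trans _ _ ((n%:R^-1)%:E * (ln K' + mu * n%:R)%:E)).
  by apply: lee_wpmul2l => //; rewrite lee_fin invr_ge0.
rewrite -EFinM lee_fin mulrC ler_pdivrMr // mulrDl addrC lerD2l.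
exact: hN.
Qed.

Lemma growth_ge (x : nat -> \bar R) N0 (k mu e : R) : (0 < e)%R -> (0 < k)%R ->
  (forall n, (N0 <= n)%N -> (k * ex mu n)%:E <= x n) ->
  exists N, forall n, (N <= n)%N -> (mu - e)%:E <= growth x n.
Proof.
move=> e0 k0 xk.
have [N hN] := natmul_unbounded (- ln k) e0.
exists (N0 + N).+1 => n hn; have n0n : (N0 <= n)%N by lia.
have nN : (N <= n)%N by lia.
 have n0 : (0 < n%:R :> R)%R by rewrite ltr0n; lia.
have kp : (0 < k * ex mu n)%R by rewrite mulr_gt0 ?ex_gt0.
have xl : (ln k + mu * n%:R)%:E <= lne (x n).
  have -> : (ln k + mu * n%:R)%:E = lne (k * ex mu n)%:E :> \bar R.
    by rewrite lne_EFin // lnM ?posrE ?ex_gt0 // /ex expRK.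
  have kp' : 0 <= (k * ex mu n)%:E by rewrite lee_fin ltW.
  rewrite (lee_lne (in_ge0 kp') (in_ge0 (le_trans kp' (xk n n0n)))).
  exact: xk.
rewrite /growth; apply: (@le_trans _ _ ((n%:R^-1)%:E * (ln k + mu * n%:R)%:E)); last first.
  by apply: lee_wpmul2l => //; rewrite lee_fin invr_ge0.
rewrite -EFinM lee_fin mulrC ler_pdivlMr // mulrDl mulNr.
by have := hN n nN; lra.
Qed.

Lemma limn_esup_le_eventually (u : nat -> \bar R) (l : \bar R) N :
  (forall n, (N <= n)%N -> u n <= l) -> limn_esup u <= l.
Proof.
move=> h; rewrite /limn_esup /limf_esup.
apply: (@le_trans _ _ (ereal_sup (u @` [set n | (N <= n)%N]))).
  by apply: ereal_inf_lbound; exists [set n | (N <= n)%N] => //; exists N.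
by apply: ge_ereal_sup => _ [n /= Nn <-]; exact: h.
Qed.

End Growth.

Section OrbitSpectrum.
Context {R : realType}.
Local Notation C := R[i].
Implicit Types (f g : C -> C) (sg : bool) (i j k m n : nat).
Variables (rho t : R) (c : nat -> bool) (x : nat -> R).
Hypothesis O : bl_orbit rho t c x.

Let rho01 : 0 < rho < 1 := orbit_rho O.
Let rho0 : 0 < rho. Proof. by case/andP: rho01. Qed.
Let O' : bl_orbit rho t (fun n => c n.+1) (fun n => x n.+1) := orbit_shift O.
Local Notation c' := (fun n => c n.+1).
Local Notation x' := (fun n => x n.+1).
Local Notation L := (PF rho (blaschke (c 0))).

Lemma H2_linear_set : linear_set (H2 rho).
Proof.
have He := ebas_H2 O 0; split; last by move=> a f g; exact: H2_lin.
by have := H2_lin (-1) rho01 He He; rewrite scaleN1r addNr.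
Qed.

Lemma PF_H2 f : H2 rho f -> H2 rho (L f).
Proof. by move=> Hf; exact: (Lit_H2 O 1 Hf). Qed.

Lemma mom_bound : exists2 K : R, 0 <= K & forall sg m f, H2 rho f ->
  normc (mom x sg m f) <= K * H2norm rho f.
Proof.
have [K K0 hK] := iter_mom_le O; exists K => // sg m f Hf.
exact: (hK sg m 0 f Hf).
Qed.

(** At order 0 the expansion involves only the pairing with 1, which all iterates conserve. *)
Lemma Lit_bounded : exists2 K : R, 0 <= K & exists N, forall n f, (N <= n)%N -> H2 rho f ->
  H2norm rho (Lit rho c n f) <= K * H2norm rho f.
Proof.
have [n0 /(_ 0%N)[K K0 hK]] := iter_norm_bound O; have [Kr Kr0 hKr] := mom_bound.
exists (K * (Kr + 1)); first by rewrite mulr_ge0 // addr_ge0.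
exists n0 => n f hn Hf; have H0 := H2norm_ge0 rho f.
apply: le_trans (hK n f (Kr * H2norm rho f) hn Hf (mulr_ge0 Kr0 H0) _) _.
  by move=> sg m; rewrite leqn0 => /eqP ->; rewrite tau0; exact: hKr.
rewrite -mulrA; apply: (ler_wpM2l K0); rewrite mulrDl mul1r lerD2l.
rewrite expr1 ler_piMr // (le_trans (eps_le_qap O n)) //.
by have /andP[q0 q1] := qap01 O; rewrite exprn_ile1 ?ltW.
Qed.

Lemma mom0_iter n f : H2 rho f -> exists2 K : R, 0 < K &
  forall n, K * normc (mom x true 0 f) <= H2norm rho (Lit rho c n f).
Proof.
move=> Hf; have [K K0 hK] := iter_mom_le O.
have K1 : 0 < K + 1 by rewrite ltr_wpDl.
exists (K + 1)^-1; first by rewrite invr_gt0.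
move=> m; rewrite mulrC ler_pdivrMr // -(tau0 c x true m f).
apply: le_trans (hK true 0%N m f Hf) _; rewrite mulrC ler_wpM2l ?H2norm_ge0 //.
by rewrite lerDl.
Qed.

Lemma op_norm_growth :
  growth (fun n => op_norm (H2 rho) (H2norm rho) (Lit rho c n)) n @[n --> \oo] --> 0%:E.
Proof.
have [K K0 [N hN]] := Lit_bounded.
have /andP[_ rho1] := rho01.
have r2 : 0 < rho / 2 < rho by have := rho0; lra.
(* On the annulus [f0] is at most 1/2 in modulus, so its norm is at most 1, while its conserved
   pairing with 1 is [rho / 2]; it bounds all operator norms from below. *)
pose f0 : C -> C := aext rho (fun z => (rho / 2)%:C * z ^ (-1)).
have Hf0 : H2 rho f0.
  apply: (H2_aext r2 rho1); apply: holM; [exact: holK|apply: holXz].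
  by case/andP: (r2).
have nf0 : H2norm rho f0 <= 1.
  have -> : (1 : R) = 2 * 2^-1 by rewrite mulfV.
  apply: (H2norm_le rho01 Hf0) => // z za; rewrite /f0 aextE // normcM exprN1 normcV.
  have /andP[z1 _] := za; have z0 : 0 < normc z by apply: lt_trans z1.
  rewrite normc_realp; last by case/andP: r2 => /ltW.
  rewrite ler_pdivrMr //; move: (normc z) z1 => y z1; lra.
have m0 : mom x true 0 f0 = (rho / 2)%:C.
  rewrite -[RHS](cmean_cst 1); apply: eq_cmean1 => z z1.
  have za : annulus rho z by have := unit_annulus rho01; rewrite -z1.
  by rewrite /f0 aextE // expr0 mulr1 exprN1 mulrCA mulfV ?mulr1 // normc1_neq0.
have [k k0 hk] := mom0_iter 0 Hf0.
have kp : 0 < k * (rho / 2) by rewrite mulr_gt0 //; case/andP: r2.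
have lower n : ((k * (rho / 2) * ex 0 n)%:E <= op_norm (H2 rho) (H2norm rho) (Lit rho c n))%E.
  apply: (@le_trans _ _ (H2norm rho (Lit rho c n f0))%:E).
    rewrite lee_fin /ex mul0r expR0 mulr1; have := hk n; rewrite m0 normc_realp //.
    by case/andP: r2 => /ltW.
  by apply: ereal_sup_ubound; exists f0.
have pos n : (0 <= op_norm (H2 rho) (H2norm rho) (Lit rho c n))%E.
  apply: le_trans (lower n); rewrite lee_fin mulr_ge0 ?ex_ge0 //; exact: ltW.
apply: cvg_finite => e e0.
have up n : (N <= n)%N ->
    (op_norm (H2 rho) (H2norm rho) (Lit rho c n) <= (K * ex 0 n)%:E)%E.
  move=> hn; rewrite /ex mul0r expR0 mulr1; apply: ge_ereal_sup => _ [f [Hf f1] <-].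
  by rewrite lee_fin; apply: le_trans (hN n f hn Hf) _; rewrite ler_piMr.
have [N1 h1] := growth_le e0 pos up.
have [N2 h2] := growth_ge e0 kp (fun n (_ : (0 <= n)%N) => lower n).
exists (N1 + N2)%N => n hn; split.
  by apply: h2; exact: leq_trans (leq_addl _ _) hn.
by apply: h1; exact: leq_trans (leq_addr _ _) hn.
Qed.

Lemma growth_cvg0 f : H2 rho f -> mom x true 0 f <> 0 ->
  growth (fun n => (H2norm rho (Lit rho c n f))%:E) n @[n --> \oo] --> 0%:E.
Proof.
move=> Hf f0; have [K K0 [N hN]] := Lit_bounded; have [k k0 hk] := mom0_iter 0 Hf.
have kp : 0 < k * normc (mom x true 0 f) by rewrite mulr_gt0 // normc_gt0; apply/eqP.
have pos n : (0 <= (H2norm rho (Lit rho c n f))%:E)%E by rewrite lee_fin H2norm_ge0.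
apply: cvg_finite => e e0.
have up n : (N <= n)%N -> ((H2norm rho (Lit rho c n f))%:E <= (K * H2norm rho f * ex 0 n)%:E)%E.
  by move=> hn; rewrite lee_fin /ex mul0r expR0 mulr1; exact: hN.
have low n : (0 <= n)%N -> ((k * normc (mom x true 0 f) * ex 0 n)%:E <= (H2norm rho (Lit rho c n f))%:E)%E.
  by move=> _; rewrite lee_fin /ex mul0r expR0 mulr1; exact: hk.
have [N1 h1] := growth_le e0 pos up.
have [N2 h2] := growth_ge e0 kp low.
exists (N1 + N2)%N => n hn; split.
  by apply: h2; exact: leq_trans (leq_addl _ _) hn.
by apply: h1; exact: leq_trans (leq_addr _ _) hn.
Qed.

Definition osel0 : set (C -> C) := [set f | H2 rho f /\
  forall sg m, (0 < m)%N -> mom x sg m f = 0]%classic.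

Lemma osel0_linear : linear_set osel0.
Proof.
have [Z0 ZD] := H2_linear_set; split.
  split=> // sg m _; have := mom_lin O sg m (-1) Z0 Z0.
  by rewrite scaler0 addr0 mulN1r addNr.
move=> a f g [Hf f0] [Hg g0]; split; first exact: ZD.
by move=> sg m m0; rewrite (mom_lin O) // f0 // g0 // mulr0 addr0.
Qed.

Lemma osel0_zero f : osel0 f -> mom x true 0 f = 0 -> f = 0.
Proof.
move=> [Hf f0] h; apply: (mom_zero O Hf) => sg [|m]; last exact: f0.
by rewrite mom0_sign.
Qed.

Lemma osel0_ebas : osel0 (ebas rho x 0) /\ mom x true 0 (ebas rho x 0) = 1.
Proof.
split; last by rewrite (mom_ebas O).
split; first exact: ebas_H2 O _.
move=> sg m m0; rewrite (mom_ebas O); have -> : (0 == sgi sg m) = false => //.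
by case: sg; rewrite /sgi; lia.
Qed.

Lemma osel0_dim : has_dim osel0 1.
Proof.
have [e1 e2] := osel0_ebas.
apply: (@has_dim_dual _ _ _ 1 (fun=> ebas rho x 0) (fun _ f => mom x true 0 f)).
- exact: osel0_linear.
- by [].
- by move=> _ a f g [Hf _] [Hg _]; exact: (mom_lin O).
- by move=> i j; rewrite e2 !ord1 eqxx.
- by move=> f Vf h; exact: osel0_zero Vf (h ord0).
Qed.

Lemma mom0_PF f : H2 rho f -> mom x' true 0 (L f) = mom x true 0 f.
Proof. by move=> Hf; rewrite -(tau0 c' x' true 0) (tau_shift O) // tau0. Qed.

Lemma osel0_PF f : osel0 f ->
  H2 rho (L f) /\ forall sg m, (0 < m)%N -> mom x' sg m (L f) = 0.
Proof.
move=> [Hf f0]; split=> [|sg m m0]; first exact: PF_H2.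
have -> : mom x' sg m (L f) = tau c' x' sg m 0 (L f) by [].
rewrite (tau_shift O) //.
by have [h _] := tau_mom O m 1 Hf (f0 sg); exact: h.
Qed.

End OrbitSpectrum.

(** * The case of a single finite exponent *)

Section SpectrumB.
Context {R : realType}.
Local Notation C := R[i].
Implicit Types (f g : C -> C) (sg : bool) (i j k m n : nat).
Variables (rho t : R) (c : nat -> bool) (x : nat -> R).
Hypothesis O : bl_orbit rho t c x.
Local Notation c' := (fun n => c n.+1).
Local Notation x' := (fun n => x n.+1).
Local Notation L := (PF rho (blaschke (c 0))).
Let rho01 : 0 < rho < 1 := orbit_rho O.

Definition ker0 (y : nat -> R) : set (C -> C) :=
  kerset (H2 rho) (fun _ _ f => mom y true 0 f) 0.

(** The space is one-dimensional with the pairing with 1 as coordinate, and the operator conserves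
    this coordinate; hence the image is everything. *)
Lemma osel0_image : L @` osel0 rho x = osel0 rho x'.
Proof.
have O' := orbit_shift O.
apply/seteqP; split=> [_ [f Vf <-]|g Vg]; first exact: osel0_PF O _ Vf.
have [e1 e2] := osel0_ebas O; have [V0 VD] := osel0_linear O.
pose f := mom x' true 0 g *: ebas rho x 0 + 0.
have Vf : osel0 rho x f by exact: VD.
have He : H2 rho (ebas rho x 0) by case: e1.
have H0 : H2 rho 0 by case: V0.
have fm : mom x true 0 f = mom x' true 0 g.
  have m00 : mom x true 0 (0 : C -> C) = 0.
    have := mom_lin O true 0 (-1) H0 H0.
    by rewrite scaler0 addr0 mulN1r addNr.
  by rewrite (mom_lin O) // e2 mulr1 m00 addr0.
exists f => //; apply/eqP; rewrite -subr_eq0 addrC -scaleN1r; apply/eqP.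
have VLf : osel0 rho x' (L f) by exact: osel0_PF O _ Vf.
have [V0' VD'] := osel0_linear O'.
apply: (osel0_zero O'); first exact: VD'.
have Hf : H2 rho f by case: Vf.
have Hg : H2 rho g by case: Vg.
rewrite (mom_lin O' true 0 (-1) Hg (PF_H2 O Hf)) (mom0_PF O Hf) fm.
by rewrite mulN1r addNr.
Qed.

Lemma osel0_growth f : osel0 rho x f -> f <> 0 ->
  growth (fun n => (H2norm rho (Lit rho c n f))%:E) n @[n --> \oo] --> 0%:E.
Proof.
move=> Vf f0; apply: (growth_cvg0 O); first by case: Vf.
by move=> h; apply: f0; exact: (osel0_zero O Vf h).
Qed.

Lemma ker0_linear : linear_set (ker0 x).
Proof.
apply: kerset_linear; first exact: H2_linear_set O.
by move=> sg i a f g _ Hf Hg; exact: (mom_lin O).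
Qed.

Lemma H2norm_cvg_small (u : nat -> C -> C) f :
  H2norm rho (u n - f) @[n --> \oo] --> (0 : R) ->
  forall e : R, 0 < e -> exists n, H2norm rho (u n - f) < e.
Proof.
move=> /cvgrPdist_lt h e e0; have [N _ hN] := h e e0; exists N.
have := hN N (leqnn N); rewrite /= sub0r normrN.
by apply: le_lt_trans; exact: ler_norm.
Qed.

Lemma functional_closed (phi : (C -> C) -> C) (K : R) (u : nat -> C -> C) f : 0 <= K ->
  (forall a f g, H2 rho f -> H2 rho g -> phi (a *: f + g) = a * phi f + phi g) ->
  (forall f, H2 rho f -> normc (phi f) <= K * H2norm rho f) ->
  (forall n, H2 rho (u n) /\ phi (u n) = 0) -> H2 rho f ->
  H2norm rho (u n - f) @[n --> \oo] --> (0 : R) -> phi f = 0.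
Proof.
move=> K0 hphi hK hu Hf /H2norm_cvg_small h.
apply/eqP; rewrite -normc_eq0 eq_le normc_ge0 andbT.
apply/ler_addgt0Pr => e e0; rewrite add0r.
have K1 : 0 < K + 1 by rewrite ltr_wpDl.
have [n hn] := h _ (divr_gt0 e0 K1); have [Hu u0] := hu n.
have Hd : H2 rho ((-1) *: f + u n) by exact: H2_lin.
have := hK _ Hd; rewrite hphi // u0 addr0 mulN1r normcNN scaleN1r addrC => le1.
apply: le_trans le1 _; apply: (@le_trans _ _ (K * (e / (K + 1)))).
  by rewrite ler_wpM2l // ltW.
by rewrite mulrCA ler_piMr ?(ltW e0) // ler_pdivrMr // mul1r lerDl.
Qed.

Lemma ker0_closed : closed_in (H2 rho) (H2norm rho) (ker0 x).
Proof.
move=> u f hu Hf cu; split=> // sg i _.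
have [K K0 hK] := mom_bound O.
apply: (functional_closed (u := u) K0) Hf cu.
- by move=> a f1 f2 H1 H2'; exact: (mom_lin O).
- by move=> f1 H1; exact: hK.
- by move=> n; case: (hu n) => H1 h; split=> //; exact: h true 0%N _.
Qed.

Lemma ker0_splitting : direct_sum (H2 rho) (fun=> osel0 rho x) 0 (ker0 x).
Proof.
apply: (@splitting _ _ (H2 rho) (fun=> osel0 rho x) (fun _ _ f => mom x true 0 f) 0).
- exact: H2_linear_set O.
- by move=> i f _ [].
- by move=> sg i a f g _ Hf Hg; exact: (mom_lin O).
- by move=> i _; exact: osel0_linear O.
- by move=> i l sg f; rewrite !leqn0 => /eqP -> /eqP ->; rewrite eqxx.
- by move=> i f _ Vf h; exact: (osel0_zero O Vf (h true)).
- move=> i f _ Hf; have [e1 e2] := osel0_ebas O; have [V0 VD] := osel0_linear O.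
  exists (mom x true 0 f *: ebas rho x 0 + 0); first exact: VD.
  move=> _; have He : H2 rho (ebas rho x 0) by case: e1.
  have H0 : H2 rho 0 by case: V0.
  have m00 : mom x true 0 (0 : C -> C) = 0.
    have := mom_lin O true 0 (-1) H0 H0.
    by rewrite scaler0 addr0 mulN1r addNr.
  by rewrite (mom_lin O) // e2 mulr1 m00 addr0.
Qed.

Lemma ker0_image : L @` ker0 x `<=` ker0 x'.
Proof.
move=> _ [f [Hf f0] <-]; split; first exact: PF_H2 O _ Hf.
by move=> sg i _; rewrite (mom0_PF O Hf); exact: f0 true 0%N _.
Qed.

(** On the kernel the order-0 expansion reduces to its remainder, so the iterates are bounded by a
    constant times [eps], which decays faster than every exponential by hypothesis. *)
Lemma ker0_growth f : (forall mu, exists2 K, 0 <= K & forall n, eps rho t (mults c x) n <= K * ex mu n) ->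
  ker0 x f -> (limn_esup (growth (fun n => (H2norm rho (Lit rho c n f))%:E)) <= -oo)%E.
Proof.
move=> hb [Hf f0]; have pos n : (0 <= (H2norm rho (Lit rho c n f))%:E)%E.
  by rewrite lee_fin H2norm_ge0.
have [n0 /(_ 0%N)[K K0 hK]] := iter_norm_bound O.
have le_all (mu : R) : (limn_esup (growth (fun n => (H2norm rho (Lit rho c n f))%:E)) <= mu%:E)%E.
  have [K1 K10 hK1] := hb (mu - 1).
  have up n : (n0 <= n)%N -> ((H2norm rho (Lit rho c n f))%:E <=
      (K * (H2norm rho f * K1) * ex (mu - 1) n)%:E)%E.
    move=> hn; rewrite lee_fin; apply: le_trans (hK n f 0 hn Hf (lexx _) _) _.
      move=> sg m; rewrite leqn0 => /eqP ->.
      by rewrite tau0 mom0_sign (f0 true 0%N (leqnn _)) normc0.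
    rewrite add0r expr1 -mulrA; apply: (ler_wpM2l K0); rewrite -mulrA.
    by rewrite ler_wpM2l ?H2norm_ge0.
  have [N hN] := growth_le (e := 1) ltr01 pos up.
  apply: (@limn_esup_le_eventually _ _ _ N) => n hn.
  by have := hN n hn; rewrite subrK.
rewrite leeNy_eq; move: le_all; case: (limn_esup _) => [r||] // h.
  by have := h (r - 1); rewrite lee_fin; lra.
by have := h 0.
Qed.

End SpectrumB.

Lemma osel_linear {R : realType} (rho t : R) (c : nat -> bool) (x : nat -> R) (Lam : R) i :
  bl_orbit rho t c x -> rates rho t c x Lam -> linear_set (osel rho c x i).
Proof.
move=> O Q; have rho01 := orbit_rho O.
have [Z0 ZD] := H2_linear_set O; split.
  split=> // [sg m _|sg l _].
    by have := mom_lin O sg m (-1) Z0 Z0; rewrite scaler0 addr0 mulN1r addNr.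
  by have := ell_lin O Q sg l (-1) Z0 Z0; rewrite scaler0 addr0 mulN1r addNr.
move=> a f g [Hf f1 f2] [Hg g1 g2]; split; first exact: ZD.
  by move=> sg m im; rewrite (mom_lin O) // f1 // g1 // mulr0 addr0.
by move=> sg l li; rewrite (ell_lin O Q) // f2 // g2 // mulr0 addr0.
Qed.

(** * The case of infinitely many exponents *)

Section SpectrumA.
Context {R : realType}.
Local Notation C := R[i].
Implicit Types (f g : C -> C) (sg : bool) (i j k m n : nat).
Variables (rho t : R) (c : nat -> bool) (x : nat -> R) (Lam : R).
Hypothesis O : bl_orbit rho t c x.
Hypothesis Q : rates rho t c x Lam.
Local Notation c' := (fun n => c n.+1).
Local Notation x' := (fun n => x n.+1).
Local Notation L := (PF rho (blaschke (c 0))).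
Hypothesis Q' : rates rho t c' x' Lam.
Let rho01 : 0 < rho < 1 := orbit_rho O.
Let O' : bl_orbit rho t c' x' := orbit_shift O.
Let Lam0 : Lam < 0 := rate_lt0 Q.

Lemma ell_shift sg i f : H2 rho f ->
  ell c' x' sg i (L f) = (mults c x 0)%:C ^+ i * ell c x sg i f.
Proof.
move=> Hf; apply: (ell_eq O' Q' (PF_H2 O Hf)).
(* The shifted orbit is normalised without the first multiplier, which is where the factor in front
   of [ell] comes from. *)
have DE n : Dn c x n.+1 = mults c x 0 * Dn c' x' n by rewrite /Dn big_ord_recl.
have nE n : nmom c' x' sg i n (L f) = (mults c x 0)%:C ^+ i * nmom c x sg i n.+1 f.
  rewrite /nmom (tau_shift O) // DE (rmorphM (real_complex R) (mults c x 0) (Dn c' x' n)) exprMn.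
  have b0 : (mults c x 0)%:C ^+ i != 0 :> C.
    by rewrite expf_neq0 // realC_neq0 // gt_eqF // (mults_gt0 Q).
  have D0 := DnC_neq0 Q' n i.
  by move: (tau _ _ _ _ _ _) (_ ^+ i) (_ ^+ i) b0 D0 => y z u z0 u0; field; rewrite z0 u0.
have [n0 [K K0 [th th01 h]]] := ell_spec O Q i.
apply: eq_clim (fun n => esym (nE n)) _ => e e0.
have [N hN] := clim_lin ((mults c x 0)%:C ^+ i) (ell_clim O Q sg i Hf) (@clim_cst R 0) e0.
exists N => n hn; have := hN n.+1 (leqW hn).
by rewrite !addr0.
Qed.

Lemma osel_off i l sg f : osel rho c x i f -> l != i -> ell c x sg l f = 0.
Proof.
move=> [Hf fm fl]; rewrite neq_ltn => /orP[li|il]; first exact: fl.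
by have [_ h] := ell_mom O Q Hf (fm sg); exact: h.
Qed.

Lemma osel_mom i sg f : osel rho c x i f -> ell c x sg i f = mom x sg i f.
Proof. by move=> [Hf fm fl]; have [] := ell_mom O Q Hf (fm sg). Qed.


Lemma osel_vec i sg : (0 < i)%N -> exists2 v, osel rho c x i v &
  forall sg', ell c x sg' i v = (sg' == sg)%:R.
Proof.
move=> i0; have [v [Hv h1 h2 h3]] := exists_osel O Q sg i0; exists v.
  split=> // [sg' m im|sg' l li]; first by apply: h1; rewrite im.
  have [->|l0] := posnP l; first by rewrite (ell0 O Q) // h1 // eqxx !orbT.
  have [e|ne] := eqVneq sg' sg; first by rewrite e h3 // l0.
  have h m : (0 < m)%N -> mom x sg' m v = 0 by move=> _; apply: h1; rewrite ne orbT.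
  by have [_ h'] := ell_mom O Q Hv h; exact: h'.
move=> sg'; have [->|ne] := eqVneq sg' sg.
  have h m : (i < m)%N -> mom x sg m v = 0 by move=> im; apply: h1; rewrite im.
  by have [-> _] := ell_mom O Q Hv h.
have h m : (0 < m)%N -> mom x sg' m v = 0 by move=> _; apply: h1; rewrite ne orbT.
by have [_ h'] := ell_mom O Q Hv h; exact: h'.
Qed.

Lemma osel0E : osel rho c x 0 = osel0 rho x.
Proof. by apply/seteqP; split=> f [Hf f0] //; split. Qed.

Lemma ell0_sign sg f : H2 rho f -> ell c x sg 0 f = mom x true 0 f.
Proof. by move=> Hf; rewrite (ell0 O Q) // mom0_sign. Qed.

(** At order 0 both signs define the same form, hence the compatibility condition; at positive
    orders the two values are prescribed independently. *)
Lemma osel_surj i (al : bool -> C) : (i = 0%N -> al true = al false) ->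
  exists2 v, osel rho c x i v & forall sg, ell c x sg i v = al sg.
Proof.
have [Z0 ZD] := osel_linear i O Q.
have HZ : H2 rho 0 by case: (H2_linear_set O).
have e00 sg l : ell c x sg l (0 : C -> C) = 0.
  by have := ell_lin O Q sg l (-1) HZ HZ; rewrite scaler0 addr0 mulN1r addNr.
case: i Z0 ZD => [|i] Z0 ZD hal.
  have [e1 e2] := osel0_ebas O; rewrite -osel0E in e1.
  have He : H2 rho (ebas rho x 0) by case: e1.
  exists (al true *: ebas rho x 0 + 0); first exact: (ZD _ _ _ e1 Z0).
  move=> sg; rewrite (ell_lin O Q) // e00 ell0_sign // e2 mulr1 addr0.
  by case: sg => //; exact: hal.
have [v Vv hv] := osel_vec true (ltn0Sn i); have [u Vu hu] := osel_vec false (ltn0Sn i).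
have Hv : H2 rho v by case: Vv.
have Hu : H2 rho u by case: Vu.
have Hw : H2 rho (al false *: u + 0) by exact: H2_lin.
exists (al true *: v + (al false *: u + 0)); first exact: (ZD _ _ _ Vv (ZD _ _ _ Vu Z0)).
move=> sg; rewrite (ell_lin O Q sg i.+1 _ Hv Hw) (ell_lin O Q sg i.+1 _ Hu HZ) hv hu e00.
by case: sg; rewrite /= ?mulr1 ?mulr0 ?addr0 ?add0r.
Qed.

Definition mult i : nat := if i is 0 then 1 else 2.

Lemma osel_dim i : has_dim (osel rho c x i) (mult i).
Proof.
case: i => [|i]; first by rewrite osel0E; exact: osel0_dim O.
have [v Vv hv] := osel_vec true (ltn0Sn i); have [u Vu hu] := osel_vec false (ltn0Sn i).
pose sgn (a : 'I_2) : bool := a == ord0.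
apply: (@has_dim_dual _ _ _ 2 (fun a => if sgn a then v else u)
  (fun a f => ell c x (sgn a) i.+1 f)).
- exact: (osel_linear _ O Q).
- by move=> a; case: (sgn a).
- by move=> a b f g [Hf _ _] [Hg _ _]; exact: (ell_lin O Q).
- move=> a b; have -> : (a == b) = (sgn a == sgn b).
    by case: a b => [[|[|a]] ha] [[|[|b]] hb] //; rewrite /sgn -!val_eqE.
  by case: (sgn b); rewrite ?hv ?hu.
- move=> f Vf h; apply: (osel_zero O Q Vf) => sg.
  by case: sg; [exact: (h ord0)|exact: (h (lift ord0 ord0))].
Qed.

Lemma osel_PF i f : osel rho c x i f -> osel rho c' x' i (L f).
Proof.
move=> [Hf f1 f2]; split; first exact: (PF_H2 O Hf).
  move=> sg m im; have -> : mom x' sg m (L f) = tau c' x' sg m 0 (L f) by [].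
  by rewrite (tau_shift O) //; have [h _] := tau_mom O m 1 Hf (f1 sg); exact: h.
by move=> sg l li; rewrite ell_shift // f2 // mulr0.
Qed.

Lemma kerA_linear j : linear_set (kerset (H2 rho) (ell c x) j).
Proof.
apply: kerset_linear; first exact: (H2_linear_set O).
by move=> sg i a f g _ Hf Hg; exact: (ell_lin O Q).
Qed.

Lemma kerA_closed j : closed_in (H2 rho) (H2norm rho) (kerset (H2 rho) (ell c x) j).
Proof.
move=> u f hu Hf cu; split=> // sg i ij.
have [K K0 hK] := ell_bound O Q sg i.
apply: (functional_closed (u := u) O K0 _ hK _ Hf cu).
- by move=> a f1 f2 H1 H2'; exact: (ell_lin O Q).
- by move=> n; case: (hu n) => H1 h; split=> //; exact: h.
Qed.

Lemma kerA_splitting j : direct_sum (H2 rho) (osel rho c x) j (kerset (H2 rho) (ell c x) j).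
Proof.
apply: (@splitting _ _ (H2 rho) (osel rho c x) (ell c x) j).
- exact: (H2_linear_set O).
- by move=> i f _ [].
- by move=> sg i a f g _ Hf Hg; exact: (ell_lin O Q).
- by move=> i _; exact: (osel_linear _ O Q).
- by move=> i l sg f _ _; exact: osel_off.
- by move=> i f _; exact: (osel_zero O Q).
- move=> i f _ Hf; apply: osel_surj => i0.
  by rewrite i0 !ell0_sign.
Qed.

Lemma kerA_image j : L @` kerset (H2 rho) (ell c x) j `<=` kerset (H2 rho) (ell c' x') j.
Proof.
move=> _ [f [Hf f0] <-]; split; first exact: (PF_H2 O Hf).
by move=> sg i ij; rewrite ell_shift // f0 // mulr0.
Qed.

Lemma kerA_growth j f : kerset (H2 rho) (ell c x) j f ->
  (limn_esup (growth (fun n => (H2norm rho (Lit rho c n f))%:E)) <= (j.+1%:R * Lam)%:E)%E.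
Proof.
move=> [Hf f0]; have pos n : (0 <= (H2norm rho (Lit rho c n f))%:E)%E.
  by rewrite lee_fin H2norm_ge0.
apply/lee_addgt0Pr => e e0; have e2 : 0 < e / 2 by rewrite divr_gt0.
have mu1 : j.+1%:R * Lam < j.+1%:R * Lam + e / 2 by rewrite ltrDl.
have [K K0 hK] := H2_decay O Q Hf f0 mu1.
have up n : (0 <= n)%N -> ((H2norm rho (Lit rho c n f))%:E <=
    (K * ex (j.+1%:R * Lam + e / 2) n)%:E)%E by move=> _; rewrite lee_fin.
have [N hN] := growth_le e2 pos up.
apply: (@limn_esup_le_eventually _ _ _ N) => n hn.
by have := hN n hn; rewrite -addrA -splitr.
Qed.

(** The upper rate is [H2_decay], as all limit forms below order i vanish. For the lower one, some
    moment of order i is nonzero, and [tau_mom] evaluates the corresponding pairing exactly as this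
    moment times [Dn ^+ i], which [iter_mom_le] compares with the norm. *)
Lemma osel_growth i f : osel rho c x i f -> f <> 0 ->
  growth (fun n => (H2norm rho (Lit rho c n f))%:E) n @[n --> \oo] --> (i%:R * Lam)%:E.
Proof.
case: i => [|i] Vf f0.
  rewrite mul0r; rewrite osel0E in Vf; exact: (osel0_growth O Vf f0).
have pos n : (0 <= (H2norm rho (Lit rho c n f))%:E)%E by rewrite lee_fin H2norm_ge0.
have [Hf f1 f2] := Vf.
have /existsNP[sg fsg] : ~ forall sg, ell c x sg i.+1 f = 0.
  by move=> h; apply: f0; exact: (osel_zero O Q Vf h).
have [Kr Kr0 hKr] := iter_mom_le O.
apply: cvg_finite => e e0; have e2 : 0 < e / 2 by rewrite divr_gt0.
have mu1 : i.+1%:R * Lam < i.+1%:R * Lam + e / 2 by rewrite ltrDl.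
have [K K0 hK] := H2_decay O Q Hf f2 mu1.
have up n : (0 <= n)%N -> ((H2norm rho (Lit rho c n f))%:E <=
    (K * ex (i.+1%:R * Lam + e / 2) n)%:E)%E by move=> _; rewrite lee_fin.
have i1 : 0 < i.+1%:R :> R by rewrite ltr0n.
have nuL : Lam - e / 2 / i.+1%:R < Lam by rewrite gtrBl !divr_gt0.
have [K2 K20 hK2] := Dn_lower Q nuL.
have K2p : 0 < K2 + 1 by rewrite ltr_wpDl.
pose k := normc (mom x sg i.+1 f) / ((Kr + 1) * (K2 + 1) ^+ i.+1).
have k0 : 0 < k.
  rewrite divr_gt0 ?mulr_gt0 ?exprn_gt0 ?ltr_wpDl // normc_gt0.
  by rewrite -osel_mom //; apply/eqP.
have muE : i.+1%:R * Lam - e / 2 = i.+1%:R * (Lam - e / 2 / i.+1%:R).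
  by field; rewrite gt_eqF.
have low n : (0 <= n)%N -> ((k * ex (i.+1%:R * Lam - e / 2) n)%:E <=
    (H2norm rho (Lit rho c n f))%:E)%E.
  move=> _; rewrite lee_fin /k mulrAC ler_pdivrMr; last first.
    by rewrite mulr_gt0 ?exprn_gt0 // ltr_wpDl.
  have [_ /(_ (erefl _)) tE] := tau_mom O i.+1 n Hf (f1 sg).
  have h1 := hKr sg i.+1 n f Hf.
  have D0 := Dn_gt0 Q n.
  rewrite tE normcM normcX normc_realp ?(ltW D0) // in h1.
  have hD : ex (Lam - e / 2 / i.+1%:R) n <= (K2 + 1) * Dn c x n.
    have hn := hK2 n; have E0 := ex_gt0 (Lam - e / 2 / i.+1%:R) n.
    have -> : ex (Lam - e / 2 / i.+1%:R) n = (ex (- (Lam - e / 2 / i.+1%:R)) n)^-1.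
      by rewrite /ex mulNr expRN invrK.
    move: hn E0; move: (ex _ _) (ex_gt0 (- (Lam - e / 2 / i.+1%:R)) n) => y y0 hn _.
    have h2 : 1 <= K2 * y * Dn c x n by rewrite -(mulVf (lt0r_neq0 D0)) ler_wpM2r // ltW.
    rewrite -[leLHS]div1r ler_pdivrMr //.
    have -> : (K2 + 1) * Dn c x n * y = K2 * y * Dn c x n + Dn c x n * y by ring.
    by apply: le_trans h2 _; rewrite lerDl mulr_ge0 // ltW.
  rewrite muE -exX.
  apply: (@le_trans _ _ (normc (mom x sg i.+1 f) * ((K2 + 1) * Dn c x n) ^+ i.+1)).
    apply: ler_wpM2l; first exact: normc_ge0.
    apply: lerXn2r; [by rewrite nnegrE ex_ge0| |exact: hD].
    by rewrite nnegrE; apply: mulr_ge0; exact: ltW.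
  have -> : normc (mom x sg i.+1 f) * ((K2 + 1) * Dn c x n) ^+ i.+1 =
    (K2 + 1) ^+ i.+1 * (Dn c x n ^+ i.+1 * normc (mom x sg i.+1 f)) by rewrite exprMn; ring.
  have -> : H2norm rho (Lit rho c n f) * ((Kr + 1) * (K2 + 1) ^+ i.+1) =
    (K2 + 1) ^+ i.+1 * ((Kr + 1) * H2norm rho (Lit rho c n f)) by ring.
  apply: ler_wpM2l; first by rewrite exprn_ge0 // ltW.
  by apply: le_trans h1 _; rewrite ler_wpM2r ?H2norm_ge0 // lerDl.
have [N1 h1] := growth_le e2 pos up.
have [N2 h2] := growth_ge e2 k0 low.
exists (N1 + N2)%N => n hn; split.
  by have := h2 n (leq_trans (leq_addl _ _) hn); rewrite -addrA -opprD -splitr.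
by have := h1 n (leq_trans (leq_addr _ _) hn); rewrite -addrA -splitr.
Qed.

Lemma osel_image i : L @` osel rho c x i = osel rho c' x' i.
Proof.
apply/seteqP; split=> [_ [f Vf <-]|g Vg]; first exact: osel_PF.
pose b := (mults c x 0)%:C ^+ i.
have b0 : b != 0 by rewrite expf_neq0 // realC_neq0 // gt_eqF // (mults_gt0 Q).
have Hg : H2 rho g by case: Vg.
have [|f Vf hf] := @osel_surj i (fun sg => ell c' x' sg i g / b).
  move=> i0; have e sg : ell c' x' sg i g = mom x' true 0 g.
    by rewrite i0 (ell0 O' Q' sg Hg) mom0_sign.
  by rewrite !e.
exists f => //; have Hf : H2 rho f by case: Vf.
have VLf := osel_PF Vf; have HLf : H2 rho (L f) by case: VLf.
apply/eqP; rewrite -subr_eq0 addrC -scaleN1r; apply/eqP.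
apply: (osel_zero O' Q' (i := i)) => [|sg].
  have [Z0 ZD] := osel_linear i O' Q'; exact: ZD.
by rewrite (ell_lin O' Q' sg i (-1) Hg HLf) ell_shift // hf mulrCA mulfV // mulr1 mulN1r addNr.
Qed.

End SpectrumA.

(** * Ergodic theory of the Bernoulli shift *)

Section MaximalErgodic.
Context {d : measure_display} {T : measurableType d} {R : realType}.
Variables (P : probability T R) (s : T -> T).
Hypothesis ms : measurable_fun setT s.
Hypothesis Ps : forall A, measurable A -> P (s @^-1` A) = P A.
Hypothesis erg : forall A, measurable A -> s @^-1` A = A -> P A = 0%E \/ P A = 1%E.

Lemma integrable_comp_shift (f : T -> R) : P.-integrable setT (EFin \o f) ->
  P.-integrable setT (EFin \o (f \o s)).
Proof.
move=> /integrableP[mf fi]; apply/integrableP; split.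
  exact: measurableT_comp mf ms.
have mn : measurable_fun setT (fun x => `|(f x)%:E|%E) by exact: measurableT_comp.
have n0 : {in setT, forall y : T, (0 <= `|(f y)%:E|)%E} by move=> y _; exact: abse_ge0.
have := ge0_integral_pushforward ms P measurableT mn n0.
rewrite preimage_setT => /= <-; rewrite (@eq_measure_integral _ _ _ _ P) //.
by move=> A mA _; exact: Ps.
Qed.

Lemma integral_comp_shift A (f : T -> R) : measurable A -> s @^-1` A = A ->
  P.-integrable setT (EFin \o f) ->
  (\int[P]_(x in A) (f (s x))%:E = \int[P]_(x in A) (f x)%:E)%E.
Proof.
move=> mA iA fi; have fsi := integrable_comp_shift fi.
have mf : measurable_fun setT (EFin \o f) by case/integrableP: fi.
have fsA : P.-integrable (s @^-1` A) ((EFin \o f) \o s).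
  by rewrite iA; apply: (integrableS measurableT mA (@subsetT _ A)); exact: fsi.
have := integral_pushforward ms mf fsA mA.
rewrite iA /= => <-; apply: eq_measure_integral => B mB _; exact: Ps.
Qed.

Variable g : T -> R.
Hypothesis ig : P.-integrable setT (EFin \o g).

(* maximum of the Birkhoff sums of lengths 1, ..., n + 1 *)
Fixpoint maxsum n w : R := if n is n'.+1 then g w + Num.max 0 (maxsum n' (s w)) else g w.

Lemma maxsum_integrable n : P.-integrable setT (EFin \o maxsum n).
Proof.
elim: n => [//|n IH]; have h := integrable_comp_shift IH.
have mh : measurable_fun setT (maxsum n \o s) by apply/measurable_EFinP; case/integrableP: h.
have hm : P.-integrable setT (EFin \o (fun w => Num.max 0 (maxsum n (s w)))).
  apply: (le_integrable measurableT _ _ h).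
    by apply/measurable_EFinP; apply: measurable_maxr => //; exact: measurable_cst.
  move=> w _ /=; rewrite lee_fin; case: (leP 0 (maxsum n (s w))) => h0; first by [].
  by rewrite normr0.
have -> : EFin \o maxsum n.+1 = (EFin \o g) \+ (EFin \o (fun w => Num.max 0 (maxsum n (s w)))).
  by apply/funext => w /=; rewrite EFinD.
exact: (integrableD measurableT ig hm).
Qed.

Lemma maxsum_measurable n : measurable_fun setT (maxsum n).
Proof. by apply/measurable_EFinP; case/integrableP: (maxsum_integrable n). Qed.

Lemma maxsum_le n w : maxsum n w <= maxsum n.+1 w.
Proof.
elim: n w => [|n IH] w /=; first by rewrite lerDl le_max lexx.
rewrite lerD2l ge_max !le_max lexx /=; apply/orP; right; exact: IH.
Qed.

Lemma maxsum_mono n m w : (n <= m)%N -> maxsum n w <= maxsum m w.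
Proof.
elim: m => [|m IH]; first by rewrite leqn0 => /eqP ->.
by rewrite leq_eqVlt => /orP[/eqP->//|/IH h]; exact: le_trans h (maxsum_le _ _).
Qed.

Lemma sum_le_maxsum n w : \sum_(i < n.+1) g (iter i s w) <= maxsum n w.
Proof.
elim: n w => [|n IH] w; first by rewrite big_ord1.
rewrite big_ord_recl /= lerD2l.
under eq_bigr => i _ do rewrite -iterS iterSr.
by apply: le_trans (IH (s w)) _; rewrite le_max lexx orbT.
Qed.

(** The set [A] where the sums are unbounded above is invariant, hence null or of full measure. On
    [A] the differences [maxsum n.+1 w - maxsum n (s w)] converge to [g w], being equal to it once
    [maxsum n (s w)] is positive; by invariance and monotonicity their integrals are nonnegative.
    They are dominated by $|g| + |g\circ s|$, so full measure would contradict the negative mean. *)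
Theorem birkhoff_bounded : (\int[P]_x (g x)%:E < 0)%E ->
  {ae P, forall w, exists K, forall n, \sum_(i < n) g (iter i s w) <= K}.
Proof.
move=> gneg.
pose A := \bigcap_(k in [set: nat]) \bigcup_n (maxsum n @^-1` `]k%:R, +oo[%classic).
have AP w : A w <-> forall k : nat, exists n, k%:R < maxsum n w.
  split=> [h k|h k _]; last first.
    by have [n hn] := h k; exists n => //=; rewrite in_itv /= hn.
  by have [n _ /=] := h k I; rewrite in_itv /= andbT => hn; exists n.
have mA : measurable A.
  apply: bigcap_measurable => [|k _]; first by exists 0%N.
  apply: bigcupT_measurable => n; rewrite -[X in measurable X]setTI.
  by apply: maxsum_measurable => //; exact: measurable_itv.
have iA : s @^-1` A = A.
  apply/seteqP; split=> w /=.
    move=> /AP h; apply/AP => k; have [n hn] := h (Num.truncn `|k%:R - g w|).+1.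
    exists n.+1 => /=; have h1 := truncnS_gt `|k%:R - g w|.
    have h2 : k%:R - g w < maxsum n (s w).
      by apply: lt_trans hn; apply: le_lt_trans h1; exact: ler_norm.
    have h3 : maxsum n (s w) <= Num.max 0 (maxsum n (s w)) by rewrite le_max lexx orbT.
    lra.
  move=> /AP h; apply/AP => k; have [n hn] := h (Num.truncn (`|g w| + k%:R)).+1.
  have h1 := truncnS_gt (`|g w| + k%:R); have h2 := ler_norm (g w).
  have k0 : 0 <= k%:R :> R by [].
  clear gneg; case: n hn => [|n] /= hn; first by lra.
  exists n; rewrite ltNge; apply/negP => h4.
  have : Num.max 0 (maxsum n (s w)) <= k%:R by rewrite ge_max k0.
  lra.
have [PA0|PA1] := erg mA iA.
  exists A; split=> // w /= hw; apply/AP => k; apply: contrapT => hk.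
  apply: hw; exists k%:R => -[|n]; first by rewrite big_ord0.
  apply: le_trans (sum_le_maxsum n w) _; rewrite leNgt; apply/negP => h.
  by apply: hk; exists n.
exfalso.
have PAc : P (~` A) = 0%E by rewrite probability_setC // PA1 subee.
have gA : (\int[P]_x (g x)%:E = \int[P]_(x in A) (g x)%:E)%E.
  rewrite (negligible_integral (measurableC mA) measurableT ig PAc).
  by rewrite setTD setCK.
have igA (f : T -> R) : P.-integrable setT (EFin \o f) -> P.-integrable A (EFin \o f).
  by move=> fi; exact: (integrableS measurableT mA (@subsetT _ A) fi).
have is_ n := integrable_comp_shift (maxsum_integrable n).
pose f_ n : T -> \bar R := fun w => (maxsum n.+1 w - maxsum n (s w))%:E.
have mf_ n : measurable_fun A (f_ n).
  apply/measurable_EFinP; apply: measurable_funTS; apply: measurable_funB.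
    exact: maxsum_measurable.
  by apply/measurable_EFinP; case/integrableP: (is_ n).
have mg : measurable_fun A (EFin \o g) by case/integrableP: (igA _ ig).
have cvf : {ae P, forall x, A x -> f_ ^~ x @ \oo --> (EFin \o g) x}.
  apply: aeW => w; rewrite -{1}iA => /AP /(_ 0%N)[N hN].
  apply: cvg_near_cst; exists N => // n /= Nn; rewrite /f_ /=.
  have h : 0 < maxsum n (s w) by apply: lt_le_trans hN (maxsum_mono _ Nn).
  by rewrite (max_idPr (ltW h)) addrK.
have igs := integrable_comp_shift ig.
have idom : P.-integrable A (fun w => `|(g w)%:E| + `|(g (s w))%:E|)%E.
  have h1 := integrable_abse (igA _ ig); have h2 := integrable_abse (igA _ igs).
  exact: (integrableD mA h1 h2).
have dom : {ae P, forall x n, A x -> (`|f_ n x| <= `|(g x)%:E| + `|(g (s x))%:E|)%E}.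
  apply: aeW => w n _; rewrite /f_ /= lee_fin.
  have h := maxsum_mono (s w) (leq0n n); rewrite /= in h.
  have -> : g w + Num.max 0 (maxsum n (s w)) - maxsum n (s w) =
      g w + (Num.max 0 (maxsum n (s w)) - maxsum n (s w)) by ring.
  apply: le_trans (ler_normD _ _) _; rewrite lerD2l.
  case: (leP 0 (maxsum n (s w))) => h0; first by rewrite subrr normr0.
  rewrite sub0r normrN ltr0_norm //; apply: (@le_trans _ _ (- g (s w))).
    by rewrite lerN2.
  by rewrite -[leRHS]normrN ler_norm.
have [_ _ cv] := dominated_convergence mA mf_ mg cvf idom dom.
have pos n : (0 <= \int[P]_(x in A) f_ n x)%E.
  have e1 : (\int[P]_(x in A) f_ n x = \int[P]_(x in A) (maxsum n.+1 x)%:E -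
      \int[P]_(x in A) (maxsum n x)%:E)%E.
    rewrite -(integral_comp_shift mA iA (maxsum_integrable n)).
    by rewrite -(integralB_EFin mA (igA _ (maxsum_integrable n.+1)) (igA _ (is_ n))).
  rewrite e1 -(integralB_EFin mA (igA _ (maxsum_integrable n.+1)) (igA _ (maxsum_integrable n))).
  by apply: integral_ge0 => w _; rewrite -EFinB lee_fin subr_ge0 maxsum_le.
have : (0 <= \int[P]_(x in A) (EFin \o g) x)%E.
  rewrite -(cvg_lim _ cv) //; apply: lime_ge; first by apply/cvg_ex; eexists; exact: cv.
  by apply: nearW => n; exact: pos.
by rewrite -gA leNgt gneg.
Qed.

End MaximalErgodic.

(** * Invariance and ergodicity of the Bernoulli measure *)

Section ShiftErgodic.
Context {R : realType}.
Variables (p : R) (P : probability Omega2 R).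
Hypothesis p01 : 0 <= p <= 1.
Hypothesis hP : bernoulli_shift p P.

Definition cylinder (I : seq int) (a : int -> bool) : set Omega2 :=
  [set w : Omega2 | forall k, k \in I -> w k = a k].

Definition cylinders : set (set Omega2) :=
  [set A | A = set0 \/ exists I a, uniq I /\ A = cylinder I a].

Lemma measurable_coord (k : int) (a : bool) : measurable ([set w : Omega2 | w k = a] : set Omega2).
Proof. by apply: sub_sigma_algebra; exists k, a. Qed.

Lemma measurable_cylinder I a : measurable (cylinder I a).
Proof.
elim: I => [|k I IH].
  by rewrite (_ : cylinder _ _ = setT) //; apply/seteqP; split.
have -> : cylinder (k :: I) a = [set w : Omega2 | w k = a k] `&` cylinder I a.
  apply/seteqP; split=> [w h|w [h1 h2] l].
    by split=> [|l lI]; apply: h; rewrite inE ?eqxx // lI orbT.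
  by rewrite inE => /orP[/eqP ->//|]; exact: h2.
by apply: measurableI => //; exact: measurable_coord.
Qed.

Lemma cylinders_gen : @measurable _ Omega2 = <<s cylinders >>.
Proof.
apply/seteqP; split.
  apply: smallest_sub; first exact: smallest_sigma_algebra.
  move=> _ [k [a ->]]; apply: sub_sigma_algebra; right.
  exists [:: k], (fun=> a); split=> //; apply/seteqP; split=> w /=.
    by move=> h l; rewrite inE => /eqP ->.
  by move=> h; apply: h; rewrite inE.
apply: smallest_sub; first exact: sigma_algebra_measurable.
move=> _ [->|[I [a [_ ->]]]]; [exact: measurable0|exact: measurable_cylinder].
Qed.

Lemma cylindersI : setI_closed cylinders.
Proof.
move=> A B [->|[I [a [uI ->]]]]; first by rewrite set0I; left.
move=> [->|[J [b [uJ ->]]]]; first by rewrite setI0; left.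
have [h|h] := pselect (forall k, k \in I -> k \in J -> a k = b k); last first.
  left; apply/seteqP; split=> w //= -[wa wb]; apply: h => k kI kJ.
  by rewrite -(wa k kI) wb.
right; exists (undup (I ++ J)), (fun k => if k \in I then a k else b k).
split; first exact: undup_uniq.
apply/seteqP; split=> [w [wa wb] k|w wab].
  rewrite mem_undup mem_cat; case: ifP => [kI _|_ /=]; [exact: wa|exact: wb].
split=> k kI; first by have := wab k; rewrite mem_undup mem_cat kI /=; apply.
have := wab k; rewrite mem_undup mem_cat kI orbT => /(_ isT) ->.
by case: ifP => // kI'; exact: h.
Qed.

Lemma left_shift_measurable : measurable_fun setT left_shift.
Proof.
apply: (@measurability _ _ Omega2 Omega2 setT left_shift coord_sets) => //.
move=> _ [_ [k [a ->]] <-]; rewrite setTI.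
exact: (measurable_coord (k + 1) a).
Qed.

Lemma iter_shift n (w : Omega2) k : iter n left_shift w k = w (k + n%:Z).
Proof.
elim: n k => [|n IH] k /=; first by rewrite addr0.
by rewrite /left_shift IH; congr (w _); lia.
Qed.

Lemma iter_shift_measurable n : measurable_fun setT (iter n left_shift).
Proof.
elim: n => [|n IH]; first exact: measurable_id.
exact: measurableT_comp left_shift_measurable IH.
Qed.

Lemma iter_shift_cylinder n I a : iter n left_shift @^-1` cylinder I a =
  cylinder [seq k + n%:Z | k <- I] (fun k => a (k - n%:Z)).
Proof.
apply/seteqP; split=> w /= h k.
  by move=> /mapP[l lI ->]; rewrite addrK -iter_shift; exact: h.
move=> kI; rewrite iter_shift h ?addrK //; exact: (map_f (fun k => k + n%:Z) kI).
Qed.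

Lemma iter_shift_preserving n (A : set Omega2) : measurable A ->
  P (iter n left_shift @^-1` A) = P A.
Proof.
move=> mA; have mpre B : measurable B -> measurable (iter n left_shift @^-1` B).
  by move=> mB; rewrite -[X in measurable X]setTI; exact: iter_shift_measurable.
apply: (dynkin_induction cylinders_gen cylindersI (P := fun B => P (iter n left_shift @^-1` B) = P B)).
- by rewrite preimage_setT.
- move=> _ [->|[I [a [uI ->]]]]; first by rewrite preimage_set0.
  rewrite iter_shift_cylinder /cylinder !hP //; last first.
    by rewrite map_inj_uniq // => x y /addIr.
  rewrite big_map; congr (_%:E); apply: eq_bigr => k _; by rewrite addrK.
- by move=> S mS h; rewrite preimage_setC !probability_setC ?h //; exact: mpre.
- move=> F mF tF h; rewrite preimage_bigcup !measure_bigcup //.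
  + by apply: eq_eseriesr => k _; exact: h.
  + by move=> i _; exact: mpre.
  + by move=> i j _ _ [w [wi wj]]; apply: tF => //; exists (iter n left_shift w).
- by rewrite -cylinders_gen.
Qed.

Let q (A : set Omega2) : R := fine (P A).

Let qE A : measurable A -> P A = (q A)%:E.
Proof. by move=> mA; rewrite fineK // fin_num_measure. Qed.

Let q_ge0 A : 0 <= q A.
Proof. by rewrite fine_ge0. Qed.

Let qU A B : measurable A -> measurable B -> A `&` B = set0 -> q (A `|` B) = q A + q B.
Proof.
move=> mA mB AB; apply: EFin_inj; rewrite EFinD -!qE //; last exact: measurableU.
exact: measureU.
Qed.

Let q_le A B : measurable A -> measurable B -> A `<=` B -> q A <= q B.
Proof. by move=> mA mB AB; rewrite -lee_fin -!qE //; apply: le_measure; rewrite ?inE. Qed.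

Let qT : q setT = 1.
Proof. by rewrite /q probability_setT. Qed.

Let q_le1 A : measurable A -> q A <= 1.
Proof. by move=> mA; rewrite -qT; apply: q_le. Qed.

Section Approximation.
Variables (Phi : nat -> set Omega2 -> R) (c : R).
Hypothesis c01 : 0 <= c <= 1.
Hypothesis Phi_le : forall n X, measurable X -> 0 <= Phi n X <= q X.
Hypothesis PhiU : forall n X Y, measurable X -> measurable Y -> X `&` Y = set0 ->
  Phi n (X `|` Y) = Phi n X + Phi n Y.

Definition phi_cvg X := forall e : R, 0 < e -> exists N, forall n, (N <= n)%N ->
  `|Phi n X - c * q X| <= e.

Lemma phi_cvgU X Y : measurable X -> measurable Y -> X `&` Y = set0 ->
  phi_cvg X -> phi_cvg Y -> phi_cvg (X `|` Y).
Proof.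
move=> mX mY XY hX hY e e0; have e2 : 0 < e / 2 by rewrite divr_gt0.
have [N hN] := hX _ e2; have [M hM] := hY _ e2.
exists (N + M)%N => n hn; have h1 := hN n (leq_trans (leq_addr _ _) hn).
have h2 := hM n (leq_trans (leq_addl _ _) hn); rewrite PhiU // qU //.
have -> : Phi n X + Phi n Y - c * (q X + q Y) =
  (Phi n X - c * q X) + (Phi n Y - c * q Y) by ring.
by apply: le_trans (ler_normD _ _) _; rewrite [leRHS]splitr; exact: lerD.
Qed.

(** A Dynkin-class argument for finitely additive [Phi n]. In a countable union, the part beyond
    finitely many sets is negligible uniformly in n, because [Phi n] is dominated by the measure. *)
Lemma phi_cvg_all : (forall X, cylinders X -> phi_cvg X) ->
  forall X, measurable X -> phi_cvg X.
Proof.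
move=> hcyl X mX.
have cT : phi_cvg setT.
  apply: hcyl; right; exists [::], (fun=> true); split=> //.
  by apply/seteqP; split.
apply: (dynkin_induction cylinders_gen cylindersI (P := phi_cvg)) => //.
- move=> S mS hS e e0; have e2 : 0 < e / 2 by rewrite divr_gt0.
  have [N hN] := hS _ e2; have [M hM] := cT _ e2.
  exists (N + M)%N => n hn; have h1 := hN n (leq_trans (leq_addr _ _) hn).
  have h2 := hM n (leq_trans (leq_addl _ _) hn).
  have mCS := measurableC mS.
  have SS : S `|` ~` S = setT by exact: setUv.
  have S0 : S `&` ~` S = set0 by exact: setICr.
  rewrite -SS PhiU // qU // in h2.
  have -> : Phi n (~` S) - c * q (~` S) =
    (Phi n S + Phi n (~` S) - c * (q S + q (~` S))) - (Phi n S - c * q S) by ring.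
  by apply: le_trans (ler_normB _ _) _; rewrite [leRHS]splitr; exact: lerD.
- move=> F mF tF hF e e0; have e4 : 0 < e / 4 by rewrite divr_gt0.
  pose BK K := \big[setU/set0]_(k < K) F k; set B := \bigcup_k F k.
  have mB : measurable B by exact: bigcup_measurable.
  have mBK K : measurable (BK K) by exact: bigsetU_measurable.
  have qBK K : P (BK K) = (\sum_(0 <= k < K) P (F k))%E.
    rewrite big_mkord; apply: measure_bigsetU => //.
  have [K hK] : exists K, q B - q (BK K) <= e / 4.
    have cvB : (fun n => \sum_(0 <= i < n) P (F i))%E @ \oo --> P B.
      exact: (measure_sigma_additive (mu := P) mF tF).
    move: cvB; rewrite (qE mB) => /fine_cvgP[_ /cvgrPdist_le/(_ _ e4)[K _ /(_ K (leqnn K)) /= hK]].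
    exists K; rewrite /q qBK; exact: le_trans (ler_norm _) hK.
  have cBK : phi_cvg (BK K).
    elim: K {hK} => [|K IH].
      by rewrite /BK big_ord0; apply: hcyl; left.
    rewrite /BK big_ord_recr /=; apply: phi_cvgU => //; first exact: (mBK K).
    rewrite -(bigcup_mkord K F); apply/seteqP; split=> w //= -[[k kK wk] wK].
    have := tF k K I I; move/(_ (ex_intro _ w (conj wk wK))) => kE.
    by move: kK; rewrite kE /= ltnn.
  have BKB : BK K `<=` B.
    by rewrite /BK -(bigcup_mkord K F) => w [k _ wk]; exists k.
  have mD : measurable (B `\` BK K) by exact: measurableD.
  have BE : B = BK K `|` (B `\` BK K).
    apply/seteqP; split=> [w wB|w [/BKB//|[]//]].
    by have [h|h] := pselect (BK K w); [left|right].
  have D0 : BK K `&` (B `\` BK K) = set0.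
    by apply/seteqP; split=> w //= -[h [_]].
  have [N hN] := cBK _ e4; exists N => n hn; have h1 := hN n hn.
  have qB : q B = q (BK K) + q (B `\` BK K) by rewrite {1}BE qU.
  have PB : Phi n B = Phi n (BK K) + Phi n (B `\` BK K) by rewrite {1}BE PhiU.
  have h2 : q (B `\` BK K) <= e / 4 by move: hK; rewrite qB; lra.
  have /andP[h3 h4] := Phi_le n mD.
  have h5 : 0 <= c * q (B `\` BK K) <= e / 4.
    case/andP: c01 => c0 c1; rewrite mulr_ge0 //=; apply: le_trans h2.
    by rewrite ler_piMl.
  move: h1 h3 h4 h5 h2; rewrite qB PB; clear.
  move: (Phi n _) (Phi n _) (q (BK K)) (q _) => a b u v.
  rewrite !ler_norml => /andP[h1 h1'] h3 h4 /andP[h5 h5'] h2.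
  by rewrite mulrDr; apply/andP; split; lra.
- by rewrite -cylinders_gen.
Qed.

End Approximation.

Lemma cylinder_indep I a J b : uniq I -> uniq J -> exists N, forall n, (N <= n)%N ->
  q (cylinder I a `&` iter n left_shift @^-1` cylinder J b) = q (cylinder I a) * q (cylinder J b).
Proof.
move=> uI uJ.
(* Beyond this shift the two index sets are disjoint, and the product formula factorises. *)
exists (\max_(k <- I) absz k + \max_(k <- J) absz k).+1 => n hn.
pose J' := [seq k + n%:Z | k <- J].
have dis k : k \in I -> k \in J' -> False.
  move=> kI /mapP[l lJ kl].
  have h1 := @leq_bigmax_seq _ I xpredT absz k kI isT.
  have h2 := @leq_bigmax_seq _ J xpredT absz l lJ isT.
  by move: kl h1 h2 hn; lia.
have uJ' : uniq J' by rewrite map_inj_uniq // => x y /addIr.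
pose c k := if k \in I then a k else b (k - n%:Z).
rewrite iter_shift_cylinder.
have -> : cylinder I a `&` cylinder J' (fun k => b (k - n%:Z)) = cylinder (I ++ J') c.
  apply/seteqP; split=> [w [wa wb] k|w h].
    rewrite mem_cat /c; case: ifP => [kI _|_ /=]; [exact: wa|exact: wb].
  split=> k kI; have := h k; rewrite mem_cat kI ?orbT => /(_ isT) ->; rewrite /c ?kI //.
  by case: ifP => // kI'; case: (dis k).
have uIJ : uniq (I ++ J').
  rewrite cat_uniq uI uJ' andbT /=; apply/hasPn => k kJ; apply/negP => kI.
  exact: (dis k).
rewrite /q /cylinder !hP //= big_cat /=; congr (_ * _).
  by apply: eq_big_seq => k kI; rewrite /c kI.
rewrite big_map; apply: eq_big_seq => k kJ; rewrite /c addrK.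
have -> // : (k + n%:Z \in I) = false.
apply/negP => kI; apply: (dis (k + n%:Z)) => //.
exact: (map_f (fun k => k + n%:Z) kJ).
Qed.

(** Mixing, extended from cylinders in two rounds. First, for a fixed cylinder C, the measure of C
    intersected with the n-th preimage of B tends to the product; for B = A this shows that A is
    independent of C. The second round replaces C by A itself, whence $q(A) = q(A)^2$. *)
Lemma shift_ergodic A : measurable A -> left_shift @^-1` A = A -> P A = 0%E \/ P A = 1%E.
Proof.
move=> mA iA.
have inA n : iter n left_shift @^-1` A = A.
  by elim: n => // n IH; rewrite -[RHS]IH -[in RHS]iA.
have mpre n B : measurable B -> measurable (iter n left_shift @^-1` B).
  by move=> mB; rewrite -[X in measurable X]setTI; exact: iter_shift_measurable.
have q01 B : measurable B -> 0 <= q B <= 1 by move=> mB; rewrite q_ge0 q_le1.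
have h1 C : cylinders C -> forall e : R, 0 < e -> `|q (C `&` A) - q C * q A| <= e.
  move=> hC e e0.
  have mC : measurable C by rewrite cylinders_gen; exact: sub_sigma_algebra.
  have := @phi_cvg_all (fun n B => q (C `&` iter n left_shift @^-1` B)) (q C) (q01 _ mC).
  case/(_ _ _ _ A mA e e0).
  - move=> n X mX; rewrite q_ge0 /=; apply: le_trans (_ : q (iter n left_shift @^-1` X) <= _).
      by apply: q_le => //; [apply: measurableI => //; exact: mpre|exact: mpre].
    by rewrite /q iter_shift_preserving.
  - move=> n X Y mX mY XY; rewrite preimage_setU setIUr qU //.
    + by apply: measurableI => //; exact: mpre.
    + by apply: measurableI => //; exact: mpre.
    + apply/seteqP; split=> w //= -[[_ wX] [_ wY]].
      have : (X `&` Y) (iter n left_shift w) by [].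
      by rewrite XY.
  - move=> _ [->|[J [b [uJ ->]]]] e' e'0.
      exists 0%N => n _; rewrite preimage_set0 setI0 /q measure0 mulr0 subr0 normr0.
      exact: ltW.
    case: hC => [->|[I [a [uI ->]]]].
      by exists 0%N => n _; rewrite set0I /q measure0 mul0r subr0 normr0; exact: ltW.
    have [N hN] := cylinder_indep a b uI uJ.
    by exists N => n hn; rewrite hN // subrr normr0 ltW.
  by move=> N /(_ N (leqnn N)); rewrite inA.
have h2 e : 0 < e -> `|q (A `&` A) - q A * q A| <= e.
  move=> e0; have := @phi_cvg_all (fun n B => q (B `&` A)) (q A) (q01 _ mA).
  case/(_ _ _ _ A mA e e0).
  - by move=> n X mX; rewrite q_ge0 /=; apply: q_le => //; exact: measurableI.
  - move=> n X Y mX mY XY; rewrite setIUl qU //; [exact: measurableI|exact: measurableI|].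
    by rewrite setIACA XY set0I.
  - by move=> X hX e' e'0; exists 0%N => n _; rewrite [q A * _]mulrC; exact: h1.
  by move=> N /(_ N (leqnn N)).
have : `|q A - q A * q A| <= 0.
  by apply/ler_addgt0Pr => e e0; rewrite add0r; move: (h2 e e0); rewrite setIid.
rewrite normr_le0 subr_eq0 => /eqP hq.
have : q A * (1 - q A) == 0 by rewrite mulrBr mulr1 -hq subrr.
rewrite mulf_eq0 => /orP[/eqP h|]; first by left; rewrite qE // h.
by rewrite subr_eq0 => /eqP h; right; rewrite qE // -h.
Qed.

End ShiftErgodic.

(** * The random fixed point *)

Section PullbackPoint.
Context {R : realType}.
Implicit Types (w : Omega2) (y t rho : R) (e : bool) (n j k : nat).

Local Notation sh e := (@blaschke_shift R e).

Definition right_shift w : Omega2 := fun k : int => w (k - 1).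

Lemma right_shiftK w : right_shift (left_shift w) = w.
Proof. by apply/funext => k; rewrite /right_shift /left_shift subrK. Qed.

Lemma right_shift_measurable : measurable_fun setT right_shift.
Proof.
apply: (@measurability _ _ Omega2 Omega2 setT right_shift coord_sets) => //.
move=> _ [_ [k [a ->]] <-]; rewrite setTI.
exact: (measurable_coord (k - 1) a).
Qed.

Definition treal e y : R := mrad (sh e) y ^+ 2.

(* Approximation of the random fixed point by pulling back the point 0. *)
Fixpoint pullback n w : R :=
  if n is n'.+1 then treal (w (-1)) (pullback n' (right_shift w)) else 0.

Definition fixpt w : R := sup (range (pullback ^~ w)).

Definition bmul w : R := bmult (w 0) (fixpt w).

Lemma mrad_le2 e y y' : 0 <= y -> y <= y' -> mrad (sh e) y <= mrad (sh e) y'.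
Proof.
move=> y0 yy; have /andP[a0 a1] := @blaschke_shift01 R e; move: (sh e) a0 a1 => a a0 a1.
have y'0 := le_trans y0 yy.
have p1 : 0 < 1 + a * y by rewrite ltr_wpDr // mulr_ge0.
have p2 : 0 < 1 + a * y' by rewrite ltr_wpDr // mulr_ge0.
rewrite /mrad ler_pdivrMr // mulrAC ler_pdivlMr // -subr_ge0.
have -> : (y' + a) * (1 + a * y) - (y + a) * (1 + a * y') = (y' - y) * (1 - a ^+ 2) by ring.
by rewrite mulr_ge0 ?subr_ge0 // expr_le1 // ltW.
Qed.

Lemma mrad_ge0 e y : 0 <= y -> 0 <= mrad (sh e) y.
Proof.
move=> y0; have a01 := @blaschke_shift01 R e; have /andP[a0 _] := a01.
exact: le_trans a0 (mrad_ge a01 y0).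
Qed.

Lemma treal_mono e y y' : 0 <= y -> y <= y' -> treal e y <= treal e y'.
Proof.
move=> y0 yy; rewrite /treal lerXn2r ?nnegrE ?mrad_ge0 ?mrad_le2 //.
exact: le_trans yy.
Qed.

Lemma treal_ge0 e y : 0 <= treal e y.
Proof. exact: sqr_ge0. Qed.

Lemma pullback_ge0 n w : 0 <= pullback n w.
Proof. by case: n => [|n] //=; exact: treal_ge0. Qed.

Lemma pullbackS n w : pullback n w <= pullback n.+1 w.
Proof.
elim: n w => [|n IH] w; first exact: pullback_ge0.
exact: treal_mono (pullback_ge0 _ _) (IH _).
Qed.

Lemma pullback_nd w : nondecreasing_seq (pullback ^~ w).
Proof. by apply/nondecreasing_seqP => n; exact: pullbackS. Qed.

Lemma pullback_lt1 n w : pullback n w < 1.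
Proof.
elim: n w => [|n IH] w /=; first exact: ltr01.
have h0 := pullback_ge0 n (right_shift w).
have h : 0 <= pullback n (right_shift w) < 1 by rewrite h0 IH.
by rewrite /treal exprn_ilt1 ?mrad_ge0 // mrad_lt1 // blaschke_shift01.
Qed.

Lemma pullback_ub w : has_ubound (range (pullback ^~ w)).
Proof. by exists 1 => _ [n _ <-]; exact: ltW (pullback_lt1 n w). Qed.

Lemma pullback_cvg w : pullback n w @[n --> \oo] --> fixpt w.
Proof. exact: nondecreasing_cvgn (pullback_nd w) (pullback_ub w). Qed.

Lemma fixpt_ge n w : pullback n w <= fixpt w.
Proof. by apply: ub_le_sup; [exact: pullback_ub|exists n]. Qed.

Lemma fixpt_ge0 w : 0 <= fixpt w.
Proof. exact: (fixpt_ge 0 w). Qed.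

Lemma fixpt_le w y : (forall n, pullback n w <= y) -> fixpt w <= y.
Proof.
move=> h; apply: ge_sup; first by exists (pullback 0 w), 0%N.
by move=> _ [n _ <-].
Qed.

Lemma mrad_cvg (u : nat -> R) e y : 0 <= y -> u n @[n --> \oo] --> y ->
  mrad (sh e) (u n) @[n --> \oo] --> mrad (sh e) y.
Proof.
move=> y0 uy; have /andP[a0 _] := @blaschke_shift01 R e; move: (sh e) a0 => a a0.
have h1 : u n + a @[n --> \oo] --> y + a by exact: (cvgD uy (cvg_cst _)).
have h2 : 1 + a * u n @[n --> \oo] --> 1 + a * y.
  exact: (cvgD (cvg_cst _) (cvgM (cvg_cst _) uy)).
have d0 : 1 + a * y != 0 by rewrite gt_eqF // ltr_wpDr // mulr_ge0.
exact: (cvgM h1 (cvgV d0 h2)).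
Qed.

Lemma bmult_cvg (u : nat -> R) e y : 0 <= y -> u n @[n --> \oo] --> y ->
  bmult e (u n) @[n --> \oo] --> bmult e y.
Proof.
move=> y0 uy; have h := mrad_cvg (e := e) y0 uy; rewrite /bmult.
have h2 : 1 + mrad (sh e) (u n) ^+ 2 @[n --> \oo] --> 1 + mrad (sh e) y ^+ 2.
  exact: (cvgD (cvg_cst _) (cvgM h h)).
have d0 : 1 + mrad (sh e) y ^+ 2 != 0 by rewrite gt_eqF // ltr_wpDr // sqr_ge0.
exact: (cvgM (cvgM (cvg_cst _) h) (cvgV d0 h2)).
Qed.

Lemma fixptS w : fixpt (left_shift w) = treal (w 0) (fixpt w).
Proof.
have h : pullback n.+1 (left_shift w) @[n --> \oo] --> treal (w 0) (fixpt w).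
  have hn := mrad_cvg (e := w 0) (fixpt_ge0 w) (@pullback_cvg w).
  rewrite (_ : (fun n => _) = fun n => mrad (sh (w 0)) (pullback n w) * mrad (sh (w 0)) (pullback n w)).
    exact: (cvgM hn hn).
  by apply/funext => n; rewrite /= right_shiftK {1}/left_shift addNr.
have h' : pullback n.+1 (left_shift w) @[n --> \oo] --> fixpt (left_shift w).
  by rewrite (cvg_shiftS (pullback ^~ (left_shift w))); exact: pullback_cvg.
exact: (cvg_unique _ h' h).
Qed.

(** Each approximation depends on finitely many symbols, so the preimage of an arbitrary set is
    measurable, and no regularity of [treal] or [bmult] has to be invoked. *)
Lemma pullback_preimage n (Y : set R) : measurable (pullback n @^-1` Y : set Omega2).
Proof.
elim: n Y => [|n IH] Y.
  have [h|h] := pselect (Y 0).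
    by rewrite (_ : _ @^-1` _ = setT) //; apply/seteqP; split.
  by rewrite (_ : _ @^-1` _ = set0) //; apply/seteqP; split.
have mr e : measurable ((fun w => pullback n (right_shift w)) @^-1` (treal e @^-1` Y) : set Omega2).
  rewrite (_ : _ @^-1` _ = right_shift @^-1` (pullback n @^-1` (treal e @^-1` Y))) //.
  by rewrite -[X in measurable X]setTI; exact: right_shift_measurable.
rewrite (_ : _ @^-1` _ =
  ([set w : Omega2 | w (-1) = true] `&` ((fun w => pullback n (right_shift w)) @^-1` (treal true @^-1` Y)))
  `|` ([set w : Omega2 | w (-1) = false] `&` ((fun w => pullback n (right_shift w)) @^-1` (treal false @^-1` Y)))).
  by apply: measurableU; apply: measurableI => //; exact: measurable_coord.
apply/seteqP; split=> w /=.
  by case E : (w (-1)) => h; [left|right].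
by case=> -[-> h].
Qed.

Lemma bmul_measurable : measurable_fun setT bmul.
Proof.
apply: (@measurable_fun_cvg _ _ _ setT (fun n w => bmult (w 0) (pullback n w))) => [n|w _].
  move=> _ Y mY; rewrite setTI.
  have mr e : measurable (pullback n @^-1` (bmult e @^-1` Y) : set Omega2) by exact: pullback_preimage.
  rewrite (_ : _ @^-1` _ =
    ([set w : Omega2 | w 0 = true] `&` (pullback n @^-1` (bmult true @^-1` Y)))
    `|` ([set w : Omega2 | w 0 = false] `&` (pullback n @^-1` (bmult false @^-1` Y)))).
    by apply: measurableU; apply: measurableI => //; exact: measurable_coord.
  apply/seteqP; split=> w /=.
    by case E : (w 0) => h; [left|right].
  by case=> -[-> h].
exact: (@bmult_cvg (pullback ^~ w) (w 0) _ (fixpt_ge0 w) (@pullback_cvg w)).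
Qed.

Section Good.
Variables (rho t : R).
Hypothesis rho01 : 0 < rho < 1.
Hypothesis t01 : 0 < t < rho.

(** Quantified over all integers: the past symbols determine the fixed point and the future ones the
    operators along the orbit. *)
Definition good w := forall k : int,
  mrad (sh (w k)) rho ^+ 2 < rho /\ mrad (sh (w k)) rho ^+ 2 <= t.

Lemma good_left w : good w -> good (left_shift w).
Proof. by move=> h k; exact: h. Qed.

Lemma good_right w : good w -> good (right_shift w).
Proof. by move=> h k; exact: h. Qed.

Lemma good_iter n w : good w -> good (iter n left_shift w).
Proof. by move=> h; elim: n => //= n; exact: good_left. Qed.

Lemma fixpt_le_t w : good w -> fixpt w <= t.
Proof.
have /andP[t0 tr] := t01.
move=> gw; apply: fixpt_le => n; elim: n w gw => [|n IH] w gw /=; first exact: ltW.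
have [_ h] := gw (-1); apply: le_trans h.
apply: treal_mono (pullback_ge0 _ _) _.
by apply: le_trans (IH _ (good_right gw)) (ltW tr).
Qed.

Definition cseq w n : bool := iter n left_shift w 0.
Definition xseq w n : R := fixpt (iter n left_shift w).

Lemma good_orbit w : good w -> bl_orbit rho t (cseq w) (xseq w).
Proof.
move=> gw; split=> // n.
- by have [] := good_iter n gw 0.
- by rewrite fixpt_ge0 fixpt_le_t //; exact: good_iter.
- by rewrite /xseq /= fixptS.
Qed.

Lemma mults_bmul w n : mults (cseq w) (xseq w) n = bmul (iter n left_shift w).
Proof. by []. Qed.

(** Runs are read backwards from position 0, since the symbols at nonpositive positions determine
    [fixpt (left_shift w)]. *)
Definition run j : set Omega2 := cylinder [seq - k%:Z | k <- iota 0 j] (fun=> false).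

(* [- ln (bmul w)] is comparable to the limit of [weight j w] *)
Definition weight j w : R := 1 + \sum_(k < j) 2 ^+ k * \1_(run k.+1) w.

Lemma runS j w : run j.+1 w <-> run j w /\ w (- j%:Z) = false.
Proof.
rewrite /run /cylinder -addn1 iotaD map_cat /=; split=> [h|[h1 h2] k].
  split=> [k kj|]; apply: h; rewrite mem_cat ?kj //= inE eqxx orbT //.
by rewrite mem_cat /= inE => /orP[/h1//|/eqP ->].
Qed.

Lemma run_mono j k w : (j <= k)%N -> run k w -> run j w.
Proof.
elim: k => [|k IH]; first by rewrite leqn0 => /eqP ->.
by rewrite leq_eqVlt => /orP[/eqP->//|/IH h] /runS[/h].
Qed.

Lemma weight_run j w : run j w -> weight j w = 2 ^+ j.
Proof.
elim: j => [_|j IH rj]; first by rewrite /weight big_ord0 addr0 expr0.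
have [rj' _] := (runS j w).1 rj.
rewrite /weight big_ord_recr /= addrA -/(weight j w) IH // indicE mem_set //=.
by rewrite mulr1 exprS; ring.
Qed.

Lemma weight_stop j m w : run j w -> ~ run j.+1 w -> (j <= m)%N -> weight m w = 2 ^+ j.
Proof.
move=> rj nrj; elim: m => [|m IH].
  by rewrite leqn0 => /eqP j0; rewrite j0 in rj *; exact: weight_run.
rewrite leq_eqVlt => /orP[/eqP <-|jm]; first exact: weight_run.
rewrite /weight big_ord_recr /= addrA -/(weight m w) IH // indicE memNset ?mulr0 ?addr0 //.
by move=> h; apply: nrj; exact: run_mono h.
Qed.

Lemma run_shift j w : run j.+1 (left_shift w) <-> run j w /\ w 1 = false.
Proof.
clear t01 rho01.
split.
  move=> h; split.
    move=> k /mapP[l]; rewrite mem_iota add0n /= => lj ->.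
    have := h (- l.+1%:Z); rewrite /left_shift.
    have -> : - l.+1%:Z + 1 = - l%:Z :> int by lia.
    by apply; apply/mapP; exists l.+1 => //; rewrite mem_iota add0n /= ltnS.
  by have := h 0; apply; apply/mapP; exists 0%N => //; rewrite mem_iota.
move=> [h h1] k /mapP[l]; rewrite mem_iota add0n /= => lj ->; rewrite /left_shift.
case: l lj => [|l] lj; first by rewrite oppr0 add0r.
have -> : - l.+1%:Z + 1 = - l%:Z :> int by lia.
by apply: h; apply/mapP; exists l => //; rewrite mem_iota add0n.
Qed.

Lemma right_shiftKV w : left_shift (right_shift w) = w.
Proof. by apply/funext => k; rewrite /right_shift /left_shift addrK. Qed.

Lemma run_right j w : run j.+1 w -> run j (right_shift w) /\ w 0 = false.
Proof.
clear t01 rho01.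
rewrite -{1}(right_shiftKV w) => /run_shift[h1 h2]; split.
  exact: h1.
exact: h2.
Qed.

Lemma treal_false y : treal false y = y ^+ 2.
Proof. by rewrite /treal /mrad /= addr0 mul0r addr0 divr1. Qed.

(** Each symbol 0 squares the moving point, and before the run that point is at most [t]. *)
Lemma fixpt_run_le j w : good w -> run j w -> fixpt (left_shift w) <= t `^ (2 ^+ j).
Proof.
have /andP[t0 tr] := t01.
elim: j w => [|j IH] w gw.
  by move=> _; rewrite expr0 powRr1 ?(ltW t0) //; exact: fixpt_le_t (good_left gw).
move=> /run_right[h1 h2]; rewrite fixptS h2 treal_false.
have := IH _ (good_right gw) h1; rewrite right_shiftKV => h.
apply: (@le_trans _ _ ((t `^ (2 ^+ j)) ^+ 2)).
  by rewrite lerXn2r ?nnegrE ?fixpt_ge0 ?powR_ge0.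
by rewrite -powR_mulrn ?powR_ge0 // -powRrM -exprSr.
Qed.

(** The run is preceded by a symbol 1, whose map sends every point of $[0,1)$ to at least $(1/4)^2$;
    hence the base 1/16, squared at each 0 of the run. *)
Lemma fixpt_run_ge j w : run j w -> ~ run j.+1 w ->
  16^-1 `^ (2 ^+ j) <= fixpt (left_shift w).
Proof.
clear t01 rho01.
elim: j w => [|j IH] w.
  move=> _ nr; have w0 : w 0 = true.
    case E : (w 0) => //; exfalso; apply: nr; apply/runS; split=> //.
  rewrite expr0 powRr1 ?invr_ge0 // fixptS w0 /treal.
  have := mrad_ge (@blaschke_shift01 R true) (fixpt_ge0 w) => h.
  have -> : 16^-1 = sh true ^+ 2 :> R by rewrite /blaschke_shift exprVn -natrX.
  by rewrite lerXn2r ?nnegrE ?mrad_ge0 ?fixpt_ge0 //; case/andP: (@blaschke_shift01 R true).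
move=> rj nrj; have [h1 h2] := run_right rj.
have nr : ~ run j.+1 (right_shift w).
  move=> h; apply: nrj; rewrite -(right_shiftKV w); apply/run_shift; split.
    exact: h.
  exact: h2.
have := IH _ h1 nr; rewrite right_shiftKV => h.
rewrite fixptS h2 treal_false.
apply: le_trans (_ : (16^-1 `^ (2 ^+ j)) ^+ 2 <= _).
  by rewrite -(powR_mulrn 2 (powR_ge0 _ _)) -powRrM -exprSr.
by rewrite lerXn2r ?nnegrE ?fixpt_ge0 ?powR_ge0.
Qed.

Lemma bmul_le w : bmul w <= 2 * mrad (sh (w 0)) (fixpt w).
Proof.
rewrite /bmul /bmult; have h := mrad_ge0 (w 0) (fixpt_ge0 w).
rewrite ler_pdivrMr ?ltr_wpDr ?sqr_ge0 //; apply: ler_peMr; first exact: mulr_ge0.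
by rewrite lerDl sqr_ge0.
Qed.

Lemma bmul_ge w : mrad (sh (w 0)) (fixpt w) <= bmul w.
Proof.
rewrite /bmul /bmult; have h := mrad_ge0 (w 0) (fixpt_ge0 w).
have h1 : mrad (sh (w 0)) (fixpt w) ^+ 2 <= 1.
  rewrite -/(treal (w 0) (fixpt w)) -fixptS.
  by apply: fixpt_le => n; exact: ltW (pullback_lt1 n _).
rewrite ler_pdivlMr ?ltr_wpDr ?sqr_ge0 // [2 * _]mulrC ler_wpM2l //.
by rewrite -[2]/(1 + 1) lerD2l.
Qed.

End Good.
End PullbackPoint.

(** * Growth rates and the Lyapunov spectrum *)

Section RatesOfBirkhoff.
Context {R : realType}.
Variables (rho t : R) (c : nat -> bool) (x : nat -> R).
Hypothesis O : bl_orbit rho t c x.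

Lemma prod_max_le (d mu K : R) : 0 < d ->
  (forall n, \sum_(i < n) (ln (Num.max (mults c x i) d) - mu) <= K) ->
  forall n, \prod_(i < n) Num.max (mults c x i) d <= expR K * ex mu n.
Proof.
move=> d0 h n; have mp i : 0 < Num.max (mults c x i) d by rewrite lt_max d0 orbT.
have -> : \prod_(i < n) Num.max (mults c x i) d =
    expR (\sum_(i < n) ln (Num.max (mults c x i) d)).
  by rewrite expR_sum; apply: eq_bigr => i _; rewrite lnK ?posrE.
rewrite /ex -expRD ler_expR -lerBlDr; have := h n.
by rewrite sumrB sumr_const card_ord mulr_natr.
Qed.

Lemma geometric_sum_le (q : R) n : 0 <= q < 1 -> \sum_(i < n) q ^+ i <= (1 - q)^-1.
Proof.
move=> /andP[q0 q1]; have h := subrX1 q n; have q1' : 0 < 1 - q by rewrite subr_gt0.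
rewrite -[leRHS]mul1r ler_pdivlMr //; have := exprn_ge0 n q0.
move: h; move: (\sum_(i < n) _) (q ^+ n) => S T h T0; lra.
Qed.

(** A factor of [eps] is at most [max b d] times $1 + q^i/d \le e^{q^i/d}$, and the product of these
    corrections is bounded by a geometric series. The floor [d] is what permits dividing by a
    multiplier that may be 0. *)
Lemma eps_of_max (d mu K : R) : 0 < d ->
  (forall n, \sum_(i < n) (ln (Num.max (mults c x i) d) - mu) <= K) ->
  exists2 K', 0 <= K' & forall n, eps rho t (mults c x) n <= K' * ex mu n.
Proof.
move=> d0 h; have /andP[q0 q1] := qap01 O; set q := qap rho t in q0 q1.
have k0 : 0 <= kap rho t.
  by have := eps_ge0 O 0; rewrite /eps big_ord0 mulr1.
pose B := expR (d^-1 * (1 - q)^-1).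
exists (kap rho t * (expR K * B)) => [|n].
  exact: mulr_ge0 k0 (mulr_ge0 (expR_ge0 _) (expR_ge0 _)).
have -> : kap rho t * (expR K * B) * ex mu n = kap rho t * (expR K * ex mu n * B) by ring.
rewrite /eps; apply: ler_wpM2l => //.
apply: (@le_trans _ _ (\prod_(i < n) (Num.max (mults c x i) d * expR (d^-1 * q ^+ i)))).
  apply: ler_prod => i _; rewrite min_qap_ge0 //= ge_min; apply/orP; right.
  have /andP[b0 _] := mults01 O i; have qi := exprn_ge0 i (ltW q0).
  have e1 := expR_ge1Dx (d^-1 * q ^+ i).
  have m1 : mults c x i <= Num.max (mults c x i) d by rewrite le_max lexx.
  have m2 : d <= Num.max (mults c x i) d by rewrite le_max lexx orbT.
  apply: le_trans (_ : Num.max (mults c x i) d * (1 + d^-1 * q ^+ i) <= _); last first.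
    by rewrite ler_wpM2l // (le_trans b0).
  rewrite mulrDr mulr1 lerD // mulrA ler_peMl // ler_pdivlMr // mul1r //.
rewrite big_split /= -expR_sum; apply: ler_pM.
- by apply: prodr_ge0 => i _; rewrite le_max (ltW d0) orbT.
- exact: expR_ge0.
- exact: prod_max_le.
rewrite ler_expR -mulr_sumr ler_wpM2l ?invr_ge0 ?(ltW d0) //.
by apply: geometric_sum_le; rewrite (ltW q0).
Qed.

End RatesOfBirkhoff.

Section RandomRates.
Context {R : realType}.
Variables (p : R) (P : probability Omega2 R) (rho : R).
Hypothesis p01 : 0 <= p <= 1.
Hypothesis hP : bernoulli_shift p P.
Hypothesis rho01 : 0 < rho < 1.
Local Notation sh e := (@blaschke_shift R e).
Implicit Types (w : Omega2) (j k m n J : nat).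

Lemma ae_shift n (Q : Omega2 -> Prop) : {ae P, forall w, Q w} ->
  {ae P, forall w, Q (iter n left_shift w)}.
Proof.
move=> [A [mA A0 h]]; exists (iter n left_shift @^-1` A); split.
- by rewrite -[X in measurable X]setTI; exact: iter_shift_measurable.
- by rewrite (iter_shift_preserving p01 hP n mA).
- by move=> w hw; exact: (h (iter n left_shift w)).
Qed.

Lemma ae_and (Q Q' : Omega2 -> Prop) : {ae P, forall w, Q w} -> {ae P, forall w, Q' w} ->
  {ae P, forall w, Q w /\ Q' w}.
Proof. by move=> h h'; apply: filterS2 h h' => w; exact: conj. Qed.

Lemma ae_nonempty (Q : Omega2 -> Prop) : {ae P, forall w, Q w} -> exists w, Q w.
Proof.
move=> [A [mA A0 h]]; apply: contrapT => hn.
have E : A = setT.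
  by apply/seteqP; split=> // w _; apply: h => /= hw; apply: hn; exists w.
by move: A0; rewrite E probability_setT => /eqP; rewrite onee_eq0.
Qed.

Lemma prob_coord (k : int) (c : bool) :
  P [set w : Omega2 | w k = c] = (if c then 1 - p else p)%:E.
Proof.
have := @hP [:: k] (fun=> c) isT; rewrite big_seq1 => <-; congr (P _).
apply/seteqP; split=> w /=; first by move=> h l; rewrite inE => /eqP ->.
by apply; rewrite inE.
Qed.

Lemma rmax_ge c : mrad (sh c) rho ^+ 2 <= rmax (@blaschke R c) rho.
Proof.
have /andP[r0 r1] := rho01; have /andP[a0 a1] := @blaschke_shift01 R c.
have na : `|sh c| < 1 by rewrite ger0_norm.
apply: ub_le_sup.
  exists 1 => _ [z zr <-]; rewrite blaschkeE /tee normcX exprn_ile1 ?normc_ge0 //.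
  by apply: mob_le1 => //; rewrite zr ltW.
exists rho%:C; first exact: normc_realp (ltW r0).
rewrite blaschkeE /tee normcX; congr (_ ^+ 2).
have -> : mob (sh c) rho%:C = (mrad (sh c) rho)%:C.
  by rewrite /mob /mrad rmorphM fmorphV !rmorphD rmorphM rmorph1.
by rewrite normc_realp // ltW // mrad_gt0.
Qed.

(** The essential supremum only concerns symbols of positive probability. A symbol violating the
    bound has probability 0 at position 0, hence at every position. *)
Lemma ae_symbols : (r_ess P rho < rho%:E)%E ->
  {ae P, forall w, forall k : int, mrad (sh (w k)) rho ^+ 2 < rho}.
Proof.
move=> hr.
have h0 : {ae P, forall w, mrad (sh (w 0)) rho ^+ 2 < rho}.
  have := ess_sup_ge P (fun w : Omega2 => (rmax (blaschke (w 0)) rho)%:E).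
  apply: filterS => w h; rewrite -lte_fin; apply: le_lt_trans (le_lt_trans h hr).
  by rewrite lee_fin rmax_ge.
have hc (c : bool) (k : int) : {ae P, forall w, w k = c -> mrad (sh c) rho ^+ 2 < rho}.
  have [hc|hc] := pselect (mrad (sh c) rho ^+ 2 < rho); first exact: aeW.
  exists [set w : Omega2 | w k = c]; split; first exact: measurable_coord.
    have [A [mA A0 hA]] := h0; apply/eqP.
    rewrite prob_coord -(prob_coord 0 c) -measure_le0 -A0.
    apply: le_measure; rewrite ?inE //; first exact: measurable_coord.
    by move=> w /= wc; apply: hA => /=; rewrite wc.
  by move=> w /= hw; apply: contrapT => wc; apply: hw => /wc.
have hk (k : int) : {ae P, forall w, mrad (sh (w k)) rho ^+ 2 < rho}.
  apply: filterS2 (hc true k) (hc false k) => w h1 h2.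
  by case E : (w k); [exact: h1|exact: h2].
have h1 := ae_foralln (fun n : nat => hk n%:Z).
have h2 := ae_foralln (fun n : nat => hk (- n%:Z)).
apply: filterS2 h1 h2 => w h1 h2 [k|k]; first exact: h1.
by rewrite NegzE; exact: h2.
Qed.

Lemma ae_good : (r_ess P rho < rho%:E)%E ->
  exists2 t, 0 < t < rho & {ae P, forall w, good rho t w}.
Proof.
move=> hr; have /andP[r0 r1] := rho01.
(* The value [rho / 2] is a default for a symbol that violates the bound and almost surely never
   occurs. *)
pose u c := if mrad (sh c) rho ^+ 2 < rho then mrad (sh c) rho ^+ 2 else rho / 2.
have u0 c : 0 < u c.
  have /andP[a0 _] := @blaschke_shift01 R c.
  by rewrite /u; case: ifP => _; [rewrite exprn_gt0 // mrad_gt0|rewrite divr_gt0].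
have ur c : u c < rho by rewrite /u; case: ifP => // _; lra.
exists (Num.max (u false) (u true)).
  by rewrite lt_max u0 /= gt_max !ur.
apply: filterS (ae_symbols hr) => w h k; split; first exact: h.
have -> : mrad (sh (w k)) rho ^+ 2 = u (w k) by rewrite /u h.
by rewrite le_max; case: (w k); rewrite lexx ?orbT.
Qed.

Lemma integral_const (a : R) : (\int[P]_w cst a%:E w = a%:E)%E.
Proof.
apply: etrans (integral_cst P measurableT a%:E) _.
exact: etrans (congr1 (mule a%:E) (@probability_setT _ _ _ P)) (mule1 _).
Qed.

Lemma measurable_run j : measurable (run j).
Proof. exact: measurable_cylinder. Qed.

Lemma prob_run j : P (run j) = (p ^+ j)%:E.
Proof.
rewrite /run /cylinder hP; last first.
  by rewrite map_inj_uniq ?iota_uniq // => a b /oppr_inj[].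
by rewrite big_map /= big_const_seq count_predT size_iota iter_mulr mulr1.
Qed.

Lemma integral_weight J (a c : R) :
  P.-integrable setT (EFin \o (fun w => a + c * weight J w)) /\
  (\int[P]_w (a + c * weight J w)%:E =
     (a + c * (1 + \sum_(k < J) 2 ^+ k * p ^+ k.+1))%:E)%E.
Proof.
elim: J => [|J [IH1 IH2]].
  have E : (fun w => a + c * weight 0 w) = cst (a + c).
    by apply/funext => w; rewrite /weight big_ord0 addr0 mulr1.
  rewrite E; split; first exact: finite_measure_integrable_cst.
  rewrite (_ : (fun w => (a + c * weight 0 w)%:E) = cst (a + c)%:E).
      by rewrite integral_const big_ord0 addr0 mulr1.
  by apply/funext => w; rewrite /weight big_ord0 addr0 mulr1.
pose G w : R := (c * 2 ^+ J) * \1_(run J.+1) w.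
have ii := integrable_indic P (measurable_run J.+1).
have GE : (EFin \o G) = (fun w => (c * 2 ^+ J)%:E * (\1_(run J.+1) w)%:E)%E.
  by apply/funext => w; rewrite -EFinM.
have iG : P.-integrable setT (EFin \o G).
  by rewrite GE; exact: integrableZl.
have E : (EFin \o (fun w => a + c * weight J.+1 w)) =
    ((EFin \o (fun w => (a + c * weight J w)%R)) \+ (EFin \o G))%E.
  apply/funext => w /=; rewrite -EFinD; congr (_%:E).
  by rewrite /weight big_ord_recr /= /G; ring.
split; first by rewrite E; exact: integrableD.
rewrite (_ : (fun w => (a + c * weight J.+1 w)%:E) = EFin \o (fun w => a + c * weight J.+1 w)) //.
rewrite E integralD_EFin // IH2 GE integralZl // integral_indic //; last exact: measurable_run.
rewrite [X in (_ * X)%E](_ : _ = (p ^+ J.+1)%:E); last by rewrite setIT; exact: prob_run.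
rewrite -EFinM -EFinD big_ord_recr /=; congr (_%:E); ring.
Qed.

Lemma run_cases J w : exists j, [/\ (j <= J)%N, run j w & j = J \/ ~ run j.+1 w].
Proof.
elim: J => [|J [j [jJ rj [jE|nr]]]]; first by exists 0%N; split=> //; left.
  have [r|nr] := pselect (run J.+1 w); first by exists J.+1; split=> //; left.
  by exists J; split; rewrite ?leqnSn -?jE // jE; right.
by exists j; split; rewrite ?(leqW jJ) //; right.
Qed.

(** After a run of length j the multiplier is at most $2\,t^{2^j/2}$, as the square of its Moebius
    factor is the next fixed point. The floor is the value of this bound at j = J, where the weight
    is truncated. *)
Lemma ln_bmul_weight t J w : 0 < t < rho -> good rho t w ->
  ln (Num.max (bmul w) (expR (ln 2 + ln t / 2 * 2 ^+ J))) <= ln 2 + ln t / 2 * weight J w.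
Proof.
move=> t01 gw; have /andP[t0 tr] := t01; have /andP[r0 r1] := rho01.
have lt0 : ln t <= 0 by rewrite ln_le0 // ltW // (lt_trans tr).
have [j [jJ rj jc]] := run_cases J w.
have -> : weight J w = 2 ^+ j :> R.
  by case: jc => [jE|nr]; [rewrite -jE weight_run|rewrite (weight_stop rj)].
rewrite -[leRHS]expRK ler_ln ?posrE ?lt_max ?expR_gt0 ?orbT // ge_max ler_expR lerD2l.
apply/andP; split; last first.
  rewrite ler_wnM2l ?mulr_le0_ge0 // ler_weXn2l //.
  by rewrite ler1n.
apply: le_trans (bmul_le w) _; rewrite expRD lnK ?posrE // ler_wpM2l //.
rewrite -(@ler_pXn2r _ 2) ?nnegrE ?mrad_ge0 ?fixpt_ge0 ?expR_ge0 //.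
have := fixpt_run_le t01 gw rj; rewrite fixptS /treal => h; apply: le_trans h _.
rewrite -expRM_natl /powR gt_eqF //; rewrite le_eqVlt; apply/orP; left; apply/eqP; congr expR.
by field.
Qed.

(** For p >= 1/2 each term $2^k p^{k+1}$ is at least 1/2, so the mean of [weight J] is at least 1 +
    J/2. As [ln t < 0], a large J pushes the mean of the bound of [ln_bmul_weight] below any given -
    m. *)
Lemma ae_eps_small t : 2^-1 <= p -> 0 < t < rho -> {ae P, forall w, good rho t w} ->
  {ae P, forall w, forall mu, exists2 K, 0 <= K & forall n,
    eps rho t (mults (cseq w) (xseq w)) n <= K * ex mu n}.
Proof.
move=> hp t01 hg; have /andP[t0 tr] := t01; have /andP[r0 r1] := rho01.
have L0 : ln t < 0 by rewrite ln_lt0 // t0 (lt_trans tr).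
have hm m : {ae P, forall w, exists2 K, 0 <= K & forall n,
    eps rho t (mults (cseq w) (xseq w)) n <= K * ex (- m%:R) n}.
  have [J hJ] : exists J, ln 2 + m%:R + ln t / 2 * (1 + J%:R / 2) < 0.
    have [N hN] := @natmul_unbounded R (ln 2 + m%:R) (- ln t / 4) ltac:(lra).
    by exists N; have := hN N (leqnn N); lra.
  have hS : 1 + J%:R / 2 <= 1 + \sum_(k < J) 2 ^+ k * p ^+ k.+1.
    rewrite lerD2l; apply: le_trans (_ : \sum_(k < J) 2^-1 <= _).
      by rewrite sumr_const card_ord -[2^-1 *+ J]mulr_natl.
    apply: ler_sum => k _; rewrite exprS mulrCA -exprMn.
    have : 1 <= (2 * p) ^+ k by rewrite exprn_ege1 //; lra.
    by move: ((2 * p) ^+ k) => y y1; nra.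
  have [iw ew] := integral_weight J (ln 2 + m%:R) (ln t / 2).
  have neg : (\int[P]_w (ln 2 + m%:R + ln t / 2 * weight J w)%:E < 0)%E.
    rewrite ew lte_fin; clear iw ew; apply: le_lt_trans hJ.
    by rewrite lerD2l ler_wnM2l //; lra.
  have Ps A : measurable A -> P (left_shift @^-1` A) = P A.
    exact: (iter_shift_preserving p01 hP 1).
  have := birkhoff_bounded left_shift_measurable Ps (shift_ergodic p01 hP) iw neg.
  apply: filterS2 (ae_foralln (fun n => ae_shift n hg)) => w gw [K hK].
  have O := good_orbit rho01 t01 (gw 0%N).
  apply: (eps_of_max O (expR_gt0 (ln 2 + ln t / 2 * 2 ^+ J))) => n.
  apply: le_trans (hK n); apply: ler_sum => i _; rewrite mults_bmul.
  by have := ln_bmul_weight J t01 (gw i); lra.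
(* Integer rates suffice, so that one null set serves all real [mu]. *)
apply: filterS (ae_foralln hm) => w h mu.
have [K K0 hK] := h (Num.truncn `|mu|).+1; exists K => // n.
apply: le_trans (hK n) _; rewrite ler_wpM2l // le_ex //.
have h1 := truncnS_gt `|mu|; have h2 := ler_norm (- mu); rewrite normrN in h2; lra.
Qed.

End RandomRates.

(** * Integrability of the logarithmic multiplier for p < 1/2 *)

Section FiniteEntropy.
Context {R : realType}.
Variables (p : R) (P : probability Omega2 R) (rho : R).
Hypothesis p01 : 0 <= p <= 1.
Hypothesis hP : bernoulli_shift p P.
Hypothesis rho01 : 0 < rho < 1.
Hypothesis p_lt : p < 2^-1.
Local Notation sh e := (@blaschke_shift R e).
Implicit Types (w : Omega2) (j k m n J : nat).

Let Ps A : measurable A -> P (left_shift @^-1` A) = P A.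
Proof. exact: (iter_shift_preserving p01 hP 1). Qed.

Lemma run_stop w : (forall j, run j w) \/ exists j, run j w /\ ~ run j.+1 w.
Proof.
have [h|h] := pselect (exists j, run j w /\ ~ run j.+1 w); first by right.
left; elim=> [//|j rj]; apply: contrapT => nr; apply: h; by exists j.
Qed.

Lemma bmul_stop j w : run j w -> ~ run j.+1 w ->
  expR (- (ln 16 / 2 * 2 ^+ j)) <= bmul w :> R.
Proof.
move=> rj nr; apply: le_trans (bmul_ge w).
rewrite -(@ler_pXn2r _ 2) ?nnegrE ?mrad_ge0 ?fixpt_ge0 ?expR_ge0 //.
have := fixpt_run_ge (R := R) rj nr; rewrite fixptS /treal; apply: le_trans.
rewrite -expRM_natl /powR gt_eqF ?invr_gt0 // lnV ?posrE //.
by rewrite le_eqVlt; apply/orP; left; apply/eqP; congr expR; field.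
Qed.

Lemma bmul_le1 w : bmul w <= 1 :> R.
Proof.
rewrite /bmul /bmult; move: (mrad _ _) => X.
rewrite ler_pdivrMr ?mul1r ?ltr_wpDr ?sqr_ge0 // -subr_ge0.
have -> : 1 + X ^+ 2 - 2 * X = (1 - X) ^+ 2 by ring.
exact: sqr_ge0.
Qed.

(** A multiplier can vanish only after an infinite run of zeros in the past, an event of probability
    at most $p^j$ for every j. *)
Lemma ae_bmul_gt0 : {ae P, forall w, forall n, 0 < bmul (iter n left_shift w) :> R}.
Proof.
suff h : {ae P, forall w, 0 < bmul w :> R}.
  by apply: ae_foralln => n; exact: (ae_shift p01 hP n h).
exists (\bigcap_(j in [set: nat]) run j); split.
- by apply: bigcap_measurable => [|j _]; [exists 0%N|exact: measurable_run].
- apply/eqP; rewrite eq_le measure_ge0 andbT.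
  have le j : (P (\bigcap_(j in [set: nat]) run j) <= (p ^+ j)%:E)%E.
    rewrite -(prob_run hP) //; apply: le_measure; rewrite ?inE.
    + by apply: bigcap_measurable => [|i _]; [exists 0%N|exact: measurable_run].
    + exact: measurable_run.
    + by move=> w /(_ j I).
  apply/lee_addgt0Pr => e e0; rewrite add0e.
  have p1 : 0 <= p < 1 by case/andP: p01 => -> _ /=; apply: lt_trans p_lt _; rewrite invf_lt1 ?ltr1n.
  have [N hN] := geometric_small 1 p1 e0.
  apply: le_trans (le N) _; rewrite lee_fin -[p ^+ N]mul1r; exact: ltW (hN N (leqnn N)).
move=> w /= hw j _; have [h//|[i [ri nri]]] := run_stop w.
by exfalso; apply: hw; exact: lt_le_trans (expR_gt0 _) (bmul_stop ri nri).
Qed.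

Lemma ln_bmul_measurable : measurable_fun setT (fun w => ln (bmul w) : R).
Proof. exact: measurableT_comp (@measurable_ln R) bmul_measurable. Qed.

Let c0 : R := ln 16 / 2.

Let c0_gt0 : 0 < c0.
Proof. by rewrite divr_gt0 // ln_gt0 // ltr1n. Qed.

Let term k w : R := if k is k'.+1 then c0 * 2 ^+ k' * \1_(run k) w else c0.

Let term_ge0 k w : 0 <= term k w.
Proof.
case: k => [|k] /=; first exact: ltW.
apply: mulr_ge0; last by rewrite indicE ler0n.
by apply: mulr_ge0; [exact: ltW|exact: exprn_ge0].
Qed.

Let term_sum m w : \sum_(0 <= k < m.+1) term k w = c0 * weight m w.
Proof.
rewrite big_nat_recl // big_mkord /weight mulrDr mulr1 mulr_sumr; congr (_ + _).
by apply: eq_bigr => k _ /=; rewrite mulrA.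
Qed.

(** A run of finite length j gives the bound with m = j. On an infinite run the weights are
    unbounded and exceed any value of [ln]; so no exceptional set is needed. *)
Lemma ln_bmul_le w : exists m, `|ln (bmul w)| <= c0 * weight m w.
Proof.
have ln0le : ln (bmul w) <= 0 :> R by rewrite ln_le0 // bmul_le1.
rewrite (ler0_norm ln0le).
have [h|[j [rj nr]]] := run_stop w.
  have [N hN] := natmul_unbounded (- ln (bmul w)) c0_gt0.
  exists N; apply: le_trans (hN N (leqnn N)) _; rewrite weight_run // ler_wpM2l ?(ltW c0_gt0) //.
  by rewrite -natrX ler_nat ltnW // ltn_expl.
exists j; rewrite weight_run // lerNl -[leLHS]expRK ler_ln ?posrE ?expR_gt0 //.
  exact: bmul_stop.
exact: lt_le_trans (expR_gt0 _) (bmul_stop rj nr).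
Qed.

Let measurable_term k : measurable_fun setT (EFin \o term k).
Proof.
apply/measurable_EFinP; case: k => [|k].
  exact: (@measurable_cst _ _ _ _ setT c0).
apply: measurable_funM; first exact: measurable_cst.
exact: measurable_indic (measurable_run k.+1).
Qed.

Let integral_term k : (\int[P]_w (term k w)%:E <= (c0 * (2 * p) ^+ k.-1)%:E)%E.
Proof.
case: k => [|k] /=.
  by have := integral_const P c0; rewrite /= => ->; rewrite expr0 mulr1.
have ii := integrable_indic P (measurable_run k.+1).
rewrite (_ : (fun w => _) = (fun w => (c0 * 2 ^+ k)%:E * (\1_(run k.+1) w)%:E)%E); last first.
  by apply/funext => w; rewrite -EFinM.
rewrite integralZl // integral_indic //; last exact: measurable_run.
rewrite [X in (_ * X)%E](_ : _ = (p ^+ k.+1)%:E); last by rewrite setIT; exact: (prob_run hP).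
rewrite -EFinM lee_fin -mulrA ler_wpM2l ?(ltW c0_gt0) //.
rewrite exprMn ler_wpM2l ?exprn_ge0 // exprS.
by case/andP: p01 => p0 p1; rewrite ler_piMl ?exprn_ge0.
Qed.

(** The dominating series is integrated term by term; a run of length k + 1 contributes at most
    $c_0(2p)^k$, which is summable. *)
Lemma ln_bmul_integrable : P.-integrable setT (EFin \o (fun w => ln (bmul w) : R)).
Proof.
apply/integrableP; split; first by apply/measurable_EFinP; exact: ln_bmul_measurable.
have t0 k w : (0 <= (EFin \o term k) w)%E by rewrite lee_fin term_ge0.
have le1 : (\int[P]_w `|(EFin \o (fun w => ln (bmul w) : R)) w| <=
    \int[P]_w \sum_(0 <= k <oo) (EFin \o term k) w)%E.
  apply: ge0_le_integral => //.
  - apply: measurableT_comp => //; apply/measurable_EFinP; exact: ln_bmul_measurable.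
  - exact: (@ge0_emeasurable_sum _ _ _ setT (fun k => EFin \o term k) xpredT
      (fun k w _ _ => t0 k w) (fun k _ => measurable_term k)).
  - move=> w _; have [m hm] := ln_bmul_le w.
    apply: le_trans (_ : ((c0 * weight m w)%:E <= _)%E); first by rewrite lee_fin.
    rewrite -term_sum -sumEFin; 
    exact: (@nneseries_lim_ge R (fun k => (EFin \o term k) w) xpredT 0 m.+1 (fun k _ _ => t0 k w)).
apply: le_lt_trans le1 _; rewrite integral_nneseries //.
apply: le_lt_trans (_ : ((c0 + c0 * (1 - 2 * p)^-1)%:E < _)%E); last exact: ltry.
apply: lime_le; first by apply: is_cvg_nneseries => k _ _; exact: integral_ge0.
apply: nearW => n.
apply: le_trans (_ : (\sum_(0 <= k < n.+1) \int[P]_w (EFin \o term k) w <= _)%E).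
  rewrite big_nat_recr //=; apply: leeDl; apply: integral_ge0 => w _; exact: t0.
apply: le_trans (_ : (\sum_(0 <= k < n.+1) (c0 * (2 * p) ^+ k.-1)%:E <= _)%E).
  by apply: lee_sum => k _; exact: integral_term.
rewrite sumEFin lee_fin big_nat_recl //= expr0 mulr1 lerD2l -mulr_sumr big_mkord.
rewrite ler_wpM2l ?(ltW c0_gt0) //; apply: geometric_sum_le.
by case/andP: p01 => p0 _; rewrite mulr_ge0 //= -ltr_pdivlMl // mulr1.
Qed.

Definition log_mean : R := fine (\int[P]_w (ln (bmul w))%:E)%E.

Lemma log_meanE : (\int[P]_w (ln (bmul w))%:E)%E = log_mean%:E.
Proof. by rewrite /log_mean fineK //; exact: integrable_fin_num ln_bmul_integrable. Qed.

(** [eps_of_max] needs multipliers bounded below. As the floor tends to 0, the means of the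
    truncated logarithms tend to [log_mean] by dominated convergence; [d <= 1] keeps them dominated
    by [ln (bmul w)]. *)
Lemma log_max_mean mu : log_mean < mu -> exists2 d : R, 0 < d <= 1 &
  P.-integrable setT (EFin \o (fun w => ln (Num.max (bmul w) d))) /\
  (\int[P]_w (ln (Num.max (bmul w) d))%:E < mu%:E)%E.
Proof.
move=> hmu; pose d n : R := n.+1%:R^-1.
have d01 n : 0 < d n <= 1 by rewrite invr_gt0 ltr0Sn invf_le1 ?ltr0Sn // ler1n.
pose f_ n := EFin \o (fun w => ln (Num.max (bmul w) (d n))).
have mf n : measurable_fun setT (f_ n).
  apply/measurable_EFinP; apply: measurableT_comp; first exact: measurable_ln.
  by apply: measurable_maxr; [exact: bmul_measurable|exact: measurable_cst].
have bp : {ae P, forall w, 0 < bmul w :> R}.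
  by apply: filterS ae_bmul_gt0 => w h; exact: (h 0%N).
have cvf : {ae P, forall w, setT w -> f_ ^~ w @ \oo --> (EFin \o (fun w => ln (bmul w))) w}.
  apply: filterS bp => w b0 _.
  have [N hN] := ltr_add_invr b0; rewrite add0r in hN.
  apply: cvg_near_cst; exists N => // n /= Nn; rewrite /f_ /= (max_idPl _) //.
  by apply: le_trans (ltW hN); rewrite /d lef_pV2 ?posrE // ler_nat ltnS.
have le1 n w : 0 < bmul w :> R -> (`|f_ n w| <= `|(EFin \o (fun w => ln (bmul w))) w|)%E.
  move=> b0; rewrite /f_ /= lee_fin; have /andP[dn0 dn1] := d01 n.
  have m1 : Num.max (bmul w) (d n) <= 1 by rewrite ge_max bmul_le1.
  rewrite !ler0_norm ?ln_le0 ?bmul_le1 // lerN2 ler_ln ?posrE ?lt_max ?b0 //.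
  by rewrite le_max lexx.
have iabs := integrable_abse ln_bmul_integrable.
have dom : {ae P, forall w n, setT w -> (`|f_ n w| <= `|(EFin \o (fun w => ln (bmul w))) w|)%E}.
  by apply: filterS bp => w b0 n _; exact: le1.
have ml : measurable_fun setT (EFin \o (fun w => ln (bmul w) : R)).
  by apply/measurable_EFinP; exact: ln_bmul_measurable.
have [_ _ cv] := dominated_convergence measurableT mf ml cvf iabs dom.
move: cv; rewrite /= log_meanE => cv.
have : (\forall n \near \oo, (\int[P]_w f_ n w < mu%:E)%E).
  have : nbhs (log_mean%:E) [set y : \bar R | (y < mu%:E)%E].
    by apply: (@open_ereal_lt' R); rewrite lte_fin.
  by move=> /cv.
move=> [N _ /(_ N (leqnn N)) /= hN]; exists (d N) => //; split=> //.
apply/integrableP; split; first exact: mf.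
have /integrableP[_ fin] := iabs; apply: le_lt_trans fin.
apply: ae_ge0_le_integral => //.
- by apply: measurableT_comp => //; exact: mf.
- by apply: measurableT_comp => //; apply: measurableT_comp.
by apply: filterS bp => w b0 _; rewrite abse_id; exact: le1.
Qed.

Lemma ae_rates t : 0 < t < rho -> {ae P, forall w, good rho t w} ->
  {ae P, forall w, rates rho t (cseq w) (xseq w) log_mean}.
Proof.
move=> t01 hg; have /andP[t0 tr] := t01; have /andP[r0 r1] := rho01.
(* The tolerances run through the countable family 1/(m+1), which keeps the union of the exceptional
   sets null. *)
have upper m : {ae P, forall w, exists2 d : R, 0 < d & exists K, forall n,
    \sum_(i < n) (ln (Num.max (bmul (iter i left_shift w)) d) - (log_mean + m.+1%:R^-1)) <= K}.
  have lt1 : log_mean < log_mean + m.+1%:R^-1 by rewrite ltrDl invr_gt0.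
  have [d /andP[d0 d1] [id ed]] := log_max_mean lt1.
  have ic := finite_measure_integrable_cst P (- (log_mean + m.+1%:R^-1)) measurableT.
  have is_ := integrableD measurableT id ic.
  have es : (\int[P]_w (ln (Num.max (bmul w) d) - (log_mean + m.+1%:R^-1))%:E < 0)%E.
    have := integralD_EFin measurableT id ic; rewrite /= => e1.
    under eq_integral => w _ do rewrite EFinD.
    rewrite e1; have fin := integrable_fin_num measurableT id.
    have := integral_const P (- (log_mean + m.+1%:R^-1)); rewrite /= => ->.
    move: ed fin; rewrite /comp => ed fin; move: ed; rewrite -(fineK fin) -EFinD !lte_fin.
    by rewrite subr_lt0.
  have := birkhoff_bounded left_shift_measurable Ps (shift_ergodic p01 hP) is_ es.
  by apply: filterS => w [K hK]; exists d => //; exists K.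
have lower m : {ae P, forall w, exists K, forall n,
    \sum_(i < n) (log_mean - m.+1%:R^-1 - ln (bmul (iter i left_shift w))) <= K}.
  have il : P.-integrable setT (EFin \o (fun w => - ln (bmul w) : R)).
    exact: (integrableN ln_bmul_integrable).
  have ic := finite_measure_integrable_cst P (log_mean - m.+1%:R^-1) measurableT.
  have is_ := integrableD measurableT ic il.
  have es : (\int[P]_w (log_mean - m.+1%:R^-1 - ln (bmul w))%:E < 0)%E.
    have := integralD_EFin measurableT ic il; rewrite /= => e1.
    under eq_integral => w _ do rewrite EFinD.
    rewrite e1; have := integral_const P (log_mean - m.+1%:R^-1); rewrite /= => ->.
    have -> : (\int[P]_w (- ln (bmul w))%:E = - log_mean%:E)%E.
      rewrite -log_meanE -integralN //.
      exact: integrable_add_def ln_bmul_integrable.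
    by rewrite -EFinN -EFinD lte_fin addrAC subrr sub0r oppr_lt0 invr_gt0.
  exact: (birkhoff_bounded left_shift_measurable Ps (shift_ergodic p01 hP) is_ es).
have hall := ae_and (ae_foralln upper) (ae_foralln lower).
have hgb := ae_and (ae_foralln (fun n => ae_shift p01 hP n hg)) ae_bmul_gt0.
apply: filterS (ae_and hall hgb) => w [[hu hl] [gw bw]]; have O : bl_orbit rho t (cseq w) (xseq w) := good_orbit rho01 t01 (gw 0%N).
have pick (e : R) : 0 < e -> exists m, m.+1%:R^-1 < e.
  by move=> e0; have [m hm] := ltr_add_invr e0; exists m; rewrite add0r in hm.
have Dpos n : 0 < Dn (cseq w) (xseq w) n :> R.
  elim: n => [|n IH]; first by rewrite /Dn big_ord0.
  by rewrite /Dn big_ord_recr /=; exact: mulr_gt0 IH (bw n).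
have low nu : nu < log_mean -> exists2 K, 0 <= K &
    forall n, (Dn (cseq w) (xseq w) n)^-1 <= K * ex (- nu) n.
  move=> hnu; have [m hm] : exists m, m.+1%:R^-1 < log_mean - nu by apply: pick; rewrite subr_gt0.
  have [K hK] := hl m; exists (expR K); first exact: expR_ge0.
  move=> n; have -> : (Dn (cseq w) (xseq w) n)^-1 =
      expR (- \sum_(i < n) ln (bmul (iter i left_shift w))) :> R.
    rewrite expRN expR_sum; congr (_^-1); apply: eq_bigr => i _.
    by rewrite lnK ?posrE // mults_bmul.
  rewrite /ex -expRD ler_expR; have := hK n.
  rewrite sumrB sumr_const card_ord -[(_ - _) *+ n]mulr_natr => h1.
  have h2 : nu * n%:R <= (log_mean - m.+1%:R^-1) * n%:R.
    by rewrite ler_wpM2r // lerBrDr -lerBrDl ltW.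
  rewrite mulNr lerBrDl; apply: le_trans h1; exact: lerD h2 (lexx _).
split.
(* The multipliers are uniformly at most [kk < 1], so [Dn] is at most [kk ^+ n]. If [log_mean] were
   nonnegative, the lower bound at the rate [ln kk / 2] would force $e^{-n\ln(kk)/2}$ to stay
   bounded. *)
- rewrite ltNge; apply/negP => L0.
  pose kk : R := 1 - (1 - t) ^+ 2 / 8.
  have kk1 : kk < 1.
    by rewrite /kk ltrBlDr ltrDl divr_gt0 // exprn_gt0 // subr_gt0 (lt_trans tr).
  have kk0 : 0 < kk by have /andP[_ h] := mults_bound O 0; exact: lt_le_trans (bw 0%N) h.
  have lk : ln kk < 0 by rewrite ln_lt0 // kk0.
  have [K K0 hK] := low (ln kk / 2) ltac:(lra).
  have [N hN] := @natmul_unbounded R K (- ln kk / 2) ltac:(lra).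
  have h1 : expR (- (ln kk * N%:R)) <= K * ex (- (ln kk / 2)) N.
    apply: le_trans (hK N); rewrite expRN lef_pV2 ?posrE ?expR_gt0 //.
    rewrite mulrC expRM_natl lnK ?posrE // -[X in _ <= _ ^+ X]card_ord -prodr_const.
    by apply: ler_prod => i _; case/andP: (mults_bound O i) => -> ->.
  have h2 : expR (- (ln kk / 2) * N%:R) <= K.
    rewrite -(ler_pM2r (ex_gt0 (- (ln kk / 2)) N)); apply: le_trans h1.
    by rewrite /ex -expRD le_eqVlt; apply/orP; left; apply/eqP; congr expR; field.
  have h3 := expR_ge1Dx (- (ln kk / 2) * N%:R).
  have e3 : - ln kk / 2 * N%:R = - (ln kk / 2) * N%:R by field.
  have h4 := hN N (leqnn N); rewrite e3 in h4.
  by have := le_trans h3 (le_trans h2 h4); rewrite gerDr ler10.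
- move=> mu hmu; have [m hm] : exists m, m.+1%:R^-1 < mu - log_mean by apply: pick; rewrite subr_gt0.
  have [d d0 [K hK]] := hu m; have [K' K'0 h] := eps_of_max O d0 hK.
  exists K' => // n; by apply: le_trans (h n) _; rewrite ler_wpM2l // le_ex // -lerBrDl ltW.
- exact: low.
- move=> mu hmu; have [m hm] : exists m, m.+1%:R^-1 < mu - log_mean by apply: pick; rewrite subr_gt0.
  have [d d0 [K hK]] := hu m; exists (expR K); first exact: expR_ge0.
  move=> n; apply: le_trans (_ : \prod_(i < n) Num.max (mults (cseq w) (xseq w) i) d <= _).
    apply: ler_prod => i _; rewrite le_max lexx /= andbT.
    by case/andP: (mults01 O i).
  by apply: le_trans (prod_max_le d0 hK n) _; rewrite ler_wpM2l ?expR_ge0 // le_ex // -lerBrDl ltW.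
- by move=> n; exact: bw.
Qed.

End FiniteEntropy.

Lemma cocycle_iterE {R : realType} (rho : R) n (w : Omega2) f :
  cocycle_iter left_shift (fun w : Omega2 => PF rho (blaschke (w 0))) n w f = Lit rho (cseq w) n f.
Proof. by elim: n => //= n ->. Qed.

Lemma cseq_shift (w : Omega2) : cseq (left_shift w) = (fun n => cseq w n.+1).
Proof. by apply/funext => n; rewrite /cseq iterSr. Qed.

Lemma xseq_shift {R : realType} (w : Omega2) :
  xseq (left_shift w) = (fun n => xseq w n.+1) :> (nat -> R).
Proof. by apply/funext => n; rewrite /xseq iterSr. Qed.

Lemma vector_growthE {R : realType} (rho : R) (w : Omega2) f :
  vector_growth left_shift (H2norm rho) (fun w : Omega2 => PF rho (blaschke (w 0))) w f =
  growth (fun n => (H2norm rho (Lit rho (cseq w) n f))%:E).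
Proof. by apply/funext => n; rewrite /vector_growth /growth cocycle_iterE. Qed.

Lemma cocycle_norm_growth {R : realType} (rho t : R) (w : Omega2) :
  0 < rho < 1 -> 0 < t < rho -> good rho t w ->
  growth (fun n => op_norm (H2 rho) (H2norm rho)
    (cocycle_iter left_shift (fun w : Omega2 => PF rho (blaschke (w 0))) n w)) n @[n --> \oo]
    --> 0%:E.
Proof.
move=> rho01 t01 gw; have H := @op_norm_growth R rho t (cseq w) (xseq w) (good_orbit rho01 t01 gw).
have e n : cocycle_iter left_shift (fun w : Omega2 => PF rho (blaschke (w 0))) n w = Lit rho (cseq w) n.
  by apply/funext => f; exact: cocycle_iterE.
have E : (fun n => op_norm (H2 rho) (H2norm rho)
    (cocycle_iter left_shift (fun w : Omega2 => PF rho (blaschke (w 0))) n w)) =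
  (fun n => op_norm (H2 rho) (H2norm rho) (Lit rho (cseq w) n)).
  by apply/funext => n; rewrite e.
exact: (eq_ind_r (fun u => growth u n @[n --> \oo] --> 0%:E) H E).
Qed.

Section Spectrum.
Context {R : realType}.
Variables (p : R) (P : probability Omega2 R) (rho : R).
Hypothesis p01 : 0 <= p <= 1.
Hypothesis hP : bernoulli_shift p P.
Hypothesis rho01 : 0 < rho < 1.
Hypothesis hr : (r_ess P rho < rho%:E)%E.

Lemma spectrum_infinite : p < 2^-1 ->
  blaschke_spectrum P rho None (fun i => i%:R * log_mean P) mult.
Proof.
move=> p_lt; have [t t01 hg] := ae_good hP rho01 hr.
have hrate := ae_rates p01 hP rho01 p_lt t01 hg.
have Lam0 : log_mean P < 0 by have [w /rate_lt0] := ae_nonempty hrate.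
(* Both [w] and its image must be typical, since equivariance compares the spaces at the two
   points. *)
have hs := ae_and (ae_and hg (ae_shift p01 hP 1 hg)) (ae_and hrate (ae_shift p01 hP 1 hrate)).
split=> //.
- by move=> i _; rewrite ltr_nM2r // ltr_nat.
- by move=> [|i].
- by apply: filterS hg => w gw; rewrite mul0r; exact: cocycle_norm_growth t01 gw.
exists (fun i w => osel rho (cseq w) (xseq w) i).
exists (fun j w => kerset (H2 rho) (ell (cseq w) (xseq w)) j).
apply: filterS hs => w [[gw gw'] [Q Q']] i _.
have O := good_orbit rho01 t01 gw.
rewrite /= cseq_shift xseq_shift in Q'.
rewrite cseq_shift xseq_shift.
split.
- split; first exact: (osel_dim O Q i).
    exact: (osel_image O Q Q' i).
  by move=> f Vf f0; rewrite vector_growthE; exact: (osel_growth O Q Vf f0).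
- split; first exact: (kerA_linear O Q i).
    exact: (kerA_closed O Q).
  exact: (kerA_splitting O Q i).
- exact: (kerA_image O Q Q').
by move=> f Ff; rewrite vector_growthE; exact: (kerA_growth O Q Ff).
Qed.

Lemma spectrum_single : 2^-1 <= p ->
  blaschke_spectrum P rho (Some 1%N) (fun=> 0) (fun=> 1%N).
Proof.
move=> p_ge; have [t t01 hg] := ae_good hP rho01 hr.
have heps := ae_eps_small p01 hP rho01 p_ge t01 hg.
split=> //.
- by apply: filterS hg => w gw; exact: cocycle_norm_growth t01 gw.
exists (fun i w => osel0 rho (xseq w)), (fun j w => ker0 rho (xseq w)).
apply: filterS (ae_and hg heps) => w [gw ew] [|//] _.
have O := good_orbit rho01 t01 gw.
rewrite xseq_shift; split.
- split; first exact: (osel0_dim O).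
    exact: (osel0_image O).
  by move=> f Vf f0; rewrite vector_growthE; exact: (osel0_growth O Vf f0).
- split; first exact: (ker0_linear O).
    exact: (ker0_closed O).
  exact: (ker0_splitting O).
- exact: (ker0_image O).
by move=> f Ff; rewrite vector_growthE; exact: (ker0_growth O ew Ff).
Qed.

End Spectrum.

Theorem corollary2 (R : realType) (p : R) (P : probability Omega2 R) (rho : R)
    (hp : 0 <= p <= 1) (hP : bernoulli_shift p P)
    (hrho : 0 < rho < 1) (hr : (r_ess P rho < rho%:E)%E) :
  (p < 2^-1 ->
     exists (lam : nat -> R) (m : nat -> nat),
       blaschke_spectrum P rho None lam m) /\
  (2^-1 <= p ->
     exists (lam : nat -> R) (m : nat -> nat),
       [/\ blaschke_spectrum P rho (Some 1%N) lam m,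
           lam 0%N = 0 & m 0%N = 1%N]).
Proof.
split=> hp2.
  exists (fun i => i%:R * log_mean P), mult.
  exact: (spectrum_infinite hp hP hrho hr hp2).
exists (fun=> 0), (fun=> 1%N); split=> //.
exact: (spectrum_single hp hP hrho hr hp2).
Qed.
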